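(* Let $T>0$ and $u_0\in H^\gamma(\mathbb{T})$, $u_0\not\equiv0$. Let $u$ be the solution on $[0,T]$ of $$ i\partial_t u+\partial_{xx}u-|u|^2u=0,\quad x\in\mathbb{T},\qquad u(0,\cdot)=u_0, $$ and let $U^n$ be defined by $U^0=u_0$ and $U^{n+1}=\Psi(U^n)+G_1(U^n)+G_2(U^n)$, $n=0,1,\dots,\frac T\tau-1$, with $\Psi,G_1,G_2$ as defined below; $t_n=n\tau$. (a) If $\gamma>\frac32$, there exist $\tau_0,C>0$ depending only on $T$ and $\|u\|_{L^\infty((0,T);H^\gamma)}$ such that for all $0<\tau\le\tau_0$ and $n=0,1,\dots,\frac T\tau$, $$\|u(t_n,\cdot)-U^n\|_{H^\gamma}\le C\tau\qquad\text{and}\qquad |M(U^n)-M(u_0)|\le C\tau^5 .$$ (b) If $\gamma=1$, then for every $\epsilon>0$ there exist $\tau_0,C>0$ depending only on $\epsilon$, $T$ and $\|u\|_{L^\infty((0,T);H^1)}$ such that for all $0<\tau\le\tau_0$ and $n=0,1,\dots,\frac T\tau$, $$\|u(t_n,\cdot)-U^n\|_{H^1}\le C\tau^{\frac12-\epsilon}.$$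
   Context: $\mathbb{T}=\mathbb{R}/2\pi\mathbb{Z}$. Fourier coefficients: $\hat f_k=\frac1{2\pi}\int_{\mathbb{T}}e^{-ikx}f(x)\,dx$; $\|f\|_{H^s}^2=2\pi\sum_k(1+k^2)^s|\hat f_k|^2$. $\partial_x^{-1}$ is the Fourier multiplier $(ik)^{-1}$ for $k\ne0$ and $0$ for $k=0$; $\partial_x^{-2}=(\partial_x^{-1})^2$. $e^{it\partial_x^2}$ is the Fourier multiplier $e^{-itk^2}$. $\Pi_0(f)=\frac1{2\pi}\int_{\mathbb{T}}f\,dx$. Mass: $M(f)=\Pi_0(|f|^2)$. $M_0=M(u_0)$, $P_0=\Pi_0(u_0\,\partial_x\overline{u_0})$. The operator $e^{i\tau(-2M_0-2P_0\partial_x^{-1}+\partial_x^2)}$ is the Fourier multiplier $\exp(i\tau(-2M_0-2P_0 m_k-k^2))$ with $m_k=(ik)^{-1}$ for $k\ne0$, $m_0=0$. The map $\Psi$ is $$\Psi(u)=e^{i\tau(-2M_0-2P_0\partial_x^{-1}+\partial_x^2)}u-i\tau\,\Pi_0(|u|^2u)+2i\tau M_0\,\Pi_0(u)-\tfrac12\partial_x^{-2}\Big[\big(e^{-i\tau\partial_x^2}\bar u\big)\cdot e^{i\tau\partial_x^2}(u^2)\Big]+\tfrac12 e^{i\tau\partial_x^2}\partial_x^{-2}\big[|u|^2u\big]$$ $$\qquad+\partial_x^{-1}\Big[\big(e^{i\tau\partial_x^2}u\big)\cdot\partial_x^{-1}\big(|e^{i\tau\partial_x^2}u|^2\big)\Big]-e^{i\tau\partial_x^2}\partial_x^{-1}\Big[u\cdot\partial_x^{-1}\big(|u|^2\big)\Big].$$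 Further, $F(U)=\Psi(U)-e^{i\tau\partial_x^2}U$, $$H(U)=-M_0^{-1}\Big[\mathrm{Re}\,\Pi_0\big(F(U)\,\overline{e^{i\tau\partial_x^2}U}\big)+\tfrac12\Pi_0\big(|F(U)|^2\big)\Big],$$ $G_1(U)=H(U)\,e^{i\tau\partial_x^2}U$, and $$G_2(U)=-\tfrac12 H(U)^2e^{i\tau\partial_x^2}U-M_0^{-1}H(U)\,\mathrm{Re}\,\Pi_0\big(F(U)\,\overline{e^{i\tau\partial_x^2}U}\big)\,e^{i\tau\partial_x^2}U.$$ *)

(* Defs.v *)
From Stdlib Require Import Reals ZArith.
From Coquelicot Require Import Coquelicot.

Open Scope R_scope.

(** A function on the torus T = R/2piZ is represented by its sequence of
    Fourier coefficients  k |-> \hat f_k  (k : Z). *)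
Definition F := Z -> C.

(** Symmetric sums over Z: sum_{k in Z} a_k := lim_N sum_{|k| <= N} a_k. *)
Definition pairZ (a : Z -> R) (n : nat) : R :=
  match n with
  | O => a 0%Z
  | S _ => a (Z.of_nat n) + a (- Z.of_nat n)%Z
  end.
Definition zsumR (a : Z -> R) : R := Series (pairZ a).
Definition zsumC (a : Z -> C) : C :=
  (zsumR (fun k => Re (a k)), zsumR (fun k => Im (a k))).

Definition Hweight (s : R) (k : Z) : R := Rpower (1 + IZR k ^ 2) s.
Definition Hterm (s : R) (f : F) (k : Z) : R := Hweight s k * (Cmod (f k)) ^ 2.
Definition in_H (s : R) (f : F) : Prop := ex_series (pairZ (Hterm s f)).
Definition Hnorm (s : R) (f : F) : R := sqrt (2 * PI * zsumR (Hterm s f)).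

Definition zeroF : F := fun _ => 0%C.
Definition addF (f g : F) : F := fun k => Cplus (f k) (g k).
Definition subF (f g : F) : F := fun k => Cminus (f k) (g k).
Definition sclF (c : C) (f : F) : F := fun k => Cmult c (f k).

(** Pointwise product in x = convolution of coefficients; conjugation. *)
Definition mulF (f g : F) : F := fun k => zsumC (fun j => Cmult (f j) (g (k - j)%Z)).
Definition conjF (f : F) : F := fun k => Cconj (f (- k)%Z).
Definition abs2F (f : F) : F := mulF f (conjF f).
Definition cubicF (f : F) : F := mulF (abs2F f) f.

(** Mean value Pi_0 (a number) and the constant function with value c. *)
Definition Pi0 (f : F) : C := f 0%Z.
Definition constF (c : C) : F := fun k => if Z.eqb k 0 then c else 0%C.

Definition mass (f : F) : C := Pi0 (abs2F f).

Definition multF (m : Z -> C) (f : F) : F := fun k => Cmult (m k) (f k).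
Definition ci : C := (0, 1).
Definition Cexp (z : C) : C := (exp (Re z) * cos (Im z), exp (Re z) * sin (Im z)).
Definition dx_sym (k : Z) : C := Cmult ci (RtoC (IZR k)).
Definition dxinv_sym (k : Z) : C := if Z.eqb k 0 then 0%C else Cinv (dx_sym k).
Definition dxF (f : F) : F := multF dx_sym f.
Definition dxinvF (f : F) : F := multF dxinv_sym f.
Definition dxinv2F (f : F) : F := dxinvF (dxinvF f).
(* e^{i t d_xx}: multiplier e^{-i t k^2} *)
Definition eS (t : R) (f : F) : F :=
  multF (fun k => Cexp (Cmult ci (RtoC (- t * IZR k ^ 2)))) f.
(* e^{i tau (-2 M0 - 2 P0 d_x^{-1} + d_xx)}: multiplier exp(i tau(-2M0 - 2P0 m_k - k^2)) *)
Definition eBig (tau : R) (M0 P0 : C) (f : F) : F :=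
  multF (fun k => Cexp (Cmult (Cmult ci (RtoC tau))
            (Cminus (Cminus (Copp (Cmult 2 M0)) (Cmult (Cmult 2 P0) (dxinv_sym k)))
                    (RtoC (IZR k ^ 2))))) f.

Definition M0_of (u0 : F) : C := mass u0.
Definition P0_of (u0 : F) : C := Pi0 (mulF u0 (dxF (conjF u0))).

Definition Psi (tau : R) (M0 P0 : C) (u : F) : F :=
  let e := eS tau in
  let em := eS (- tau) in
  addF (eBig tau M0 P0 u)
 (addF (sclF (Copp (Cmult ci (RtoC tau))) (constF (Pi0 (cubicF u))))
 (addF (sclF (Cmult (Cmult 2 ci) (Cmult (RtoC tau) M0)) (constF (Pi0 u)))
 (addF (sclF (Copp (RtoC (1/2))) (dxinv2F (mulF (em (conjF u)) (e (mulF u u)))))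
 (addF (sclF (RtoC (1/2)) (e (dxinv2F (cubicF u))))
 (subF (dxinvF (mulF (e u) (dxinvF (abs2F (e u)))))
       (e (dxinvF (mulF u (dxinvF (abs2F u)))))))))).

Definition Fmap (tau : R) (M0 P0 : C) (U : F) : F := subF (Psi tau M0 P0 U) (eS tau U).

Definition ReC (z : C) : C := RtoC (Re z).

Definition RePF (tau : R) (M0 P0 : C) (U : F) : C :=
  ReC (Pi0 (mulF (Fmap tau M0 P0 U) (conjF (eS tau U)))).

Definition Hcorr (tau : R) (M0 P0 : C) (U : F) : C :=
  Copp (Cmult (Cinv M0)
     (Cplus (RePF tau M0 P0 U)
            (Cmult (RtoC (1/2)) (Pi0 (abs2F (Fmap tau M0 P0 U)))))).

Definition G1 (tau : R) (M0 P0 : C) (U : F) : F := sclF (Hcorr tau M0 P0 U) (eS tau U).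

Definition G2 (tau : R) (M0 P0 : C) (U : F) : F :=
  let H := Hcorr tau M0 P0 U in
  subF (sclF (Copp (Cmult (RtoC (1/2)) (Cmult H H))) (eS tau U))
       (sclF (Cmult (Cmult (Cinv M0) H) (RePF tau M0 P0 U)) (eS tau U)).

Fixpoint scheme (tau : R) (u0 : F) (n : nat) : F :=
  match n with
  | O => u0
  | S m =>
      let U := scheme tau u0 m in
      let M0 := M0_of u0 in
      let P0 := P0_of u0 in
      addF (Psi tau M0 P0 U) (addF (G1 tau M0 P0 U) (G2 tau M0 P0 U))
  end.

(** Solution of i u_t + u_xx - |u|^2 u = 0, u(0) = u0, on [0,T], in
    C([0,T]; H^s), in mild (Duhamel) form, Fourier-coefficientwise:
    \hat u_k(t) = e^{-itk^2} \hat u0_k - i int_0^t e^{-i(t-s)k^2} (|u|^2u)^_k(s) ds. *)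
Definition phase (t : R) (k : Z) : C := Cexp (Cmult ci (RtoC (- t * IZR k ^ 2))).

Definition is_NLS_solution (s T : R) (u0 : F) (u : R -> F) : Prop :=
  (forall t, 0 <= t <= T -> in_H s (u t)) /\
  (forall t, 0 <= t <= T -> forall eps, 0 < eps -> exists delta, 0 < delta /\
     forall t', 0 <= t' <= T -> Rabs (t' - t) < delta -> Hnorm s (subF (u t') (u t)) < eps) /\
  (forall t, 0 <= t <= T -> forall k : Z,
     u t k = Cminus (Cmult (phase t k) (u0 k))
               (Cmult ci (@RInt C_R_CompleteNormedModule
                  (fun s' => Cmult (phase (t - s') k) (cubicF (u s') k)) 0 t))).

(* Main.v *)
(** In the twisted variable [V = e^{-it dxx} U] both the equation and the scheme are driven by cubic
    operators with the parallelogram frequencies [k, k2, k3] and [p = k2 + k3 - k], oscillating with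
    the phase [phi = 2 (k2 - k) (k3 - k)].  One step equals the exact Duhamel integral to first order,
    up to three corrections: an antisymmetric symbol that cancels, the resonances [k3 = k], which the
    operator with [M0] and [P0] integrates exactly, and a symbol [Esym], the local error, of size
    [tau^(1+th) (|k2| |k3|)^th <p> / <k>].

    The corrections [G1] and [G2] multiply the iterate by [1 + eta], where, to leading order, [eta] is
    [- Re <Esym(V, V, V), V> / M0].  Because of the division by [M0], the local error bound makes [eta]
    of size [tau^(1+th)] only with a constant that explodes for small mass; uniformly in the data one
    merely has [eta = O(tau)].  What is uniformly small are the partial sums [Th] of the [eta_j]:
    summation by parts in time and a count of the resonances of [sum_j exp (i j tau phi)] bound the
    time-summed local error form by [tau^th1] times the mass.  A Gronwall argument for [v - V + Th V]
    then gives the rate [tau^th1].  The mass defect of a step is quadratic in [Re <Y, V>], where [Y] is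
    the increment of the step, so the mass is conserved up to [tau^(3 + 2 th1)].  The exponents are
    [th1 = 1] for [gamma > 3/2], and [th1 = 1/2 - eps] for [gamma = 1]. *)
Require Import Defs.
From Stdlib Require Import Reals ZArith List Lra Lia Classical ClassicalEpsilon FunctionalExtensionality ssreflect.
From Coquelicot Require Import Coquelicot.
Open Scope R_scope.

(** * Unconditional sums over an arbitrary index type *)

(** The statement sums symmetrically over the frequencies, but the argument permutes the vertices of
    parallelograms and interchanges sums. Hence all sums are first made unconditional, and every
    norm estimate is a bound over finite lists.

    The two exponents have different roles. With [a = k2 - k] and [b = k3 - k], the time-summed
    error is large where [tau a b] is near a multiple of [PI]. The weight [(tau a)^(-th1) b^(-th2)]
    there costs [a^th1 b^th2] and gains [tau^th1]. Square summability in [b] asks for [2 th2 > 1].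
    In [H^1] only one derivative is left besides the one on [p], so [th1 + th2 = 1]: this is the
    origin of the loss [eps]. For [gamma > 3/2], three derivatives can be shared by two factors and
    [th1 = th2 = 1] is allowed.

    Uniformity for small mass dictates the bookkeeping: a function carries an [L2] bound [mu],
    comparable to the root of [M0], and an [H^s] bound [D]. Quantities divided by [M0] are estimated
    with a factor [mu^2]. That the iterates stay in this class is a bootstrap: the mass drift
    relative to [M0] keeps [mu], the convergence estimate itself keeps [D]. *)

Definition lsum {I : Type} (f : I -> R) (l : list I) : R :=
  fold_right (fun i a => f i + a) 0 l.
Definition csum {I : Type} (f : I -> C) (l : list I) : C :=
  fold_right (fun i a => Cplus (f i) a) (RtoC 0) l.

(** Classical decidability of equality, so that [nodup] and [in_dec] are available for every index
    type. *)
Definition eq_dec_of (I : Type) (x y : I) : {x = y} + {x <> y} :=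
  excluded_middle_informative (x = y).

(** For nonnegative [f], [Bnd f S] says that the sum of [f] is at most [S]. *)
Definition Bnd {I : Type} (f : I -> R) (S : R) : Prop :=
  forall l, NoDup l -> lsum f l <= S.

Section FiniteSums.
Context {I : Type}.
Implicit Types (f g : I -> R) (l : list I).

Lemma lsum_app f l l' : lsum f (l ++ l') = lsum f l + lsum f l'.
Proof. elim: l => [|i l IH] /=; [lra | rewrite IH; lra]. Qed.

Lemma lsum_ext f g l : (forall i, In i l -> f i = g i) -> lsum f l = lsum g l.
Proof.
elim: l => [//|i l IH] H /=; rewrite H /=; last by left.
by rewrite IH // => j Hj; apply: H; right.
Qed.

Lemma lsum_le f g l : (forall i, In i l -> f i <= g i) -> lsum f l <= lsum g l.
Proof.
elim: l => [|i l IH] H /=; first lra.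
apply: Rplus_le_compat; first by apply: H; left.
by apply: IH => j Hj; apply: H; right.
Qed.

Lemma lsum_ge0 f l : (forall i, 0 <= f i) -> 0 <= lsum f l.
Proof. move=> H; elim: l => [|i l IH] /=; [lra | have := H i; lra]. Qed.

Lemma lsum_plus f g l : lsum (fun i => f i + g i) l = lsum f l + lsum g l.
Proof. elim: l => [|i l IH] /=; [lra | rewrite IH; lra]. Qed.

Lemma lsum_scal c f l : lsum (fun i => c * f i) l = c * lsum f l.
Proof. elim: l => [|i l IH] /=; [lra | rewrite IH; lra]. Qed.

Lemma lsum_const c l : lsum (fun _ => c) l = INR (length l) * c.
Proof.
elim: l => [|i l IH]; first by rewrite /=; lra.
by rewrite [length _]/= S_INR /= IH; lra.
Qed.

Lemma lsum_incl f l l' : (forall i, 0 <= f i) -> NoDup l -> incl l l' ->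
  lsum f l <= lsum f l'.
Proof.
move=> H0; elim: l l' => [|i l IH] l' Hnd Hin; first by apply: lsum_ge0.
have [l1 [l2 El]] : exists l1 l2, l' = l1 ++ i :: l2.
  by apply: in_split; apply: Hin; left.
inversion Hnd; subst.
have : lsum f l <= lsum f (l1 ++ l2).
  apply: IH => // j Hj.
  have : In j (l1 ++ i :: l2) by apply: Hin; right.
  rewrite !in_app_iff /=; case=> [|[E|]]; [by left | by subst | by right].
rewrite !lsum_app /=; lra.
Qed.

Lemma csum_app (f : I -> C) l l' : csum f (l ++ l') = Cplus (csum f l) (csum f l').
Proof. elim: l => [|i l IH] /=; [ring | rewrite IH; ring]. Qed.

Lemma csum_plus (f g : I -> C) l :
  csum (fun i => Cplus (f i) (g i)) l = Cplus (csum f l) (csum g l).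
Proof. elim: l => [|i l IH] /=; [ring | rewrite IH; ring]. Qed.

Lemma csum_scal c (f : I -> C) l :
  csum (fun i => Cmult c (f i)) l = Cmult c (csum f l).
Proof. elim: l => [|i l IH] /=; [ring | rewrite IH; ring]. Qed.

Lemma csum_conj (f : I -> C) l : csum (fun i => Cconj (f i)) l = Cconj (csum f l).
Proof.
elim: l => [|i l IH] /=; last by rewrite IH Cplus_conj.
by rewrite /Cconj /=; congr pair; ring.
Qed.

Lemma Cmod_csum (f : I -> C) l : Cmod (csum f l) <= lsum (fun i => Cmod (f i)) l.
Proof.
elim: l => [|i l IH] /=; first by rewrite Cmod_0; lra.
apply: Rle_trans; first by apply: Cmod_triangle.
lra.
Qed.

Lemma csum_re (f : I -> C) l : fst (csum f l) = lsum (fun i => fst (f i)) l.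
Proof. by elim: l => [|i l IH] //=; rewrite IH. Qed.

Lemma csum_im (f : I -> C) l : snd (csum f l) = lsum (fun i => snd (f i)) l.
Proof. by elim: l => [|i l IH] //=; rewrite IH. Qed.

Lemma csum_ext (f g : I -> C) l : (forall i, In i l -> f i = g i) -> csum f l = csum g l.
Proof.
elim: l => [//|i l IH] H /=; rewrite H /=; last by left.
by rewrite IH // => j Hj; apply: H; right.
Qed.

End FiniteSums.

Lemma lsum_map {I J} (h : J -> I) (f : I -> R) l :
  lsum f (map h l) = lsum (fun j => f (h j)) l.
Proof. by elim: l => [//|j l IH] /=; rewrite IH. Qed.

Lemma csum_map {I J} (h : J -> I) (f : I -> C) l :
  csum f (map h l) = csum (fun j => f (h j)) l.
Proof. by elim: l => [//|j l IH] /=; rewrite IH. Qed.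

Lemma lsum_prod {I J} (f : I * J -> R) li lj :
  lsum f (list_prod li lj) = lsum (fun i => lsum (fun j => f (i, j)) lj) li.
Proof. by elim: li => [//|i li IH] /=; rewrite lsum_app IH lsum_map. Qed.

Lemma csum_prod {I J} (f : I * J -> C) li lj :
  csum f (list_prod li lj) = csum (fun i => csum (fun j => f (i, j)) lj) li.
Proof. by elim: li => [//|i li IH] /=; rewrite csum_app IH csum_map. Qed.

Lemma NoDup_map_inj {I J} (h : J -> I) l :
  (forall x y, h x = h y -> x = y) -> NoDup l -> NoDup (map h l).
Proof. move=> Hi; apply: NoDup_map_NoDup_ForallPairs => x y _ _; exact: Hi. Qed.

Lemma NoDup_prod {I J} (li : list I) (lj : list J) :
  NoDup li -> NoDup lj -> NoDup (list_prod li lj).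
Proof.
move=> Hi Hj; elim: Hi => [|i l Hn _ IH] /=; first by constructor.
apply: NoDup_app => //.
- by apply: NoDup_map_inj => // x y [].
- move=> [x y] /in_map_iff [z [[E1 E2] _]] /in_prod_iff [H _]; by subst.
Qed.

Section BndRules.
Context {I : Type}.
Implicit Types (f g : I -> R).

Lemma Bnd_ge0 f S : Bnd f S -> 0 <= S.
Proof. by move=> H; have := H nil (NoDup_nil _). Qed.

Lemma Bnd_le f g S : (forall i, f i <= g i) -> Bnd g S -> Bnd f S.
Proof.
move=> H Hg l Hl; apply: Rle_trans (Hg l Hl); apply: lsum_le => i _; exact: H.
Qed.

Lemma Bnd_mono f S S' : S <= S' -> Bnd f S -> Bnd f S'.
Proof. move=> H Hf l Hl; have := Hf l Hl; lra. Qed.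

Lemma Bnd_plus f g S S' : Bnd f S -> Bnd g S' -> Bnd (fun i => f i + g i) (S + S').
Proof. move=> Hf Hg l Hl; rewrite lsum_plus; have := Hf l Hl; have := Hg l Hl; lra. Qed.

Lemma Bnd_scal c f S : 0 <= c -> Bnd f S -> Bnd (fun i => c * f i) (c * S).
Proof. move=> Hc Hf l Hl; rewrite lsum_scal; apply: Rmult_le_compat_l => //; exact: Hf. Qed.

Lemma Bnd_point f S i : Bnd f S -> f i <= S.
Proof.
move=> H; have := H (i :: nil) (NoDup_cons _ (@in_nil _ i) (NoDup_nil _)) => /=; lra.
Qed.

Lemma Bnd_zero : Bnd (fun _ : I => 0) 0.
Proof. move=> l _; rewrite lsum_const; lra. Qed.

(** Young's inequality with a free weight [s], then [s = B / A]. If just one of [A], [B] vanishes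
    there is no optimal weight, and [s] is adapted to a tolerance [e] instead. *)
Lemma Bnd_CS f g A B : (forall i, 0 <= f i) -> (forall i, 0 <= g i) -> 0 <= A -> 0 <= B ->
  Bnd (fun i => f i ^ 2) (A ^ 2) -> Bnd (fun i => g i ^ 2) (B ^ 2) ->
  Bnd (fun i => f i * g i) (A * B).
Proof.
move=> f0 g0 A0 B0 HA HB l Hl.
have HA' := HA l Hl; have HB' := HB l Hl.
have key : forall s, 0 < s ->
    lsum (fun i => f i * g i) l <= s / 2 * A ^ 2 + / (2 * s) * B ^ 2.
  move=> s s0.
  apply: Rle_trans (_ : lsum (fun i => s / 2 * f i ^ 2 + / (2 * s) * g i ^ 2) l <= _).
    apply: lsum_le => i _.
    have -> : s / 2 * f i ^ 2 + / (2 * s) * g i ^ 2 =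
        f i * g i + / (2 * s) * (s * f i - g i) ^ 2 by field; lra.
    have : 0 <= / (2 * s) * (s * f i - g i) ^ 2.
      apply: Rmult_le_pos; last by apply: pow2_ge_0.
      by left; apply: Rinv_0_lt_compat; lra.
    lra.
  rewrite lsum_plus !lsum_scal.
  apply: Rplus_le_compat; apply: Rmult_le_compat_l => //; first lra.
  by left; apply: Rinv_0_lt_compat; lra.
case: (Rle_lt_or_eq_dec 0 A A0) => [A1|EA]; last first.
  have Hf0 : lsum (fun i => f i * g i) l <= 0.
    apply: le_epsilon => e e0.
    case: (Rle_lt_or_eq_dec 0 B B0) => [B1|EB].
      have := key (B ^ 2 / e).
      have B2 : 0 < B ^ 2 by apply: pow_lt.
      rewrite -EA => /(_ (Rdiv_lt_0_compat _ _ B2 e0)).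
      have -> : B ^ 2 / e / 2 * 0 ^ 2 + / (2 * (B ^ 2 / e)) * B ^ 2 = e / 2 by field; lra.
      lra.
    have := key 1 Rlt_0_1; rewrite -EA -EB; lra.
  by rewrite -EA; lra.
case: (Rle_lt_or_eq_dec 0 B B0) => [B1|EB].
  have := key (B / A) (Rdiv_lt_0_compat _ _ B1 A1).
  have -> : B / A / 2 * A ^ 2 + / (2 * (B / A)) * B ^ 2 = A * B by field; lra.
  by [].
rewrite -EB Rmult_0_r; apply: le_epsilon => e e0.
have A2 : 0 < A ^ 2 by apply: pow_lt.
have := key (e / A ^ 2) (Rdiv_lt_0_compat _ _ e0 A2).
rewrite -EB; have -> : e / A ^ 2 / 2 * A ^ 2 = e / 2 by field; lra.
have -> : / (2 * (e / A ^ 2)) * 0 ^ 2 = 0 by field; lra.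
lra.
Qed.

End BndRules.

Lemma Bnd_inj {I J} (h : J -> I) (g : I -> R) (f : J -> R) S :
  (forall x y, h x = h y -> x = y) -> (forall j, f j <= g (h j)) -> Bnd g S -> Bnd f S.
Proof.
move=> Hi Hle Hg l Hl; apply: Rle_trans (Hg (map h l) (NoDup_map_inj _ _ Hi Hl)).
rewrite lsum_map; apply: lsum_le => i _; exact: Hle.
Qed.

(** A finite list of pairs lies in the rectangle spanned by its two projections, so nonnegativity
    reduces the claim to iterated finite sums. *)
Lemma Bnd_prod {I J} (f : I * J -> R) (s : I -> R) S :
  (forall t, 0 <= f t) -> (forall i, Bnd (fun j => f (i, j)) (s i)) -> Bnd s S -> Bnd f S.
Proof.
move=> f0 Hs HS l Hl.
set li := nodup (eq_dec_of I) (map fst l); set lj := nodup (eq_dec_of J) (map snd l).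
apply: Rle_trans (_ : lsum f (list_prod li lj) <= _).
  apply: lsum_incl => // -[x y] Hx; apply: in_prod; rewrite nodup_In.
  - exact: (in_map fst _ _ Hx).
  - exact: (in_map snd _ _ Hx).
rewrite lsum_prod; apply: Rle_trans (HS li (NoDup_nodup _ _)).
by apply: lsum_le => i _; apply: Hs; apply: NoDup_nodup.
Qed.

Lemma Bnd_section {I J} (f : I * J -> R) S i : Bnd f S -> Bnd (fun j => f (i, j)) S.
Proof. move=> H; by apply: (Bnd_inj (fun j => (i, j)) f) => [x y []|j|] //; lra. Qed.

(** The sum of [f] when [f >= 0] has bounded finite sums; a junk value otherwise. *)
Definition rsum {I : Type} (f : I -> R) : R :=
  real (Lub_Rbar (fun x => exists l, NoDup l /\ x = lsum f l)).

Lemma rsum_spec {I} (f : I -> R) S : Bnd f S ->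
  Bnd f (rsum f) /\ rsum f <= S /\
  forall e, 0 < e -> exists l, NoDup l /\ rsum f - e < lsum f l.
Proof.
move=> H; rewrite /rsum; set E := fun x => _.
have [ub lub] := Lub_Rbar_correct E.
have HS : Rbar_le (Lub_Rbar E) S by apply: lub => x [l [Hl ->]]; exact: H.
have H0 : Rbar_le 0 (Lub_Rbar E).
  by apply: (ub 0); exists nil; split; [constructor|].
have [b Eb] : exists b, Lub_Rbar E = Finite b.
  by case: (Lub_Rbar E) HS H0 => [b| |] //; exists b.
rewrite Eb in ub lub HS *; rewrite /=.
split; last split => //.
- by move=> l Hl; apply: (ub (lsum f l)); exists l.
- move=> e He; apply: NNPP => Hn.
  have : Rbar_le b (b - e).
    apply: lub => x [l [Hl ->]] /=; apply: Rnot_lt_le => Hlt.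
    by apply: Hn; exists l.
  by rewrite /=; lra.
Qed.

Lemma rsum_Bnd {I} (f : I -> R) S : Bnd f S -> Bnd f (rsum f).
Proof. by case/rsum_spec. Qed.

Lemma rsum_le {I} (f : I -> R) S : Bnd f S -> rsum f <= S.
Proof. by case/rsum_spec => _ []. Qed.

Lemma rsum_ge0 {I} (f : I -> R) S : Bnd f S -> 0 <= rsum f.
Proof. by case/rsum_spec => /Bnd_ge0. Qed.

(** For finitely many rows there is one common list of columns on which every row is within [d] of
    its total; the number of rows times [d] stays below [e]. *)
Lemma Bnd_prod_inv {I J} (f : I * J -> R) S : (forall t, 0 <= f t) -> Bnd f S ->
  Bnd (fun i => rsum (fun j => f (i, j))) S.
Proof.
move=> f0 H l Hl; apply: le_epsilon => e e0.
pose d := e / (INR (length l) + 1).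
have Hlen : 0 < INR (length l) + 1 by have := pos_INR (length l); lra.
have d0 : 0 < d by apply: Rdiv_lt_0_compat.
have [lj [Hj Hle]] : exists lj, NoDup lj /\ forall i, In i l ->
    rsum (fun j => f (i, j)) - d <= lsum (fun j => f (i, j)) lj.
  elim: (l) => [|i l' [lj [Hj Hle]]]; first by exists nil; split; [constructor|].
  have [_ [_ /(_ d d0) [l1 [Hl1 H1]]]] := rsum_spec _ _ (Bnd_section f S i H).
  exists (nodup (eq_dec_of J) (l1 ++ lj)); split; first by apply: NoDup_nodup.
  move=> i' [E|Hi'].
  - subst i'; apply: Rle_trans (_ : lsum (fun j => f (i, j)) l1 <= _); first lra.
    apply: lsum_incl => // x Hx; rewrite nodup_In; apply: in_or_app; by left.
  - apply: Rle_trans (Hle _ Hi') _; apply: lsum_incl => // x Hx.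
    rewrite nodup_In; apply: in_or_app; by right.
have := H (list_prod l lj) (NoDup_prod _ _ Hl Hj); rewrite lsum_prod.
have : lsum (fun i => rsum (fun j => f (i, j)) + - d) l <=
       lsum (fun i => lsum (fun j => f (i, j)) lj) l.
  by apply: lsum_le => i Hi; have := Hle i Hi; lra.
rewrite lsum_plus lsum_const.
have : INR (length l) * - d >= - e.
  have -> : - e = (INR (length l) + 1) * - d by rewrite /d; field; lra.
  have := pos_INR (length l); nra.
lra.
Qed.

(** Convergence of the net of finite sums ordered by inclusion. Unlike symmetric summation it is
    stable under reindexing and under Fubini. *)
Definition hassum {I : Type} (f : I -> C) (s : C) : Prop :=
  forall e, 0 < e -> exists l0, NoDup l0 /\
    forall l, NoDup l -> incl l0 l -> Cmod (Cminus (csum f l) s) < e.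

(** An unspecified number, not zero, when there is no sum; this is why summability is carried as a
    side condition. *)
Definition tsum {I : Type} (f : I -> C) : C := epsilon (inhabits (RtoC 0)) (hassum f).

Definition summable {I : Type} (f : I -> C) : Prop := exists S, Bnd (fun i => Cmod (f i)) S.

Lemma incl_union {I : Type} (l1 l2 : list I) :
  exists l, NoDup l /\ incl l1 l /\ incl l2 l.
Proof.
exists (nodup (eq_dec_of I) (l1 ++ l2)); split; first by apply: NoDup_nodup.
by split=> x Hx; rewrite nodup_In; apply: in_or_app; [left|right].
Qed.

Lemma hassum_unique {I} (f : I -> C) s s' : hassum f s -> hassum f s' -> s = s'.
Proof.
move=> H H'.
have H0 : Cmod (Cminus s s') <= 0.
  apply: le_epsilon => e e0.
  have [l1 [N1 H1]] := H (e / 2) ltac:(lra).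
  have [l2 [N2 H2]] := H' (e / 2) ltac:(lra).
  have [l [Nl [I1 I2]]] := incl_union l1 l2.
  have h1 := H1 l Nl I1; have h2 := H2 l Nl I2.
  have -> : Cminus s s' = Cplus (Cminus (csum f l) s') (Copp (Cminus (csum f l) s)) by ring.
  have := Cmod_triangle (Cminus (csum f l) s') (Copp (Cminus (csum f l) s)).
  rewrite Cmod_opp; lra.
have := Cmod_ge_0 (Cminus s s') => H1.
have E : Cminus s s' = 0 by apply: Cmod_eq_0; lra.
have -> : s = Cplus (Cminus s s') s' by ring.
by rewrite E; ring.
Qed.

Lemma tsum_eq {I} (f : I -> C) s : hassum f s -> tsum f = s.
Proof.
move=> H; apply: (hassum_unique f) => //.
apply: epsilon_spec; by exists s.
Qed.

Lemma Rnonneg_hassum {I} (f : I -> R) S : (forall i, 0 <= f i) -> Bnd f S ->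
  hassum (fun i => RtoC (f i)) (RtoC (rsum f)).
Proof.
move=> f0 H; have [H1 [_ H2]] := rsum_spec _ _ H.
move=> e /H2 [l0 [N0 Hl0]]; exists l0; split => // l Nl Hin.
have -> : csum (fun i => RtoC (f i)) l = RtoC (lsum f l).
  apply: injective_projections; first by rewrite csum_re.
  by rewrite csum_im /= lsum_const; ring.
rewrite -RtoC_minus Cmod_R.
have := H1 l Nl; have := lsum_incl f l0 l f0 N0 Hin.
move=> ? ?; rewrite Rabs_left1; lra.
Qed.

Lemma hassum_plus {I} (f g : I -> C) a b : hassum f a -> hassum g b ->
  hassum (fun i => Cplus (f i) (g i)) (Cplus a b).
Proof.
move=> Hf Hg e e0.
have [l1 [N1 H1]] := Hf (e / 2) ltac:(lra).
have [l2 [N2 H2]] := Hg (e / 2) ltac:(lra).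
have [l0 [Nl [I1 I2]]] := incl_union l1 l2.
exists l0; split => // l Nl' Hin.
have h1 := H1 l Nl' (incl_tran I1 Hin); have h2 := H2 l Nl' (incl_tran I2 Hin).
rewrite csum_plus.
have -> : Cminus (Cplus (csum f l) (csum g l)) (Cplus a b) =
  Cplus (Cminus (csum f l) a) (Cminus (csum g l) b) by ring.
have := Cmod_triangle (Cminus (csum f l) a) (Cminus (csum g l) b); lra.
Qed.

Lemma hassum_scal {I} c (f : I -> C) a : hassum f a ->
  hassum (fun i => Cmult c (f i)) (Cmult c a).
Proof.
move=> Hf e e0.
have Hc : 0 < Cmod c + 1 by have := Cmod_ge_0 c; lra.
have [l1 [N1 H1]] := Hf (e / (Cmod c + 1)) (Rdiv_lt_0_compat _ _ e0 Hc).
exists l1; split => // l Nl Hin; rewrite csum_scal.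
have -> : Cminus (Cmult c (csum f l)) (Cmult c a) = Cmult c (Cminus (csum f l) a) by ring.
rewrite Cmod_mult.
have h := H1 l Nl Hin.
apply: Rle_lt_trans (_ : (Cmod c + 1) * Cmod (Cminus (csum f l) a) < e).
  by apply: Rmult_le_compat_r; [apply: Cmod_ge_0 | lra].
have -> : e = (Cmod c + 1) * (e / (Cmod c + 1)) by field; lra.
by apply: Rmult_lt_compat_l.
Qed.

Lemma hassum_conj {I} (f : I -> C) a : hassum f a ->
  hassum (fun i => Cconj (f i)) (Cconj a).
Proof.
move=> Hf e /Hf [l1 [N1 H1]]; exists l1; split => // l Nl Hin.
by rewrite csum_conj -Cminus_conj Cmod_conj; exact: H1.
Qed.

Lemma hassum_ext {I} (f g : I -> C) a : (forall i, f i = g i) -> hassum f a -> hassum g a.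
Proof. by move=> H; have -> : g = f by apply: functional_extensionality => i; rewrite H. Qed.

Lemma im_le_Cmod c : Rabs (Im c) <= Cmod c.
Proof.
rewrite -(Rabs_pos_eq (Cmod c)); last by apply: Cmod_ge_0.
apply: Rsqr_le_abs_0; have := Cmod2_alt c; rewrite /Rsqr.
have := pow2_ge_0 (Re c); rewrite /=; lra.
Qed.

Lemma tsum_hassum {I} (f : I -> C) : summable f -> hassum f (tsum f).
Proof.
move=> [S HS]; apply: epsilon_spec.
(* A real part is written as [(Cmod (f i) + u (f i)) - Cmod (f i)], a difference of nonnegative
   summable families, with [u] equal to [Re] and then to [Im]. *)
pose part (u : C -> R) i := (Cmod (f i) + u (f i)).
have Hpart : forall u : C -> R, (forall c, Rabs (u c) <= Cmod c) ->
  exists s, hassum (fun i => RtoC (u (f i))) s.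
  move=> u Hu.
  have Habs := fun i => proj1 (Rabs_le_between _ _) (Hu (f i)).
  have B1 : Bnd (part u) (2 * S).
    apply: (Bnd_le _ (fun i => 2 * Cmod (f i))); last by apply: Bnd_scal => //; lra.
    by move=> i; rewrite /part; have := Habs i; lra.
  have P1 : forall i, 0 <= part u i by move=> i; rewrite /part; have := Habs i; lra.
  have := hassum_plus _ _ _ _ (Rnonneg_hassum _ _ P1 B1)
     (hassum_scal (RtoC (-1)) _ _ (Rnonneg_hassum _ _ (fun i => Cmod_ge_0 (f i)) HS)).
  move=> H; eexists; apply: hassum_ext H => i /=; rewrite /part RtoC_plus; ring.
have [a Ha] := Hpart Re re_le_Cmod; have [b Hb] := Hpart Im im_le_Cmod.
exists (Cplus a (Cmult (0, 1) b)).
apply: hassum_ext (hassum_plus _ _ _ _ Ha (hassum_scal (0, 1) _ _ Hb)) => i.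
by apply: injective_projections; rewrite /= /Re /Im; ring.
Qed.

Lemma tsum_ext {I} (f g : I -> C) : (forall i, f i = g i) -> tsum f = tsum g.
Proof. by move=> H; have -> : g = f by apply: functional_extensionality => i; rewrite H. Qed.

Lemma summable_le {I} (f : I -> C) (g : I -> R) S :
  (forall i, Cmod (f i) <= g i) -> Bnd g S -> summable f.
Proof. by move=> H Hg; exists S; apply: Bnd_le Hg. Qed.

Lemma summable_ext {I} (f g : I -> C) : (forall i, f i = g i) -> summable f -> summable g.
Proof. by move=> H; have -> : g = f by apply: functional_extensionality => i; rewrite H. Qed.

Lemma summable_plus {I} (f g : I -> C) : summable f -> summable g ->
  summable (fun i => Cplus (f i) (g i)).
Proof.
move=> [S HS] [S' HS'].
exact: (summable_le _ _ _ (fun i => Cmod_triangle (f i) (g i)) (Bnd_plus _ _ _ _ HS HS')).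
Qed.

Lemma summable_scal {I} c (f : I -> C) : summable f -> summable (fun i => Cmult c (f i)).
Proof.
move=> [S HS]; apply: (summable_le _ (fun i => Cmod c * Cmod (f i)) (Cmod c * S)).
- by move=> i; rewrite Cmod_mult; lra.
- by apply: Bnd_scal => //; apply: Cmod_ge_0.
Qed.

Lemma summable_conj {I} (f : I -> C) : summable f -> summable (fun i => Cconj (f i)).
Proof.
move=> [S HS]; apply: (summable_le _ _ _ _ HS) => i; by rewrite Cmod_conj; lra.
Qed.

Lemma tsum_plus {I} (f g : I -> C) : summable f -> summable g ->
  tsum (fun i => Cplus (f i) (g i)) = Cplus (tsum f) (tsum g).
Proof. by move=> Hf Hg; apply: tsum_eq; apply: hassum_plus; apply: tsum_hassum. Qed.

Lemma tsum_scal {I} c (f : I -> C) : summable f ->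
  tsum (fun i => Cmult c (f i)) = Cmult c (tsum f).
Proof. by move=> Hf; apply: tsum_eq; apply: hassum_scal; apply: tsum_hassum. Qed.

Lemma tsum_conj {I} (f : I -> C) : summable f ->
  tsum (fun i => Cconj (f i)) = Cconj (tsum f).
Proof. by move=> Hf; apply: tsum_eq; apply: hassum_conj; apply: tsum_hassum. Qed.

Lemma tsum_minus {I} (f g : I -> C) : summable f -> summable g ->
  tsum (fun i => Cminus (f i) (g i)) = Cminus (tsum f) (tsum g).
Proof.
move=> Hf Hg; rewrite (tsum_ext _ (fun i => Cplus (f i) (Cmult (RtoC (-1)) (g i)))).
  by rewrite tsum_plus ?tsum_scal //; [ring | apply: summable_scal].
by move=> i; ring.
Qed.

Lemma summable_minus {I} (f g : I -> C) : summable f -> summable g ->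
  summable (fun i => Cminus (f i) (g i)).
Proof.
move=> Hf Hg; apply: (summable_ext (fun i => Cplus (f i) (Cmult (RtoC (-1)) (g i)))).
  by move=> i; ring.
by apply: summable_plus => //; apply: summable_scal.
Qed.

Lemma tsum_bound {I} (f : I -> C) (g : I -> R) S :
  (forall i, Cmod (f i) <= g i) -> Bnd g S -> Cmod (tsum f) <= S.
Proof.
move=> Hle HS; apply: le_epsilon => e e0.
have [l [Nl H]] := tsum_hassum f (summable_le _ _ _ Hle HS) e e0.
have := H l Nl (incl_refl _).
have := Cmod_csum f l; have := Bnd_le _ _ _ Hle HS l Nl.
have -> : tsum f = Cplus (csum f l) (Copp (Cminus (csum f l) (tsum f))) by ring.
have := Cmod_triangle (csum f l) (Copp (Cminus (csum f l) (tsum f))).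
rewrite Cmod_opp.
have -> : Cplus (csum f l) (Copp (Cminus (csum f l) (tsum f))) = tsum f by ring.
lra.
Qed.

Lemma tsum_rsum {I} (f : I -> R) S : (forall i, 0 <= f i) -> Bnd f S ->
  tsum (fun i => RtoC (f i)) = RtoC (rsum f).
Proof. by move=> f0 H; apply: tsum_eq; apply: Rnonneg_hassum H. Qed.

Lemma summable_reindex {I J} (h : J -> I) (f : I -> C) :
  (forall x y, h x = h y -> x = y) -> summable f -> summable (fun j => f (h j)).
Proof.
move=> Hi [S HS]; exists S; apply: (Bnd_inj h _ _ _ Hi _ HS) => j; lra.
Qed.

Lemma tsum_reindex {I J} (h : J -> I) (g : I -> J) (f : I -> C) :
  (forall i, h (g i) = i) -> (forall j, g (h j) = j) -> summable f ->
  tsum (fun j => f (h j)) = tsum f.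
Proof.
move=> hg gh Hf; apply: tsum_eq => e e0.
have [l0 [N0 H0]] := tsum_hassum f Hf e e0.
exists (map g l0); split.
  by apply: NoDup_map_inj => // x y E; rewrite -(hg x) E hg.
move=> l Nl Hin; rewrite -csum_map; apply: H0.
  by apply: NoDup_map_inj => // x y E; rewrite -(gh x) E gh.
move=> i Hi; rewrite -(hg i); apply: in_map; apply: Hin; exact: in_map.
Qed.

Lemma summable_section {I J} (f : I * J -> C) i : summable f -> summable (fun j => f (i, j)).
Proof. move=> [S HS]; exists S; exact: (Bnd_section (fun t => Cmod (f t))). Qed.

Lemma summable_prod {I J} (f : I * J -> C) : summable f ->
  summable (fun i => tsum (fun j => f (i, j))).
Proof.
move=> [S HS].
have H := Bnd_prod_inv _ _ (fun t => Cmod_ge_0 (f t)) HS.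
apply: (summable_le _ _ _ _ H) => i.
apply: (tsum_bound _ (fun j => Cmod (f (i, j)))); first by move=> j; lra.
exact: rsum_Bnd (Bnd_section (fun t => Cmod (f t)) S i HS).
Qed.

(** Fubini: half of the error compares the total with a large rectangle, the other half truncates
    finitely many rows, each to within [d]. *)
Lemma tsum_prod {I J} (f : I * J -> C) : summable f ->
  tsum (fun i => tsum (fun j => f (i, j))) = tsum f.
Proof.
move=> Hf; apply: tsum_eq => e e0.
have [l0 [N0 H0]] := tsum_hassum f Hf (e / 2) ltac:(lra).
exists (nodup (eq_dec_of I) (map fst l0)); split; first by apply: NoDup_nodup.
move=> li Ni Hin.
pose d := e / 2 / (INR (length li) + 1).
have Hlen : 0 < INR (length li) + 1 by have := pos_INR (length li); lra.
have d0 : 0 < d by apply: Rdiv_lt_0_compat; lra.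
have [lj [Nj [Hj Hle]]] : exists lj, NoDup lj /\ incl (map snd l0) lj /\
    forall i, In i li -> forall l, NoDup l -> incl lj l ->
      Cmod (Cminus (csum (fun j => f (i, j)) l) (tsum (fun j => f (i, j)))) < d.
  elim: (li) => [|i l' [lj [Nj [Hj Hle]]]].
    exists (nodup (eq_dec_of J) (map snd l0)); split; first by apply: NoDup_nodup.
    by split => // x; rewrite nodup_In.
  have [l1 [N1 H1]] := tsum_hassum _ (summable_section f i Hf) d d0.
  have [l2 [N2 [I1 I2]]] := incl_union l1 lj.
  exists l2; split => //; split; first exact: incl_tran I2.
  move=> i' [<-|Hi'] l Nl Hl.
  - by apply: H1 => //; exact: incl_tran Hl.
  - by apply: Hle => //; exact: incl_tran Hl.
have Hbox : Cmod (Cminus (csum f (list_prod li lj)) (tsum f)) < e / 2.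
  apply: H0; first exact: NoDup_prod.
  move=> [x y] Hx; apply: in_prod.
  - by apply: Hin; rewrite nodup_In; exact: (in_map fst _ _ Hx).
  - by apply: Hj; exact: (in_map snd _ _ Hx).
have Hd : Cmod (Cminus (csum (fun i => tsum (fun j => f (i, j))) li)
                       (csum f (list_prod li lj))) <= e / 2.
  rewrite csum_prod.
  have -> : Cminus (csum (fun i => tsum (fun j => f (i, j))) li)
     (csum (fun i => csum (fun j => f (i, j)) lj) li) =
     csum (fun i => Cplus (tsum (fun j => f (i, j)))
        (Cmult (RtoC (-1)) (csum (fun j => f (i, j)) lj))) li.
    by rewrite csum_plus csum_scal; ring.
  apply: Rle_trans; first by apply: Cmod_csum.
  apply: Rle_trans (_ : lsum (fun _ : I => d) li <= _).
    apply: lsum_le => i Hi.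
    have := Hle i Hi lj Nj (incl_refl _).
    rewrite -Cmod_opp.
    have -> : (- (csum (fun j => f (i, j)) lj - tsum (fun j => f (i, j))))%C =
      (tsum (fun j => f (i, j)) + RtoC (-1) * csum (fun j => f (i, j)) lj)%C by ring.
    lra.
  rewrite lsum_const.
  have -> : e / 2 = (INR (length li) + 1) * d by rewrite /d; field; lra.
  have := pos_INR (length li); nra.
have -> : Cminus (csum (fun i => tsum (fun j => f (i, j))) li) (tsum f) =
  Cplus (Cminus (csum (fun i => tsum (fun j => f (i, j))) li) (csum f (list_prod li lj)))
        (Cminus (csum f (list_prod li lj)) (tsum f)) by ring.
have := Cmod_triangle
  (Cminus (csum (fun i => tsum (fun j => f (i, j))) li) (csum f (list_prod li lj)))
  (Cminus (csum f (list_prod li lj)) (tsum f)); lra.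
Qed.

Lemma hassum_single {I} (f : I -> C) i0 : (forall i, i <> i0 -> f i = 0) -> hassum f (f i0).
Proof.
move=> H e e0; exists (i0 :: nil); split.
  by constructor; [move=> [] | constructor].
move=> l Nl Hin.
have Hi : In i0 l by apply: Hin; left.
have [l1 [l2 El]] := in_split _ _ Hi; subst l.
have Np := NoDup_remove_2 _ _ _ Nl.
have -> : csum f (l1 ++ i0 :: l2) = f i0.
  have Hz : forall l, ~ In i0 l -> csum f l = RtoC 0.
    move=> l Hl; rewrite (csum_ext f (fun _ => Cmult 0 0)); first by rewrite csum_scal; ring.
    by move=> i Hi'; rewrite H; [ring | move=> E; subst].
  rewrite csum_app /= !Hz; first by ring.
  - by move=> H2; apply: Np; apply: in_or_app; right.
  - by move=> H1; apply: Np; apply: in_or_app; left.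
have -> : Cminus (f i0) (f i0) = 0 by ring.
by rewrite Cmod_0.
Qed.

Lemma tsum_zero {I} : tsum (fun _ : I => RtoC 0) = RtoC 0.
Proof.
apply: tsum_eq => e e0; exists nil; split; first by constructor.
move=> l _ _; rewrite (csum_ext _ (fun _ => Cmult 0 0)); last by move=> i _; ring.
rewrite csum_scal.
have -> : (0 * csum (fun _ : I => RtoC 0) l - 0)%C = 0 by ring.
by rewrite Cmod_0.
Qed.

Lemma tsum_re {I} (f : I -> C) : summable f -> forall g : I -> R,
  (forall i, Re (f i) = g i) -> tsum (fun i => RtoC (g i)) = RtoC (Re (tsum f)).
Proof.
move=> Hf g Hg; rewrite re_alt -tsum_conj // -tsum_plus //; last exact: summable_conj.
have E : forall z, (z / 2)%C = Cmult (/ 2)%C z by move=> z; rewrite /Cdiv; ring.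
rewrite E -tsum_scal; last by apply: summable_plus => //; exact: summable_conj.
apply: tsum_ext => i; rewrite -Hg re_alt /Cdiv; ring.
Qed.

(** * Symmetric sums over [Z] and Sobolev weights *)

Fixpoint zlist (n : nat) : list Z :=
  match n with
  | O => 0%Z :: nil
  | S m => Z.of_nat (S m) :: (- Z.of_nat (S m))%Z :: zlist m
  end.

Lemma zlist_In n k : In k (zlist n) <-> (Z.abs k <= Z.of_nat n)%Z.
Proof.
elim: n => [|n IH]; first by rewrite /=; lia.
by rewrite [zlist _]/= -/(zlist n) [In _ _]/= IH; lia.
Qed.

Lemma zlist_NoDup n : NoDup (zlist n).
Proof.
elim: n => [|n IH]; first by constructor; [case | constructor].
rewrite [zlist _]/= -/(zlist n); constructor; last constructor => //.
- rewrite [In _ _]/= zlist_In; lia.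
- rewrite zlist_In; lia.
Qed.

Lemma zlist_cover (l : list Z) : exists n, forall m, (n <= m)%nat -> incl l (zlist m).
Proof.
elim: l => [|k l [n IH]]; first by exists 0%nat => m _ x [].
exists (n + Z.abs_nat k)%nat => m Hm x [<-|Hx].
- apply/zlist_In; lia.
- apply: (IH m _ x Hx); lia.
Qed.

Lemma sum_n_pairZ (a : Z -> R) n : sum_n (pairZ a) n = lsum a (zlist n).
Proof.
elim: n => [|n IH]; first by rewrite sum_O /=; ring.
rewrite sum_Sn IH /plus /=; ring.
Qed.

(** The symmetric windows [zlist n] eventually contain any given finite list, so unconditional
    convergence determines the symmetric limit. *)
Lemma zsumR_lim (a : Z -> R) s :
  (forall e, 0 < e -> exists l0, NoDup l0 /\ forall l, NoDup l -> incl l0 l -> Rabs (lsum a l - s) < e) ->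
  zsumR a = s.
Proof.
move=> H; apply: is_series_unique.
suff : is_lim_seq (sum_n (pairZ a)) s by [].
apply/is_lim_seq_spec => -[e e0] /=.
have [l0 [_ Hl0]] := H e e0.
have [n Hn] := zlist_cover l0.
exists n => m Hm; rewrite sum_n_pairZ; apply: Hl0; first exact: zlist_NoDup.
exact: Hn.
Qed.

Lemma zsumC_tsum (f : Z -> C) : summable f -> zsumC f = tsum f.
Proof.
move=> Hf; have H := tsum_hassum f Hf.
apply: injective_projections => /=; apply: zsumR_lim => e /H [l0 [N0 Hl0]];
  exists l0; split => // l Nl Hin; apply: Rle_lt_trans (Hl0 l Nl Hin).
- by have := re_le_Cmod (Cminus (csum f l) (tsum f)); rewrite /Re /= csum_re.
- by have := im_le_Cmod (Cminus (csum f l) (tsum f)); rewrite /Im /= csum_im.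
Qed.

Lemma Bnd_zlist (a : Z -> R) S : (forall k, 0 <= a k) ->
  (forall n, lsum a (zlist n) <= S) -> Bnd a S.
Proof.
move=> a0 H l Nl; have [n Hn] := zlist_cover l.
apply: Rle_trans (H n); apply: lsum_incl => //; exact: Hn.
Qed.

Lemma ex_series_Bnd (a : Z -> R) : (forall k, 0 <= a k) -> ex_series (pairZ a) -> Bnd a (zsumR a).
Proof.
move=> a0 Hex; apply: Bnd_zlist => // n; rewrite -sum_n_pairZ.
have H : is_lim_seq (sum_n (pairZ a)) (zsumR a) := Series_correct _ Hex.
apply: (is_lim_seq_incr_compare _ _ H) => m.
rewrite sum_Sn /plus /=; have := a0 (Z.of_nat (S m)); have := a0 (- Z.of_nat (S m))%Z.
rewrite /=; lra.
Qed.

Lemma Bnd_ex_series (a : Z -> R) S : (forall k, 0 <= a k) -> Bnd a S ->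
  ex_series (pairZ a) /\ zsumR a <= S.
Proof.
move=> a0 HS.
have Hinc : forall n, sum_n (pairZ a) n <= sum_n (pairZ a) (Datatypes.S n).
  move=> m; rewrite sum_Sn /plus /=.
  have := a0 (Z.of_nat (Datatypes.S m)); have := a0 (- Z.of_nat (Datatypes.S m))%Z.
  rewrite /=; lra.
have Hb : forall n, sum_n (pairZ a) n <= S.
  by move=> n; rewrite sum_n_pairZ; apply: HS; apply: zlist_NoDup.
have [l Hl] := ex_finite_lim_seq_incr _ _ Hinc Hb.
split; first by exists l.
rewrite /zsumR (is_series_unique _ l Hl).
exact: (is_lim_seq_le (sum_n (pairZ a)) (fun _ => S) l S Hb Hl (is_lim_seq_const S)).
Qed.

(** The Japanese bracket. The Sobolev weight [Hweight s] is the square of [W s], which lets [Hterm]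
    be read as a square in [l2]. *)
Definition jp (k : Z) : R := sqrt (1 + IZR k ^ 2).
Definition W (s : R) (k : Z) : R := Rpower (jp k) s.

Lemma jp_sqr k : jp k ^ 2 = 1 + IZR k ^ 2.
Proof. rewrite /jp pow2_sqrt //; have := pow2_ge_0 (IZR k); lra. Qed.

Lemma jp_ge1 k : 1 <= jp k.
Proof. rewrite /jp -{1}sqrt_1; apply: sqrt_le_1; have := pow2_ge_0 (IZR k); lra. Qed.

Lemma jp_abs k : Rabs (IZR k) <= jp k.
Proof.
apply: Rsqr_incr_0; [|exact: Rabs_pos | have := jp_ge1 k; lra].
rewrite -Rsqr_abs !Rsqr_pow2 jp_sqr; lra.
Qed.

Lemma IZR_abs_ge1 k : k <> 0%Z -> 1 <= Rabs (IZR k).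
Proof. move=> Hk; rewrite -abs_IZR; apply: IZR_le; lia. Qed.

Lemma jp_le_abs k : k <> 0%Z -> jp k <= 2 * Rabs (IZR k).
Proof.
move=> /IZR_abs_ge1 Hk; have := jp_sqr k; rewrite -(pow2_abs (IZR k)).
have := jp_ge1 k; nra.
Qed.

Lemma jp_opp k : jp (- k) = jp k.
Proof. by rewrite /jp opp_IZR; congr sqrt; ring. Qed.

Lemma jp_add k l : jp (k + l) <= jp k + jp l.
Proof.
have a1 := jp_ge1 k; have a2 := jp_ge1 l; have a3 := jp_ge1 (k + l).
have b1 := jp_abs k; have b2 := jp_abs l.
apply: Rsqr_incr_0; [|lra|lra]; rewrite !Rsqr_pow2 jp_sqr plus_IZR.
have -> : (jp k + jp l) ^ 2 = jp k ^ 2 + jp l ^ 2 + 2 * (jp k * jp l) by ring.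
rewrite !jp_sqr.
have : IZR k * IZR l <= jp k * jp l.
  apply: Rle_trans (Rle_abs _) _; rewrite Rabs_mult.
  by apply: Rmult_le_compat => //; exact: Rabs_pos.
nra.
Qed.

Lemma jp_sub k l : jp (k - l) <= jp k + jp l.
Proof. by have := jp_add k (- l); rewrite jp_opp. Qed.

Lemma jp_sum3 k k2 k3 : jp k <= jp k2 + jp k3 + jp (k2 + k3 - k).
Proof.
have -> : jp k = jp (k2 + k3 - (k2 + k3 - k)) by congr jp; ring.
have := jp_sub (k2 + k3) (k2 + k3 - k); have := jp_add k2 k3; lra.
Qed.

Lemma W_pos s k : 0 < W s k.
Proof. exact: exp_pos. Qed.

Lemma W_plus s t k : W (s + t) k = W s k * W t k.
Proof. exact: Rpower_plus. Qed.

Lemma W_0 k : W 0 k = 1.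
Proof. apply: Rpower_O; have := jp_ge1 k; lra. Qed.

Lemma W_1 k : W 1 k = jp k.
Proof. apply: Rpower_1; have := jp_ge1 k; lra. Qed.

Lemma W_le s t k : s <= t -> W s k <= W t k.
Proof. by move=> H; apply: Rle_Rpower => //; exact: jp_ge1. Qed.

Lemma W_ge1 s k : 0 <= s -> 1 <= W s k.
Proof. by move=> H; rewrite -(W_0 k); exact: W_le. Qed.

Lemma W_opp s k : W (- s) k = / W s k.
Proof. exact: Rpower_Ropp. Qed.

Lemma W_0_eq s : W s 0 = 1.
Proof.
rewrite /W; have -> : jp 0 = 1 by rewrite /jp -{2}sqrt_1; congr sqrt; ring.
by rewrite /Rpower ln_1 Rmult_0_r exp_0.
Qed.

Lemma Rpower_max3 x y z s : 0 < x -> 0 < y -> 0 < z -> 0 <= s ->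
  Rpower (x + y + z) s <= Rpower 3 s * (Rpower x s + Rpower y s + Rpower z s).
Proof.
move=> x0 y0 z0 s0.
have px := exp_pos (s * ln x); have py := exp_pos (s * ln y); have pz := exp_pos (s * ln z).
have p3 := exp_pos (s * ln 3).
pose m := Rmax x (Rmax y z).
have Hm : x + y + z <= 3 * m.
  have := Rmax_l x (Rmax y z); have := Rmax_r x (Rmax y z).
  have := Rmax_l y z; have := Rmax_r y z; rewrite -/m; lra.
have m0 : 0 < m by have := Rmax_l x (Rmax y z); rewrite -/m; lra.
apply: Rle_trans (Rle_Rpower_l _ _ _ s0 (conj _ Hm)) _; first lra.
rewrite -Rpower_mult_distr //; last lra.
apply: Rmult_le_compat_l; first by left.
rewrite /m /Rmax; case: (Rle_dec y z) => _; case: (Rle_dec _ _) => _; rewrite /Rpower; lra.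
Qed.

Lemma W_sum3 s k k2 k3 : 0 <= s ->
  W s k <= Rpower 3 s * (W s k2 + W s k3 + W s (k2 + k3 - k)).
Proof.
move=> s0; have a1 := jp_ge1 k2; have a2 := jp_ge1 k3; have a3 := jp_ge1 (k2 + k3 - k).
apply: Rle_trans (Rpower_max3 _ _ _ _ _ _ _ s0); try lra.
apply: Rle_Rpower_l => //; split; first by have := jp_ge1 k; lra.
exact: jp_sum3.
Qed.

Lemma Hterm_W s f k : Hterm s f k = (W s k * Cmod (f k)) ^ 2.
Proof.
rewrite /Hterm /Hweight -jp_sqr Rpow_mult_distr; congr Rmult.
rewrite -(Rpower_pow 2 (W s k)); last exact: W_pos.
rewrite -(Rpower_pow 2 (jp k)); last by have := jp_ge1 k; lra.
rewrite /W !Rpower_mult; congr Rpower; ring.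
Qed.

(** * l1 and l2 bounds for nonnegative families *)

(** A bound rather than a norm: finiteness, the estimate and the nonnegativity of the family travel
    together and compose by monotonicity. *)
Definition L2 {I : Type} (f : I -> R) (A : R) : Prop :=
  (forall i, 0 <= f i) /\ 0 <= A /\ Bnd (fun i => f i ^ 2) (A ^ 2).
Definition L1 {I : Type} (f : I -> R) (A : R) : Prop :=
  (forall i, 0 <= f i) /\ Bnd f A.

Lemma L2_le {I} (f g : I -> R) A : (forall i, 0 <= f i) -> (forall i, f i <= g i) ->
  L2 g A -> L2 f A.
Proof.
move=> f0 H [g0 [A0 HA]]; split => //; split => //.
apply: Bnd_le HA => i; apply: pow_incr; split => //.
Qed.

Lemma L2_mono {I} (f : I -> R) A B : A <= B -> L2 f A -> L2 f B.
Proof.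
move=> H [f0 [A0 HA]]; split => //; split; first lra.
by apply: Bnd_mono HA; apply: pow_incr.
Qed.

Lemma L2_ext {I} (f g : I -> R) A : (forall i, f i = g i) -> L2 f A -> L2 g A.
Proof. by move=> H; have -> : g = f by apply: functional_extensionality => i; rewrite H. Qed.

Lemma L2_ge0 {I} (f : I -> R) A : L2 f A -> 0 <= A.
Proof. by case=> _ []. Qed.

Lemma L2_scal {I} c (f : I -> R) A : 0 <= c -> L2 f A -> L2 (fun i => c * f i) (c * A).
Proof.
move=> c0 [f0 [A0 HA]]; split; first by move=> i; apply: Rmult_le_pos.
split; first exact: Rmult_le_pos.
rewrite Rpow_mult_distr; apply: (Bnd_le _ (fun i => c ^ 2 * f i ^ 2)).
  by move=> i; rewrite Rpow_mult_distr; lra.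
by apply: Bnd_scal => //; exact: pow2_ge_0.
Qed.

Lemma L2_CS {I} (f g : I -> R) A B : L2 f A -> L2 g B -> L1 (fun i => f i * g i) (A * B).
Proof.
move=> [f0 [A0 HA]] [g0 [B0 HB]]; split; first by move=> i; exact: Rmult_le_pos.
exact: Bnd_CS.
Qed.

Lemma L2_plus {I} (f g : I -> R) A B : L2 f A -> L2 g B -> L2 (fun i => f i + g i) (A + B).
Proof.
move=> Hf Hg; have [_ Hfg] := L2_CS _ _ _ _ Hf Hg.
case: Hf => [f0 [A0 HA]]; case: Hg => [g0 [B0 HB]].
split; first by move=> i; have := f0 i; have := g0 i; lra.
split; first lra.
have -> : (A + B) ^ 2 = (A ^ 2 + B ^ 2) + 2 * (A * B) by ring.
apply: (Bnd_le _ (fun i => (f i ^ 2 + g i ^ 2) + 2 * (f i * g i))).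
  by move=> i; apply: Req_le; ring.
by apply: Bnd_plus; [exact: Bnd_plus | apply: Bnd_scal => //; lra].
Qed.

Lemma L2_zero {I} : L2 (fun _ : I => 0) 0.
Proof.
split; first by move=> i; lra.
split; first lra.
by apply: (Bnd_le _ (fun _ => 0)); [move=> i; lra | have -> : 0 ^ 2 = 0 by ring]; exact: Bnd_zero.
Qed.

Lemma L2_point {I} (f : I -> R) A i : L2 f A -> f i <= A.
Proof.
move=> [f0 [A0 HA]]; apply: Rsqr_incr_0 => //; rewrite !Rsqr_pow2.
exact: (Bnd_point (fun i => f i ^ 2)).
Qed.

Lemma L2_inj {I J} (h : J -> I) (g : I -> R) A : (forall x y, h x = h y -> x = y) ->
  L2 g A -> L2 (fun j => g (h j)) A.
Proof.
move=> Hi [g0 [A0 HA]]; split => //; split => //.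
by apply: (Bnd_inj h _ _ _ Hi _ HA) => j; lra.
Qed.

Lemma L2_prod {I J} (f : I * J -> R) (s : I -> R) S :
  (forall t, 0 <= f t) -> (forall i, L2 (fun j => f (i, j)) (s i)) -> L2 s S -> L2 f S.
Proof.
move=> f0 Hs [s0 [S0 HS]]; split => //; split => //.
apply: (Bnd_prod _ (fun i => s i ^ 2)) => //; first by move=> t; exact: pow2_ge_0.
by move=> i; case: (Hs i) => _ [].
Qed.

Lemma Bnd_single {I} (i0 : I) (f : I -> R) : (forall i, i <> i0 -> f i = 0) -> 0 <= f i0 ->
  Bnd f (f i0).
Proof.
move=> Hf H0 l Nl; case: (classic (In i0 l)) => Hi; last first.
  rewrite (lsum_ext f (fun _ => 0)); first by rewrite lsum_const; lra.
  by move=> i Hi'; apply: Hf => E; subst.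
have [l1 [l2 El]] := in_split _ _ Hi; subst l.
have Np := NoDup_remove_2 _ _ _ Nl.
have Hz : forall l, ~ In i0 l -> lsum f l = 0.
  move=> l Hl; rewrite (lsum_ext f (fun _ => 0)); first by rewrite lsum_const; lra.
  by move=> i Hi'; apply: Hf => E; subst.
rewrite lsum_app /= !Hz; first lra.
- by move=> H2; apply: Np; apply: in_or_app; right.
- by move=> H1; apply: Np; apply: in_or_app; left.
Qed.

(** Telescoping: [h] plays the part of the tail in the integral test. *)
Lemma Bnd_nat (f h : nat -> R) : (forall n, 0 <= f n) -> (forall n, 0 <= h n) ->
  (forall n, f n <= h n - h (S n)) -> Bnd f (h 0%nat).
Proof.
move=> f0 h0 H l Nl.
have Hs : forall N, lsum f (seq 0 N) <= h 0%nat - h N.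
  elim=> [|N IH]; first by rewrite /=; lra.
  by rewrite seq_S lsum_app /=; have := H N; lra.
apply: Rle_trans (_ : lsum f (seq 0 (S (list_max l))) <= _).
  apply: lsum_incl => // n Hn; apply/in_seq; split; first lia.
  have /list_max_le /Forall_forall := Nat.le_refl (list_max l).
  move=> /(_ n Hn); lia.
have := Hs (S (list_max l)); have := h0 (S (list_max l)); lra.
Qed.

(** One step of the integral test for the power [- s]. It rests on [/ (x + 1) <= ln ((x + 1) / x)]
    and on [1 + z <= exp z]. *)
Lemma Rpower_series_step s n : 1 < s ->
  (s - 1) * Rpower (INR (S (S n))) (- s) <=
  Rpower (INR (S n)) (1 - s) - Rpower (INR (S (S n))) (1 - s).
Proof.
move=> Hs; set x := INR (S n); have x1 : 1 <= x.
  by rewrite /x S_INR; have := pos_INR n; lra.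
have -> : INR (S (S n)) = x + 1 by rewrite (S_INR (S n)).
have -> : Rpower (x + 1) (- s) = Rpower (x + 1) (1 - s) / (x + 1).
  have -> : 1 - s = - s + 1 by ring.
  rewrite Rpower_plus Rpower_1; [field; lra | lra].
have -> : Rpower x (1 - s) = Rpower (x + 1) (1 - s) * Rpower ((x + 1) / x) (s - 1).
  rewrite -{1}(_ : (x + 1) * / ((x + 1) / x) = x); last by field; lra.
  have Hd : 0 < (x + 1) / x by apply: Rdiv_lt_0_compat; lra.
  rewrite -Rpower_mult_distr; [|lra|by apply: Rinv_0_lt_compat].
  by congr Rmult; rewrite /Rpower ln_Rinv //; congr exp; ring.
have Hl : / (x + 1) <= ln ((x + 1) / x).
  have Hd : 0 < x / (x + 1) by apply: Rdiv_lt_0_compat; lra.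
  have -> : (x + 1) / x = / (x / (x + 1)) by field; lra.
  rewrite ln_Rinv //.
  have := exp_ineq1_le (ln (x / (x + 1))); rewrite exp_ln //.
  have -> : x / (x + 1) = 1 - / (x + 1) by field; lra.
  lra.
have He : 1 + (s - 1) * / (x + 1) <= Rpower ((x + 1) / x) (s - 1).
  have := exp_ineq1_le ((s - 1) * ln ((x + 1) / x)); rewrite -/(Rpower _ _).
  have : (s - 1) * / (x + 1) <= (s - 1) * ln ((x + 1) / x).
    by apply: Rmult_le_compat_l; lra.
  lra.
have p := exp_pos ((1 - s) * ln (x + 1)); rewrite -/(Rpower (x + 1) (1 - s)) in p.
rewrite /Rdiv; nra.
Qed.

Lemma Bnd_Rpower_nat s : 1 < s ->
  Bnd (fun n : nat => Rpower (INR (S n)) (- s)) (1 + / (s - 1)).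
Proof.
move=> Hs.
pose h n := match n with O => 1 + / (s - 1) | S m => / (s - 1) * Rpower (INR (S m)) (1 - s) end.
have i0 : 0 < / (s - 1) by apply: Rinv_0_lt_compat; lra.
apply: (Bnd_nat _ h).
- by move=> n; left; exact: exp_pos.
- case=> [|n] /=; first lra.
  by left; apply: Rmult_lt_0_compat => //; exact: exp_pos.
- case=> [|n]; first by rewrite /= /Rpower ln_1 !Rmult_0_r exp_0; lra.
  rewrite /h -Rmult_minus_distr_l.
  have := Rpower_series_step s n Hs => H.
  apply: Rle_trans (Rmult_le_compat_l _ _ _ (Rlt_le _ _ i0) H).
  by rewrite -Rmult_assoc Rinv_l; lra.
Qed.

(** An integer is determined by its sign and its absolute value, whence the factor [2]. *)
Lemma Bnd_nat_Z (g : nat -> R) (f : Z -> R) S : (forall n, 0 <= g n) ->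
  (forall k, f k <= g (Z.abs_nat k)) -> Bnd g S -> Bnd f (2 * S).
Proof.
move=> g0 Hf Hg.
apply: (Bnd_inj (fun k => (Z.ltb k 0, Z.abs_nat k)) (fun t => g (snd t))).
- move=> x y [] H1 H2.
  have : (x <? 0)%Z = true <-> (y <? 0)%Z = true by rewrite H1.
  rewrite !Z.ltb_lt; lia.
- by move=> k.
- apply: (Bnd_prod _ (fun _ => S)) => //.
  move=> l Nl; rewrite lsum_const.
  have HS := Bnd_ge0 _ _ Hg.
  have : (length l <= 2)%nat.
    apply: (NoDup_incl_length (l' := true :: false :: nil)) => //.
    by case=> _; [left | right; left].
  move=> /le_INR; rewrite [INR 2]/= => Hlen; have := pos_INR (length l); nra.
Qed.

Lemma W_L2 q : 1/2 < q -> exists K, 0 < K /\ L2 (W (- q)) K.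
Proof.
(* The leading [1] is the frequency zero; the rest is the bound for the exponent [2 * q], counted
   for both signs. *)
move=> Hq; pose K2 := 1 + 2 * (1 + / (2 * q - 1)).
have i0 : 0 < / (2 * q - 1) by apply: Rinv_0_lt_compat; lra.
exists (sqrt K2); split; first by apply: sqrt_lt_R0; rewrite /K2; lra.
split; first by move=> k; left; exact: W_pos.
split; first exact: sqrt_pos.
have -> : sqrt K2 ^ 2 = K2 by rewrite pow2_sqrt // /K2; lra.
have Hsq : forall k, W (- q) k ^ 2 = W (- (2 * q)) k.
  by move=> k; rewrite /= Rmult_1_r -W_plus; congr W; ring.
pose g n := match n with O => 0 | S m => Rpower (INR (S m)) (- (2 * q)) end.
apply: (Bnd_le _ (fun k => (if Z.eqb k 0 then 1 else 0) + g (Z.abs_nat k))).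
  move=> k; rewrite Hsq; case: (Z.eqb_spec k 0) => [->|Hk].
    by rewrite W_0_eq /=; lra.
  rewrite Rplus_0_l /g.
  case E : (Z.abs_nat k) => [|m]; first lia.
  rewrite -E W_opp Rpower_Ropp; apply: Rinv_le_contravar; first exact: exp_pos.
  apply: Rle_Rpower_l; first lra; split.
    by apply: lt_0_INR; lia.
  by rewrite INR_IZR_INZ Zabs2Nat.id_abs abs_IZR; exact: jp_abs.
apply: Bnd_plus.
  have := Bnd_single 0%Z (fun k => if Z.eqb k 0 then 1 else 0); apply.
    by move=> k; case: (Z.eqb_spec k 0).
  by rewrite /=; lra.
apply: (Bnd_nat_Z g); [|by move=> k; lra|].
- by case=> [|n] /=; [lra | left; exact: exp_pos].
- move=> l Nl.
  have Hs : 1 < 2 * q by lra.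
  have HB := Bnd_Rpower_nat _ Hs.
  (* Removing the index zero and shifting the others by one matches the list with a sum that starts
     at [S n]. *)
  pose dec := fun n : nat => match n with O => false | S _ => true end.
  apply: Rle_trans (HB (map Nat.pred (filter dec l)) _).
  + rewrite lsum_map; elim: (l) => [|n l' IH]; first by rewrite /=; lra.
    case: n => [|n]; rewrite [filter _ _]/= [lsum _ (_ :: l')]/=; first lra.
    rewrite [X in _ <= X]/= -/(INR (S n)); exact: Rplus_le_compat_l.
  + apply: NoDup_map_NoDup_ForallPairs; last exact: NoDup_filter.
    move=> [|x] [|y] /filter_In [_ Hx] /filter_In [_ Hy] //= E; by rewrite E.
Qed.

(** Cauchy-Schwarz against [W (t - s)], square summable because [s - t > 1/2]: the embedding of
    [H^s] into a weighted Wiener algebra. *)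
Lemma L1_weight s t : t + 1/2 < s -> exists K, 0 < K /\
  forall (f : Z -> R) D, L2 (fun k => W s k * f k) D -> L1 (fun k => W t k * f k) (K * D).
Proof.
move=> H; have [K [K0 HK]] := W_L2 (s - t) ltac:(lra).
exists K; split => // f D Hf.
have := L2_CS _ _ _ _ HK Hf => -[H0 H1].
have E : forall k, W (- (s - t)) k * (W s k * f k) = W t k * f k.
  move=> k; rewrite -Rmult_assoc -W_plus; congr (W _ _ * _); ring.
split; first by move=> k; rewrite -E.
by apply: Bnd_le H1 => k; rewrite E; lra.
Qed.

(** * Quadrilinear forms on the parallelogram [k, k2, k3, p = k2 + k3 - k] *)

(** The kernel sees only [k2 - k] and [k3 - k], whose product is half of the phase; the bounds below
    rely on this translation invariance. *)
Definition quad (kap : Z -> Z -> R) (A X Y V : Z -> R) (t : Z * (Z * Z)) : R :=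
  A (fst t) * (X (fst (snd t)) * Y (snd (snd t)) * V (fst (snd t) + snd (snd t) - fst t)%Z)
  * kap (fst (snd t) - fst t)%Z (snd (snd t) - fst t)%Z.

Definition Quad kap A X Y V S := Bnd (quad kap A X Y V) S.

Lemma pair_eq {A B} (x x' : A) (y y' : B) : x = x' -> y = y' -> (x, y) = (x', y').
Proof. by move=> -> ->. Qed.

Ltac inj3 := let k := fresh "k" in let k2 := fresh "k2" in let k3 := fresh "k3" in
  let l := fresh "l" in let l2 := fresh "l2" in let l3 := fresh "l3" in
  intros [k [k2 k3]] [l [l2 l3]]; cbn; intros E; injection E; intros;
  repeat apply: pair_eq; lia.

Lemma Quad_swap23 kap A X Y V S : Quad (fun a b => kap b a) A Y X V S -> Quad kap A X Y V S.
Proof.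
move=> H; apply: (Bnd_inj (fun t => (fst t, (snd (snd t), fst (snd t)))) _ _ _ _ _ H); first by inj3.
move=> [k [k2 k3]]; rewrite /quad /=; apply: Req_le.
rewrite (Z.add_comm k3 k2); ring.
Qed.

(** Exchanges the diagonals [{k, p}] and [{k2, k3}] of the parallelogram: the first difference
    changes sign, the second is preserved since [p - k2 = k3 - k]. *)
Lemma Quad_swap kap A X Y V S : Quad (fun a b => kap (- a)%Z b) X A V Y S -> Quad kap A X Y V S.
Proof.
move=> H.
apply: (Bnd_inj (fun t => (fst (snd t), (fst t, (fst (snd t) + snd (snd t) - fst t)%Z))) _ _ _ _ _ H).
  by inj3.
move=> [k [k2 k3]]; rewrite /quad /=; apply: Req_le.
have -> : (k + (k2 + k3 - k) - k2 = k3)%Z by ring.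
have -> : (- (k - k2) = k2 - k)%Z by ring.
have -> : (k2 + k3 - k - k2 = k3 - k)%Z by ring.
ring.
Qed.

Lemma Rmult4_ge0 a b c d : 0 <= a -> 0 <= b -> 0 <= c -> 0 <= d -> 0 <= a * (b * c * d).
Proof. by move=> *; repeat apply: Rmult_le_pos. Qed.

Definition one2 (a b : Z) : R := 1.

(** Three [l2] functions against one [l1] function, the coupling kernel being square summable in
    one of its variables uniformly in the other. *)
Lemma Quad_schur kap c A X Y V a x y v :
  (forall m, L2 (kap m) c) -> L1 A a -> L2 X x -> L2 Y y -> L2 V v ->
  Quad kap A X Y V (a * (x * c * (y * v))).
Proof.
move=> Hk [A0 HA] HX HY HV.
have [X0 [x0 _]] := HX; have [Y0 [y0 _]] := HY; have [V0 [v0 _]] := HV.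
have k0 : forall m n, 0 <= kap m n by move=> m; case: (Hk m).
have c0 : 0 <= c by apply: L2_ge0 (Hk 0%Z).
apply: (Bnd_prod _ (fun k => (x * c * (y * v)) * A k)).
- move=> [k [k2 k3]]; rewrite /quad /=; apply: Rmult_le_pos => //; exact: Rmult4_ge0.
- move=> k; rewrite Rmult_comm.
  apply: (Bnd_le _ (fun t : Z * Z => A k * ((X (fst t) * kap (fst t - k)%Z (snd t - k)%Z) *
     (Y (snd t) * V (fst t + snd t - k)%Z)))).
    by move=> [k2 k3]; rewrite /quad /=; apply: Req_le; ring.
  apply: Bnd_scal => //; apply: (proj2 (L2_CS _ _ _ _ _ _)).
  + apply: (L2_prod _ (fun k2 => c * X k2)).
    * by move=> [k2 k3] /=; exact: Rmult_le_pos.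
    * move=> k2 /=; rewrite Rmult_comm; apply: L2_scal => //.
      by apply: (L2_inj (fun j => j - k)%Z (kap (k2 - k)%Z)) => // u w; lia.
    * by rewrite Rmult_comm; exact: L2_scal.
  + suff H : L2 (fun t : Z * Z => Y (fst t) * V (snd t + fst t - k)%Z) (y * v).
      apply: (L2_inj (fun t : Z * Z => (snd t, fst t)) _ _ _ H).
      by move=> [u1 u2] [w1 w2] /= [-> ->].
    apply: (L2_prod _ (fun k3 => v * Y k3)).
    * by move=> [k2 k3] /=; exact: Rmult_le_pos.
    * move=> k3 /=; rewrite Rmult_comm; apply: L2_scal => //.
      by apply: (L2_inj (fun j => j + k3 - k)%Z V) => // u w; lia.
    * by rewrite Rmult_comm; exact: L2_scal.
- by rewrite (Rmult_comm a); apply: Bnd_scal => //; repeat apply: Rmult_le_pos.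
Qed.

(** Once the two [l1] frequencies are frozen, [k] determines [p], and Cauchy-Schwarz in [k] takes
    care of the two [l2] slots. [Quad_side] is the same with [p] and [k3] frozen. *)
Lemma Quad_ends A X Y V a x y v : L2 A a -> L2 V v -> L1 X x -> L1 Y y ->
  Quad one2 A X Y V (a * v * x * y).
Proof.
move=> HA HV [X0 HX] [Y0 HY].
have [A0 [a0 _]] := HA; have [V0 [v0 _]] := HV.
have x0 := Bnd_ge0 _ _ HX; have y0 := Bnd_ge0 _ _ HY.
suff H : Bnd (fun t : Z * (Z * Z) => Y (fst t) * (X (fst (snd t)) *
    (A (snd (snd t)) * V (fst (snd t) + fst t - snd (snd t))%Z))) (a * v * x * y).
  apply: (Bnd_inj (fun t => (snd (snd t), (fst (snd t), fst t))) _ _ _ _ _ H); first by inj3.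
  by move=> [k [k2 k3]]; rewrite /quad /one2 /=; apply: Req_le; ring.
apply: (Bnd_prod _ (fun k3 => (a * v * x) * Y k3)).
- move=> [k3 [k2 k]] /=; repeat apply: Rmult_le_pos => //.
- move=> k3 /=; rewrite Rmult_comm; apply: Bnd_scal => //.
  apply: (Bnd_prod _ (fun k2 => (a * v) * X k2)).
  + move=> [k2 k] /=; repeat apply: Rmult_le_pos => //.
  + move=> k2 /=; rewrite Rmult_comm; apply: Bnd_scal => //=.
    apply: (proj2 (L2_CS _ (fun k => V (k2 + k3 - k)%Z) _ _ HA _)).
    by apply: (L2_inj (fun k => k2 + k3 - k)%Z V) => // u w; lia.
  + by apply: Bnd_scal => //; exact: Rmult_le_pos.
- by apply: Bnd_scal => //; repeat apply: Rmult_le_pos.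
Qed.

Lemma Quad_side A X Y V a x y v : L2 A a -> L2 X x -> L1 Y y -> L1 V v ->
  Quad one2 A X Y V (a * x * y * v).
Proof.
move=> HA HX [Y0 HY] [V0 HV].
have [A0 [a0 _]] := HA; have [X0 [x0 _]] := HX.
have y0 := Bnd_ge0 _ _ HY; have v0 := Bnd_ge0 _ _ HV.
suff H : Bnd (fun t : Z * (Z * Z) => V (fst t) * (Y (fst (snd t)) *
    (A (snd (snd t)) * X (fst t + snd (snd t) - fst (snd t))%Z))) (a * x * y * v).
  apply: (Bnd_inj (fun t => (fst (snd t) + snd (snd t) - fst t, (snd (snd t), fst t))%Z)
    _ _ _ _ _ H); first by inj3.
  move=> [k [k2 k3]]; rewrite /quad /one2 /=.
  have -> : (k2 + k3 - k + k - k3 = k2)%Z by ring.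
  by apply: Req_le; ring.
apply: (Bnd_prod _ (fun k3 => (a * x * y) * V k3)).
- move=> [k3 [k2 k]] /=; repeat apply: Rmult_le_pos => //.
- move=> p /=; rewrite Rmult_comm; apply: Bnd_scal => //.
  apply: (Bnd_prod _ (fun k3 => (a * x) * Y k3)).
  + move=> [k2 k] /=; repeat apply: Rmult_le_pos => //.
  + move=> k3 /=; rewrite Rmult_comm; apply: Bnd_scal => //=.
    apply: (proj2 (L2_CS _ (fun k => X (p + k - k3)%Z) _ _ HA _)).
    by apply: (L2_inj (fun k => p + k - k3)%Z X) => // u w; lia.
  + by apply: Bnd_scal => //; exact: Rmult_le_pos.
- by apply: Bnd_scal => //; repeat apply: Rmult_le_pos.
Qed.

(** All four functions stay in [l2]. Cauchy-Schwarz on triples after grouping [A V al] and [X Y be]: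
    in each group the three arguments can be summed one after the other, so its [l2] norm is a
    product. *)
Lemma Quad_prodkernel al be A X Y V ca cb a x y v : L2 al ca -> L2 be cb ->
  L2 A a -> L2 X x -> L2 Y y -> L2 V v ->
  Quad (fun m n => al m * be n) A X Y V ((a * v * ca) * (x * y * cb)).
Proof.
move=> Hal Hbe HA HX HY HV.
have [A0 [a0 _]] := HA; have [X0 [x0 _]] := HX; have [Y0 [y0 _]] := HY; have [V0 [v0 _]] := HV.
have [al0 [ca0 _]] := Hal; have [be0 [cb0 _]] := Hbe.
apply: (Bnd_le _ (fun t : Z * (Z * Z) =>
  (A (fst t) * V (fst (snd t) + snd (snd t) - fst t)%Z * al (fst (snd t) - fst t)%Z) *
  (X (fst (snd t)) * Y (snd (snd t)) * be (snd (snd t) - fst t)%Z))).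
  by move=> [k [k2 k3]]; rewrite /quad /=; apply: Req_le; ring.
apply: (proj2 (L2_CS _ _ _ _ _ _)).
- apply: (L2_prod _ (fun k => (v * ca) * A k)).
  + by move=> [k [k2 k3]] /=; repeat apply: Rmult_le_pos.
  + move=> k /=.
    suff : L2 (fun t : Z * Z => A k * (al (fst t - k)%Z * V (fst t + snd t - k)%Z)) (A k * (ca * v)).
      have -> : v * ca * A k = A k * (ca * v) by ring.
      by apply: L2_ext => -[k2 k3] /=; ring.
    apply: L2_scal => //; apply: (L2_prod _ (fun k2 => v * al (k2 - k)%Z)).
    * by move=> [k2 k3] /=; repeat apply: Rmult_le_pos.
    * move=> k2 /=; rewrite Rmult_comm; apply: L2_scal => //.
      by apply: (L2_inj (fun j => k2 + j - k)%Z V) => // u w; lia.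
    * rewrite Rmult_comm; apply: L2_scal => //.
      by apply: (L2_inj (fun j => j - k)%Z al) => // u w; lia.
  + have -> : a * v * ca = (v * ca) * a by ring.
    by apply: L2_scal => //; exact: Rmult_le_pos.
- suff H : L2 (fun t : Z * (Z * Z) => X (fst t) * (Y (fst (snd t)) * be (fst (snd t) - snd (snd t))%Z))
     (x * (y * cb)).
    rewrite Rmult_assoc.
    apply: L2_ext (L2_inj (fun t => (fst (snd t), (snd (snd t), fst t))) _ _ _ H).
      by move=> [k [k2 k3]] /=; ring.
    by inj3.
  apply: (L2_prod _ (fun k2 => (y * cb) * X k2)).
  + by move=> [k [k2 k3]] /=; repeat apply: Rmult_le_pos.
  + move=> k2 /=; rewrite Rmult_comm; apply: L2_scal => //.
    apply: (L2_prod _ (fun k3 => cb * Y k3)).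
    * by move=> [k3 k] /=; repeat apply: Rmult_le_pos.
    * move=> k3 /=; rewrite Rmult_comm; apply: L2_scal => //.
      by apply: (L2_inj (fun j => k3 - j)%Z be) => // u w; lia.
    * by rewrite Rmult_comm; exact: L2_scal.
  + by rewrite (Rmult_comm x); apply: L2_scal => //; exact: Rmult_le_pos.
Qed.

Definition diag2 (a b : Z) : R := if Z.eqb a 0 then 1 else 0.

(** On [k2 = k] also [p = k3], so the form factorises into two scalar products. *)
Lemma Quad_diag A X Y V a x y v : L2 A a -> L2 X x -> L2 Y y -> L2 V v ->
  Quad diag2 A X Y V ((a * x) * (y * v)).
Proof.
move=> HA HX HY HV.
have [AX0 HAX] := L2_CS _ _ _ _ HA HX; have [YV0 HYV] := L2_CS _ _ _ _ HY HV.
have c0 := Bnd_ge0 _ _ HAX; have d0 := Bnd_ge0 _ _ HYV.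
have [A0 _] := HA; have [X0 _] := HX; have [Y0 _] := HY; have [V0 _] := HV.
suff H : Bnd (fun t : Z * (Z * Z) => if Z.eqb (snd (snd t)) (fst t)
    then (A (fst t) * X (fst t)) * (Y (fst (snd t)) * V (fst (snd t))) else 0) ((a * x) * (y * v)).
  apply: (Bnd_inj (fun t => (fst t, (snd (snd t), fst (snd t)))) _ _ _ _ _ H); first by inj3.
  move=> [k [k2 k3]]; rewrite /quad /diag2 /=.
  case: (Z.eqb_spec k2 k) => [->|Hn].
  - rewrite Z.sub_diag Z.eqb_refl; have -> : (k + k3 - k = k3)%Z by ring.
    by apply: Req_le; ring.
  - case: (Z.eqb_spec (k2 - k) 0) => [|_]; [lia|lra].
apply: (Bnd_prod _ (fun k => (y * v) * (A k * X k))).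
- move=> [k [k3 k2]] /=; case: Z.eqb; last lra.
  by repeat apply: Rmult_le_pos.
- move=> k; rewrite Rmult_comm; apply: (Bnd_prod _ (fun k3 => (A k * X k) * (Y k3 * V k3))).
  + move=> [k3 k2] /=; case: Z.eqb; last lra.
    by repeat apply: Rmult_le_pos.
  + move=> k3 /=.
    pose f i := if Z.eqb i k then (A k * X k) * (Y k3 * V k3) else 0.
    have := Bnd_single k f; rewrite /f Z.eqb_refl; apply.
    * by move=> i; case: (Z.eqb_spec i k).
    * by repeat apply: Rmult_le_pos.
  + by apply: Bnd_scal => //; exact: AX0.
- by rewrite (Rmult_comm (a * x)); apply: Bnd_scal.
Qed.

(** * The trilinear operators *)

(** The test function is [Cmod (T k)] on a finite list and zero elsewhere. Its square norm is at
    most the finite sum [Q] to be bounded, and the hypothesis yields [Q <= S * sqrt Q]. *)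
Lemma dual_L2 {J} (A : Z * J -> R) (T : Z -> C) S : 0 <= S -> (forall t, 0 <= A t) ->
  (forall g, L2 g 1 -> Bnd (fun t => g (fst t) * A t) S) ->
  (forall k s, Bnd (fun j => A (k, j)) s -> Cmod (T k) <= s) ->
  L2 (fun k => Cmod (T k)) S.
Proof.
move=> S0 A0 H HT.
have Hg : forall g G, 0 < G -> L2 g G -> Bnd (fun t => g (fst t) * A t) (S * G).
  move=> g G G0 Hg.
  have H1 : L2 (fun k => / G * g k) 1.
    rewrite -(Rinv_l G); last lra.
    by apply: L2_scal => //; left; exact: Rinv_0_lt_compat.
  have := Bnd_scal G _ _ (Rlt_le _ _ G0) (H _ H1).
  rewrite Rmult_comm; apply: Bnd_le => t; apply: Req_le; field; lra.
split; first by move=> k; exact: Cmod_ge_0.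
split => // l Nl; set Q := lsum _ l.
case: (Rle_lt_dec Q 0) => Q0; first by have := pow2_ge_0 S; lra.
pose g k := if in_dec (eq_dec_of Z) k l is left _ then Cmod (T k) else 0.
have g0 : forall k, 0 <= g k by move=> k; rewrite /g; case: in_dec => _; [exact: Cmod_ge_0|lra].
have HgL : L2 g (sqrt Q).
  split => //; split; first exact: sqrt_pos.
  rewrite pow2_sqrt; last lra.
  move=> l' Nl'.
  pose l1 := filter (fun k => if in_dec (eq_dec_of Z) k l is left _ then true else false) l'.
  apply: Rle_trans (_ : lsum (fun k => Cmod (T k) ^ 2) l1 <= _).
    rewrite /l1; elim: (l') => [|k m IH] /=; first lra.
    rewrite /g; case: in_dec => _ /=; move: IH; rewrite /g /=; lra.
  apply: lsum_incl; [by move=> k; exact: pow2_ge_0 | exact: NoDup_filter |].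
  by move=> k /filter_In []; case: in_dec.
have sQ : 0 < sqrt Q by exact: sqrt_lt_R0.
have HB := Hg g (sqrt Q) sQ HgL.
have HB2 : Q <= S * sqrt Q.
  have gA0 : forall t, 0 <= g (fst t) * A t by move=> t; exact: Rmult_le_pos.
  apply: Rle_trans (Bnd_prod_inv _ _ gA0 HB l Nl).
  apply: lsum_le => k Hk.
  have Hgk : g k = Cmod (T k) by rewrite /g; case: in_dec.
  case: (Rle_lt_or_eq_dec 0 (Cmod (T k)) (Cmod_ge_0 _)) => [Tk|<-]; last first.
    apply: Rle_trans (rsum_ge0 _ _ (Bnd_section _ _ k HB)); rewrite /=; lra.
  have Hsec := rsum_Bnd _ _ (Bnd_section _ _ k HB).
  set s := rsum _ in Hsec *.
  have Hs : Bnd (fun j => A (k, j)) (/ Cmod (T k) * s).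
    have := Bnd_scal (/ Cmod (T k)) _ _ (Rlt_le _ _ (Rinv_0_lt_compat _ Tk)) Hsec.
    by apply: Bnd_le => j /=; rewrite Hgk; apply: Req_le; field; lra.
  have := HT k _ Hs => H1.
  have := Rmult_le_compat_l _ _ _ (Rlt_le _ _ Tk) H1.
  have -> : Cmod (T k) * (/ Cmod (T k) * s) = s by field; lra.
  by rewrite /= Rmult_1_r.
have HQ : Q = sqrt Q * sqrt Q by rewrite sqrt_sqrt; lra.
have : sqrt Q <= S.
  by apply: (Rmult_le_reg_r (sqrt Q)) => //; rewrite -HQ.
move=> HS; rewrite HQ /= Rmult_1_r; apply: Rmult_le_compat; lra.
Qed.

Definition tri (b : Z -> Z -> Z -> C) (f g h : F) (k : Z) (t : Z * Z) : C :=
  Cmult (b k (fst t) (snd t))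
    (Cmult (Cmult (f (fst t)) (g (snd t))) (Cconj (h (fst t + snd t - k)%Z))).

Definition TB (b : Z -> Z -> Z -> C) (f g h : F) : F := fun k => tsum (tri b f g h k).

Lemma Cmod_tri b f g h k t : Cmod (tri b f g h k t) =
  Cmod (b k (fst t) (snd t)) *
  (Cmod (f (fst t)) * Cmod (g (snd t)) * Cmod (h (fst t + snd t - k)%Z)).
Proof. by rewrite /tri !Cmod_mult Cmod_conj. Qed.

(** Duality: a weighted [l2] bound on [TB b f g h] follows from the quadrilinear form obtained by
    testing against [l2]. *)
Lemma TB_L2 (om : Z -> R) b f g h S : 0 <= S -> (forall k, 0 < om k) ->
  (forall G, L2 G 1 -> Bnd (fun t : Z * (Z * Z) =>
     G (fst t) * (om (fst t) * Cmod (tri b f g h (fst t) (snd t)))) S) ->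
  (forall k, summable (tri b f g h k)) /\
  L2 (fun k => om k * Cmod (TB b f g h k)) S.
Proof.
move=> S0 om0 H.
split.
- move=> k.
  (* The unit mass at [k], of [l2] norm one, isolates the row whose summability is claimed. *)
  pose G i := if Z.eqb i k then 1 else 0.
  have HG : L2 G 1.
    split; first by move=> i; rewrite /G; case: Z.eqb; lra.
    split; first lra.
    apply: (Bnd_le _ G).
      by move=> i; rewrite /G; case: Z.eqb; lra.
    have E : G k = 1 by rewrite /G Z.eqb_refl.
    rewrite pow1 -E; apply: Bnd_single; last by rewrite E; lra.
    by move=> i; rewrite /G; case: (Z.eqb_spec i k).
  have := Bnd_section _ _ k (H G HG) => /=.
  rewrite /G Z.eqb_refl => Hs.
  apply: (summable_le _ _ _ _ (Bnd_scal (/ om k) _ _ (Rlt_le _ _ (Rinv_0_lt_compat _ (om0 k))) Hs)).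
  by move=> t; apply: Req_le; field; have := om0 k; lra.
- apply: (L2_ext (fun k => Cmod (Cmult (om k) (TB b f g h k)))).
    by move=> k; rewrite Cmod_mult Cmod_R Rabs_pos_eq //; left.
  apply: (dual_L2 (fun t : Z * (Z * Z) => om (fst t) * Cmod (tri b f g h (fst t) (snd t)))) => //.
    by move=> t; apply: Rmult_le_pos; [left | exact: Cmod_ge_0].
  move=> k s /= Hs.
  rewrite Cmod_mult Cmod_R Rabs_pos_eq; last by left.
  have Hi : 0 <= / om k by left; apply: Rinv_0_lt_compat.
  have := Bnd_scal _ _ _ Hi Hs => Hs2.
  have := tsum_bound _ _ _ _ Hs2 => /(_ (tri b f g h k)).
  move=> H1; have {}H1 : Cmod (TB b f g h k) <= / om k * s.
    by apply: H1 => t; apply: Req_le; field; have := om0 k; lra.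
  have := Rmult_le_compat_l _ _ _ (Rlt_le _ _ (om0 k)) H1.
  have -> : om k * (/ om k * s) = s by field; have := om0 k; lra.
  by [].
Qed.

(** * One step of the scheme in the twisted variable *)

#[local] Arguments pow : simpl never.

Definition cis (x : R) : C := (cos x, sin x).

Lemma cis_plus x y : cis (x + y) = Cmult (cis x) (cis y).
Proof. by apply: injective_projections; rewrite /= ?cos_plus ?sin_plus; ring. Qed.

Lemma cis_0 : cis 0 = 1.
Proof. by rewrite /cis cos_0 sin_0. Qed.

Lemma cis_opp x : cis (- x) = Cconj (cis x).
Proof. by rewrite /cis cos_neg sin_neg. Qed.

Lemma Cmod_cis x : Cmod (cis x) = 1.
Proof.
rewrite /Cmod /= -!Rsqr_pow2 Rplus_comm sin2_cos2; exact: sqrt_1.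
Qed.

Lemma Cmod_ci : Cmod ci = 1.
Proof. rewrite /Cmod /ci /=; have -> : 0 ^ 2 + 1 ^ 2 = 1 by ring. exact: sqrt_1. Qed.

Lemma Cexp_cis y : Cexp (Cmult ci (RtoC y)) = cis y.
Proof.
have E : Cmult ci (RtoC y) = (0, y) by apply: injective_projections; rewrite /=; ring.
by rewrite E /Cexp /cis /= exp_0 !Rmult_1_l.
Qed.

Lemma eS_cis t f k : eS t f k = Cmult (cis (- t * IZR k ^ 2)) (f k).
Proof. by rewrite /eS /multF Cexp_cis. Qed.

Definition phi (k k2 k3 : Z) : R := IZR (2 * (k - k2) * (k - k3)).

(** The factorised phase is a difference of kinetic energies, so twisting the three factors and the
    output by [eS] produces [cis (t * phi)]; it vanishes only for [k2 = k] or [k3 = k]. *)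
Lemma phi_sq k k2 k3 :
  phi k k2 k3 = IZR k ^ 2 + IZR (k2 + k3 - k) ^ 2 - IZR k2 ^ 2 - IZR k3 ^ 2.
Proof. rewrite /phi minus_IZR plus_IZR !mult_IZR !minus_IZR; ring. Qed.

(** [summable f]: [f] belongs to the Wiener algebra. *)
Lemma summable_multF (m : Z -> C) (f : F) M : (forall k, Cmod (m k) <= M) -> summable f ->
  summable (multF m f).
Proof.
move=> Hm [S HS]; apply: (summable_le _ (fun k => M * Cmod (f k)) (M * S)).
- move=> k; rewrite /multF Cmod_mult; apply: Rmult_le_compat_r => //; exact: Cmod_ge_0.
- by apply: Bnd_scal => //; have := Hm 0%Z; have := Cmod_ge_0 (m 0%Z); lra.
Qed.

Lemma summable_eS t f : summable f -> summable (eS t f).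
Proof.
by apply: (summable_multF _ _ 1) => k; rewrite Cexp_cis Cmod_cis; lra.
Qed.

Lemma summable_conjF f : summable f -> summable (conjF f).
Proof.
move=> [S HS]; exists S.
apply: (Bnd_inj (fun k => - k)%Z (fun k => Cmod (f k))) => //; first by move=> x y; lia.
by move=> k; rewrite /conjF Cmod_conj; lra.
Qed.

(** * Products in the Wiener algebra as trilinear sums *)

Lemma summable_conv (f g : F) : summable f -> summable g ->
  summable (fun t : Z * Z => Cmult (f (snd t)) (g (fst t - snd t)%Z)).
Proof.
move=> [S HS] [S' HS'].
have H : Bnd (fun t : Z * Z => Cmod (f (fst t)) * Cmod (g (snd t))) (S' * S).
  apply: (Bnd_prod _ (fun i => S' * Cmod (f i))).
  - by move=> t; apply: Rmult_le_pos; exact: Cmod_ge_0.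
  - by move=> i /=; rewrite Rmult_comm; apply: Bnd_scal => //; exact: Cmod_ge_0.
  - by apply: Bnd_scal => //; exact: Bnd_ge0 HS'.
exists (S' * S); apply: (Bnd_inj (fun t => (snd t, fst t - snd t)%Z) _ _ _ _ _ H).
- by move=> [x1 x2] [y1 y2] /= [E1 E2]; apply: pair_eq; lia.
- by move=> [x y] /=; rewrite Cmod_mult; lra.
Qed.

Lemma mulF_tsum f g k : summable f -> summable g ->
  mulF f g k = tsum (fun j => Cmult (f j) (g (k - j)%Z)).
Proof.
by move=> Hf Hg; apply: zsumC_tsum; exact: (summable_section _ k (summable_conv _ _ Hf Hg)).
Qed.

Lemma summable_mulF f g : summable f -> summable g -> summable (mulF f g).
Proof.
move=> Hf Hg; apply: summable_ext (summable_prod _ (summable_conv _ _ Hf Hg)) => k /=.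
by rewrite mulF_tsum.
Qed.

Lemma mulF_comm f g k : summable f -> summable g -> mulF f g k = mulF g f k.
Proof.
move=> Hf Hg; rewrite !mulF_tsum //.
rewrite -(tsum_reindex (fun j => k - j)%Z (fun j => k - j)%Z); first last.
- exact: (summable_section _ k (summable_conv _ _ Hf Hg)).
- by move=> j; ring.
- by move=> j; ring.
apply: tsum_ext => j; have -> : (k - (k - j) = j)%Z by ring.
by rewrite Cmult_comm.
Qed.

Lemma tri_summable b f g h k M : (forall t, Cmod (b k (fst t) (snd t)) <= M) ->
  summable f -> summable g -> summable h -> summable (tri b f g h k).
Proof.
move=> Hb [Sf HSf] [Sg HSg] [Sh HSh].
have M0 : 0 <= M by have := Hb (0%Z, 0%Z); have := Cmod_ge_0 (b k (fst (0%Z, 0%Z)) (snd (0%Z, 0%Z))); lra.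
have f0 := Bnd_ge0 _ _ HSf; have g0 := Bnd_ge0 _ _ HSg; have h0 := Bnd_ge0 _ _ HSh.
apply: (summable_le _ (fun t => M * Sh * (Cmod (f (fst t)) * Cmod (g (snd t)))) (M * Sh * (Sg * Sf))).
- move=> t; rewrite Cmod_tri.
  have -> : M * Sh * (Cmod (f (fst t)) * Cmod (g (snd t))) =
     M * (Cmod (f (fst t)) * Cmod (g (snd t)) * Sh) by ring.
  have a1 := Cmod_ge_0 (f (fst t)); have a2 := Cmod_ge_0 (g (snd t)).
  have a3 := Cmod_ge_0 (h (fst t + snd t - k)%Z).
  have a4 := Bnd_point _ _ (fst t + snd t - k)%Z HSh; cbn beta in a4.
  apply: Rmult_le_compat => //; first exact: Cmod_ge_0.
    by repeat apply: Rmult_le_pos.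
  by apply: Rmult_le_compat_l => //; exact: Rmult_le_pos.
- apply: Bnd_scal; first exact: Rmult_le_pos.
  apply: (Bnd_prod _ (fun i => Sg * Cmod (f i))).
  + by move=> t; apply: Rmult_le_pos; exact: Cmod_ge_0.
  + by move=> i /=; rewrite Rmult_comm; apply: Bnd_scal => //; exact: Cmod_ge_0.
  + exact: Bnd_scal.
Qed.

Lemma TB_ext b b' f g h k : (forall k2 k3, b k k2 k3 = b' k k2 k3) -> TB b f g h k = TB b' f g h k.
Proof. by move=> H; apply: tsum_ext => -[k2 k3]; rewrite /tri /= H. Qed.

Lemma TB_scal (c : Z -> C) b f g h k : summable (tri b f g h k) ->
  TB (fun k k2 k3 => Cmult (c k) (b k k2 k3)) f g h k = Cmult (c k) (TB b f g h k).
Proof. move=> H; rewrite /TB -tsum_scal //; apply: tsum_ext => t; rewrite /tri; ring. Qed.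

Lemma abs2F_tsum u m : summable u ->
  abs2F u m = tsum (fun j => Cmult (u j) (Cconj (u (j - m)%Z))).
Proof.
move=> Hu; rewrite /abs2F mulF_tsum //; last exact: summable_conjF.
by apply: tsum_ext => j; rewrite /conjF; have -> : (- (m - j) = j - m)%Z by ring.
Qed.

Lemma summable_abs2F u : summable u -> summable (abs2F u).
Proof. by move=> Hu; apply: summable_mulF => //; exact: summable_conjF. Qed.

(** The outer factor carries [k3]; the squared modulus carries [k2] and the conjugate at [p], so its
    frequency is [k2 - p = k - k3]. *)
Lemma mulF_abs2 (m : Z -> C) M u k : (forall j, Cmod (m j) <= M) -> summable u ->
  mulF u (multF m (abs2F u)) k = TB (fun k k2 k3 => m (k - k3)%Z) u u u k.
Proof.
move=> Hm Hu; rewrite mulF_tsum //; last first.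
  by apply: summable_multF Hm _; exact: summable_abs2F.
have Ht := tri_summable (fun k k2 k3 => m (k - k3)%Z) u u u k M (fun t => Hm _) Hu Hu Hu.
pose sw := fun t : Z * Z => (snd t, fst t).
rewrite /TB -(tsum_reindex sw sw) //; try by case.
rewrite -tsum_prod; last first.
  by apply: (summable_reindex sw) => // -[x1 x2] [y1 y2] [-> ->].
apply: tsum_ext => k3; rewrite /multF abs2F_tsum // Cmult_assoc -tsum_scal; last first.
  have := summable_section _ (k - k3)%Z (summable_conv _ _ Hu (summable_conjF _ Hu)).
  apply: summable_ext => j /=; rewrite /conjF.
  by have -> : (- (k - k3 - j) = j - (k - k3))%Z by ring.
apply: tsum_ext => k2; rewrite /tri /sw /=.
have -> : (k2 - (k - k3) = k2 + k3 - k)%Z by ring.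
by ring.
Qed.

Lemma cubicF_TB u k : summable u -> cubicF u k = TB (fun _ _ _ => 1) u u u k.
Proof.
move=> Hu; rewrite /cubicF mulF_comm //; last exact: summable_abs2F.
have H1 : forall j : Z, Cmod 1 <= 1 by move=> _; rewrite Cmod_1; lra.
rewrite -(mulF_abs2 (fun _ => RtoC 1) 1) //.
congr (mulF u _ k); apply: functional_extensionality => j; rewrite /multF; ring.
Qed.

(** The square carries [k2 + k3], and the conjugate then sits at [k - (k2 + k3) = - p]. *)
Lemma mulF_square (a c : Z -> C) M u k : (forall j, Cmod (a j) <= M) -> (forall j, Cmod (c j) <= M) ->
  summable u ->
  mulF (multF a (conjF u)) (multF c (mulF u u)) k =
  TB (fun k k2 k3 => Cmult (a (k - (k2 + k3))%Z) (c (k2 + k3)%Z)) u u u k.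
Proof.
move=> Ha Hc Hu.
have Hcj := summable_conjF _ Hu; have Huu := summable_mulF _ _ Hu Hu.
rewrite mulF_comm; [|exact: summable_multF Ha _|exact: summable_multF Hc _].
rewrite mulF_tsum; [|exact: summable_multF Hc _|exact: summable_multF Ha _].
have Ht : summable (tri (fun k k2 k3 => Cmult (a (k - (k2 + k3))%Z) (c (k2 + k3)%Z)) u u u k).
  apply: (tri_summable _ _ _ _ _ (M * M)) => // t; rewrite Cmod_mult.
  by apply: Rmult_le_compat => //; exact: Cmod_ge_0.
pose h := fun t : Z * Z => (snd t, fst t - snd t)%Z.
pose h' := fun t : Z * Z => (fst t + snd t, fst t)%Z.
have hh' : forall t, h (h' t) = t by move=> [x y]; rewrite /h /h' /=; apply: pair_eq; ring.
have h'h : forall t, h' (h t) = t by move=> [x y]; rewrite /h /h' /=; apply: pair_eq; ring.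
rewrite /TB -(tsum_reindex h h') // -tsum_prod; last first.
  by apply: (summable_reindex h) => // x y E; rewrite -(h'h x) E h'h.
apply: tsum_ext => m; rewrite /multF mulF_tsum //.
rewrite (Cmult_comm (Cmult _ _)) Cmult_assoc -tsum_scal; last first.
  exact: (summable_section _ m (summable_conv _ _ Hu Hu)).
apply: tsum_ext => j; rewrite /tri /h /=.
have -> : (j + (m - j) = m)%Z by ring.
rewrite /conjF; have -> : (- (k - m) = m - k)%Z by ring.
by ring.
Qed.

Lemma TB_eS b t f k M : (forall k2 k3, Cmod (b k k2 k3) <= M) -> summable f ->
  TB b (eS t f) (eS t f) (eS t f) k =
  Cmult (cis (- t * IZR k ^ 2))
   (TB (fun k k2 k3 => Cmult (b k k2 k3) (cis (t * phi k k2 k3))) f f f k).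
Proof.
move=> Hb Hf; rewrite -(TB_scal (fun k => cis (- t * IZR k ^ 2))); last first.
  apply: (tri_summable _ _ _ _ _ M) => // u; rewrite Cmod_mult Cmod_cis; have := Hb (fst u) (snd u); lra.
apply: tsum_ext => -[k2 k3]; rewrite /tri /= !eS_cis Cmult_conj -cis_opp.
set p := (k2 + k3 - k)%Z.
have E : Cmult (cis (- t * IZR k ^ 2)) (cis (t * phi k k2 k3)) =
   Cmult (Cmult (cis (- t * IZR k2 ^ 2)) (cis (- t * IZR k3 ^ 2))) (cis (- (- t * IZR p ^ 2))).
  by rewrite -!cis_plus phi_sq -/p; congr cis; ring.
transitivity (Cmult (Cmult (Cmult (Cmult (cis (- t * IZR k2 ^ 2)) (cis (- t * IZR k3 ^ 2)))
  (cis (- (- t * IZR p ^ 2)))) (b k k2 k3)) (Cmult (Cmult (f k2) (f k3)) (Cconj (f p)))); first by ring.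
rewrite -E; cbv beta; ring.
Qed.

(** [Bsym] collects the nonlinear terms of [Psi] into one trilinear symbol, whose conjugated factor has
    the frequency [p = k2 + k3 - k]. *)
Definition Bsym (tau : R) (k k2 k3 : Z) : C :=
  if Z.eqb k 0 then Cmult (Copp ci) (RtoC tau)
  else Cminus (Cmult (RtoC (/ (2 * IZR k ^ 2))) (Cminus (cis (- (2 * tau * IZR k * IZR (k2 + k3 - k)))) 1))
    (if Z.eqb k3 k then RtoC 0
     else Cmult (RtoC (/ (IZR k * IZR (k - k3)))) (Cminus (cis (tau * phi k k2 k3)) 1)).

(** Phase of the modified propagator once [cis (- tau * k^2)] is split off. [P0] is the imaginary
    number [- i q], which makes the multiplier [- 2 P0 / (i k)] the real number [2 q / k]. *)
Definition theta (tau m0 q : R) (k : Z) : R :=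
  if Z.eqb k 0 then tau * (- 2 * m0) else tau * (- 2 * m0 + 2 * q / IZR k).

Definition PsiV (tau m0 q t : R) (V : F) : F := fun k =>
  Cplus (Cmult (cis (theta tau m0 q k)) (V k))
  (Cplus (if Z.eqb k 0 then Cmult (Cmult (Cmult 2 ci) (RtoC (tau * m0))) (V k) else RtoC 0)
    (TB (fun k k2 k3 => Cmult (Bsym tau k k2 k3) (cis (t * phi k k2 k3))) V V V k)).

Lemma dxinv_sym_val k : k <> 0%Z -> dxinv_sym k = Cmult (Copp ci) (RtoC (/ IZR k)).
Proof.
move=> Hk; rewrite /dxinv_sym; case: (Z.eqb_spec k 0) => // _.
have Hk' : IZR k <> 0 by apply: not_0_IZR.
rewrite /dx_sym /Cinv /Cmult /Copp /RtoC /ci /=; congr pair; field; lra.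
Qed.

Lemma dxinv_sym_bound k : Cmod (dxinv_sym k) <= 1.
Proof.
case: (Z.eq_dec k 0) => [->|Hk]; first by rewrite /dxinv_sym /= Cmod_0; lra.
have H1 := IZR_abs_ge1 _ Hk.
rewrite dxinv_sym_val // Cmod_mult Cmod_opp Cmod_R.
rewrite Cmod_ci Rmult_1_l Rabs_inv -Rinv_1; apply: Rinv_le_contravar; lra.
Qed.

Lemma ci_sqr : Cmult ci ci = RtoC (-1).
Proof. by apply: injective_projections; rewrite /=; ring. Qed.

Lemma eBig_sym tau m0 q k :
  Cexp (Cmult (Cmult ci (RtoC tau))
     (Cminus (Cminus (Copp (Cmult 2 (RtoC m0))) (Cmult (Cmult 2 (0, - q)) (dxinv_sym k)))
             (RtoC (IZR k ^ 2)))) = Cmult (cis (- tau * IZR k ^ 2)) (cis (theta tau m0 q k)).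
Proof.
rewrite -cis_plus -Cexp_cis; congr Cexp; rewrite /theta.
case: (Z.eqb_spec k 0) => [->|Hk].
  by rewrite /dxinv_sym; apply: injective_projections; rewrite /=; ring.
rewrite dxinv_sym_val //.
have Hk' : IZR k <> 0 by apply: not_0_IZR.
by apply: injective_projections; rewrite /=; field.
Qed.

(** Every nonlinear term becomes [cis (- (t + tau) * k^2)] times a trilinear sum with explicit
    symbol, and the symbols add up to [Bsym]. The frequency zero is separate: [dxinvF] annihilates
    it and only the mean value terms remain. *)
Lemma Psi_twisted tau m0 q t V k : summable V ->
  Psi tau (RtoC m0) (0, - q) (eS t V) k = eS (t + tau) (PsiV tau m0 q t V) k.
Proof.
move=> HV; have HU := summable_eS t _ HV.
set U := eS t V in HU *.
have d1 := dxinv_sym_bound.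
have e1 : forall s j, Cmod (Cexp (Cmult ci (RtoC (- s * IZR j ^ 2)))) <= 1.
  by move=> s j; rewrite Cexp_cis Cmod_cis; lra.
have Hc1 : forall j : Z, Cmod 1 <= 1 by move=> _; rewrite Cmod_1; lra.
rewrite eS_cis /PsiV /Psi /addF /subF /sclF.
have -> : eBig tau (RtoC m0) (0, - q) U k =
   Cmult (cis (- (t + tau) * IZR k ^ 2)) (Cmult (cis (theta tau m0 q k)) (V k)).
  rewrite /eBig /multF eBig_sym /U eS_cis.
  have -> : - (t + tau) * IZR k ^ 2 = - tau * IZR k ^ 2 + - t * IZR k ^ 2 by ring.
  by rewrite cis_plus; ring.
case: (Z.eqb_spec k 0) => [->|Hk].
  have Hz : forall f : F, dxinvF f 0%Z = 0 by move=> f; rewrite /dxinvF /multF /dxinv_sym /=; ring.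
  rewrite /dxinv2F !eS_cis !Hz /constF /= /Pi0.
  rewrite cubicF_TB // {1}/U (TB_eS _ _ _ _ 1) //.
  have E0 : forall s, cis (s * IZR 0 ^ 2) = 1 by move=> s; rewrite -cis_0; congr cis; ring.
  rewrite /U eS_cis.
  rewrite (TB_ext (fun k k2 k3 => Cmult (Bsym tau k k2 k3) (cis (t * phi k k2 k3)))
     (fun k k2 k3 => Cmult (Cmult (Copp ci) (RtoC tau)) (Cmult 1 (cis (t * phi k k2 k3))))); last first.
    by move=> k2 k3; rewrite /Bsym /=; ring.
  rewrite (TB_scal (fun _ => Cmult (Copp ci) (RtoC tau))); last first.
    apply: (tri_summable _ _ _ _ _ 1) => // s; rewrite Cmod_mult Cmod_1 Cmod_cis; lra.
  rewrite !E0 RtoC_mult; ring.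
have K0 : IZR k <> 0 by apply: not_0_IZR.
have Hd2 : forall z, Cmult (dxinv_sym k) (Cmult (dxinv_sym k) z) = Cmult (RtoC (- / IZR k ^ 2)) z.
  move=> z; rewrite dxinv_sym_val //.
  transitivity (Cmult (Cmult (Cmult ci ci) (RtoC (/ IZR k * / IZR k))) z).
    by rewrite RtoC_mult; ring.
  rewrite ci_sqr -RtoC_mult; congr Cmult; congr RtoC; field; lra.
have -> : constF (Pi0 (cubicF U)) k = 0 by rewrite /constF; case: (Z.eqb_spec k 0).
have -> : constF (Pi0 U) k = 0 by rewrite /constF; case: (Z.eqb_spec k 0).
have T1 : dxinv2F (mulF (eS (- tau) (conjF U)) (eS tau (mulF U U))) k =
   Cmult (cis (- (t + tau) * IZR k ^ 2)) (TB (fun k k2 k3 => Cmult (Cmult (RtoC (- / IZR k ^ 2))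
      (cis (- (2 * tau * IZR k * IZR (k2 + k3 - k))))) (cis (t * phi k k2 k3))) V V V k).
  rewrite /dxinv2F /dxinvF /multF Hd2.
  rewrite (mulF_square _ _ 1) // (TB_eS _ _ _ _ 1) //; last first.
    by move=> k2 k3; cbv beta; rewrite Cmod_mult !Cexp_cis !Cmod_cis; lra.
  have Es : forall (Q : Z -> Z -> Z -> R),
      summable (tri (fun k k2 k3 => Cmult (cis (Q k k2 k3)) (cis (t * phi k k2 k3))) V V V k).
    move=> Q; apply: (tri_summable _ _ _ _ _ 1) => // s; rewrite Cmod_mult !Cmod_cis; lra.
  rewrite (TB_ext _ (fun k k2 k3 => Cmult (cis (- tau * IZR k ^ 2)) (Cmult
      (cis (- (2 * tau * IZR k * IZR (k2 + k3 - k)))) (cis (t * phi k k2 k3))))); last first.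
    move=> k2 k3; rewrite !Cexp_cis -!cis_plus; congr cis.
    rewrite !minus_IZR !plus_IZR; ring.
  rewrite (TB_scal (fun k => cis (- tau * IZR k ^ 2))) //.
  rewrite (TB_ext (fun k k2 k3 => Cmult (Cmult (RtoC (- / IZR k ^ 2)) _) _)
     (fun k k2 k3 => Cmult (RtoC (- / IZR k ^ 2)) (Cmult
      (cis (- (2 * tau * IZR k * IZR (k2 + k3 - k)))) (cis (t * phi k k2 k3))))); last first.
    by move=> k2 k3; ring.
  rewrite (TB_scal (fun k => RtoC (- / IZR k ^ 2))) //.
  have -> : - (t + tau) * IZR k ^ 2 = - tau * IZR k ^ 2 + - t * IZR k ^ 2 by ring.
  rewrite cis_plus; ring.
have T2 : eS tau (dxinv2F (cubicF U)) k =
   Cmult (cis (- (t + tau) * IZR k ^ 2)) (TB (fun k k2 k3 => Cmult (RtoC (- / IZR k ^ 2))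
      (cis (t * phi k k2 k3))) V V V k).
  rewrite eS_cis /dxinv2F /dxinvF /multF Hd2 cubicF_TB // (TB_eS _ _ _ _ 1) //.
  have Es : summable (tri (fun k k2 k3 => cis (t * phi k k2 k3)) V V V k).
    apply: (tri_summable _ _ _ _ _ 1) => // s; rewrite !Cmod_cis; lra.
  rewrite (TB_scal (fun k => RtoC (- / IZR k ^ 2))) //.
  rewrite (TB_ext _ (fun k k2 k3 => cis (t * phi k k2 k3))); last by move=> *; ring.
  have -> : - (t + tau) * IZR k ^ 2 = - tau * IZR k ^ 2 + - t * IZR k ^ 2 by ring.
  rewrite cis_plus; ring.
have Hdd : forall s, summable (tri (fun k k2 k3 => Cmult (dxinv_sym (k - k3)) (cis (s * phi k k2 k3))) V V V k).
  move=> s; apply: (tri_summable _ _ _ _ _ 1) => // r; rewrite Cmod_mult Cmod_cis.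
  by have := d1 (k - snd r)%Z; lra.
(* Used twice: with [s = t + tau] when the propagator acts before the product, with [s = t] when it
   acts after it. *)
have T3 : forall s, dxinvF (mulF (eS s V) (dxinvF (abs2F (eS s V)))) k =
   Cmult (cis (- s * IZR k ^ 2)) (TB (fun k k2 k3 => Cmult (dxinv_sym k) (Cmult (dxinv_sym (k - k3))
      (cis (s * phi k k2 k3)))) V V V k).
  move=> s; rewrite {1}/dxinvF /multF [mulF _ _ _](mulF_abs2 _ 1) //; last exact: summable_eS.
  rewrite (TB_eS _ _ _ _ 1) //.
  by rewrite TB_scal //; ring.
have Eee : eS tau U = eS (t + tau) V.
  apply: functional_extensionality => j; rewrite /U !eS_cis Cmult_assoc -cis_plus; congr Cmult.
  by congr cis; ring.
rewrite Eee T3 T1 T2 eS_cis [dxinvF (mulF U _) k]T3.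
set E1 := fun k k2 k3 => Cmult (Cmult (RtoC (- / IZR k ^ 2)) _) _.
set E2 := fun k k2 k3 => Cmult (RtoC (- / IZR k ^ 2)) (cis (t * phi k k2 k3)).
set E3 := fun k k2 k3 => Cmult (dxinv_sym k) (Cmult (dxinv_sym (k - k3)) (cis ((t + tau) * phi k k2 k3))).
set E4 := fun k k2 k3 => Cmult (dxinv_sym k) (Cmult (dxinv_sym (k - k3)) (cis (t * phi k k2 k3))).
have k21 : Rabs (- / IZR k ^ 2) <= 1.
  have H : 1 <= IZR k ^ 2 by rewrite -pow2_abs; have := IZR_abs_ge1 _ Hk; nra.
  rewrite Rabs_Ropp Rabs_pos_eq; last by left; apply: Rinv_0_lt_compat; lra.
  by rewrite -Rinv_1; apply: Rinv_le_contravar; lra.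
have S1 : summable (tri E1 V V V k).
  by apply: (tri_summable _ _ _ _ _ 1) => // r; rewrite /E1 !Cmod_mult !Cmod_cis Cmod_R; lra.
have S2 : summable (tri E2 V V V k).
  by apply: (tri_summable _ _ _ _ _ 1) => // r; rewrite /E2 !Cmod_mult !Cmod_cis Cmod_R; lra.
have dd : forall j l, Cmod (dxinv_sym j) * Cmod (dxinv_sym l) <= 1.
  by move=> j l; have := d1 j; have := d1 l; have := Cmod_ge_0 (dxinv_sym j);
     have := Cmod_ge_0 (dxinv_sym l); nra.
have S3 : summable (tri E3 V V V k).
  apply: (tri_summable _ _ _ _ _ 1) => // r; rewrite /E3 !Cmod_mult !Cmod_cis Rmult_1_r; exact: dd.
have S4 : summable (tri E4 V V V k).
  apply: (tri_summable _ _ _ _ _ 1) => // r; rewrite /E4 !Cmod_mult !Cmod_cis Rmult_1_r; exact: dd.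
have key : TB (fun k k2 k3 => Cmult (Bsym tau k k2 k3) (cis (t * phi k k2 k3))) V V V k =
  Cplus (Cplus (Cmult (RtoC (- (1 / 2))) (TB E1 V V V k)) (Cmult (RtoC (1 / 2)) (TB E2 V V V k)))
        (Cminus (TB E3 V V V k) (TB E4 V V V k)).
  rewrite /TB -!tsum_scal // -tsum_plus; try exact: summable_scal.
  rewrite -tsum_minus // -tsum_plus; first last.
  - exact: summable_minus.
  - by apply: summable_plus; exact: summable_scal.
  apply: tsum_ext => -[k2 k3]; rewrite /tri /E1 /E2 /E3 /E4 /Bsym /=.
  case: (Z.eqb_spec k 0) => // _.
  have -> : (t + tau) * phi k k2 k3 = t * phi k k2 k3 + tau * phi k k2 k3 by ring.
  rewrite cis_plus.
  set c1 := cis (t * _); set c2 := cis (tau * _); set c3 := cis (- _); set z := Cmult (Cmult (V k2) _) _.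
  have -> : RtoC (/ (2 * IZR k ^ 2)) = Cmult (RtoC (1 / 2)) (Copp (RtoC (- / IZR k ^ 2))).
    by rewrite -RtoC_opp -RtoC_mult; congr RtoC; field.
  have -> : RtoC (- (1 / 2)) = Copp (RtoC (1 / 2)) by rewrite RtoC_opp.
  case: (Z.eqb_spec k3 k) => [->|Hk3].
    by rewrite Z.sub_diag {2 4}/dxinv_sym /=; ring.
  rewrite (dxinv_sym_val (k - k3)); last lia.
  rewrite dxinv_sym_val //.
  have K3 : IZR (k - k3) <> 0 by apply: not_0_IZR; lia.
  have -> : RtoC (/ (IZR k * IZR (k - k3))) = Cmult (RtoC (/ IZR k)) (RtoC (/ IZR (k - k3))).
    by rewrite -RtoC_mult; congr RtoC; field.
  have -> : Cmult (Cmult (Copp ci) (RtoC (/ IZR k))) (Cmult (Cmult (Copp ci) (RtoC (/ IZR (k - k3)))) (Cmult c1 c2)) =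
    Cmult (Cmult (Cmult ci ci) (Cmult (RtoC (/ IZR k)) (RtoC (/ IZR (k - k3))))) (Cmult c1 c2) by ring.
  have -> : Cmult (Cmult (Copp ci) (RtoC (/ IZR k))) (Cmult (Cmult (Copp ci) (RtoC (/ IZR (k - k3)))) c1) =
    Cmult (Cmult (Cmult ci ci) (Cmult (RtoC (/ IZR k)) (RtoC (/ IZR (k - k3))))) c1 by ring.
  rewrite ci_sqr; ring.
rewrite key.
have -> : - (t + tau) * IZR k ^ 2 = - tau * IZR k ^ 2 + - t * IZR k ^ 2 by ring.
rewrite cis_plus RtoC_opp; ring.
Qed.

(** * Scalar products, mass and momentum on Fourier coefficients *)

Definition ip (f g : F) : C := tsum (fun j => Cmult (f j) (Cconj (g j))).
Definition massR (f : F) : R := rsum (fun j => Cmod (f j) ^ 2).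
Definition momR (f : F) : R := Re (tsum (fun j => RtoC (IZR j * Cmod (f j) ^ 2))).
Definition absF (f : F) : Z -> R := fun k => Cmod (f k).

Lemma Cmod_RtoC x : 0 <= x -> Cmod (RtoC x) = x.
Proof. by move=> H; rewrite Cmod_R Rabs_pos_eq. Qed.

Lemma summable_ip f g A B : L2 (absF f) A -> L2 (absF g) B ->
  summable (fun j => Cmult (f j) (Cconj (g j))).
Proof.
move=> Hf Hg; apply: (summable_le _ _ _ _ (proj2 (L2_CS _ _ _ _ Hf Hg))) => j.
by rewrite Cmod_mult Cmod_conj; apply: Rle_refl.
Qed.

Lemma Cmod_ip f g A B : L2 (absF f) A -> L2 (absF g) B -> Cmod (ip f g) <= A * B.
Proof.
move=> Hf Hg; apply: (tsum_bound _ _ _ _ (proj2 (L2_CS _ _ _ _ Hf Hg))) => j.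
by rewrite Cmod_mult Cmod_conj; apply: Rle_refl.
Qed.

Lemma massR_tsum f A : L2 (absF f) A -> RtoC (massR f) = tsum (fun j => RtoC (Cmod (f j) ^ 2)).
Proof.
by move=> [_ [_ H]]; rewrite (tsum_rsum _ _ _ H) // => j; exact: pow2_ge_0.
Qed.

Lemma massR_ip f A : L2 (absF f) A -> RtoC (massR f) = ip f f.
Proof.
by move=> H; rewrite (massR_tsum _ _ H); apply: tsum_ext => j; rewrite -Cmod2_conj.
Qed.

Lemma massR_L2 f A : L2 (absF f) A -> L2 (absF f) (sqrt (massR f)).
Proof.
move=> [f0 [A0 H]]; split => //; split; first exact: sqrt_pos.
rewrite pow2_sqrt; [exact: rsum_Bnd H | exact: rsum_ge0 H].
Qed.

Lemma massR_ge0 f A : L2 (absF f) A -> 0 <= massR f.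
Proof. by move=> [_ [_ H]]; exact: rsum_ge0 H. Qed.

Lemma massR_le f A : L2 (absF f) A -> massR f <= A ^ 2.
Proof. by move=> [_ [_ H]]; exact: rsum_le H. Qed.

Lemma Pi0_ip f g A B : L2 (absF f) A -> L2 (absF g) B -> Pi0 (mulF f (conjF g)) = ip f g.
Proof.
move=> Hf Hg; have Hs := summable_ip _ _ _ _ Hf Hg.
have E : (fun j => Cmult (f j) (conjF g (0 - j)%Z)) = (fun j => Cmult (f j) (Cconj (g j))).
  by apply: functional_extensionality => j; rewrite /conjF; have -> : (- (0 - j) = j)%Z by ring.
by rewrite /Pi0 /mulF E; exact: zsumC_tsum.
Qed.

Lemma mass_massR f A : L2 (absF f) A -> mass f = RtoC (massR f).
Proof. by move=> H; rewrite /mass /abs2F (Pi0_ip _ _ _ _ H H) (massR_ip _ _ H). Qed.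

Lemma absF_eS t f : absF (eS t f) = absF f.
Proof.
by apply: functional_extensionality => k; rewrite /absF eS_cis Cmod_mult Cmod_cis Rmult_1_l.
Qed.

Lemma ip_eS t f g : ip (eS t f) (eS t g) = ip f g.
Proof.
apply: tsum_ext => j; rewrite !eS_cis Cmult_conj.
transitivity (Cmult (Cmult (cis (- t * IZR j ^ 2)) (Cconj (cis (- t * IZR j ^ 2)))) (Cmult (f j) (Cconj (g j)))).
  by ring.
by rewrite -Cmod2_conj Cmod_cis pow1; ring.
Qed.

Lemma massR_eS t f : massR (eS t f) = massR f.
Proof. by rewrite /massR -/(absF _) -[fun j => _]/(fun j => absF (eS t f) j ^ 2) absF_eS. Qed.

(** The derivative falls on the conjugate, at frequency [- j], so [P0] is [- i] times the real
    momentum. *)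
Lemma P0_momR f A B : L2 (absF f) A -> L2 (fun k => W 1 k * absF f k) B ->
  Pi0 (mulF f (dxF (conjF f))) = (0, - momR f).
Proof.
move=> HA HB.
have Hs : summable (fun j => RtoC (IZR j * Cmod (f j) ^ 2)).
  apply: (summable_le _ _ _ _ (proj2 (L2_CS _ _ _ _ HB HA))) => j.
  rewrite Cmod_R Rabs_mult (Rabs_pos_eq (_ ^ 2)); last exact: pow2_ge_0.
  rewrite W_1 /absF; have := jp_abs j; have := pow2_ge_0 (Cmod (f j)).
  by move=> h1 h2; have := Rmult_le_compat_r _ _ _ h1 h2; lra.
have E : (fun j => Cmult (f j) (dxF (conjF f) (0 - j)%Z)) =
    (fun j => Cmult (Copp ci) (RtoC (IZR j * Cmod (f j) ^ 2))).
  apply: functional_extensionality => j; rewrite /dxF /multF /dx_sym /conjF.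
  have -> : (- (0 - j) = j)%Z by ring.
  have -> : (0 - j = - j)%Z by ring.
  rewrite opp_IZR RtoC_mult Cmod2_conj RtoC_opp; ring.
rewrite /Pi0 /mulF E zsumC_tsum; last exact: summable_scal.
rewrite tsum_scal // /momR.
have HR : tsum (fun j => RtoC (IZR j * Cmod (f j) ^ 2)) =
   RtoC (Re (tsum (fun j => RtoC (IZR j * Cmod (f j) ^ 2)))).
  by rewrite -(tsum_re _ Hs (fun j => IZR j * Cmod (f j) ^ 2)).
by rewrite {1}HR; apply: injective_projections; rewrite /=; ring.
Qed.

(** Mass correction: with [Y = PsiV V - V], [eta] is the real factor [H + h] by which [G1 + G2]
    multiplies the (twisted) current iterate. *)
Definition Yst (tau m0 q t : R) (V : F) : F := fun k => Cminus (PsiV tau m0 q t V k) (V k).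
Definition Rst tau m0 q t V : R := Re (ip (Yst tau m0 q t V) V).
Definition Hst tau m0 q t V : R :=
  - / m0 * (Rst tau m0 q t V + 1 / 2 * massR (Yst tau m0 q t V)).
Definition hst tau m0 q t V : R :=
  - (1 / 2 * (Hst tau m0 q t V * Hst tau m0 q t V)) - / m0 * Hst tau m0 q t V * Rst tau m0 q t V.
Definition eta tau m0 q t V : R := Hst tau m0 q t V + hst tau m0 q t V.
Definition stepV tau m0 q t (V : F) : F := fun k =>
  Cplus (PsiV tau m0 q t V k) (Cmult (RtoC (eta tau m0 q t V)) (V k)).

(** [eS] is unitary, so the scalar products inside [Hcorr], [G1] and [G2] can be computed on twisted
    functions. All of them being real, the two corrections merge into the real factor [eta]. *)
Lemma scheme_twisted tau m0 q t V A B : m0 <> 0 -> summable V -> L2 (absF V) A ->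
  L2 (absF (Yst tau m0 q t V)) B ->
  let U := eS t V in let P0 := (0, - q) in
  addF (Psi tau (RtoC m0) P0 U) (addF (G1 tau (RtoC m0) P0 U) (G2 tau (RtoC m0) P0 U)) =
  eS (t + tau) (stepV tau m0 q t V).
Proof.
move=> Hm HV HA HB U P0.
have EU : eS tau U = eS (t + tau) V.
  apply: functional_extensionality => j; rewrite /U !eS_cis Cmult_assoc -cis_plus; congr Cmult.
  by congr cis; ring.
have EF : Fmap tau (RtoC m0) P0 U = eS (t + tau) (Yst tau m0 q t V).
  apply: functional_extensionality => k; rewrite /Fmap /subF Psi_twisted // EU /Yst !eS_cis; ring.
have HA' : L2 (absF (eS (t + tau) V)) A by rewrite absF_eS.
have HB' : L2 (absF (eS (t + tau) (Yst tau m0 q t V))) B by rewrite absF_eS.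
have ER : RePF tau (RtoC m0) P0 U = RtoC (Rst tau m0 q t V).
  by rewrite /RePF EF EU (Pi0_ip _ _ _ _ HB' HA') ip_eS.
have EM : Pi0 (abs2F (Fmap tau (RtoC m0) P0 U)) = RtoC (massR (Yst tau m0 q t V)).
  by rewrite EF -/(mass _) (mass_massR _ _ HB') massR_eS.
have EH : Hcorr tau (RtoC m0) P0 U = RtoC (Hst tau m0 q t V).
  rewrite /Hcorr ER EM /Hst RtoC_mult RtoC_plus RtoC_opp RtoC_mult RtoC_inv //; ring.
apply: functional_extensionality => k.
rewrite /addF /G1 /G2 /sclF /subF EH ER EU Psi_twisted // !eS_cis /stepV /eta /hst.
rewrite RtoC_plus RtoC_minus !RtoC_opp !RtoC_mult !RtoC_opp RtoC_inv //.
by ring.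
Qed.

Lemma L2_comb (c : R) (f g : F) A B : L2 (absF f) A -> L2 (absF g) B ->
  L2 (absF (fun k => Cplus (f k) (Cmult (RtoC c) (g k)))) (A + Rabs c * B).
Proof.
move=> Hf Hg.
apply: (L2_le _ _ _ (fun k => Cmod_ge_0 _) _ (L2_plus _ _ _ _ Hf (L2_scal _ _ _ (Rabs_pos c) Hg))).
move=> k; rewrite /absF; apply: Rle_trans (Cmod_triangle _ _) _.
by rewrite Cmod_mult Cmod_R; lra.
Qed.

Lemma massR_comb (c : R) (f g : F) A B : L2 (absF f) A -> L2 (absF g) B ->
  massR (fun k => Cplus (f k) (Cmult (RtoC c) (g k))) =
  massR f + 2 * c * Re (ip f g) + c ^ 2 * massR g.
Proof.
move=> Hf Hg; have Hc := L2_comb c _ _ _ _ Hf Hg.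
apply: RtoC_inj; rewrite (massR_tsum _ _ Hc) !RtoC_plus (RtoC_mult (2 * c)) (RtoC_mult (c ^ 2)).
rewrite (massR_tsum _ _ Hf) (massR_tsum _ _ Hg).
have Hs := summable_ip _ _ _ _ Hf Hg.
have sq : forall f A, L2 (absF f) A -> summable (fun j => RtoC (Cmod (f j) ^ 2)).
  move=> h K [_ [_ H]]; exists (K ^ 2); apply: Bnd_le H => j.
  by rewrite Cmod_RtoC; [apply: Rle_refl | exact: pow2_ge_0].
have H1 := sq _ _ Hf; have H2 := sq _ _ Hg.
rewrite /ip -(tsum_re _ Hs (fun j => Re (Cmult (f j) (Cconj (g j))))) //.
have H3 : summable (fun j => RtoC (Re (Cmult (f j) (Cconj (g j))))).
  case: Hs => S HS; exists S; apply: Bnd_le HS => j; rewrite Cmod_R; exact: re_le_Cmod.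
rewrite -(tsum_scal (RtoC (2 * c))) // -(tsum_scal (RtoC (c ^ 2))) //.
rewrite -tsum_plus //; last exact: summable_scal.
rewrite -tsum_plus //; [|apply: summable_plus => //; exact: summable_scal|exact: summable_scal].
apply: tsum_ext => j; rewrite -!RtoC_mult -!RtoC_plus; congr RtoC.
rewrite !Cmod2_alt /Re /Im /=; ring.
Qed.

(** [G1] and [G2] are chosen so that the mass error is multiplied by [(1 + eta)^2] up to the
    remainder [- h |Y|^2 + m0 h^2], quadratically small in [h]. *)
Lemma mass_step tau m0 q t V A B : m0 <> 0 -> L2 (absF V) A -> L2 (absF (Yst tau m0 q t V)) B ->
  let e := eta tau m0 q t V in let h := hst tau m0 q t V in
  massR (stepV tau m0 q t V) - m0 =
  (1 + e) ^ 2 * (massR V - m0) - h * massR (Yst tau m0 q t V) + m0 * h ^ 2.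
Proof.
move=> Hm HA HB e h.
have -> : stepV tau m0 q t V = (fun k => Cplus (Yst tau m0 q t V k) (Cmult (RtoC (1 + e)) (V k))).
  apply: functional_extensionality => k; rewrite /stepV /Yst -/e RtoC_plus; ring.
rewrite (massR_comb _ _ _ _ _ HB HA) -/(Rst tau m0 q t V) /e /h /eta /hst /Hst.
set r := Rst _ _ _ _ _; set M := massR (Yst _ _ _ _ _); set mv := massR V.
field; exact: Hm.
Qed.

(** * Complex-valued derivatives and the oscillatory integral [Ei] *)

(** Componentwise, so that the mean value theorem and the rules for real derivatives apply
    directly. *)
Definition Cder (f : R -> C) (s : R) (l : C) : Prop :=
  is_derive (fun x => Re (f x)) s (Re l) /\ is_derive (fun x => Im (f x)) s (Im l).

Lemma Cder_ext f g s l : (forall x, f x = g x) -> Cder f s l -> Cder g s l.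
Proof. by move=> H; have -> : g = f by apply: functional_extensionality => x; rewrite H. Qed.

Lemma Cder_plus f g s l m : Cder f s l -> Cder g s m ->
  Cder (fun x => Cplus (f x) (g x)) s (Cplus l m).
Proof.
move=> [f1 f2] [g1 g2]; split; rewrite /Re /Im /=.
- exact: (is_derive_plus (fun x => Re (f x)) (fun x => Re (g x))).
- exact: (is_derive_plus (fun x => Im (f x)) (fun x => Im (g x))).
Qed.

Lemma Cder_scal c f s l : Cder f s l -> Cder (fun x => Cmult c (f x)) s (Cmult c l).
Proof.
move=> [f1 f2].
have h : forall (a b : R), is_derive (fun x => a * Re (f x) + b * Im (f x)) s (a * Re l + b * Im l).
  move=> a b; apply: (is_derive_plus (fun x => a * Re (f x)) (fun x => b * Im (f x)));
  exact: is_derive_scal.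
split.
- have -> : Re (Cmult c l) = Re c * Re l + (- Im c) * Im l by rewrite /Re /Im /=; ring.
  by apply: is_derive_ext (h _ _) => x; rewrite /Re /Im /=; ring.
- have -> : Im (Cmult c l) = Im c * Re l + Re c * Im l by rewrite /Re /Im /=; ring.
  by apply: is_derive_ext (h _ _) => x; rewrite /Re /Im /=; ring.
Qed.

Lemma Cder_const c s : Cder (fun _ => c) s 0.
Proof. split; exact: is_derive_const. Qed.

Lemma Cder_cis a s : Cder (fun x => cis (x * a)) s (Cmult (Cmult ci (RtoC a)) (cis (s * a))).
Proof. by split; rewrite /cis /Re /Im /=; auto_derive => //; ring. Qed.

(** Test [f] against the conjugate of the increment. *)
Lemma C_MVT (f f' : R -> C) a b A : a <= b -> (forall s, a <= s <= b -> Cder f s (f' s)) ->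
  (forall s, a <= s <= b -> Cmod (f' s) <= A) -> Cmod (Cminus (f b) (f a)) <= A * (b - a).
Proof.
move=> ab Hd HA.
have A0 : 0 <= A by have := HA a ltac:(lra); have := Cmod_ge_0 (f' a); lra.
set z := Cminus (f b) (f a).
case: (Rle_lt_or_eq_dec 0 (Cmod z) (Cmod_ge_0 _)) => [z0|<-]; last first.
  by apply: Rmult_le_pos; lra.
pose g s := Re (Cmult (Cconj z) (f s)).
have Hg : forall s, a <= s <= b -> is_derive g s (Re (Cmult (Cconj z) (f' s))).
  by move=> s Hs; case: (Cder_scal (Cconj z) f s _ (Hd s Hs)).
have [c [Hc E]] := MVT_gen g a b (fun s => Re (Cmult (Cconj z) (f' s)))
  ltac:(rewrite Rmin_left // Rmax_right // => s Hs; apply: Hg; lra)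
  ltac:(rewrite Rmin_left // Rmax_right // => s Hs;
        apply: derivable_continuous_pt; exists (Re (Cmult (Cconj z) (f' s)));
        apply/is_derive_Reals; exact: Hg).
rewrite Rmin_left // Rmax_right // in Hc.
have E1 : g b - g a = Cmod z ^ 2.
  rewrite /g Cmod2_alt /z /Re /Im /=; ring.
have E2 : Re (Cmult (Cconj z) (f' c)) <= Cmod z * A.
  apply: Rle_trans (Rle_abs _) _; apply: Rle_trans (re_le_Cmod _) _.
  rewrite Cmod_mult Cmod_conj; apply: Rmult_le_compat_l; [exact: Cmod_ge_0 | exact: HA].
have E3 : Cmod z ^ 2 <= Cmod z * A * (b - a).
  by rewrite -E1 E; apply: Rmult_le_compat_r; lra.
apply: (Rmult_le_reg_l (Cmod z)) => //; move: E3; rewrite /pow; lra.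
Qed.

Lemma cis_lip x y : Cmod (Cminus (cis x) (cis y)) <= Rabs (x - y).
Proof.
wlog H : x y / y <= x.
  move=> Hw; case: (Rle_dec y x) => [|Hn]; first exact: Hw.
  rewrite -Cmod_opp Rabs_minus_sym; have -> : (- (cis x - cis y) = cis y - cis x)%C by ring.
  by apply: Hw; lra.
have := C_MVT (fun s => cis (s * 1)) (fun s => Cmult (Cmult ci (RtoC 1)) (cis (s * 1))) y x 1 H
  (fun s _ => Cder_cis 1 s).
rewrite !Rmult_1_r Rmult_1_l Rabs_pos_eq; last lra.
by apply=> s _; rewrite !Cmod_mult Cmod_ci Cmod_1 Cmod_cis; lra.
Qed.

(** [Ei s x] is the integral of [exp (i sigma x)] over [0 <= sigma <= s]. *)
Definition Ei (s x : R) : C :=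
  if Req_EM_T x 0 is left _ then RtoC s else (sin (s * x) / x, (1 - cos (s * x)) / x).

Lemma Ei_0 x : Ei 0 x = 0.
Proof.
rewrite /Ei; case: Req_EM_T => // H; rewrite Rmult_0_l sin_0 cos_0.
apply: injective_projections; rewrite /=; field; exact: H.
Qed.

Lemma Ei_at0 s : Ei s 0 = RtoC s.
Proof. by rewrite /Ei; case: Req_EM_T. Qed.

Lemma Ei_der x s : Cder (fun r => Ei r x) s (cis (s * x)).
Proof.
rewrite /Ei; case: Req_EM_T => [->|H].
  by split; rewrite /cis /Re /Im /= ?Rmult_0_r ?cos_0 ?sin_0; auto_derive.
by split; rewrite /cis /Re /Im /=; auto_derive => //; field.
Qed.

Lemma Ei_conj s x : Ei s (- x) = Cconj (Ei s x).
Proof.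
rewrite /Ei; case: Req_EM_T => H1; case: Req_EM_T => H2; try lra.
- by rewrite /Cconj /=; apply: injective_projections; rewrite /=; ring.
- have -> : s * - x = - (s * x) by ring.
  by rewrite sin_neg cos_neg; apply: injective_projections; rewrite /=; field.
Qed.

Lemma cis_Ei s x : Cminus (cis (s * x)) 1 = Cmult (Cmult ci (RtoC x)) (Ei s x).
Proof.
rewrite /Ei; case: Req_EM_T => [->|H].
  by rewrite Rmult_0_r cis_0; ring.
by apply: injective_projections; rewrite /=; field.
Qed.

Lemma Ei_bound s x : 0 <= s -> Cmod (Ei s x) <= s.
Proof.
move=> Hs; have := C_MVT (fun r => Ei r x) (fun r => cis (r * x)) 0 s 1 Hs (fun r _ => Ei_der x r).
rewrite Ei_0; have -> : Cminus (Ei s x) 0 = Ei s x by ring.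
by rewrite Rminus_0_r Rmult_1_l; apply=> r _; rewrite Cmod_cis; lra.
Qed.

Lemma Ei_lip s x y : 0 <= s -> Cmod (Cminus (Ei s x) (Ei s y)) <= s ^ 2 * Rabs (x - y).
Proof.
move=> Hs.
have := C_MVT (fun r => Cminus (Ei r x) (Ei r y)) (fun r => Cminus (cis (r * x)) (cis (r * y)))
  0 s (s * Rabs (x - y)) Hs.
rewrite !Ei_0; have -> : Cminus (Cminus (Ei s x) (Ei s y)) (Cminus 0 0) = Cminus (Ei s x) (Ei s y) by ring.
have -> : s * Rabs (x - y) * (s - 0) = s ^ 2 * Rabs (x - y) by ring.
apply.
- move=> r _; apply: (Cder_ext (fun r => Cplus (Ei r x) (Cmult (RtoC (-1)) (Ei r y)))).
    by move=> u; ring.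
  have -> : Cminus (cis (r * x)) (cis (r * y)) = Cplus (cis (r * x)) (Cmult (RtoC (-1)) (cis (r * y))) by ring.
  by apply: Cder_plus; [exact: Ei_der | apply: Cder_scal; exact: Ei_der].
- move=> r Hr; apply: Rle_trans (cis_lip _ _) _.
  have -> : r * x - r * y = r * (x - y) by ring.
  rewrite Rabs_mult Rabs_pos_eq; last lra.
  by apply: Rmult_le_compat_r; [exact: Rabs_pos | lra].
Qed.

(** * Bounds for the symbols *)

(** The phase that the first integral term of the scheme uses in place of [phi]. The discrepancy
    [2 * k2 * k3] involves only the two unconjugated frequencies, which is why the local error asks
    for derivatives on them. *)
Definition psi (k k2 k3 : Z) : R := - (2 * IZR k * IZR (k2 + k3 - k)).

Lemma phi_psi k k2 k3 : phi k k2 k3 - psi k k2 k3 = 2 * IZR k2 * IZR k3.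
Proof. rewrite /phi /psi !mult_IZR !minus_IZR plus_IZR; ring. Qed.

(** The value [1] at [k = 0] makes the frequency zero fit [Esym]: there [psi = 0], and the scheme
    replaces the oscillating integral by [tau]. *)
Definition qsym (k p : Z) : R := if Z.eqb k 0 then 1 else IZR p / IZR k.

(** Symbol of the local error. *)
Definition Esym (tau : R) (k k2 k3 : Z) : C :=
  Cmult (Cmult ci (RtoC (qsym k (k2 + k3 - k)))) (Cminus (Ei tau (phi k k2 k3)) (Ei tau (psi k k2 k3))).

Lemma qsym_bound k p : Rabs (qsym k p) <= 2 * (jp p / jp k).
Proof.
rewrite /qsym; have p1 := jp_ge1 p; have k1 := jp_ge1 k.
case: (Z.eqb_spec k 0) => [->|Hk].
  have -> : jp 0 = 1 by rewrite -(W_1 0) W_0_eq.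
  by rewrite Rabs_R1; lra.
have Hk1 := IZR_abs_ge1 _ Hk; have Hk2 := jp_le_abs _ Hk; have Hp := jp_abs p.
rewrite /Rdiv Rabs_mult Rabs_inv.
apply: (Rmult_le_reg_r (Rabs (IZR k) * jp k)); first nra.
have -> : Rabs (IZR p) * / Rabs (IZR k) * (Rabs (IZR k) * jp k) = Rabs (IZR p) * jp k by field; lra.
have -> : 2 * (jp p * / jp k) * (Rabs (IZR k) * jp k) = jp p * (2 * Rabs (IZR k)) by field; lra.
apply: Rmult_le_compat => //; [exact: Rabs_pos | lra].
Qed.

Lemma Esym_bound2 tau k k2 k3 : 0 <= tau ->
  Cmod (Esym tau k k2 k3) <= Rabs (qsym k (k2 + k3 - k)) * (2 * tau).
Proof.
move=> Ht; rewrite /Esym !Cmod_mult Cmod_ci Rmult_1_l Cmod_R.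
apply: Rmult_le_compat_l; first exact: Rabs_pos.
apply: Rle_trans (Cmod_triangle _ _) _; rewrite Cmod_opp.
have := Ei_bound tau (phi k k2 k3) Ht; have := Ei_bound tau (psi k k2 k3) Ht; lra.
Qed.

Lemma Esym_bound1 tau k k2 k3 : 0 <= tau ->
  Cmod (Esym tau k k2 k3) <= Rabs (qsym k (k2 + k3 - k)) * (2 * tau ^ 2 * (Rabs (IZR k2) * Rabs (IZR k3))).
Proof.
move=> Ht; rewrite /Esym !Cmod_mult Cmod_ci Rmult_1_l Cmod_R.
apply: Rmult_le_compat_l; first exact: Rabs_pos.
apply: Rle_trans (Ei_lip _ _ _ Ht) _; rewrite phi_psi !Rabs_mult (Rabs_pos_eq 2); lra.
Qed.

Lemma min_power x th : 0 < x -> 0 <= th <= 1 -> Rmin 1 x <= Rpower x th.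
Proof.
move=> x0 Hth; case: (Rle_dec x 1) => Hx.
- rewrite Rmin_right //.
  have : ln x <= 0 by rewrite -ln_1; case: (Rle_lt_or_eq_dec _ _ Hx) => [h|->]; [left; exact: ln_increasing | right].
  move=> Hl; rewrite -{1}(exp_ln x) // /Rpower.
  have : ln x <= th * ln x by nra.
  by case=> [h|h]; [left; exact: exp_increasing | rewrite -h; right].
- rewrite Rmin_left; last lra.
  rewrite -(Rpower_O x) //; apply: Rle_Rpower; lra.
Qed.

Lemma Rpower_W s th k : 0 < s -> Rpower (s * jp k) th = Rpower s th * W th k.
Proof. by move=> Hs; rewrite Rpower_mult_distr //; have := jp_ge1 k; lra. Qed.

(** Interpolates between the trivial bound, of order [tau], and the Lipschitz bound, of order
    [tau^2] but costing [|k2| |k3|], by means of [min 1 x <= x^th]. *)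
Lemma Esym_boundq th tau k k2 k3 : 0 < tau -> 0 <= th <= 1 ->
  Cmod (Esym tau k k2 k3) <=
  Rabs (qsym k (k2 + k3 - k)) * (2 * Rpower tau (1 + th) * (W th k2 * W th k3)).
Proof.
move=> Ht Hth; set q := Rabs _.
have b1 := Esym_bound1 tau k k2 k3 ltac:(lra); have b2 := Esym_bound2 tau k k2 k3 ltac:(lra).
rewrite -/q in b1 b2.
have j2 := jp_ge1 k2; have j3 := jp_ge1 k3.
have q0 : 0 <= q by exact: Rabs_pos.
have a23 : Rabs (IZR k2) * Rabs (IZR k3) <= jp k2 * jp k3.
  by apply: Rmult_le_compat; try exact: Rabs_pos; exact: jp_abs.
have x0 : 0 < tau * jp k2 * jp k3 by repeat apply: Rmult_lt_0_compat; lra.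
have := min_power _ _ x0 Hth.
rewrite Rpower_W; last by apply: Rmult_lt_0_compat; lra.
rewrite Rpower_W // Rpower_plus Rpower_1 // => Hm.
have Hmin : Cmod (Esym tau k k2 k3) <= q * (2 * tau) * Rmin 1 (tau * jp k2 * jp k3).
  rewrite /Rmin; case: Rle_dec => _; first by rewrite Rmult_1_r.
  apply: Rle_trans b1 _.
  have -> : q * (2 * tau) * (tau * jp k2 * jp k3) = q * (2 * tau ^ 2 * (jp k2 * jp k3)) by ring.
  apply: Rmult_le_compat_l => //; apply: Rmult_le_compat_l => //.
  have := pow2_ge_0 tau; lra.
apply: Rle_trans Hmin _.
apply: Rle_trans (Rmult_le_compat_l _ _ _ _ Hm) _; first by apply: Rmult_le_pos; lra.
by apply: Req_le; ring.
Qed.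

Lemma Esym_bound th tau k k2 k3 : 0 < tau -> 0 <= th <= 1 ->
  Cmod (Esym tau k k2 k3) <=
  4 * Rpower tau (1 + th) * ((jp (k2 + k3 - k) / jp k) * (W th k2 * W th k3)).
Proof.
move=> Ht Hth; apply: Rle_trans (Esym_boundq _ _ _ _ _ Ht Hth) _.
have P : 0 <= 2 * Rpower tau (1 + th) * (W th k2 * W th k3).
  have := W_pos th k2; have := W_pos th k3; have := exp_pos ((1 + th) * ln tau) => *.
  by left; repeat apply: Rmult_lt_0_compat => //; lra.
have := Rmult_le_compat_r _ _ _ P (qsym_bound k (k2 + k3 - k)); lra.
Qed.

(** The part of the symbol generated by the frequencies [k3 = k]. *)
Definition Rsym (tau : R) (k k2 k3 : Z) : C :=
  if Z.eqb k 0 then RtoC 0 else if Z.eqb k3 k then Cmult ci (RtoC (2 * tau * (IZR (k - k2) / IZR k))) else RtoC 0.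

Definition Ssym (tau : R) (k k2 k3 : Z) : C :=
  if Z.eqb k 0 then RtoC 0 else Cmult (Cmult (Copp ci) (RtoC (IZR (k3 - k2) / IZR k))) (Ei tau (phi k k2 k3)).

(** Since [2 (k - k2) = (k - p) + (k3 - k2)], the symbol splits into the exact one, the local error,
    an antisymmetric part and the resonances. *)
Lemma Bsym_decomp tau k k2 k3 :
  Bsym tau k k2 k3 = Cplus (Cplus (Cmult (Copp ci) (Ei tau (phi k k2 k3))) (Esym tau k k2 k3))
    (Cplus (Ssym tau k k2 k3) (Rsym tau k k2 k3)).
Proof.
rewrite /Bsym /Esym /Ssym /Rsym /qsym; case: (Z.eqb_spec k 0) => [->|Hk].
  have -> : psi 0 k2 k3 = 0 by rewrite /psi; ring.
  rewrite Ei_at0; ring.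
have K0 : IZR k <> 0 by apply: not_0_IZR.
have -> : - (2 * tau * IZR k * IZR (k2 + k3 - k)) = tau * psi k k2 k3 by rewrite /psi; ring.
rewrite cis_Ei.
have -> : Cmult (RtoC (/ (2 * IZR k ^ 2))) (Cmult (Cmult ci (RtoC (psi k k2 k3))) (Ei tau (psi k k2 k3))) =
  Cmult (Copp (Cmult ci (RtoC (IZR (k2 + k3 - k) / IZR k)))) (Ei tau (psi k k2 k3)).
  transitivity (Cmult (Cmult ci (Cmult (RtoC (/ (2 * IZR k ^ 2))) (RtoC (psi k k2 k3)))) (Ei tau (psi k k2 k3))).
    by ring.
  rewrite -RtoC_mult.
  have -> : / (2 * IZR k ^ 2) * psi k k2 k3 = - (IZR (k2 + k3 - k) / IZR k) by rewrite /psi; field.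
  rewrite RtoC_opp; ring.
have Hq : RtoC (IZR (k2 + k3 - k) / IZR k) = Cminus 1 (Cplus (RtoC (2 * (IZR (k - k2) / IZR k)))
   (Copp (RtoC (IZR (k3 - k2) / IZR k)))).
  rewrite -RtoC_opp -RtoC_plus -RtoC_minus; congr RtoC; rewrite !minus_IZR plus_IZR; field; exact: K0.
case: (Z.eqb_spec k3 k) => [->|Hk3].
  have -> : phi k k2 k = 0 by rewrite /phi Z.sub_diag Z.mul_0_r.
  rewrite Ei_at0 in Hq *.
  have -> : (k2 + k - k = k2)%Z by ring.
  have -> : RtoC (2 * tau * (IZR (k - k2) / IZR k)) = Cmult (RtoC tau) (RtoC (2 * (IZR (k - k2) / IZR k))).
    by rewrite -RtoC_mult; congr RtoC; ring.
  have -> : RtoC (IZR k2 / IZR k) = Cminus 1 (RtoC (IZR (k - k2) / IZR k)).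
    rewrite -RtoC_minus; congr RtoC; rewrite minus_IZR; field; exact: K0.
  rewrite (RtoC_mult 2); ring.
rewrite cis_Ei.
have K3 : IZR (k - k3) <> 0 by apply: not_0_IZR; lia.
have -> : Cmult (RtoC (/ (IZR k * IZR (k - k3)))) (Cmult (Cmult ci (RtoC (phi k k2 k3))) (Ei tau (phi k k2 k3))) =
  Cmult (Cmult ci (RtoC (2 * (IZR (k - k2) / IZR k)))) (Ei tau (phi k k2 k3)).
  transitivity (Cmult (Cmult ci (Cmult (RtoC (/ (IZR k * IZR (k - k3)))) (RtoC (phi k k2 k3)))) (Ei tau (phi k k2 k3))).
    by ring.
  rewrite -RtoC_mult; congr Cmult; congr Cmult; congr RtoC; rewrite /phi !mult_IZR; field; by split.
rewrite Hq; ring.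
Qed.

(** Common majorant of all pieces of the symbol: one derivative is gained at [k] and paid by one of
    the other three frequencies. *)
Definition JJ (k k2 k3 : Z) : R := (jp k2 + jp k3 + jp (k2 + k3 - k)) / jp k.

Lemma JJ_ge1 k k2 k3 : 1 <= JJ k k2 k3.
Proof.
have k1 := jp_ge1 k; apply: (Rmult_le_reg_r (jp k)); first lra.
have -> : JJ k k2 k3 * jp k = jp k2 + jp k3 + jp (k2 + k3 - k) by rewrite /JJ; field; lra.
have := jp_sum3 k k2 k3; lra.
Qed.

Lemma quot_JJ k k2 k3 m : jp m <= 2 * (jp k2 + jp k3 + jp (k2 + k3 - k)) -> k <> 0%Z ->
  Rabs (IZR m / IZR k) <= 4 * JJ k k2 k3.
Proof.
move=> Hm Hk; have := qsym_bound k m; rewrite /qsym; case: (Z.eqb_spec k 0) => // _ H.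
apply: Rle_trans H _; have k1 := jp_ge1 k.
have : jp m / jp k <= 2 * JJ k k2 k3.
  have -> : 2 * JJ k k2 k3 = 2 * (jp k2 + jp k3 + jp (k2 + k3 - k)) / jp k by rewrite /JJ; field; lra.
  by apply: Rmult_le_compat_r => //; left; apply: Rinv_0_lt_compat; lra.
lra.
Qed.

Lemma Ssym_JJ tau k k2 k3 : 0 <= tau -> Cmod (Ssym tau k k2 k3) <= 4 * tau * JJ k k2 k3.
Proof.
move=> Ht; have J1 := JJ_ge1 k k2 k3; rewrite /Ssym; case: (Z.eqb_spec k 0) => [_|Hk].
  by rewrite Cmod_0; apply: Rmult_le_pos; lra.
rewrite !Cmod_mult Cmod_opp Cmod_ci Rmult_1_l Cmod_R.
have H := quot_JJ k k2 k3 (k3 - k2) ltac:(have := jp_sub k3 k2; have := jp_ge1 k2;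
  have := jp_ge1 k3; have := jp_ge1 (k2 + k3 - k); lra) Hk.
have -> : 4 * tau * JJ k k2 k3 = 4 * JJ k k2 k3 * tau by ring.
by apply: Rmult_le_compat => //; [exact: Rabs_pos | exact: Cmod_ge_0 | exact: Ei_bound].
Qed.

Lemma Rsym_JJ tau k k2 k3 : 0 <= tau -> Cmod (Rsym tau k k2 k3) <= 8 * tau * JJ k k2 k3.
Proof.
move=> Ht; have J1 := JJ_ge1 k k2 k3; have J0 : 0 <= 8 * tau * JJ k k2 k3 by apply: Rmult_le_pos; lra.
rewrite /Rsym; case: (Z.eqb_spec k 0) => [_|Hk]; first by rewrite Cmod_0.
case: Z.eqb; last by rewrite Cmod_0.
rewrite !Cmod_mult Cmod_ci Rmult_1_l Cmod_R.
have Hj : jp (k - k2) <= jp k3 + jp (k2 + k3 - k).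
  have E : (k - k2 = k3 - (k2 + k3 - k))%Z by ring.
  by rewrite {1}E; exact: jp_sub.
have H := quot_JJ k k2 k3 (k - k2) ltac:(have := jp_ge1 k2;
  have := jp_ge1 k3; have := jp_ge1 (k2 + k3 - k); lra) Hk.
rewrite (Rabs_mult (2 * tau)) (Rabs_pos_eq (2 * tau)); last lra.
have := Rmult_le_compat_l _ _ _ Ht H; lra.
Qed.

Lemma Esym_JJ tau k k2 k3 : 0 <= tau -> Cmod (Esym tau k k2 k3) <= 4 * tau * JJ k k2 k3.
Proof.
move=> Ht; apply: Rle_trans (Esym_bound2 _ _ _ _ Ht) _.
have := qsym_bound k (k2 + k3 - k); have k1 := jp_ge1 k.
have : jp (k2 + k3 - k) / jp k <= JJ k k2 k3.
  apply: Rmult_le_compat_r; first by left; apply: Rinv_0_lt_compat; lra.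
  have := jp_ge1 k2; have := jp_ge1 k3; lra.
move=> h1 h2; have := Rmult_le_compat_r (2 * tau) _ _ ltac:(lra) (Rle_trans _ _ _ h2 (Rmult_le_compat_l 2 _ _ ltac:(lra) h1)).
lra.
Qed.

Lemma Bsym_JJ tau k k2 k3 : 0 <= tau -> Cmod (Bsym tau k k2 k3) <= 17 * tau * JJ k k2 k3.
Proof.
move=> Ht; rewrite Bsym_decomp.
apply: Rle_trans (Cmod_triangle _ _) _.
have t1 := Cmod_triangle (Cmult (Copp ci) (Ei tau (phi k k2 k3))) (Esym tau k k2 k3).
have t2 := Cmod_triangle (Ssym tau k k2 k3) (Rsym tau k k2 k3).
have b1 := Ssym_JJ _ k k2 k3 Ht; have b2 := Rsym_JJ _ k k2 k3 Ht; have b3 := Esym_JJ _ k k2 k3 Ht.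
have b4 := Ei_bound tau (phi k k2 k3) Ht.
move: t1; rewrite Cmod_mult Cmod_opp Cmod_ci Rmult_1_l => t1.
have := JJ_ge1 k k2 k3 => J1.
have : tau <= tau * JJ k k2 k3 by nra.
lra.
Qed.

(** * Norm estimates for trilinear operators *)

(** The digits in this and the next names are the two slots kept in [l2], the output being slot 1
    and the conjugated frequency slot 4; the other two slots are [l1]. *)
Lemma Quad_13 A X Y V a x y v : L2 A a -> L2 Y y -> L1 X x -> L1 V v ->
  Quad one2 A X Y V (a * x * y * v).
Proof.
move=> HA HY HX HV; apply: Quad_swap23.
by apply: Bnd_mono (Quad_side _ _ _ _ _ _ _ _ HA HY HX HV); apply: Req_le; ring.
Qed.

Lemma Quad_14 A X Y V a x y v : L2 A a -> L2 V v -> L1 X x -> L1 Y y ->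
  Quad one2 A X Y V (a * x * y * v).
Proof.
move=> HA HV HX HY.
by apply: Bnd_mono (Quad_ends _ _ _ _ _ _ _ _ HA HV HX HY); apply: Req_le; ring.
Qed.

Lemma Quad_24 A X Y V a x y v : L2 X x -> L2 V v -> L1 A a -> L1 Y y ->
  Quad one2 A X Y V (a * x * y * v).
Proof.
move=> HX HV HA HY; apply: Quad_swap.
by apply: Bnd_mono (Quad_13 _ _ _ _ _ _ _ _ HX HV HA HY); apply: Req_le; ring.
Qed.

Lemma Quad_34 A X Y V a x y v : L2 Y y -> L2 V v -> L1 A a -> L1 X x ->
  Quad one2 A X Y V (a * x * y * v).
Proof.
move=> HY HV HA HX; apply: Quad_swap23.
by apply: Bnd_mono (Quad_24 _ _ _ _ _ _ _ _ HY HV HA HX); apply: Req_le; ring.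
Qed.

Definition HS (s : R) (f : F) (A : R) : Prop := L2 (fun k => W s k * absF f k) A.

(** The two sizes are kept apart because [mu] may be arbitrarily small while [D] is not: what is
    later divided by the mass must exhibit powers of [mu]. *)
Definition cls (g mu D : R) (f : F) : Prop := L2 (absF f) mu /\ HS g f D.

Lemma HS_le s t f A : t <= s -> HS s f A -> HS t f A.
Proof.
move=> H; apply: L2_le => k.
- by apply: Rmult_le_pos; [left; exact: W_pos | exact: Cmod_ge_0].
- by apply: Rmult_le_compat_r; [exact: Cmod_ge_0 | exact: W_le].
Qed.

Lemma HS_0 f A : HS 0 f A <-> L2 (absF f) A.
Proof.
have E : (fun k => W 0 k * absF f k) = absF f.
  by apply: functional_extensionality => k; rewrite W_0 Rmult_1_l.
by rewrite /HS E.
Qed.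

Lemma cls_le g g' mu D f : g' <= g -> cls g mu D f -> cls g' mu D f.
Proof. by move=> H [h1 h2]; split => //; exact: HS_le h2. Qed.

Lemma HS_comb s (c : C) f g A B : HS s f A -> HS s g B ->
  HS s (fun k => Cplus (f k) (Cmult c (g k))) (A + Cmod c * B).
Proof.
move=> Hf Hg.
apply: (L2_le _ _ _ _ _ (L2_plus _ _ _ _ Hf (L2_scal _ _ _ (Cmod_ge_0 c) Hg))) => k.
- by apply: Rmult_le_pos; [left; exact: W_pos | exact: Cmod_ge_0].
- rewrite /absF; have := Cmod_triangle (f k) (Cmult c (g k)); rewrite Cmod_mult => H.
  have := Rmult_le_compat_l _ _ _ (Rlt_le _ _ (W_pos s k)) H; lra.
Qed.

Lemma HS_plus s f g A B : HS s f A -> HS s g B -> HS s (fun k => Cplus (f k) (g k)) (A + B).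
Proof.
move=> Hf Hg; have := HS_comb s 1 _ _ _ _ Hf Hg; rewrite Cmod_1 Rmult_1_l.
by apply: L2_ext => k; congr (_ * Cmod _); ring.
Qed.

Lemma HS_minus s f g A B : HS s f A -> HS s g B -> HS s (fun k => Cminus (f k) (g k)) (A + B).
Proof.
move=> Hf Hg; have := HS_comb s (Copp 1) _ _ _ _ Hf Hg; rewrite Cmod_opp Cmod_1 Rmult_1_l.
by apply: L2_ext => k; congr (_ * Cmod _); ring.
Qed.

Lemma HS_ext s f g A : (forall k, f k = g k) -> HS s f A -> HS s g A.
Proof. by move=> H; have -> : g = f by apply: functional_extensionality => i; rewrite H. Qed.

Lemma HS_diag s (d : Z -> C) M f A : 0 <= M -> (forall k, Cmod (d k) <= M) -> HS s f A ->
  HS s (fun k => Cmult (d k) (f k)) (M * A).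
Proof.
move=> M0 Hd Hf; apply: (L2_le _ _ _ _ _ (L2_scal M _ _ M0 Hf)) => k.
- by apply: Rmult_le_pos; [left; exact: W_pos | exact: Cmod_ge_0].
- rewrite /absF Cmod_mult.
  have := Rmult_le_compat_r (Cmod (f k)) _ _ (Cmod_ge_0 _) (Hd k) => H.
  have := Rmult_le_compat_l _ _ _ (Rlt_le _ _ (W_pos s k)) H; lra.
Qed.

Lemma HS_L1 s t : t + 1/2 < s -> exists K, 0 < K /\
  forall f D, HS s f D -> L1 (fun k => W t k * absF f k) (K * D).
Proof. by move=> H; have [K [K0 HK]] := L1_weight s t H; exists K; split => // f D; exact: HK. Qed.

Lemma HS_wiener s f D : 1/2 < s -> HS s f D -> summable f.
Proof.
move=> Hs Hf; have [K [_ HK]] := HS_L1 s 0 ltac:(lra).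
have [_ H] := HK _ _ Hf; exists (K * D); apply: Bnd_le H => k; rewrite W_0 /absF; lra.
Qed.

Lemma absF_ge0 f k : 0 <= absF f k.
Proof. exact: Cmod_ge_0. Qed.

(** The output weight falls on one factor, kept in [l2]; the two others carry [W th] and go to [l1]
    thanks to [th + 1/2 < s]. For [th = 0] this is the algebra property. *)
Lemma TB_HS s th : 0 <= th -> th + 1/2 < s -> exists K, 0 < K /\
  forall b M f g h x y z, 0 <= M ->
  (forall k k2 k3, let p := (k2 + k3 - k)%Z in W s k * Cmod (b k k2 k3) <=
     M * (W s k2 * W th k3 * W th p + W th k2 * W s k3 * W th p + W th k2 * W th k3 * W s p)) ->
  HS s f x -> HS s g y -> HS s h z ->
  (forall k, summable (tri b f g h k)) /\ HS s (TB b f g h) (K * M * (x * y * z)).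
Proof.
move=> th0 Hs; have [K1 [K0 HK]] := HS_L1 s th Hs.
exists (3 * (K1 * K1)); split; first nra.
move=> b M f g h x y z M0 Hb Hf Hg Hh.
have x0 := L2_ge0 _ _ Hf; have y0 := L2_ge0 _ _ Hg; have z0 := L2_ge0 _ _ Hh.
have Lf := HK _ _ Hf; have Lg := HK _ _ Hg; have Lh := HK _ _ Hh.
apply: TB_L2.
- by repeat apply: Rmult_le_pos => //; lra.
- by move=> k; exact: W_pos.
move=> G HG.
have Q1 := Quad_side _ _ _ _ _ _ _ _ HG Hf Lg Lh.
have Q2 := Quad_13 _ _ _ _ _ _ _ _ HG Hg Lf Lh.
have Q3 := Quad_14 _ _ _ _ _ _ _ _ HG Hh Lf Lg.
have := Bnd_scal M _ _ M0 (Bnd_plus _ _ _ _ (Bnd_plus _ _ _ _ Q1 Q2) Q3) => Q.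
apply: Bnd_mono (Bnd_le _ _ _ _ Q); first by apply: Req_le; ring.
move=> [k [k2 k3]]; rewrite Cmod_tri /quad /one2 /=.
have G0 : 0 <= G k by case: HG.
have := Hb k k2 k3; set p := (k2 + k3 - k)%Z => /= H.
rewrite -/(absF f k2) -/(absF g k3) -/(absF h p).
have a0 : 0 <= absF f k2 * absF g k3 * absF h p.
  by repeat apply: Rmult_le_pos; exact: Cmod_ge_0.
have := Rmult_le_compat_l _ _ _ (Rmult_le_pos _ _ G0 a0) H; lra.
Qed.

(** The larger of the two frequencies can take all [s] powers. *)
Lemma W_mul_le s a b : 1 <= s -> W (s - 1) a * jp b <= W s a + W s b.
Proof.
move=> Hs; have wa := W_pos s a; have wb := W_pos s b.
have Ea : W s a = W (s - 1) a * jp a by rewrite -(W_1 a) -W_plus; congr W; ring.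
have Eb : W s b = W (s - 1) b * jp b by rewrite -(W_1 b) -W_plus; congr W; ring.
have pa := W_pos (s - 1) a; have pb := W_pos (s - 1) b; have ja := jp_ge1 a; have jb := jp_ge1 b.
case: (Rle_dec (jp a) (jp b)) => H.
- have : W (s - 1) a <= W (s - 1) b by apply: Rle_Rpower_l; lra.
  move=> H1; have := Rmult_le_compat_r (jp b) _ _ ltac:(lra) H1; lra.
- have := Rmult_le_compat_l _ _ _ (Rlt_le _ _ pa) (Rlt_le _ _ (Rnot_le_lt _ _ H)); lra.
Qed.

(** Symbols bounded by [JJ] do not lose derivatives in [H^s], [s >= 1]. *)
Lemma JJ_weight s k k2 k3 : 1 <= s ->
  W s k * JJ k k2 k3 <= 9 * Rpower 3 (s - 1) * (W s k2 + W s k3 + W s (k2 + k3 - k)).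
Proof.
move=> Hs; set p := (k2 + k3 - k)%Z.
have Ek : W s k * JJ k k2 k3 = W (s - 1) k * (jp k2 + jp k3 + jp p).
  rewrite -{1}(Rplus_minus_r s 1) (_ : s + 1 - 1 = (s - 1) + 1); last ring.
  by rewrite W_plus W_1 /JJ -/p; field; have := jp_ge1 k; lra.
rewrite Ek; have := W_sum3 (s - 1) k k2 k3 ltac:(lra); rewrite -/p => H.
have j2 := jp_ge1 k2; have j3 := jp_ge1 k3; have jp' := jp_ge1 p.
apply: Rle_trans (Rmult_le_compat_r (jp k2 + jp k3 + jp p) _ _ ltac:(lra) H) _.
have P3 : 0 < Rpower 3 (s - 1) by exact: exp_pos.
have -> : 9 * Rpower 3 (s - 1) * (W s k2 + W s k3 + W s p) =
  Rpower 3 (s - 1) * (9 * (W s k2 + W s k3 + W s p)) by ring.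
rewrite Rmult_assoc; apply: Rmult_le_compat_l; first lra.
have h := fun a b => W_mul_le s a b Hs.
have := h k2 k2; have := h k2 k3; have := h k2 p; have := h k3 k2; have := h k3 k3.
have := h k3 p; have := h p k2; have := h p k3; have := h p p.
have := W_pos s k2; have := W_pos s k3; have := W_pos s p.
lra.
Qed.

Lemma TB_JJ_HS s : 1 <= s -> exists K, 0 < K /\
  forall b M f g h x y z, 0 <= M ->
  (forall k k2 k3, Cmod (b k k2 k3) <= M * JJ k k2 k3) ->
  HS s f x -> HS s g y -> HS s h z ->
  (forall k, summable (tri b f g h k)) /\ HS s (TB b f g h) (K * M * (x * y * z)).
Proof.
move=> Hs; have [K [K0 HK]] := TB_HS s 0 ltac:(lra) ltac:(lra).
have P3 : 0 < Rpower 3 (s - 1) by exact: exp_pos.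
exists (K * (9 * Rpower 3 (s - 1))); split; first by apply: Rmult_lt_0_compat; lra.
move=> b M f g h x y z M0 Hb Hf Hg Hh.
have -> : K * (9 * Rpower 3 (s - 1)) * M * (x * y * z) = K * (9 * Rpower 3 (s - 1) * M) * (x * y * z) by ring.
apply: HK => //; first by apply: Rmult_le_pos; lra.
move=> k k2 k3 p; rewrite !W_0 !Rmult_1_r !Rmult_1_l.
have := Rmult_le_compat_l _ _ _ (Rlt_le _ _ (W_pos s k)) (Hb k k2 k3).
have := Rmult_le_compat_l _ _ _ M0 (JJ_weight s k k2 k3 Hs); rewrite -/p; lra.
Qed.

(** The [L2] bound keeps one factor in [L2]: this makes the mass correction, which divides by the
    mass, uniform in the data. *)
Lemma TB_JJ_L2 : exists K, 0 < K /\ forall b M f g h mu D, 0 <= M ->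
  (forall k k2 k3, Cmod (b k k2 k3) <= M * JJ k k2 k3) ->
  cls 1 mu D f -> cls 1 mu D g -> cls 1 mu D h ->
  L2 (absF (TB b f g h)) (K * M * (mu * D ^ 2)).
Proof.
have [K1 [K10 HK1]] := HS_L1 1 0 ltac:(lra).
have [K2 [K20 HK2]] := W_L2 1 ltac:(lra).
exists (3 * (K2 * K1)); split; first by apply: Rmult_lt_0_compat; nra.
move=> b M f g h mu D M0 Hb [Hf0 Hf1] [Hg0 Hg1] [Hh0 Hh1].
have mu0 := L2_ge0 _ _ Hf0; have D0 := L2_ge0 _ _ Hf1.
have L1f := HK1 _ _ Hf1; have L1g := HK1 _ _ Hg1.
apply/HS_0; apply: (proj2 (TB_L2 (W 0) b f g h _ _ _ _)).
- by repeat apply: Rmult_le_pos => //; try lra; exact: pow2_ge_0.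
- by move=> k; exact: W_pos.
move=> G HG; have [G0 _] := HG.
have L1G := L2_CS _ _ _ _ HK2 HG.
have Q1 := Quad_24 _ _ _ _ _ _ _ _ Hf1 Hh0 L1G L1g.
have Q2 := Quad_34 _ _ _ _ _ _ _ _ Hg1 Hh0 L1G L1f.
have Q3 := Quad_34 _ _ _ _ _ _ _ _ Hg0 Hh1 L1G L1f.
have := Bnd_scal M _ _ M0 (Bnd_plus _ _ _ _ (Bnd_plus _ _ _ _ Q1 Q2) Q3) => Q.
apply: Bnd_mono (Bnd_le _ _ _ _ Q); first by apply: Req_le; ring.
move=> [k [k2 k3]]; rewrite Cmod_tri /quad /one2 /= !W_0 !Rmult_1_l !W_1 W_opp W_1.
have := Hb k k2 k3; rewrite /JJ; set p := (k2 + k3 - k)%Z => H.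
rewrite -/(absF f k2) -/(absF g k3) -/(absF h p).
have a0 : 0 <= absF f k2 * absF g k3 * absF h p.
  by repeat apply: Rmult_le_pos; exact: Cmod_ge_0.
have := Rmult_le_compat_l _ _ _ (Rmult_le_pos _ _ (G0 k) a0) H; rewrite /Rdiv; lra.
Qed.

(** * Structure of one step *)

Definition ph (t : R) (b : Z -> Z -> Z -> C) : Z -> Z -> Z -> C :=
  fun k k2 k3 => Cmult (b k k2 k3) (cis (t * phi k k2 k3)).

Lemma Cmod_ph t b k k2 k3 : Cmod (ph t b k k2 k3) = Cmod (b k k2 k3).
Proof. by rewrite /ph Cmod_mult Cmod_cis Rmult_1_r. Qed.

Definition Msym (tau : R) : Z -> Z -> Z -> C :=
  fun k k2 k3 => Cmult (Copp ci) (Ei tau (phi k k2 k3)).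

Lemma Msym_JJ tau k k2 k3 : 0 <= tau -> Cmod (Msym tau k k2 k3) <= tau * JJ k k2 k3.
Proof.
move=> Ht; rewrite /Msym Cmod_mult Cmod_opp Cmod_ci Rmult_1_l.
have := Ei_bound tau (phi k k2 k3) Ht; have := JJ_ge1 k k2 k3 => J1 H.
by apply: Rle_trans H _; nra.
Qed.

Lemma phi_swap23 k k2 k3 : phi k k3 k2 = phi k k2 k3.
Proof. rewrite /phi; congr IZR; ring. Qed.

Lemma phi_swapkp k k2 k3 : phi (k2 + k3 - k) k2 k3 = phi k k2 k3.
Proof. rewrite /phi; congr IZR; ring. Qed.

Lemma phi_conj k k2 k3 : phi k2 k (k2 + k3 - k) = - phi k k2 k3.
Proof. rewrite /phi -opp_IZR; congr IZR; ring. Qed.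

Lemma TB_antisym b f k : (forall k2 k3, b k k3 k2 = Copp (b k k2 k3)) ->
  summable (tri b f f f k) -> TB b f f f k = 0.
Proof.
move=> Hb Hs.
pose sw := fun t : Z * Z => (snd t, fst t).
have E : TB b f f f k = Cmult (RtoC (-1)) (TB b f f f k).
  rewrite {1}/TB -(tsum_reindex sw sw) //; try by case.
  rewrite /TB -tsum_scal //; apply: tsum_ext => -[k2 k3]; rewrite /tri /sw /= Hb (Z.add_comm k3 k2).
  ring.
have E2 : Cmult 2 (TB b f f f k) = 0.
  transitivity (Cminus (TB b f f f k) (Cmult (RtoC (-1)) (TB b f f f k))); first by ring.
  by rewrite -E; ring.
transitivity (Cmult (/ 2)%C (Cmult 2 (TB b f f f k))); last by rewrite E2; ring.
field; move=> H; have := RtoC_inj _ _ H; lra.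
Qed.

(** Linear in [V] up to its mass and momentum: for [k <> 0] the factor is [- i theta] when [m0] and
    [q] are these two numbers, so the modified propagator cancels it to first order. *)
Definition resF (tau : R) (V : F) : F := fun k =>
  if Z.eqb k 0 then RtoC 0 else Cmult (Cmult ci (RtoC (2 * tau * (massR V - momR V / IZR k)))) (V k).

Lemma summable_mom f mu D : cls 1 mu D f -> summable (fun j => RtoC (IZR j * Cmod (f j) ^ 2)) /\
  Rabs (momR f) <= mu * D.
Proof.
move=> [HA HB].
have Hb := proj2 (L2_CS _ _ _ _ HA HB).
have Hle : forall j, Cmod (RtoC (IZR j * Cmod (f j) ^ 2)) <= absF f j * (W 1 j * absF f j).
  move=> j; rewrite Cmod_R Rabs_mult (Rabs_pos_eq (_ ^ 2)); last exact: pow2_ge_0.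
  rewrite W_1 /absF; have := Rmult_le_compat_r (Cmod (f j) ^ 2) _ _ (pow2_ge_0 _) (jp_abs j).
  rewrite /pow; lra.
split; first exact: (summable_le _ _ _ Hle Hb).
apply: Rle_trans (re_le_Cmod _) _; exact: tsum_bound Hle Hb.
Qed.

(** On [k3 = k] one has [p = k2] and no oscillation; the remaining sum of [(1 - k2 / k) |V(k2)|^2]
    is the mass minus the momentum divided by [k]. *)
Lemma TB_Rsym tau t V k mu D : 0 <= tau -> cls 1 mu D V -> TB (ph t (Rsym tau)) V V V k = resF tau V k.
Proof.
move=> Ht HV; have [HV0 HV1] := HV.
have [K [_ HK]] := TB_JJ_HS 1 (Rle_refl 1).
have [Hs _] := HK (ph t (Rsym tau)) (8 * tau) V V V _ _ _ ltac:(lra)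
  ltac:(move=> *; rewrite Cmod_ph; exact: Rsym_JJ) HV1 HV1 HV1.
rewrite /resF; case: (Z.eqb_spec k 0) => [->|Hk].
  rewrite /TB -(@tsum_zero (Z * Z)); apply: tsum_ext => -[k2 k3]; rewrite /tri /ph /Rsym /=; ring.
have K0 : IZR k <> 0 by apply: not_0_IZR.
pose sw := fun t : Z * Z => (snd t, fst t).
rewrite /TB -(tsum_reindex sw sw) //; try by case.
rewrite -tsum_prod; last first.
  by apply: (summable_reindex sw) => // -[x1 x2] [y1 y2] [-> ->].
pose g k3 := tsum (fun k2 => tri (ph t (Rsym tau)) V V V k (sw (k3, k2))).
have Hg : hassum g (g k).
  apply: hassum_single => k3 Hk3; rewrite /g -(@tsum_zero Z); apply: tsum_ext => k2.
  rewrite /tri /ph /Rsym /=; case: (Z.eqb_spec k 0) => // _; case: (Z.eqb_spec k3 k) => // _; ring.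
rewrite -[fun i => _]/g (tsum_eq _ _ Hg) /g.
have [Sm _] := summable_mom _ _ _ HV.
have Sq : summable (fun j => RtoC (Cmod (V j) ^ 2)).
  case: HV0 => _ [_ H]; exists (mu ^ 2); apply: Bnd_le H => j.
  by rewrite Cmod_RtoC; [apply: Rle_refl | exact: pow2_ge_0].
have EM := massR_tsum _ _ HV0.
have EP : RtoC (momR V) = tsum (fun j => RtoC (IZR j * Cmod (V j) ^ 2)).
  by rewrite -(tsum_re _ Sm (fun j => IZR j * Cmod (V j) ^ 2)).
transitivity (Cmult (Cmult (Cmult ci (RtoC (2 * tau))) (V k))
   (Cminus (tsum (fun j => RtoC (Cmod (V j) ^ 2))) (Cmult (RtoC (/ IZR k)) (tsum (fun j => RtoC (IZR j * Cmod (V j) ^ 2)))))); last first.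
  rewrite -EM -EP -RtoC_mult -RtoC_minus.
  have -> : RtoC (2 * tau * (massR V - momR V / IZR k)) = Cmult (RtoC (2 * tau)) (RtoC (massR V - / IZR k * momR V)).
    by rewrite -RtoC_mult; congr RtoC; rewrite /Rdiv; ring.
  ring.
rewrite -(tsum_scal (RtoC (/ IZR k))) // -tsum_minus //; last exact: summable_scal.
rewrite -tsum_scal; last by apply: summable_minus => //; exact: summable_scal.
apply: tsum_ext => k2; rewrite /tri /ph /Rsym /=.
case: (Z.eqb_spec k 0) => // _; rewrite Z.eqb_refl.
have -> : phi k k2 k = 0 by rewrite /phi Z.sub_diag Z.mul_0_r.
rewrite Rmult_0_r cis_0.
have -> : (k2 + k - k = k2)%Z by ring.
have -> : RtoC (2 * tau * (IZR (k - k2) / IZR k)) = Cmult (RtoC (2 * tau)) (Cminus 1 (Cmult (RtoC (/ IZR k)) (RtoC (IZR k2)))).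
  by rewrite -RtoC_mult -RtoC_minus -RtoC_mult; congr RtoC; rewrite minus_IZR; field.
rewrite (RtoC_mult (IZR k2)) Cmod2_conj; ring.
Qed.

Lemma TB_Bsym tau t V k mu D : 0 <= tau -> cls 1 mu D V ->
  TB (ph t (Bsym tau)) V V V k =
  Cplus (Cplus (TB (ph t (Msym tau)) V V V k) (TB (ph t (Esym tau)) V V V k)) (resF tau V k).
Proof.
move=> Ht HV; have [HV0 HV1] := HV.
have [K [_ HK]] := TB_JJ_HS 1 (Rle_refl 1).
have S : forall b M, 0 <= M -> (forall k k2 k3, Cmod (b k k2 k3) <= M * JJ k k2 k3) ->
    summable (tri (ph t b) V V V k).
  move=> b M M0 Hb; apply: (proj1 (HK (ph t b) M V V V _ _ _ M0 _ HV1 HV1 HV1)).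
  by move=> *; rewrite Cmod_ph.
have S1 := S _ _ Ht (fun k k2 k3 => Msym_JJ tau k k2 k3 Ht).
have S2 := S _ (4 * tau) ltac:(lra) (fun k k2 k3 => Esym_JJ tau k k2 k3 Ht).
have S3 := S _ (4 * tau) ltac:(lra) (fun k k2 k3 => Ssym_JJ tau k k2 k3 Ht).
have S4 := S _ (8 * tau) ltac:(lra) (fun k k2 k3 => Rsym_JJ tau k k2 k3 Ht).
have E3 : TB (ph t (Ssym tau)) V V V k = 0.
  apply: TB_antisym => // k2 k3; rewrite /ph /Ssym phi_swap23; case: Z.eqb; first by ring.
  have -> : IZR (k2 - k3) / IZR k = - (IZR (k3 - k2) / IZR k) by rewrite !minus_IZR /Rdiv; ring.
  rewrite RtoC_opp; ring.
rewrite -(TB_Rsym tau t V k mu D) //.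
have -> : TB (ph t (Rsym tau)) V V V k =
  Cplus (TB (ph t (Ssym tau)) V V V k) (TB (ph t (Rsym tau)) V V V k) by rewrite E3; ring.
rewrite /TB -!tsum_plus //; try exact: summable_plus.
by apply: tsum_ext => s; rewrite /tri /ph Bsym_decomp /Msym; ring.
Qed.

Lemma Yst_decomp tau m0 q t V k mu D : 0 <= tau -> cls 1 mu D V ->
  Yst tau m0 q t V k =
  Cplus (Cplus (TB (ph t (Msym tau)) V V V k) (TB (ph t (Esym tau)) V V V k))
   (Cplus (Cmult (Cplus (Cminus (cis (theta tau m0 q k)) 1)
     (if Z.eqb k 0 then Cmult ci (RtoC (2 * tau * m0)) else RtoC 0)) (V k)) (resF tau V k)).
Proof.
move=> Ht HV; rewrite /Yst /PsiV -/(ph t (Bsym tau)) (TB_Bsym _ _ _ _ _ _ Ht HV).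
case: Z.eqb; last by ring.
have -> : RtoC (2 * tau * m0) = Cmult 2 (RtoC (tau * m0)) by rewrite -RtoC_mult; congr RtoC; ring.
ring.
Qed.

(** Averaging over the symmetries of the parallelogram: the quadrilinear form with real weight
    [lam k] is real when [lam k + lam p = lam k2 + lam k3]. *)
Lemma Quad_real (e : Z -> Z -> Z -> C) (lam : Z -> R) M V mu D : cls 1 mu D V ->
  (forall k k2 k3, Cmod (e k k2 k3) <= M) ->
  (forall k k2 k3, e k k3 k2 = e k k2 k3) ->
  (forall k k2 k3, e (k2 + k3 - k)%Z k2 k3 = e k k2 k3) ->
  (forall k k2 k3, e k2 k (k2 + k3 - k)%Z = Cconj (e k k2 k3)) ->
  (forall k, Rabs (lam k) <= jp k) ->
  (forall k k2 k3, lam k + lam (k2 + k3 - k)%Z = lam k2 + lam k3) ->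
  Im (tsum (fun k => Cmult (RtoC (lam k)) (Cmult (TB e V V V k) (Cconj (V k))))) = 0.
Proof.
move=> [HV0 HV1] He Hs1 Hs2 Hs3 Hlam Hadd.
have M0 : 0 <= M by apply: Rle_trans (He 0%Z 0%Z 0%Z); exact: Cmod_ge_0.
pose T (t : Z * (Z * Z)) := Cmult (tri e V V V (fst t) (snd t)) (Cconj (V (fst t))).
have [K [_ HK]] := HS_L1 1 0 ltac:(lra).
have LV := HK _ _ HV1.
have Q := Bnd_scal M _ _ M0 (Quad_side _ _ _ _ _ _ _ _ HV1 HV0 LV LV).
have S1 : summable (fun t => Cmult (RtoC (lam (fst t))) (T t)).
  apply: (summable_le _ _ _ _ Q) => -[k [k2 k3]]; rewrite /T Cmod_mult (Cmod_mult (tri _ _ _ _ _ _)) Cmod_tri Cmod_conj Cmod_R.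
  rewrite /quad /one2 /= !W_0 !Rmult_1_l W_1 Rmult_1_r /absF.
  set z := _ * Cmod (V (k2 + k3 - k)%Z).
  have z0 : 0 <= z by rewrite /z; repeat apply: Rmult_le_pos; exact: Cmod_ge_0.
  have h1 := He k k2 k3; have h2 := Hlam k; have h3 := Cmod_ge_0 (V k).
  have -> : Rabs (lam k) * (Cmod (e k k2 k3) * z * Cmod (V k)) =
     (Rabs (lam k) * Cmod (e k k2 k3)) * (z * Cmod (V k)) by ring.
  have -> : M * (jp k * Cmod (V k) * z) = (jp k * M) * (z * Cmod (V k)) by ring.
  apply: Rmult_le_compat_r; first exact: Rmult_le_pos.
  by apply: Rmult_le_compat => //; [exact: Rabs_pos | exact: Cmod_ge_0].
have sec : forall k, summable (tri e V V V k).
  move=> k; apply: (tri_summable _ _ _ _ _ M) => //; exact: (HS_wiener 1 _ _ ltac:(lra) HV1).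
have E0 : tsum (fun k => Cmult (RtoC (lam k)) (Cmult (TB e V V V k) (Cconj (V k)))) =
   tsum (fun t => Cmult (RtoC (lam (fst t))) (T t)).
  rewrite -(tsum_prod _ S1); apply: tsum_ext => k /=.
  rewrite tsum_scal; last first.
    by apply: summable_ext (summable_scal (Cconj (V k)) _ (sec k)) => s; rewrite /T /=; ring.
  congr Cmult; rewrite Cmult_comm /TB -tsum_scal //; apply: tsum_ext => s; rewrite /T /=; ring.
rewrite E0; set S := tsum _.
(* [h1] exchanges [k] and [p], [h3] exchanges [k2] and [k3], and [h2] exchanges the two diagonals,
   which conjugates the summand. *)
pose h1 (t : Z * (Z * Z)) := ((fst (snd t) + snd (snd t) - fst t)%Z, snd t).
pose h2 (t : Z * (Z * Z)) := (fst (snd t), (fst t, (fst (snd t) + snd (snd t) - fst t)%Z)).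
pose h3 (t : Z * (Z * Z)) := (fst t, (snd (snd t), fst (snd t))).
have i1 : forall t, h1 (h1 t) = t by move=> [k [k2 k3]]; rewrite /h1 /=; repeat apply: pair_eq; lia.
have i2 : forall t, h2 (h2 t) = t by move=> [k [k2 k3]]; rewrite /h2 /=; repeat apply: pair_eq; lia.
have i3 : forall t, h3 (h3 t) = t by move=> [k [k2 k3]].
have inj : forall h : Z * (Z * Z) -> Z * (Z * Z), (forall t, h (h t) = t) -> forall x y, h x = h y -> x = y.
  by move=> h Hi x y E; rewrite -(Hi x) E Hi.
have T1 : forall t, T (h1 t) = T t.
  move=> [k [k2 k3]]; rewrite /T /h1 /tri /=; set p := (k2 + k3 - k)%Z.
  have -> : (k2 + k3 - p = k)%Z by rewrite /p; ring.
  rewrite /p Hs2; ring.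
have T2 : forall t, T (h2 t) = Cconj (T t).
  move=> [k [k2 k3]]; rewrite /T /h2 /tri /= Hs3; set p := (k2 + k3 - k)%Z.
  have -> : (k + p - k2 = k3)%Z by rewrite /p; ring.
  rewrite !Cmult_conj !Cconj_conj; ring.
have T3 : forall t, T (h3 t) = T t.
  move=> [k [k2 k3]]; rewrite /T /h3 /tri /= Hs1 (Z.add_comm k3 k2); ring.
have R1 : S = tsum (fun t => Cmult (RtoC (lam (fst (snd t) + snd (snd t) - fst t)%Z)) (T t)).
  rewrite /S -(tsum_reindex h1 h1) //; apply: tsum_ext => t; by rewrite T1.
have S1' : summable (fun t => Cmult (RtoC (lam (fst (snd t) + snd (snd t) - fst t)%Z)) (T t)).
  apply: summable_ext (summable_reindex h1 _ (inj _ i1) S1) => t; by rewrite T1.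
have R2 : Cconj S = tsum (fun t => Cmult (RtoC (lam (fst (snd t)))) (T t)).
  rewrite /S -(tsum_reindex h2 h2) // -tsum_conj; last exact: (summable_reindex h2 _ (inj _ i2) S1).
  apply: tsum_ext => t; rewrite T2 Cmult_conj Cconj_conj; congr Cmult.
  by rewrite /Cconj /= Ropp_0.
have S2' : summable (fun t => Cmult (RtoC (lam (fst (snd t)))) (T t)).
  apply: summable_ext (summable_conj _ (summable_reindex h2 _ (inj _ i2) S1)) => t.
  rewrite T2 Cmult_conj Cconj_conj; congr Cmult; by rewrite /Cconj /= Ropp_0.
have R3 : Cconj S = tsum (fun t => Cmult (RtoC (lam (snd (snd t)))) (T t)).
  rewrite R2 -(tsum_reindex h3 h3) //; apply: tsum_ext => t; by rewrite T3.
have S3' : summable (fun t => Cmult (RtoC (lam (snd (snd t)))) (T t)).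
  apply: summable_ext (summable_reindex h3 _ (inj _ i3) S2') => t; by rewrite T3.
(* The left side carries the weight [lam k + lam p], the right side [lam k2 + lam k3]; they agree by
   additivity, so [S] is real. *)
have E : Cplus S S = Cplus (Cconj S) (Cconj S).
  rewrite {2}R1 {1}R2 R3 {1}/S -!tsum_plus //; apply: tsum_ext => -[k [k2 k3]] /=.
  transitivity (Cmult (RtoC (lam k + lam (k2 + k3 - k)%Z)) (T (k, (k2, k3)))).
    by rewrite RtoC_plus; ring.
  by rewrite Hadd RtoC_plus; ring.
have := f_equal Im E; rewrite /Im /=; lra.
Qed.

Lemma Ei_symbol_sym tau t : 0 <= tau ->
  let e := ph t (fun k k2 k3 => Ei tau (phi k k2 k3)) in
  (forall k k2 k3, Cmod (e k k2 k3) <= tau) /\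
  (forall k k2 k3, e k k3 k2 = e k k2 k3) /\
  (forall k k2 k3, e (k2 + k3 - k)%Z k2 k3 = e k k2 k3) /\
  (forall k k2 k3, e k2 k (k2 + k3 - k)%Z = Cconj (e k k2 k3)).
Proof.
move=> Ht e; rewrite /e /ph; split; [|split; [|split]] => k k2 k3.
- by rewrite Cmod_mult Cmod_cis Rmult_1_r; exact: Ei_bound.
- by rewrite phi_swap23.
- by rewrite phi_swapkp.
- rewrite phi_conj Ei_conj Cmult_conj -cis_opp; congr Cmult; congr cis; ring.
Qed.

(** The exact part of the step does not change the (weighted) mass to first order. *)
Lemma Msym_orth tau t lam V mu D : 0 <= tau -> cls 1 mu D V ->
  (forall k, Rabs (lam k) <= jp k) ->
  (forall k k2 k3, lam k + lam (k2 + k3 - k)%Z = lam k2 + lam k3) ->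
  Re (tsum (fun k => Cmult (RtoC (lam k)) (Cmult (TB (ph t (Msym tau)) V V V k) (Cconj (V k))))) = 0.
Proof.
move=> Ht HV Hl Ha; have [e1 [e2 [e3 e4]]] := Ei_symbol_sym tau t Ht.
have H0 := Quad_real _ lam tau V mu D HV e1 e2 e3 e4 Hl Ha.
have HV1 := proj2 HV.
have [K [_ HK]] := TB_JJ_HS 1 (Rle_refl 1).
have [Hs1 Hs2] := HK (ph t (fun k k2 k3 => Ei tau (phi k k2 k3))) tau V V V _ _ _ Ht
  ltac:(move=> k k2 k3; apply: Rle_trans (e1 k k2 k3) _; have := JJ_ge1 k k2 k3; nra) HV1 HV1 HV1.
have Sm : summable (fun k => Cmult (RtoC (lam k)) (Cmult (TB (ph t (fun k k2 k3 => Ei tau (phi k k2 k3))) V V V k) (Cconj (V k)))).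
  apply: (summable_le _ _ _ _ (proj2 (L2_CS _ _ _ _ Hs2 (proj1 HV)))) => k.
  rewrite !Cmod_mult Cmod_conj Cmod_R W_1 /absF Rmult_assoc; apply: Rmult_le_compat_r => //.
  by apply: Rmult_le_pos; exact: Cmod_ge_0.
have -> : (fun k => Cmult (RtoC (lam k)) (Cmult (TB (ph t (Msym tau)) V V V k) (Cconj (V k)))) =
  (fun k => Cmult (Copp ci) (Cmult (RtoC (lam k)) (Cmult (TB (ph t (fun k k2 k3 => Ei tau (phi k k2 k3))) V V V k) (Cconj (V k))))).
  apply: functional_extensionality => k.
  rewrite (TB_ext (ph t (Msym tau)) (fun k k2 k3 => Cmult (Copp ci) (ph t (fun k k2 k3 => Ei tau (phi k k2 k3)) k k2 k3))).
    by rewrite (TB_scal (fun _ => Copp ci)) //; ring.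
  by move=> k2 k3; rewrite /ph /Msym; ring.
rewrite tsum_scal //; move: H0; set S := tsum _ => H0.
by rewrite /Re /Im /= in H0 *; rewrite H0; ring.
Qed.

(** * Exact solutions in the twisted variable *)

Lemma Hnorm_HS s f : in_H s f -> HS s f (Hnorm s f).
Proof.
move=> Hf.
have E : Hterm s f = (fun k => (W s k * absF f k) ^ 2).
  by apply: functional_extensionality => k; exact: Hterm_W.
have H0 : forall k, 0 <= Hterm s f k by move=> k; rewrite E; exact: pow2_ge_0.
have HB := ex_series_Bnd _ H0 Hf; have H1 := Bnd_ge0 _ _ HB.
have p1 := PI2_1.
split; first by move=> k; apply: Rmult_le_pos; [left; exact: W_pos | exact: Cmod_ge_0].
split; first exact: sqrt_pos.
rewrite /Hnorm pow2_sqrt; last by apply: Rmult_le_pos; lra.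
rewrite -E; apply: Bnd_mono HB; nra.
Qed.

Lemma HS_Hnorm s f A : HS s f A -> in_H s f /\ Hnorm s f <= 3 * A.
Proof.
move=> [_ [A0 HA]].
have E : Hterm s f = (fun k => (W s k * absF f k) ^ 2).
  by apply: functional_extensionality => k; exact: Hterm_W.
have H0 : forall k, 0 <= Hterm s f k by move=> k; rewrite E; exact: pow2_ge_0.
rewrite -E in HA; have [H1 H2] := Bnd_ex_series _ _ H0 HA.
have H3 := Bnd_ge0 _ _ (ex_series_Bnd _ H0 H1).
split => //; rewrite /Hnorm -(sqrt_pow2 (3 * A)); last lra.
have p0 := PI_RGT_0; have p4 := PI_4.
apply: sqrt_le_1_alt.
have -> : (3 * A) ^ 2 = 9 * A ^ 2 by ring.
by apply: Rmult_le_compat; lra.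
Qed.

Lemma tri_diff b f g k t :
  Cminus (tri b f f f k t) (tri b g g g k t) =
  Cplus (Cplus (tri b (fun j => Cminus (f j) (g j)) f f k t)
     (tri b g (fun j => Cminus (f j) (g j)) f k t)) (tri b g g (fun j => Cminus (f j) (g j)) k t).
Proof. rewrite /tri Cminus_conj; ring. Qed.

Lemma TB_diff_HS s : 1 <= s -> exists K, 0 < K /\ forall b M f g x d, 0 <= M ->
  (forall k k2 k3, Cmod (b k k2 k3) <= M * JJ k k2 k3) ->
  HS s f x -> HS s g x -> HS s (fun k => Cminus (f k) (g k)) d ->
  HS s (fun k => Cminus (TB b f f f k) (TB b g g g k)) (K * M * (x ^ 2 * d)).
Proof.
move=> Hs; have [K [K0 HK]] := TB_JJ_HS s Hs.
exists (3 * K); split; first lra.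
move=> b M f g x d M0 Hb Hf Hg Hd.
have [S1 _] := HK b M f f f _ _ _ M0 Hb Hf Hf Hf.
have [S2 _] := HK b M g g g _ _ _ M0 Hb Hg Hg Hg.
have [T1 H1] := HK b M _ f f _ _ _ M0 Hb Hd Hf Hf.
have [T2 H2] := HK b M g _ f _ _ _ M0 Hb Hg Hd Hf.
have [T3 H3] := HK b M g g _ _ _ _ M0 Hb Hg Hg Hd.
have := HS_plus _ _ _ _ _ (HS_plus _ _ _ _ _ H1 H2) H3.
have -> : K * M * (d * x * x) + K * M * (x * d * x) + K * M * (x * x * d) = 3 * K * M * (x ^ 2 * d) by ring.
apply: HS_ext => k; rewrite /TB -(tsum_minus (tri b f f f k)) // -!tsum_plus //; last exact: summable_plus.
by apply: tsum_ext => t; rewrite tri_diff.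
Qed.

Definition one3 (k k2 k3 : Z) : C := 1.

Lemma one3_JJ k k2 k3 : Cmod (one3 k k2 k3) <= 1 * JJ k k2 k3.
Proof. by rewrite /one3 Cmod_1; have := JJ_ge1 k k2 k3; lra. Qed.

Lemma ph_JJ t b M k k2 k3 : Cmod (b k k2 k3) <= M * JJ k k2 k3 -> Cmod (ph t b k k2 k3) <= M * JJ k k2 k3.
Proof. by rewrite Cmod_ph. Qed.

Lemma HS_eS s t f A : HS s f A <-> HS s (eS t f) A.
Proof. by rewrite /HS absF_eS. Qed.

Lemma HS_point s f A k : 0 <= s -> HS s f A -> Cmod (f k) <= A.
Proof.
move=> Hs Hf; apply: Rle_trans (L2_point _ _ k Hf).
have := W_ge1 s k Hs; have := Cmod_ge_0 (f k); rewrite /absF; nra.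
Qed.

Lemma Ccont_Re (f : R -> C) s :
  (forall e, 0 < e -> exists d, 0 < d /\ forall r, Rabs (r - s) < d -> Cmod (Cminus (f r) (f s)) < e) ->
  continuous (fun r => Re (f r)) s /\ continuous (fun r => Im (f r)) s.
Proof.
move=> H; split; apply/filterlim_locally => -[e e0] /=;
  have [d [d0 Hd]] := H e e0; exists (mkposreal d d0) => r Hr;
  apply: Rle_lt_trans (Hd r Hr).
- by have := re_le_Cmod (Cminus (f r) (f s)); rewrite /Re /=.
- by have := im_le_Cmod (Cminus (f r) (f s)); rewrite /Im /=.
Qed.

(** Extends functions of time constantly outside [[0, T]], so that continuity and the fundamental
    theorem of calculus hold at the endpoints without one-sided versions. *)
Definition clampT (T t : R) : R := Rmax 0 (Rmin t T).

Lemma clampT_in T t : 0 <= T -> 0 <= clampT T t <= T.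
Proof.
move=> HT; split; first exact: Rmax_l.
by apply: Rmax_lub => //; exact: Rmin_r.
Qed.

Lemma clampT_id T t : 0 <= t <= T -> clampT T t = t.
Proof. by move=> [h1 h2]; rewrite /clampT Rmin_left // Rmax_right. Qed.

Lemma clampT_lip T a b : Rabs (clampT T a - clampT T b) <= Rabs (a - b).
Proof.
rewrite /clampT; apply: Rle_trans (_ : Rabs (Rmin a T - Rmin b T) <= _).
- by rewrite /Rmax; case: Rle_dec => ?; case: Rle_dec => ?; rewrite /Rabs;
    repeat (case: Rcase_abs => ?); lra.
- by rewrite /Rmin; case: Rle_dec => ?; case: Rle_dec => ?; rewrite /Rabs;
    repeat (case: Rcase_abs => ?); lra.
Qed.

Lemma phase_cis t k : phase t k = cis (- t * IZR k ^ 2).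
Proof. exact: Cexp_cis. Qed.

Lemma is_RInt_Cmult (c : C) (h : R -> C) (a b x y : R) :
  is_RInt (fun r => Re (h r)) a b x -> is_RInt (fun r => Im (h r)) a b y ->
  @is_RInt C_R_NormedModule (fun r => Cmult c (h r)) a b (Cmult c (x, y)).
Proof.
move=> Hx Hy; apply: (@is_RInt_fct_extend_pair R_NormedModule R_NormedModule).
- exact: (is_RInt_minus _ _ _ _ _ _ (is_RInt_scal _ _ _ (fst c) _ Hx) (is_RInt_scal _ _ _ (snd c) _ Hy)).
- exact: (is_RInt_plus _ _ _ _ _ _ (is_RInt_scal _ _ _ (fst c) _ Hy) (is_RInt_scal _ _ _ (snd c) _ Hx)).
Qed.

Definition nls_rhs (t : R) (f : F) : F := fun k => Cmult (Copp ci) (TB (ph t one3) f f f k).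

(** Continuity in [H^s] makes each coefficient of the cubic term continuous in time, so the Duhamel
    integral can be differentiated; stripping the phase leaves a cubic term oscillating with
    [cis (t * phi)]. *)
Lemma exact_twisted s T u0 u : 1 <= s -> 0 < T -> is_NLS_solution s T u0 u ->
  exists v : R -> F, v 0 = u0 /\
  forall t, 0 <= t <= T -> u t = eS t (v t) /\
    forall k, Cder (fun r => v r k) t (nls_rhs t (v t) k).
Proof.
move=> Hs HT [Hin [Hcont Hduh]].
have Hc := fun t => clampT_in T t (Rlt_le _ _ HT).
have HU : forall t, HS s (u (clampT T t)) (Hnorm s (u (clampT T t))).
  by move=> t; apply: Hnorm_HS; exact: Hin.
have Hw : forall t, summable (u (clampT T t)) by move=> t; apply: (HS_wiener s _ _ ltac:(lra) (HU t)).
pose g k r := Cmult (phase (- r) k) (cubicF (u (clampT T r)) k).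
have gcont : forall k r, continuous (fun r => Re (g k r)) r /\ continuous (fun r => Im (g k r)) r.
  move=> k r; apply: Ccont_Re => e e0.
  set x := Hnorm s (u (clampT T r)) in HU.
  have x0 : 0 <= x by exact: sqrt_pos.
  have [K [K0 HK]] := TB_diff_HS s Hs.
  set c0 := Cmod (cubicF (u (clampT T r)) k).
  have c00 : 0 <= c0 by exact: Cmod_ge_0.
  have k20 : 0 <= IZR k ^ 2 by exact: pow2_ge_0.
  (* [A] dominates the Lipschitz constant of the cubic coefficient on the ball of radius [x + 1];
     [D] below does the same for the rotating phase. *)
  pose A := K * (x + 1) ^ 2 + 1.
  have A0 : 0 < A by rewrite /A; have := pow2_ge_0 (x + 1); nra.
  pose e1 := Rmin 1 (e / (2 * A)).
  have e10 : 0 < e1 by apply: Rmin_pos; [lra | apply: Rdiv_lt_0_compat; lra].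
  have [d [d0 Hd]] := Hcont _ (Hc r) e1 e10.
  pose D := IZR k ^ 2 * c0 + 1.
  have D0 : 0 < D by rewrite /D; nra.
  exists (Rmin d (e / (2 * D))); split.
    by apply: Rmin_pos => //; apply: Rdiv_lt_0_compat; lra.
  move=> r' Hr'.
  have h1 : Rabs (r' - r) < d by apply: Rlt_le_trans Hr' (Rmin_l _ _).
  have h2 : Rabs (r' - r) < e / (2 * D) by apply: Rlt_le_trans Hr' (Rmin_r _ _).
  have Hdiff : HS s (fun j => Cminus (u (clampT T r') j) (u (clampT T r) j)) (Hnorm s (subF (u (clampT T r')) (u (clampT T r)))).
    apply: Hnorm_HS.
    by apply: (proj1 (HS_Hnorm s _ _ (HS_minus _ _ _ _ _ (HU r') (HU r)))).
  have Hn : Hnorm s (subF (u (clampT T r')) (u (clampT T r))) < e1.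
    by apply: Hd => //; apply: Rle_lt_trans (clampT_lip _ _ _) h1.
  have {}Hdiff := L2_mono _ _ _ (Rlt_le _ _ Hn) Hdiff.
  have HU1 : HS s (u (clampT T r)) (x + 1) by apply: L2_mono (HU r); rewrite /x; lra.
  have HU2 : HS s (u (clampT T r')) (x + 1).
    have e11 : e1 <= 1 by exact: Rmin_l.
    have := HS_plus _ _ _ _ _ (HU r) (L2_mono _ _ _ e11 Hdiff).
    by apply: HS_ext => j; ring.
  have HD := HK one3 1 _ _ _ _ ltac:(lra) one3_JJ HU2 HU1 Hdiff.
  have Hk := HS_point s _ _ k ltac:(lra) HD.
  rewrite -!cubicF_TB // in Hk.
  have E : Cminus (g k r') (g k r) = Cplus (Cmult (phase (- r') k) (Cminus (cubicF (u (clampT T r')) k) (cubicF (u (clampT T r)) k)))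
     (Cmult (Cminus (phase (- r') k) (phase (- r) k)) (cubicF (u (clampT T r)) k)) by rewrite /g; ring.
  rewrite E; apply: Rle_lt_trans (Cmod_triangle _ _) _.
  rewrite !Cmod_mult !phase_cis Cmod_cis Rmult_1_l -/c0.
  have Hl := cis_lip (- - r' * IZR k ^ 2) (- - r * IZR k ^ 2).
  have El : - - r' * IZR k ^ 2 - - - r * IZR k ^ 2 = (r' - r) * IZR k ^ 2 by ring.
  rewrite El Rabs_mult (Rabs_pos_eq (IZR k ^ 2)) // in Hl.
  have H3 : Rabs (r' - r) * IZR k ^ 2 * c0 <= Rabs (r' - r) * D.
    by rewrite Rmult_assoc; apply: Rmult_le_compat_l; [exact: Rabs_pos | rewrite /D; lra].
  have H4 : Rabs (r' - r) * D < e / 2.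
    by have := Rmult_lt_compat_r _ _ _ D0 h2; have -> : e / (2 * D) * D = e / 2 by field; lra.
  have H5 : K * 1 * ((x + 1) ^ 2 * e1) <= e / 2.
    have : e1 <= e / (2 * A) by exact: Rmin_r.
    move=> He; have := Rmult_le_compat_l _ _ _ (Rlt_le _ _ A0) He.
    have -> : A * (e / (2 * A)) = e / 2 by field; lra.
    rewrite /A; lra.
  have H6 := Rmult_le_compat_r _ _ _ c00 Hl; lra.
have Hint : forall (f : R -> R), (forall r, continuous f r) -> forall t, is_RInt f 0 t (RInt f 0 t).
  by move=> f Hf t; apply: RInt_correct; apply: ex_RInt_continuous => r _; exact: Hf.
have HR : forall (f : R -> R), (forall r, continuous f r) -> forall t,
    is_derive (fun x => RInt f 0 x) t (f t).
  move=> f Hf t; apply: (is_derive_RInt f (RInt f 0) 0 t) => //.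
  by exists (mkposreal 1 Rlt_0_1) => r _; exact: Hint.
(* Defined with the clamped integrand for all real times, hence differentiable from both sides also
   at [0] and [T]. *)
pose v t : F := fun k => Cplus (u0 k) (Cmult (Copp ci)
    (RInt (fun r => Re (g k r)) 0 t, RInt (fun r => Im (g k r)) 0 t)).
have Hder : forall k t, Cder (fun r => v r k) t (Cmult (Copp ci) (g k t)).
  move=> k t; have -> : Cmult (Copp ci) (g k t) = Cplus 0 (Cmult (Copp ci) (g k t)) by ring.
  apply: Cder_plus; first exact: Cder_const.
  apply: Cder_scal; split.
  - exact: (HR (fun r => Re (g k r)) (fun r => proj1 (gcont k r))).
  - exact: (HR (fun r => Im (g k r)) (fun r => proj2 (gcont k r))).
exists v; split.
  apply: functional_extensionality => k; rewrite /v !RInt_point /zero /=.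
  by apply: injective_projections; rewrite /=; ring.
move=> t Ht.
have Eu : u t = eS t (v t).
  apply: functional_extensionality => k; rewrite Hduh // eS_cis -phase_cis /v.
  have H1 := is_RInt_Cmult (phase t k) (g k) 0 t _ _
     (Hint _ (fun r => proj1 (gcont k r)) t) (Hint _ (fun r => proj2 (gcont k r)) t).
  have H2 : @is_RInt C_R_NormedModule (fun s' => Cmult (phase (t - s') k) (cubicF (u s') k)) 0 t
     (Cmult (phase t k) (RInt (fun r => Re (g k r)) 0 t, RInt (fun r => Im (g k r)) 0 t)).
    apply: is_RInt_ext H1 => r; rewrite Rmin_left ?Rmax_right; try lra; move=> Hr.
    rewrite /g clampT_id; last lra.
    rewrite Cmult_assoc; congr Cmult; rewrite !phase_cis -cis_plus; congr cis; ring.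
  rewrite (@is_RInt_unique C_R_CompleteNormedModule _ _ _ _ H2); ring.
split => // k.
have := Hder k t; rewrite /g clampT_id // /nls_rhs.
have Sv : summable (v t).
  have := Hw t; rewrite clampT_id // Eu => H; apply: summable_ext (summable_eS (- t) _ H) => j.
  rewrite !eS_cis Cmult_assoc -cis_plus; have -> : - - t * IZR j ^ 2 + - t * IZR j ^ 2 = 0 by ring.
  by rewrite cis_0; ring.
rewrite Eu cubicF_TB; last exact: summable_eS.
rewrite (TB_eS _ _ _ _ 1) //; last by move=> *; rewrite Cmod_1; lra.
rewrite phase_cis (Cmult_assoc (cis _)) -cis_plus.
have -> : - - t * IZR k ^ 2 + - t * IZR k ^ 2 = 0 by ring.
by rewrite cis_0 Cmult_1_l.
Qed.

(** Test a finite piece of the increment against itself. *)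
Lemma HS_MVT s (y y' : R -> F) a b A : a <= b ->
  (forall r, a <= r <= b -> forall k, Cder (fun r => y r k) r (y' r k)) ->
  (forall r, a <= r <= b -> HS s (y' r) A) ->
  HS s (fun k => Cminus (y b k) (y a k)) (A * (b - a)).
Proof.
move=> ab Hd HA; have A0 := L2_ge0 _ _ (HA a ltac:(lra)).
have S0 : 0 <= A * (b - a) by apply: Rmult_le_pos; lra.
split; first by move=> k; apply: Rmult_le_pos; [left; exact: W_pos | exact: Cmod_ge_0].
split => // l Nl.
pose z k := Cminus (y b k) (y a k).
pose f k := W s k * absF z k.
have f0 : forall k, 0 <= f k by move=> k; apply: Rmult_le_pos; [left; exact: W_pos | exact: Cmod_ge_0].
set Q := lsum _ l; have EQ : Q = lsum (fun k => f k ^ 2) l by [].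
have Q0 : 0 <= Q by apply: lsum_ge0 => k; exact: pow2_ge_0.
case: (Rle_lt_or_eq_dec 0 Q Q0) => [Qp|<-]; last exact: pow2_ge_0.
have sQ : 0 < sqrt Q by exact: sqrt_lt_R0.
have ssQ : sqrt Q * sqrt Q = Q by rewrite sqrt_sqrt.
pose c k := Cmult (RtoC (W s k ^ 2)) (Cconj (z k)).
have Hsum : forall r, a <= r <= b -> Cder (fun r => csum (fun k => Cmult (c k) (y r k)) l) r
    (csum (fun k => Cmult (c k) (y' r k)) l).
  move=> r Hr; elim: (l) => [|k m IH] /=; first exact: Cder_const.
  by apply: Cder_plus => //; apply: Cder_scal; exact: Hd.
have Hbd : forall r, a <= r <= b -> Cmod (csum (fun k => Cmult (c k) (y' r k)) l) <= sqrt Q * A.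
  move=> r Hr; apply: Rle_trans (Cmod_csum _ _) _.
  have Ha := HA r Hr.
  have key : forall x, 0 < x ->
     lsum (fun k => Cmod (Cmult (c k) (y' r k))) l <= / (2 * x) * Q + x / 2 * A ^ 2.
    move=> x x0.
    apply: Rle_trans (_ : lsum (fun k => / (2 * x) * f k ^ 2 + x / 2 * (W s k * absF (y' r) k) ^ 2) l <= _).
      apply: lsum_le => k _; rewrite /c !Cmod_mult Cmod_conj Cmod_RtoC; last exact: pow2_ge_0.
      have : 0 <= / (2 * x) * (f k - x * (W s k * absF (y' r) k)) ^ 2.
        by apply: Rmult_le_pos; [left; apply: Rinv_0_lt_compat; lra | exact: pow2_ge_0].
      have -> : / (2 * x) * (f k - x * (W s k * absF (y' r) k)) ^ 2 =
        / (2 * x) * f k ^ 2 + x / 2 * (W s k * absF (y' r) k) ^ 2 - f k * (W s k * absF (y' r) k) by field; lra.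
      rewrite /f /absF /pow; lra.
    rewrite lsum_plus !lsum_scal -EQ; apply: Rplus_le_compat_l.
    by apply: Rmult_le_compat_l; [lra | case: Ha => _ [_]; apply].
  case: (Rle_lt_or_eq_dec 0 A A0) => [Ap|EA].
    have := key (sqrt Q / A) (Rdiv_lt_0_compat _ _ sQ Ap).
    have -> : / (2 * (sqrt Q / A)) * Q + sqrt Q / A / 2 * A ^ 2 = sqrt Q * A.
      by rewrite -{2}ssQ; field; lra.
    by [].
  rewrite -EA Rmult_0_r; apply: le_epsilon => e e0.
  have := key (Q / e) (Rdiv_lt_0_compat _ _ Qp e0); rewrite -EA.
  have -> : / (2 * (Q / e)) * Q + Q / e / 2 * 0 ^ 2 = e / 2 by field; lra.
  lra.
have H := C_MVT _ _ a b _ ab Hsum Hbd.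
have E : Cminus (csum (fun k => Cmult (c k) (y b k)) l) (csum (fun k => Cmult (c k) (y a k)) l) = RtoC Q.
  rewrite EQ; elim: (l) => [|k m IH] /=; first by ring.
  rewrite RtoC_plus -IH /f Rpow_mult_distr RtoC_mult /absF Cmod2_conj /c /z; ring.
rewrite E Cmod_RtoC // in H.
have HsQ : sqrt Q <= A * (b - a).
  by apply: (Rmult_le_reg_l (sqrt Q)) => //; rewrite ssQ; lra.
rewrite -ssQ /pow Rmult_1_r; apply: Rmult_le_compat; lra.
Qed.

(** * Differentiation of infinite sums and first-order expansion of the exact flow *)

Lemma Cder_eps f s l : (forall e, 0 < e -> exists d, 0 < d /\ forall h, Rabs h < d ->
    Cmod (Cminus (Cminus (f (s + h)) (f s)) (Cmult (RtoC h) l)) <= e * Rabs h) <-> Cder f s l.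
Proof.
split.
- move=> H; split; apply/is_derive_Reals => e e0; have [d [d0 Hd]] := H (e / 2) ltac:(lra);
    exists (mkposreal d d0) => h h0 Hh; have Hp := Rabs_pos_lt _ h0;
    have := Hd h Hh => Hc.
  + have := Rle_trans _ _ _ (re_le_Cmod _) Hc; rewrite /Re /= => Hr.
    have -> : (fst (f (s + h)) - fst (f s)) / h - fst l =
      (fst (f (s + h)) + - fst (f s) + - (h * fst l - 0 * snd l)) / h by field.
    rewrite /Rdiv Rabs_mult Rabs_inv; apply: (Rmult_lt_reg_r (Rabs h)) => //.
    rewrite Rmult_assoc Rinv_l; last lra.
    nra.
  + have := Rle_trans _ _ _ (im_le_Cmod _) Hc; rewrite /Im /= => Hr.
    have -> : (snd (f (s + h)) - snd (f s)) / h - snd l =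
      (snd (f (s + h)) + - snd (f s) + - (h * snd l + 0 * fst l)) / h by field.
    rewrite /Rdiv Rabs_mult Rabs_inv; apply: (Rmult_lt_reg_r (Rabs h)) => //.
    rewrite Rmult_assoc Rinv_l; last lra.
    nra.
- move=> [/is_derive_Reals H1 /is_derive_Reals H2] e e0.
  have [d1 Hd1] := H1 (e / 2) ltac:(lra); have [d2 Hd2] := H2 (e / 2) ltac:(lra).
  exists (Rmin d1 d2); split; first by apply: Rmin_pos; [case: (d1) | case: (d2)].
  move=> h Hh; case: (Req_dec h 0) => [->|h0].
    have -> : Cminus (Cminus (f (s + 0)) (f s)) (Cmult (RtoC 0) l) = 0 by rewrite Rplus_0_r; ring.
    by rewrite Cmod_0 Rabs_R0; lra.
  have Hp := Rabs_pos_lt _ h0.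
  have a1 := Hd1 h h0 (Rlt_le_trans _ _ _ Hh (Rmin_l _ _)).
  have a2 := Hd2 h h0 (Rlt_le_trans _ _ _ Hh (Rmin_r _ _)).
  set z := Cminus _ _.
  have E1 : Re z = ((Re (f (s + h)) - Re (f s)) / h - Re l) * h.
    by rewrite /z /Re /=; field.
  have E2 : Im z = ((Im (f (s + h)) - Im (f s)) / h - Im l) * h.
    by rewrite /z /Im /=; field.
  have b1 : Rabs (Re z) <= e / 2 * Rabs h.
    by rewrite E1 Rabs_mult; apply: Rmult_le_compat_r; [exact: Rabs_pos | left].
  have b2 : Rabs (Im z) <= e / 2 * Rabs h.
    by rewrite E2 Rabs_mult; apply: Rmult_le_compat_r; [exact: Rabs_pos | left].
  have Ez : z = Cplus (RtoC (Re z)) (Cmult ci (RtoC (Im z))).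
    by apply: injective_projections; rewrite /Re /Im /=; ring.
  rewrite Ez; apply: Rle_trans (Cmod_triangle _ _) _.
  rewrite Cmod_mult Cmod_ci !Cmod_R; lra.
Qed.

Lemma csum_incl {I} (f : I -> C) (g : I -> R) l l' : (forall i, Cmod (f i) <= g i) ->
  NoDup l -> incl l l' -> Cmod (Cminus (csum f l') (csum f l)) <= lsum g l' - lsum g l.
Proof.
move=> Hg; elim: l l' => [|i l IH] l' Hnd Hin.
  rewrite /= Rminus_0_r; have -> : Cminus (csum f l') 0 = csum f l' by ring.
  by apply: Rle_trans (Cmod_csum _ _) _; exact: lsum_le.
have [l1 [l2 El]] : exists l1 l2, l' = l1 ++ i :: l2.
  by apply: in_split; apply: Hin; left.
inversion Hnd; subst.
have : Cmod (Cminus (csum f (l1 ++ l2)) (csum f l)) <= lsum g (l1 ++ l2) - lsum g l.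
  apply: IH => // j Hj.
  have : In j (l1 ++ i :: l2) by apply: Hin; right.
  rewrite !in_app_iff /=; case=> [|[E|]]; [by left | by subst | by right].
rewrite !lsum_app !csum_app /=.
have -> : Cminus (Cplus (csum f l1) (Cplus (f i) (csum f l2))) (Cplus (f i) (csum f l)) =
  Cminus (Cplus (csum f l1) (csum f l2)) (csum f l) by ring.
lra.
Qed.

(** Differentiation under a dominated sum. Outside a finite list where the majorant is within
    [e / 4] of its total, the increment and its linear part are each at most [g i * Rabs h], the
    former by the mean value inequality. *)
Lemma Cder_tsum {I} (f f' : R -> I -> C) (g : I -> R) S s : (forall r, summable (f r)) ->
  (forall r i, Cder (fun r => f r i) r (f' r i)) -> (forall r i, Cmod (f' r i) <= g i) -> Bnd g S ->
  Cder (fun r => tsum (f r)) s (tsum (f' s)).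
Proof.
move=> Hs Hd Hg HS; apply/Cder_eps => e e0.
have g0 : forall i, 0 <= g i by move=> i; apply: Rle_trans (Cmod_ge_0 _) (Hg s i).
have [HB [_ Hl]] := rsum_spec _ _ HS.
have [l [Nl Hl1]] := Hl (e / 4) ltac:(lra).
have [d [d0 Hdl]] : exists d, 0 < d /\ forall h, Rabs h < d -> 
    Cmod (csum (fun i => Cminus (Cminus (f (s + h) i) (f s i)) (Cmult (RtoC h) (f' s i))) l) <= e / 2 * Rabs h.
  have Hc : Cder (fun r => csum (f r) l) s (csum (f' s) l).
    elim: (l) => [|i m IH] /=; first exact: Cder_const.
    by apply: Cder_plus.
  have [d [d0 Hd1]] := proj2 (Cder_eps _ _ _) Hc (e / 2) ltac:(lra).
  exists d; split => // h Hh; apply: Rle_trans (Hd1 h Hh).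
  apply: Req_le; congr Cmod; elim: (l) => [|i m IH] /=; [ring | rewrite IH; ring].
exists d; split => // h Hh.
have Sf' : summable (f' s) by apply: (summable_le _ _ _ (Hg s) HS).
pose D i := Cminus (Cminus (f (s + h) i) (f s i)) (Cmult (RtoC h) (f' s i)).
have SD : summable D.
  by apply: summable_minus; [apply: summable_minus | apply: summable_scal].
have -> : Cminus (Cminus (tsum (f (s + h))) (tsum (f s))) (Cmult (RtoC h) (tsum (f' s))) = tsum D.
  by rewrite /D tsum_minus ?tsum_minus ?tsum_scal //; [exact: summable_minus | exact: summable_scal].
have HD : forall i, Cmod (D i) <= 2 * Rabs h * g i.
  move=> i; apply: Rle_trans (Cmod_triangle _ _) _; rewrite Cmod_opp Cmod_mult Cmod_R.
  have h1 := Rmult_le_compat_l _ _ _ (Rabs_pos h) (Hg s i).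
  have : Cmod (Cminus (f (s + h) i) (f s i)) <= g i * Rabs h.
    case: (Rle_dec 0 h) => Hh0.
    - have := C_MVT (fun r => f r i) (fun r => f' r i) s (s + h) (g i) ltac:(lra)
        (fun r _ => Hd r i) (fun r _ => Hg r i).
      by rewrite (Rabs_pos_eq h) //; have -> : s + h - s = h by ring.
    - have := C_MVT (fun r => f r i) (fun r => f' r i) (s + h) s (g i) ltac:(lra)
        (fun r _ => Hd r i) (fun r _ => Hg r i).
      rewrite Rabs_left; last lra.
      have -> : s - (s + h) = - h by ring.
      by rewrite -Cmod_opp; have -> : (Copp (Cminus (f s i) (f (s + h) i)) = Cminus (f (s + h) i) (f s i)) by ring.
  lra.
apply: le_epsilon => e' e'0.
have [l0 [N0 Hl0]] := tsum_hassum D SD e' e'0.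
have [l1 [N1 [I1 I2]]] := incl_union l l0.
have H1 := Hl0 l1 N1 I2.
have Hcs : Cmod (csum D l1) <= e * Rabs h.
  have H2 := csum_incl D _ l l1 HD Nl I1; rewrite !lsum_scal in H2.
  have H3 := HB l1 N1; have H4 := Hdl h Hh; rewrite -/D in H4.
  have -> : csum D l1 = Cplus (csum D l) (Cminus (csum D l1) (csum D l)) by ring.
  apply: Rle_trans (Cmod_triangle _ _) _.
  have := Rmult_le_compat_l (2 * Rabs h) (lsum g l1 - lsum g l) (e / 4)
    ltac:(have := Rabs_pos h; lra) ltac:(lra).
  lra.
have -> : tsum D = Cplus (csum D l1) (Copp (Cminus (csum D l1) (tsum D))) by ring.
apply: Rle_trans (Cmod_triangle _ _) _; rewrite Cmod_opp; lra.
Qed.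

Lemma Ei_bound_abs s x : Cmod (Ei s x) <= Rabs s.
Proof.
case: (Rle_dec 0 s) => H; first by rewrite Rabs_pos_eq //; exact: Ei_bound.
have := C_MVT (fun r => Ei r x) (fun r => cis (r * x)) s 0 1 ltac:(lra) (fun r _ => Ei_der x r).
rewrite Ei_0 Rabs_left; last lra.
have -> : Cminus 0 (Ei s x) = Copp (Ei s x) by ring.
rewrite Cmod_opp; have -> : 1 * (0 - s) = - s by ring.
by apply=> r _; rewrite Cmod_cis; lra.
Qed.

Lemma Cder_shift f t r l : Cder f (t + r) l -> Cder (fun x => f (t + x)) r l.
Proof.
move=> /Cder_eps H; apply/Cder_eps => e /H [d [d0 Hd]]; exists d; split => // h Hh.
by rewrite -Rplus_assoc; exact: Hd.
Qed.

Lemma nls_rhs_HS s : 1 <= s -> exists K, 0 < K /\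
  (forall t f x, HS s f x -> HS s (nls_rhs t f) (K * x ^ 3)) /\
  (forall t f g x d, HS s f x -> HS s g x -> HS s (fun k => Cminus (f k) (g k)) d ->
    HS s (fun k => Cminus (nls_rhs t f k) (nls_rhs t g k)) (K * (x ^ 2 * d))).
Proof.
move=> Hs; have [K1 [K10 HK1]] := TB_JJ_HS s Hs; have [K2 [K20 HK2]] := TB_diff_HS s Hs.
have c1 : forall k : Z, Cmod (Copp ci) <= 1 by move=> _; rewrite Cmod_opp Cmod_ci; lra.
have o3 := fun t k k2 k3 => ph_JJ t one3 1 k k2 k3 (one3_JJ k k2 k3).
exists (K1 + K2); split; first lra; split.
- move=> t f x Hf; have [_ H] := HK1 (ph t one3) 1 f f f x x x ltac:(lra) (o3 t) Hf Hf Hf.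
  have x0 := L2_ge0 _ _ Hf.
  apply: L2_mono (HS_diag s _ 1 _ _ ltac:(lra) c1 H).
  have : 0 <= x ^ 3 by apply: pow_le.
  have -> : x * x * x = x ^ 3 by ring.
  nra.
- move=> t f g x d Hf Hg Hd; have H := HK2 (ph t one3) 1 f g x d ltac:(lra) (o3 t) Hf Hg Hd.
  have d0 := L2_ge0 _ _ Hd.
  apply: L2_mono (HS_ext _ _ _ _ _ (HS_diag s _ 1 _ _ ltac:(lra) c1 H)).
    have : 0 <= x ^ 2 * d by apply: Rmult_le_pos => //; exact: pow2_ge_0.
    nra.
  by move=> k; rewrite /nls_rhs; ring.
Qed.

(** [Msym r] integrates the oscillation in time with [V] frozen, so its derivative in [r] is the
    right-hand side at frozen data. *)
Lemma Cder_Msym t V k r : summable V ->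
  Cder (fun r => TB (ph t (Msym r)) V V V k) r (nls_rhs (t + r) V k).
Proof.
move=> HV.
have S3 : forall b, (forall k k2 k3, Cmod (b k k2 k3) <= 1) -> summable (tri b V V V k).
  by move=> b Hb; apply: (tri_summable _ _ _ _ _ 1).
have So : forall s k k2 k3, Cmod (ph s one3 k k2 k3) <= 1.
  by move=> *; rewrite Cmod_ph /one3 Cmod_1; lra.
rewrite /nls_rhs /TB -tsum_scal; last exact: S3.
have [S HS3] := S3 one3 ltac:(move=> *; rewrite /one3 Cmod_1; lra).
apply: (Cder_tsum _ (fun r i => Cmult (Copp ci) (tri (ph (t + r) one3) V V V k i))
  (fun i => Cmod (tri one3 V V V k i)) S) => //.
- move=> r'; apply: (tri_summable _ _ _ _ _ (Rabs r')) => // i.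
  rewrite Cmod_ph /Msym Cmod_mult Cmod_opp Cmod_ci Rmult_1_l; exact: Ei_bound_abs.
- move=> r' i; rewrite /tri.
  set z := Cmult (Cmult (V (fst i)) _) _; set x := phi k (fst i) (snd i).
  apply: (Cder_ext (fun r => Cmult (Cmult (Cmult (Copp ci) (cis (t * x))) z) (Ei r x))).
    by move=> u; rewrite /ph /Msym -/x; ring.
  have -> : Cmult (Copp ci) (Cmult (ph (t + r') one3 k (fst i) (snd i)) z) =
    Cmult (Cmult (Cmult (Copp ci) (cis (t * x))) z) (cis (r' * x)).
    rewrite /ph /one3 -/x; have -> : (t + r') * x = t * x + r' * x by ring.
    by rewrite cis_plus; ring.
  apply: Cder_scal; exact: Ei_der.
- by move=> r' i; cbv beta; rewrite Cmod_mult Cmod_opp Cmod_ci Rmult_1_l !Cmod_tri Cmod_ph; exact: Rle_refl.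
Qed.

Definition twisted_on (s : R) (v : R -> F) (B a b : R) : Prop :=
  forall r, a <= r <= b -> HS s (v r) B /\ forall k, Cder (fun x => v x k) r (nls_rhs r (v r) k).

(** The second bound compares [v] with the evolution whose nonlinearity is frozen at time [t]. The
    derivative of the difference is a difference of right-hand sides at points at distance
    [K B^3 r], hence second order in [h]. *)
Lemma twisted_incr s : 1 <= s -> exists K, 0 < K /\ forall v B t h, 0 <= h ->
  twisted_on s v B t (t + h) ->
  HS s (fun k => Cminus (v (t + h) k) (v t k)) (K * B ^ 3 * h) /\
  HS s (fun k => Cminus (Cminus (v (t + h) k) (v t k)) (TB (ph t (Msym h)) (v t) (v t) (v t) k))
     (K * B ^ 5 * h ^ 2).
Proof.
move=> Hs; have [K [K0 [HK1 HK2]]] := nls_rhs_HS s Hs.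
exists (K + K * K); split; first nra.
move=> v B t h h0 Hv.
have [Ht _] := Hv t ltac:(lra); have B0 := L2_ge0 _ _ Ht.
have B3 : 0 <= B ^ 3 by exact: pow_le.
have B5 : 0 <= B ^ 5 by exact: pow_le.
have lip : forall r, 0 <= r <= h -> HS s (fun k => Cminus (v (t + r) k) (v t k)) (K * B ^ 3 * r).
  move=> r Hr; have -> : K * B ^ 3 * r = K * B ^ 3 * (t + r - t) by ring.
  apply: (HS_MVT s v (fun x => nls_rhs x (v x))); first lra.
  - by move=> x Hx; case: (Hv x ltac:(lra)).
  - by move=> x Hx; apply: HK1; case: (Hv x ltac:(lra)).
split.
  apply: L2_mono (lip h ltac:(lra)).
  have : 0 <= K * K * B ^ 3 * h by repeat apply: Rmult_le_pos; lra.
  lra.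
have Sv := HS_wiener s _ _ ltac:(lra) Ht.
pose y r : F := fun k => Cplus (v (t + r) k) (Cmult (Copp 1) (TB (ph t (Msym r)) (v t) (v t) (v t) k)).
pose y' r : F := fun k => Cminus (nls_rhs (t + r) (v (t + r)) k) (nls_rhs (t + r) (v t) k).
have Hy : HS s (fun k => Cminus (y h k) (y 0 k)) (K * (B ^ 2 * (K * B ^ 3 * h)) * (h - 0)).
  apply: (HS_MVT s y y') => //.
  - move=> r Hr k.
    have -> : y' r k = Cplus (nls_rhs (t + r) (v (t + r)) k) (Cmult (Copp 1) (nls_rhs (t + r) (v t) k)).
      by rewrite /y'; ring.
    apply: Cder_plus; last by apply: Cder_scal; exact: Cder_Msym.
    by apply: (Cder_shift (fun x => v x k)); case: (Hv (t + r) ltac:(lra)).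
  - move=> r Hr; apply: (HK2 _ _ _ B) => //; first by case: (Hv (t + r) ltac:(lra)).
    apply: L2_mono (lip r Hr); apply: Rmult_le_compat_l; last lra.
    by apply: Rmult_le_pos; lra.
apply: L2_mono (HS_ext _ _ _ _ _ Hy).
  have -> : K * (B ^ 2 * (K * B ^ 3 * h)) * (h - 0) = K * K * B ^ 5 * h ^ 2 by ring.
  have : 0 <= K * B ^ 5 * h ^ 2 by repeat apply: Rmult_le_pos; try lra; exact: pow2_ge_0.
  lra.
move=> k; rewrite /y Rplus_0_r.
have -> : TB (ph t (Msym 0)) (v t) (v t) (v t) k = 0.
  rewrite /TB -(@tsum_zero (Z * Z)); apply: tsum_ext => i; rewrite /tri /ph /Msym Ei_0; ring.
ring.
Qed.

(** * Conservation of mass and momentum *)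

(** [lam = 1] yields the mass and [lam = IZR] the momentum; both weights are additive on
    parallelograms. *)
Definition ipl (lam : Z -> R) (f g : F) : C :=
  tsum (fun k => Cmult (RtoC (lam k)) (Cmult (f k) (Cconj (g k)))).

Section Weighted.
Context (lam : Z -> R) (Hlam : forall k, Rabs (lam k) <= jp k).

Lemma ipl_le f g k : Cmod (Cmult (RtoC (lam k)) (Cmult (f k) (Cconj (g k)))) <=
  (W 1 k * absF f k) * absF g k.
Proof.
rewrite !Cmod_mult Cmod_conj Cmod_R W_1 /absF Rmult_assoc.
by apply: Rmult_le_compat_r => //; apply: Rmult_le_pos; exact: Cmod_ge_0.
Qed.

Lemma ipl_spec f g x y : HS 1 f x -> HS 1 g y ->
  summable (fun k => Cmult (RtoC (lam k)) (Cmult (f k) (Cconj (g k)))) /\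
  Cmod (ipl lam f g) <= x * y.
Proof.
move=> Hf Hg; have Hg0 : L2 (absF g) y by apply/HS_0; apply: HS_le Hg; lra.
have H := proj2 (L2_CS _ _ _ _ Hf Hg0); split.
- exact: (summable_le _ _ _ (ipl_le f g) H).
- exact: (tsum_bound _ _ _ (ipl_le f g) H).
Qed.

Lemma ipl_plus_l f g h x y z : HS 1 f x -> HS 1 g y -> HS 1 h z ->
  ipl lam (fun k => Cplus (f k) (g k)) h = Cplus (ipl lam f h) (ipl lam g h).
Proof.
move=> Hf Hg Hh; rewrite /ipl -tsum_plus; first by apply: tsum_ext => k; ring.
- exact: (proj1 (ipl_spec _ _ _ _ Hf Hh)).
- exact: (proj1 (ipl_spec _ _ _ _ Hg Hh)).
Qed.

Lemma ipl_conj f g x y : HS 1 f x -> HS 1 g y -> ipl lam g f = Cconj (ipl lam f g).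
Proof.
move=> Hf Hg; rewrite /ipl -tsum_conj; last exact: (proj1 (ipl_spec _ _ _ _ Hf Hg)).
apply: tsum_ext => k; rewrite !Cmult_conj Cconj_conj (_ : Cconj (RtoC (lam k)) = RtoC (lam k)); first by ring.
by rewrite /Cconj /= Ropp_0.
Qed.

Lemma ipl_incr f d x y : HS 1 f x -> HS 1 d y ->
  Re (ipl lam (fun k => Cplus (f k) (d k)) (fun k => Cplus (f k) (d k))) =
  Re (ipl lam f f) + 2 * Re (ipl lam d f) + Re (ipl lam d d).
Proof.
move=> Hf Hd; have Hs := HS_plus _ _ _ _ _ Hf Hd.
rewrite (ipl_plus_l _ _ _ _ _ _ Hf Hd Hs) (ipl_conj _ f _ _ Hs Hf) (ipl_conj _ d _ _ Hs Hd).
rewrite (ipl_plus_l _ _ _ _ _ _ Hf Hd Hf) (ipl_plus_l _ _ _ _ _ _ Hf Hd Hd).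
rewrite (ipl_conj d f _ _ Hd Hf) /Re /=; ring.
Qed.

(** The first-order part of the increment is the [Msym] term, orthogonal to [v t] by the symmetries
    of the parallelogram. There remain the second-order remainder and the square of the
    increment. *)
Lemma ipl_quadratic (Hadd : forall k k2 k3, lam k + lam (k2 + k3 - k)%Z = lam k2 + lam k3) v B T :
  0 <= T -> twisted_on 1 v B 0 T -> exists K, forall t h, 0 <= t -> 0 <= h <= 1 -> t + h <= T ->
  Rabs (Re (ipl lam (v (t + h)) (v (t + h))) - Re (ipl lam (v t) (v t))) <= K * h ^ 2.
Proof.
move=> HT Hv; have [K1 [K10 HK1]] := twisted_incr 1 (Rle_refl 1).
have [K2 [K20 HK2]] := TB_JJ_HS 1 (Rle_refl 1).
have B0 : 0 <= B by case: (Hv 0 ltac:(lra)) => /L2_ge0.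
exists (2 * (K1 * B ^ 5 * B) + (K1 * B ^ 3) * (K1 * B ^ 3)) => t h Ht Hh Hth.
have Hv' : twisted_on 1 v B t (t + h) by move=> r Hr; apply: Hv; lra.
have [Hd Hr] := HK1 v B t h ltac:(lra) Hv'.
have [Hf _] := Hv t ltac:(lra).
set d : F := fun k => Cminus (v (t + h) k) (v t k).
set m : F := TB (ph t (Msym h)) (v t) (v t) (v t).
have Hm : HS 1 m _ := proj2 (HK2 (ph t (Msym h)) h (v t) (v t) (v t) B B B ltac:(lra)
   ltac:(move=> *; apply: ph_JJ; apply: Msym_JJ; lra) Hf Hf Hf).
have Ev : v (t + h) = (fun k => Cplus (v t k) (d k)) by apply: functional_extensionality => k; rewrite /d; ring.
rewrite {1 2}Ev (ipl_incr _ _ _ _ Hf Hd).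
have Ed : d = (fun k => Cplus (m k) (Cminus (d k) (m k))) by apply: functional_extensionality => k; ring.
have E2 : Re (ipl lam d (v t)) = Re (ipl lam (fun k => Cminus (d k) (m k)) (v t)).
  have H0 : Re (ipl lam m (v t)) = 0 := Msym_orth h t lam (v t) B B ltac:(lra)
    (conj (proj1 (HS_0 _ _) (HS_le 1 0 _ _ (Rlt_le _ _ Rlt_0_1) Hf)) Hf) Hlam Hadd.
  rewrite {1}Ed (ipl_plus_l _ _ _ _ _ _ Hm Hr Hf) (_ : forall a b, Re (Cplus a b) = Re a + Re b) // H0.
  by rewrite Rplus_0_l.
have b1 := Rle_trans _ _ _ (re_le_Cmod _) (proj2 (ipl_spec _ _ _ _ Hr Hf)).
have b2 := Rle_trans _ _ _ (re_le_Cmod _) (proj2 (ipl_spec _ _ _ _ Hd Hd)).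
rewrite -/d -/m -E2 in b1; rewrite -/d in b2.
set A := Re (ipl lam (v t) (v t)).
have -> : A + 2 * Re (ipl lam d (v t)) + Re (ipl lam d d) - A = 2 * Re (ipl lam d (v t)) + Re (ipl lam d d) by ring.
apply: Rle_trans (Rabs_triang _ _) _; rewrite Rabs_mult (Rabs_pos_eq 2); last lra.
have := b1; have := b2.
have -> : K1 * B ^ 3 * h * (K1 * B ^ 3 * h) = (K1 * B ^ 3) * (K1 * B ^ 3) * h ^ 2 by ring.
lra.
Qed.

End Weighted.

(** Cutting [[0, t]] into [n] equal pieces bounds the variation by a multiple of [1 / n].
    Conservation thus follows without differentiating the infinite sums for mass and momentum. *)
Lemma const_of_quadratic (N : R -> R) T K : 0 <= T ->
  (forall t h, 0 <= t -> 0 <= h <= 1 -> t + h <= T -> Rabs (N (t + h) - N t) <= K * h ^ 2) ->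
  forall t, 0 <= t <= T -> N t = N 0.
Proof.
move=> HT H t Ht.
have K0 : 0 <= Rmax K 0 by exact: Rmax_r.
have step : forall n, t <= INR (S n) -> Rabs (N t - N 0) <= Rmax K 0 * t ^ 2 * / INR (S n).
  move=> n Hn; have Hp : 0 < INR (S n) by apply: lt_0_INR; lia.
  set h := t / INR (S n).
  have Eh : INR (S n) * h = t by rewrite /h; field; lra.
  have h0 : 0 <= h by apply: Rmult_le_pos; [lra | left; exact: Rinv_0_lt_compat].
  have h1 : h <= 1 by apply: (Rmult_le_reg_l (INR (S n))) => //; lra.
  have Hi : forall i, (i <= S n)%nat -> Rabs (N (INR i * h) - N 0) <= INR i * (Rmax K 0 * h ^ 2).
    elim=> [|i IH] Hi; first by rewrite !Rmult_0_l Rminus_diag Rabs_R0; lra.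
    have Hle : INR (S i) * h <= T.
      by apply: Rle_trans (_ : INR (S n) * h <= T); [apply: Rmult_le_compat_r => //; exact: le_INR | lra].
    rewrite S_INR in Hle *.
    have := H (INR i * h) h ltac:(have := pos_INR i; nra) ltac:(lra) ltac:(lra).
    have -> : INR i * h + h = (INR i + 1) * h by ring.
    have := IH ltac:(lia).
    have := Rabs_triang (N ((INR i + 1) * h) - N (INR i * h)) (N (INR i * h) - N 0).
    have -> : N ((INR i + 1) * h) - N (INR i * h) + (N (INR i * h) - N 0) = N ((INR i + 1) * h) - N 0 by ring.
    have := Rmult_le_compat_r (h ^ 2) _ _ (pow2_ge_0 h) (Rmax_l K 0).
    lra.
  have := Hi (S n) (Nat.le_refl _); rewrite Eh.
  have -> : INR (S n) * (Rmax K 0 * h ^ 2) = Rmax K 0 * t ^ 2 * / INR (S n) by rewrite /h; field; lra.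
  by [].
have Hz : Rabs (N t - N 0) <= 0.
  apply: le_epsilon => e e0; rewrite Rplus_0_l.
  set A := Rmax K 0 * t ^ 2.
  have A0 : 0 <= A by apply: Rmult_le_pos => //; exact: pow2_ge_0.
  have [n Hn] := INR_unbounded (t + A / e).
  have Ae : 0 <= A / e by apply: Rmult_le_pos => //; left; exact: Rinv_0_lt_compat.
  have Hn' : t + A / e < INR (S n) by rewrite S_INR; lra.
  apply: Rle_trans (step n ltac:(lra)) _.
  apply: (Rmult_le_reg_r (INR (S n))); first lra.
  rewrite -/A Rmult_assoc Rinv_l; last lra.
  have := Rmult_le_compat_l e (A / e) (INR (S n)) ltac:(lra) ltac:(lra).
  have -> : e * (A / e) = A by field; lra.
  lra.
have := Rabs_pos (N t - N 0) => Hp.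
have : Rabs (N t - N 0) = 0 by lra.
by move=> E; apply: NNPP => Hne; have := Rabs_no_R0 (N t - N 0) ltac:(lra).
Qed.

Lemma conservation v B T : 0 <= T -> twisted_on 1 v B 0 T -> forall t, 0 <= t <= T ->
  massR (v t) = massR (v 0) /\ momR (v t) = momR (v 0).
Proof.
move=> HT Hv t Ht.
have cons : forall lam, (forall k, Rabs (lam k) <= jp k) ->
    (forall k k2 k3, lam k + lam (k2 + k3 - k)%Z = lam k2 + lam k3) ->
    Re (ipl lam (v t) (v t)) = Re (ipl lam (v 0) (v 0)).
  move=> lam H1 H2; have [K HK] := ipl_quadratic lam H1 H2 v B T HT Hv.
  exact: (const_of_quadratic (fun t => Re (ipl lam (v t) (v t))) T K HT HK).
have h1 := cons (fun _ => 1) ltac:(move=> k; rewrite Rabs_R1; exact: jp_ge1) ltac:(move=> *; lra).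
have h2 := cons IZR jp_abs ltac:(move=> *; rewrite minus_IZR plus_IZR; ring).
have Em : forall r, 0 <= r <= T -> massR (v r) = Re (ipl (fun _ => 1) (v r) (v r)).
  move=> r Hr; have [Hf _] := Hv r Hr.
  have := massR_ip (v r) B (proj1 (HS_0 _ _) (HS_le 1 0 _ _ (Rlt_le _ _ Rlt_0_1) Hf)) => E.
  have -> : massR (v r) = Re (RtoC (massR (v r))) by [].
  by rewrite E; congr Re; apply: tsum_ext => k; ring.
have Eq : forall r, momR (v r) = Re (ipl IZR (v r) (v r)).
  by move=> r; congr Re; apply: tsum_ext => k; rewrite RtoC_mult Cmod2_conj.
by rewrite !Em; try lra; rewrite !Eq.
Qed.

(** * Local error *)

(** If [b] dominates, it takes over the [s - 1] powers. If [a] dominates, only the factor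
    [W (1 - th) b] of [jp b] is moved to [a], so that both sides keep their weight [th]. *)
Lemma W_mul_th s th a b : 1 <= s -> 0 <= th <= 1 ->
  W (s - 1) a * jp b * W th a <= W s a * W th b + W th a * W s b.
Proof.
move=> Hs Hth; have wta := W_pos th a; have wtb := W_pos th b.
have wsa := W_pos s a; have wsb := W_pos s b; have pa := W_pos (s - 1) a.
have ja := jp_ge1 a; have jb := jp_ge1 b.
case: (Rle_dec (jp a) (jp b)) => H.
- have h : W (s - 1) a <= W (s - 1) b by apply: Rle_Rpower_l; lra.
  have Eb : W s b = W (s - 1) b * jp b by rewrite -(W_1 b) -W_plus; congr W; ring.
  have := Rmult_le_compat_r (jp b * W th a) _ _ ltac:(nra) h.
  have : 0 <= W s a * W th b by nra.
  rewrite Eb; lra.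
- have h : W (1 - th) b <= W (1 - th) a by apply: Rle_Rpower_l; lra.
  have Eb : jp b = W th b * W (1 - th) b by rewrite -(W_1 b) -W_plus; congr W; ring.
  have Ea : W s a = W (s - 1) a * (W th a * W (1 - th) a) by rewrite -!W_plus; congr W; ring.
  have := Rmult_le_compat_l (W (s - 1) a * W th a * W th b) _ _ ltac:(left; repeat apply: Rmult_lt_0_compat => //) h.
  have : 0 <= W th a * W s b by nra.
  rewrite {1}Eb Ea; lra.
Qed.

(** The [1 / jp k] in the symbol lowers the output weight to [W (s - 1)], which is distributed over
    the three inputs; recombined with the derivative on [p] it puts [W s] on one factor only. *)
Lemma TB_Esym s th : 1 <= s -> 0 <= th <= 1 -> th + 1/2 < s -> exists K, 0 < K /\
  forall tau t f x, 0 < tau -> HS s f x ->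
  HS s (TB (ph t (Esym tau)) f f f) (K * Rpower tau (1 + th) * x ^ 3).
Proof.
move=> Hs Hth Hst; have [K [K0 HK]] := TB_HS s th ltac:(lra) Hst.
have P3 : 0 < Rpower 3 (s - 1) by exact: exp_pos.
exists (K * (12 * Rpower 3 (s - 1))); split; first by apply: Rmult_lt_0_compat; lra.
move=> tau t f x Ht Hf.
have Pt : 0 < Rpower tau (1 + th) by exact: exp_pos.
have -> : K * (12 * Rpower 3 (s - 1)) * Rpower tau (1 + th) * x ^ 3 =
  K * (12 * Rpower 3 (s - 1) * Rpower tau (1 + th)) * (x * x * x) by ring.
apply: (proj2 (HK _ _ f f f x x x _ _ Hf Hf Hf)).
  by left; repeat apply: Rmult_lt_0_compat; lra.
move=> k k2 k3 p; rewrite Cmod_ph.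
have := Esym_bound th tau k k2 k3 Ht Hth; rewrite -/p => HE.
have ws := W_pos s k; have w2 := W_pos th k2; have w3 := W_pos th k3; have wp := W_pos th p.
apply: Rle_trans (Rmult_le_compat_l _ _ _ (Rlt_le _ _ ws) HE) _.
have Ek : W s k = W (s - 1) k * jp k by rewrite -(W_1 k) -W_plus; congr W; ring.
have -> : W s k * (4 * Rpower tau (1 + th) * (jp p / jp k * (W th k2 * W th k3))) =
  4 * Rpower tau (1 + th) * (W (s - 1) k * (jp p * (W th k2 * W th k3))).
  by rewrite Ek; field; have := jp_ge1 k; lra.
have -> : 12 * Rpower 3 (s - 1) * Rpower tau (1 + th) * (W s k2 * W th k3 * W th p + W th k2 * W s k3 * W th p + W th k2 * W th k3 * W s p) =
  4 * Rpower tau (1 + th) * (3 * Rpower 3 (s - 1) * (W s k2 * W th k3 * W th p + W th k2 * W s k3 * W th p + W th k2 * W th k3 * W s p)) by ring.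
apply: Rmult_le_compat_l; first lra.
have j0 : 0 < jp p * (W th k2 * W th k3) by repeat apply: Rmult_lt_0_compat => //; have := jp_ge1 p; lra.
have := W_sum3 (s - 1) k k2 k3 ltac:(lra); rewrite -/p => H.
apply: Rle_trans (Rmult_le_compat_r _ _ _ (Rlt_le _ _ j0) H) _.
have -> : Rpower 3 (s - 1) * (W (s - 1) k2 + W (s - 1) k3 + W (s - 1) p) * (jp p * (W th k2 * W th k3)) =
  Rpower 3 (s - 1) * ((W (s - 1) k2 * jp p * W th k2) * W th k3 + (W (s - 1) k3 * jp p * W th k3) * W th k2
     + (W (s - 1) p * jp p) * (W th k2 * W th k3)) by ring.
set X := _ + W th k2 * W th k3 * W s p.
have -> : 3 * Rpower 3 (s - 1) * X = Rpower 3 (s - 1) * (3 * X) by ring.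
apply: Rmult_le_compat_l; first lra.
have a1 := Rmult_le_compat_r _ _ _ (Rlt_le _ _ w3) (W_mul_th s th k2 p Hs Hth).
have a2 := Rmult_le_compat_r _ _ _ (Rlt_le _ _ w2) (W_mul_th s th k3 p Hs Hth).
have Ep : W (s - 1) p * jp p = W s p by rewrite -(W_1 p) -W_plus; congr W; ring.
rewrite Ep.
have q : forall a b c, 0 < a -> 0 < b -> 0 < c -> 0 < a * b * c by move=> *; repeat apply: Rmult_lt_0_compat.
have := q _ _ _ (W_pos s k2) w3 wp; have := q _ _ _ w2 (W_pos s k3) wp; have := q _ _ _ w2 w3 (W_pos s p).
rewrite /X; lra.
Qed.

Lemma theta_bound tau m0 q k : 0 <= tau -> Rabs (theta tau m0 q k) <= tau * (2 * (Rabs m0 + Rabs q)).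
Proof.
move=> Ht; rewrite /theta; have hm := Rabs_pos m0; have hq := Rabs_pos q.
case: (Z.eqb_spec k 0) => Hk; rewrite Rabs_mult (Rabs_pos_eq tau) //; apply: Rmult_le_compat_l => //.
  by rewrite Rabs_mult Rabs_Ropp (Rabs_pos_eq 2); lra.
apply: Rle_trans (Rabs_triang _ _) _.
rewrite /Rdiv !Rabs_mult Rabs_Ropp (Rabs_pos_eq 2) ?Rabs_inv; try lra.
have H1 := IZR_abs_ge1 _ Hk.
have : / Rabs (IZR k) <= 1 by rewrite -Rinv_1; apply: Rinv_le_contravar; lra.
nra.
Qed.

Lemma cis_taylor x : Cmod (Cminus (Cminus (cis x) 1) (Cmult ci (RtoC x))) <= x ^ 2.
Proof.
have := cis_Ei 1 x; rewrite Rmult_1_l => ->.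
have -> : Cminus (Cmult (Cmult ci (RtoC x)) (Ei 1 x)) (Cmult ci (RtoC x)) =
   Cmult (Cmult ci (RtoC x)) (Cminus (Ei 1 x) (Ei 1 0)) by rewrite Ei_at0; ring.
rewrite !Cmod_mult Cmod_ci Rmult_1_l Cmod_R.
have := Ei_lip 1 x 0 ltac:(lra); rewrite Rminus_0_r => H.
have := Rmult_le_compat_l _ _ _ (Rabs_pos x) H.
by rewrite -(pow2_abs x); lra.
Qed.

(** Three errors add up: freezing the nonlinearity and linearising [cis theta], both of order
    [tau^2], and the symbol [Esym]. The linear terms cancel [resF] exactly because mass and momentum
    are those of [v t] itself. *)
Lemma local_error s th B : 1 <= s -> 0 <= th <= 1 -> th + 1/2 < s -> 0 <= B -> exists K, 0 < K /\
  forall v tau t, 0 < tau <= 1 -> twisted_on s v B t (t + tau) ->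
  HS s (fun k => Cminus (v (t + tau) k) (PsiV tau (massR (v t)) (momR (v t)) t (v t) k))
    (K * Rpower tau (1 + th)).
Proof.
move=> Hs Hth Hst B0.
have [K1 [K10 HK1]] := twisted_incr s Hs; have [K2 [K20 HK2]] := TB_Esym s th Hs Hth Hst.
have B3 : 0 <= B ^ 3 by exact: pow_le.
have B5 : 0 <= B ^ 5 by exact: pow_le.
pose L := 2 * (B ^ 2 + B * B).
exists (K1 * B ^ 5 + K2 * B ^ 3 + L ^ 2 * B + 1); split.
  have : 0 <= L ^ 2 * B by apply: Rmult_le_pos => //; exact: pow2_ge_0.
  by nra.
move=> v tau t Ht Hv; have [Hf _] := Hv t ltac:(lra).
have Hf1 : HS 1 (v t) B by apply: HS_le Hf.
have Hf0 : L2 (absF (v t)) B by apply/HS_0; apply: HS_le Hf; lra.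
have [_ E1] := HK1 v B t tau ltac:(lra) Hv.
have E2 := HK2 tau t (v t) B ltac:(lra) Hf.
set m0 := massR (v t); set q := momR (v t).
have Hm0 : Rabs m0 <= B ^ 2 by rewrite Rabs_pos_eq; [exact: massR_le | exact: massR_ge0 Hf0].
have Hq : Rabs q <= B * B by exact: (proj2 (summable_mom _ _ _ (conj Hf0 Hf1))).
pose d k := Cminus (Cminus (cis (theta tau m0 q k)) 1) (Cmult ci (RtoC (theta tau m0 q k))).
have Hd : forall k, Cmod (d k) <= (tau * L) ^ 2.
  move=> k; apply: Rle_trans (cis_taylor _) _; rewrite -pow2_abs; apply: pow_incr; split; first exact: Rabs_pos.
  apply: Rle_trans (theta_bound tau m0 q k ltac:(lra)) _; apply: Rmult_le_compat_l; first lra.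
  rewrite /L; lra.
have E3 := HS_diag s d _ _ _ (pow2_ge_0 _) Hd Hf.
have := HS_minus _ _ _ _ _ (HS_minus _ _ _ _ _ E1 E2) E3 => HT.
apply: L2_mono (HS_ext _ _ _ _ _ HT).
  have Hp : tau ^ 2 <= Rpower tau (1 + th).
    rewrite -(Rpower_pow 2 tau); last lra.
    rewrite /Rpower; have Hl : ln tau <= 0.
      by rewrite -ln_1; case: (Rle_lt_or_eq_dec tau 1 ltac:(lra)) => [h|->]; [left; apply: ln_increasing; lra | right].
    have : INR 2 * ln tau <= (1 + th) * ln tau by rewrite /=; nra.
    by case=> [h|h]; [left; exact: exp_increasing | rewrite h; right].
  have P0 : 0 < Rpower tau (1 + th) by exact: exp_pos.
  have -> : (tau * L) ^ 2 * B = L ^ 2 * B * tau ^ 2 by ring.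
  have h1 := Rmult_le_compat_l (K1 * B ^ 5) _ _ ltac:(nra) Hp.
  have h2 := Rmult_le_compat_l (L ^ 2 * B) _ _ ltac:(apply: Rmult_le_pos => //; exact: pow2_ge_0) Hp.
  lra.
move=> k.
have EY := Yst_decomp tau m0 q t (v t) k B B ltac:(lra) (conj Hf0 Hf1).
have -> : PsiV tau m0 q t (v t) k = Cplus (v t k) (Yst tau m0 q t (v t) k) by rewrite /Yst; ring.
rewrite EY /d /resF -/m0 -/q /theta; case: (Z.eqb_spec k 0) => Hk.
- have -> : RtoC (tau * (- 2 * m0)) = Copp (RtoC (2 * tau * m0)) by rewrite -RtoC_opp; congr RtoC; ring.
  ring.
- have -> : RtoC (tau * (- 2 * m0 + 2 * q / IZR k)) = Copp (RtoC (2 * tau * (m0 - q / IZR k))).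
    by rewrite -RtoC_opp; congr RtoC; field; apply: not_0_IZR.
  ring.
Qed.

(** * Geometric sums and their resonances *)

Fixpoint Gs (n : nat) (x : R) : C :=
  match n with O => RtoC 0 | S m => Cplus (Gs m x) (cis (INR m * x)) end.

Lemma Gs_le n x : Cmod (Gs n x) <= INR n.
Proof.
elim: n => [|n IH]; first by rewrite /= Cmod_0; lra.
rewrite S_INR [Gs _ _]/=; apply: Rle_trans (Cmod_triangle _ _) _; rewrite Cmod_cis; lra.
Qed.

(** Closed form of the geometric sum; with the argument [2 * y] the denominator has modulus
    [2 * Rabs (sin y)], and the numerator is at most [2]. *)
Lemma Gs_sin n y : Cmod (Gs n (2 * y)) * Rabs (sin y) <= 1.
Proof.
have E : Cmult (Gs n (2 * y)) (Cminus 1 (cis (2 * y))) = Cminus 1 (cis (INR n * (2 * y))).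
  elim: n => [|n IH]; first by rewrite /= Rmult_0_l cis_0; ring.
  rewrite [Gs _ _]/= S_INR.
  have -> : (INR n + 1) * (2 * y) = INR n * (2 * y) + 2 * y by ring.
  rewrite cis_plus; transitivity (Cplus (Cmult (Gs n (2 * y)) (Cminus 1 (cis (2 * y))))
    (Cmult (cis (INR n * (2 * y))) (Cminus 1 (cis (2 * y))))); first by ring.
  rewrite IH; ring.
have E2 : Cminus 1 (cis (2 * y)) = Cmult (Cmult (RtoC (-2)) (Cmult ci (RtoC (sin y)))) (cis y).
  rewrite /cis cos_2a_sin sin_2a.
  by apply: injective_projections; rewrite /=; ring.
have := f_equal Cmod E; rewrite E2 !Cmod_mult Cmod_ci Cmod_cis !Cmod_R => H.
have := Cmod_triangle 1 (Copp (cis (INR n * (2 * y)))).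
rewrite Cmod_opp Cmod_1 Cmod_cis -/(Cminus 1 _) -H Rabs_left; lra.
Qed.

(** A crude slope suffices: [cos >= 1/2] on [[0, 1]] gives slope [1/2] there, and monotonicity
    together with [PI <= 4] covers the rest. *)
Lemma sin_lower y : 0 <= y <= PI / 2 -> y / 4 <= sin y.
Proof.
move=> Hy; have p1 := PI2_3_2; have p4 := PI_4.
have low : forall z, 0 <= z <= 1 -> z / 2 <= sin z.
  move=> z Hz; have [c [Ec Hc]] : exists c, sin z - sin 0 = cos c * (z - 0) /\ 0 <= c <= z.
    have [c [Hc E]] := MVT_gen sin 0 z cos ltac:(by move=> *; apply: is_derive_sin)
      ltac:(by move=> *; exact: continuity_sin).
    by exists c; split => //; move: Hc; rewrite Rmin_left ?Rmax_right; lra.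
  rewrite sin_0 in Ec.
  have : 1 / 2 <= cos c by rewrite -cos_PI3; apply: cos_decr_1; lra.
  nra.
case: (Rle_dec y 1) => H1; first by have := low y ltac:(lra); lra.
have : sin 1 <= sin y by apply: sin_incr_1; lra.
have := low 1 ltac:(lra); lra.
Qed.

Lemma Rabs_sin_lower y : Rabs y <= 1 -> Rabs y / 4 <= Rabs (sin y).
Proof.
move=> H; have p1 := PI2_3_2.
have := sin_lower (Rabs y) ltac:(have := Rabs_pos y; lra).
move=> h; apply: Rle_trans h _; apply: Rle_trans (Rle_abs _) _.
apply: Req_le; case: (Rle_dec 0 y) => h; first by rewrite (Rabs_pos_eq y).
by rewrite (Rabs_left y) ?sin_neg ?Rabs_Ropp; lra.
Qed.

(** [kap0 T x b] bounds [tau |Gs n|] for [n tau <= T] and [x = tau |a|]. *)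
Definition kap0 (T x y : R) : R := if Rle_dec (T * Rabs (sin y)) x is left _ then T else x / Rabs (sin y).

Lemma kap0_le T x y : 0 <= T -> 0 <= x -> 0 <= kap0 T x y <= T.
Proof.
move=> HT Hx; rewrite /kap0; case: Rle_dec => H; first lra.
have s0 := Rabs_pos (sin y).
have sp : 0 < Rabs (sin y).
  by case: (Rle_lt_or_eq_dec _ _ s0) => // E; exfalso; apply: H; rewrite -E; lra.
split; first by apply: Rmult_le_pos => //; left; exact: Rinv_0_lt_compat.
by apply: (Rmult_le_reg_r (Rabs (sin y))) => //; rewrite /Rdiv Rmult_assoc Rinv_l; lra.
Qed.

Lemma kap0_sin T x y z : 0 <= x -> 0 < z -> z <= Rabs (sin y) -> kap0 T x y <= x / z.
Proof.
move=> Hx z0 Hz; rewrite /kap0; case: Rle_dec => H.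
- apply: (Rmult_le_reg_r z) => //; rewrite /Rdiv Rmult_assoc Rinv_l; last lra.
  rewrite Rmult_1_r; case: (Rle_dec 0 T) => HT; last by nra.
  by apply: Rle_trans H; apply: Rmult_le_compat_l.
- by apply: Rmult_le_compat_l => //; apply: Rinv_le_contravar.
Qed.

Lemma Gs_kap0 T tau n x y : 0 < tau -> INR n * tau <= T -> tau <= x -> tau * Cmod (Gs n (2 * y)) <= kap0 T x y.
Proof.
move=> Ht Hn Hx; have g1 := Gs_le n (2 * y); have g2 := Gs_sin n y; have g0 := Cmod_ge_0 (Gs n (2 * y)).
rewrite /kap0; case: Rle_dec => H.
- by apply: Rle_trans Hn; rewrite Rmult_comm; apply: Rmult_le_compat_r; lra.
- have s0 := Rabs_pos (sin y).
  have sp : 0 < Rabs (sin y).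
    by case: (Rle_lt_or_eq_dec _ _ s0) => // E; exfalso; apply: H; rewrite -E; lra.
  apply: (Rmult_le_reg_r (Rabs (sin y))) => //; rewrite /Rdiv [X in _ <= X]Rmult_assoc Rinv_l; last lra.
  nra.
Qed.

Definition nfl (x : R) : nat := if Rle_dec 0 x is left H then proj1_sig (nfloor_ex x H) else 0%nat.

Lemma nfl_spec x : 0 <= x -> INR (nfl x) <= x < INR (nfl x) + 1.
Proof. move=> H; rewrite /nfl; case: Rle_dec => // H'; by case: nfloor_ex. Qed.

(** For fixed step [x < 1], a positive integer [b] is determined by the multiple [PI * l] just below
    [x * b] and by the number of steps separating the two; the sum of [kap0^2] over one period is
    therefore bounded, and the weight [(x b)^-s] makes the sum over [l] converge. *)
Lemma kap0_sum_small T s : 0 <= T -> 1 < s -> exists K, 0 < K /\ forall x, 0 < x < 1 ->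
  Bnd (fun b : nat => if Rlt_dec 1 (x * INR b) is left _ then
     kap0 T x (x * INR b) ^ 2 * Rpower (x * INR b) (- s) else 0) K.
Proof.
move=> HT Hs.
(* [fst t] counts periods, [snd t] the steps from a multiple of [PI]. [T ^ 2] serves distance zero,
   [64] the distances [i >= 1] since [(4 / i)^2 <= 64 / (i + 1)^2], and [Rpower 2 s] pays for
   replacing [x b] by [(l + 1) / 2]. *)
pose h (t : nat * nat) := (T ^ 2 + 64) * Rpower 2 s * Rpower (INR (S (fst t))) (- s) * Rpower (INR (S (snd t))) (- 2).
pose K := (T ^ 2 + 64) * Rpower 2 s * ((1 + / (s - 1)) * (1 + / (2 - 1))).
have T2 : 0 <= T ^ 2 by exact: pow2_ge_0.
have P2 : 0 < Rpower 2 s by exact: exp_pos.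
have c0 : 0 < (T ^ 2 + 64) * Rpower 2 s by apply: Rmult_lt_0_compat; lra.
have is0 : 0 < / (s - 1) by apply: Rinv_0_lt_compat; lra.
have i20 : 0 < / (2 - 1) by apply: Rinv_0_lt_compat; lra.
have K0 : 0 < K by rewrite /K; repeat apply: Rmult_lt_0_compat; lra.
have h0 : forall t, 0 <= h t.
  by move=> t; rewrite /h; left; repeat apply: Rmult_lt_0_compat; try lra; exact: exp_pos.
have Hh : Bnd h K.
  apply: (Bnd_prod _ (fun l => ((T ^ 2 + 64) * Rpower 2 s * (1 + / (2 - 1))) * Rpower (INR (S l)) (- s))) => //.
  - move=> l; rewrite /h; cbn [fst snd].
    have Hp := exp_pos (- s * ln (INR (S l))); rewrite -/(Rpower (INR (S l)) (- s)) in Hp.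
    have := Bnd_scal ((T ^ 2 + 64) * Rpower 2 s * Rpower (INR (S l)) (- s)) _ _
       ltac:(left; apply: Rmult_lt_0_compat => //) (Bnd_Rpower_nat 2 ltac:(lra)).
    apply: Bnd_mono; apply: Req_le; ring.
  - have -> : K = ((T ^ 2 + 64) * Rpower 2 s * (1 + / (2 - 1))) * (1 + / (s - 1)) by rewrite /K; ring.
    apply: Bnd_scal; last exact: Bnd_Rpower_nat.
    by apply: Rmult_le_pos; lra.
(* Two copies, because the nearest multiple of [PI] may lie below or above [x b]. *)
exists (K + K); split; first lra.
move=> x Hx.
have p1 := PI2_3_2; have p0 : 0 < PI by lra.
pose l b := nfl (x * INR b / PI).
have Hl : forall b, INR (l b) * PI <= x * INR b < (INR (l b) + 1) * PI.
  move=> b; have hb : 0 <= x * INR b by apply: Rmult_le_pos; [lra | exact: pos_INR].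
  have [h1 h2] := nfl_spec (x * INR b / PI) ltac:(apply: Rmult_le_pos => //; left; exact: Rinv_0_lt_compat).
  split.
  - have := Rmult_le_compat_r PI _ _ ltac:(lra) h1; rewrite /l.
    by have -> : x * INR b / PI * PI = x * INR b by field; lra.
  - have := Rmult_lt_compat_r PI _ _ ltac:(lra) h2; rewrite /l.
    by have -> : x * INR b / PI * PI = x * INR b by field; lra.
pose y b := x * INR b - INR (l b) * PI.
have Hy : forall b, 0 <= y b < PI by move=> b; have := Hl b; rewrite /y; lra.
pose j b := nfl (y b / x); pose j' b := nfl ((PI - y b) / x).
have Hj : forall b, INR (j b) * x <= y b < (INR (j b) + 1) * x.
  move=> b; have [h1 h2] := nfl_spec (y b / x) ltac:(apply: Rmult_le_pos; [case: (Hy b) => ? _; lra | left; apply: Rinv_0_lt_compat; lra]).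
  split.
  - have := Rmult_le_compat_r x _ _ ltac:(lra) h1; by have -> : y b / x * x = y b by field; lra.
  - have := Rmult_lt_compat_r x _ _ ltac:(lra) h2; by have -> : y b / x * x = y b by field; lra.
have Hj' : forall b, INR (j' b) * x <= PI - y b < (INR (j' b) + 1) * x.
  move=> b; have [h1 h2] := nfl_spec ((PI - y b) / x) ltac:(apply: Rmult_le_pos; [case: (Hy b) => ? ?; lra | left; apply: Rinv_0_lt_compat; lra]).
  split.
  - have := Rmult_le_compat_r x _ _ ltac:(lra) h1; by have -> : (PI - y b) / x * x = PI - y b by field; lra.
  - have := Rmult_lt_compat_r x _ _ ltac:(lra) h2; by have -> : (PI - y b) / x * x = PI - y b by field; lra.
(* Integers whose multiples of [x] differ by less than [x] coincide; both numberings by period and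
   distance are injective for this reason. *)
have close : forall b b', x * INR b < x * INR b' + x -> x * INR b' < x * INR b + x -> b = b'.
  move=> b b' H1 H2.
  have h1 : INR b < INR b' + 1 by apply: (Rmult_lt_reg_l x); lra.
  have h2 : INR b' < INR b + 1 by apply: (Rmult_lt_reg_l x); lra.
  have := h1; have := h2; rewrite -!S_INR => /INR_lt g2 /INR_lt g1; lia.
have I1 : Bnd (fun b => h (l b, j b)) K.
  apply: (Bnd_inj (fun b => (l b, j b)) h) => // [b b' [E1 E2] | b]; last lra.
  have := Hj b; have := Hj b'; rewrite E2 /y E1 => *; apply: close; lra.
have I2 : Bnd (fun b => h (l b, j' b)) K.
  apply: (Bnd_inj (fun b => (l b, j' b)) h) => // [b b' [E1 E2] | b]; last lra.
  have := Hj' b; have := Hj' b'; rewrite E2 /y E1 => *; apply: close; lra.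
apply: Bnd_le (Bnd_plus _ _ _ _ I1 I2) => b.
have hl := h0 (l b, j b); have hl' := h0 (l b, j' b).
case: Rlt_dec => Hb; last lra.
have sinE : Rabs (sin (x * INR b)) = sin (y b).
  have -> : x * INR b = y b + INR (l b) * PI by rewrite /y; ring.
  have sy : 0 <= sin (y b) by apply: sin_ge_0; case: (Hy b) => *; lra.
  elim: (l b) => [|m IH]; first by rewrite Rmult_0_l Rplus_0_r Rabs_pos_eq.
  have -> : y b + INR (S m) * PI = (y b + INR m * PI) + PI by rewrite S_INR; ring.
  by rewrite neg_sin Rabs_Ropp.
have pw : Rpower (x * INR b) (- s) <= Rpower 2 s * Rpower (INR (S (l b))) (- s).
  have Sl : 0 < INR (S (l b)) by apply: lt_0_INR; lia.
  have -> : Rpower 2 s * Rpower (INR (S (l b))) (- s) = Rpower (INR (S (l b)) / 2) (- s).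
    rewrite -(Rpower_mult_distr (INR (S (l b))) (/ 2)) //; last lra.
    rewrite Rmult_comm; congr Rmult; rewrite /Rpower ln_Rinv; last lra.
    by congr exp; ring.
  rewrite !Rpower_Ropp; apply: Rinv_le_contravar; first exact: exp_pos.
  apply: Rle_Rpower_l; first lra.
  rewrite S_INR; have := Hl b; have := pos_INR (l b).
  case E : (l b) => [|m]; first by rewrite /=; lra.
  rewrite S_INR; have := pos_INR m; nra.
have kb : forall i, INR i * x / 4 <= sin (y b) ->
    kap0 T x (x * INR b) ^ 2 <= (T ^ 2 + 64) * Rpower (INR (S i)) (- 2).
  move=> i Hi; have [k0 kT] := kap0_le T x (x * INR b) HT ltac:(lra).
  have -> : Rpower (INR (S i)) (- 2) = / INR (S i) ^ 2.
    rewrite Rpower_Ropp; congr Rinv; rewrite -(Rpower_pow 2); first by congr Rpower; rewrite /=; ring.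
    by apply: lt_0_INR; lia.
  case: i Hi => [|i] Hi.
    have -> : INR 1 ^ 2 = 1 by rewrite /=; ring.
    rewrite Rinv_1 Rmult_1_r; have : kap0 T x (x * INR b) ^ 2 <= T ^ 2 by apply: pow_incr.
    lra.
  have Pi : 0 < INR (S i) by apply: lt_0_INR; lia.
  have := kap0_sin T x (x * INR b) (INR (S i) * x / 4) ltac:(lra) ltac:(nra) ltac:(rewrite sinE; lra).
  have -> : x / (INR (S i) * x / 4) = 4 / INR (S i) by field; lra.
  move=> Hk; have : kap0 T x (x * INR b) ^ 2 <= (4 / INR (S i)) ^ 2 by apply: pow_incr.
  move=> H; apply: Rle_trans H _.
  have P1 : 1 <= INR (S i) by rewrite S_INR; have := pos_INR i; lra.
  apply: (Rmult_le_reg_r (INR (S i) ^ 2 * INR (S (S i)) ^ 2)).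
    by apply: Rmult_lt_0_compat; apply: pow_lt => //; apply: lt_0_INR; lia.
  have P3 : 0 < INR (S (S i)) by apply: lt_0_INR; lia.
  have -> : (4 / INR (S i)) ^ 2 * (INR (S i) ^ 2 * INR (S (S i)) ^ 2) = 16 * INR (S (S i)) ^ 2 by field; lra.
  have -> : (T ^ 2 + 64) * / INR (S (S i)) ^ 2 * (INR (S i) ^ 2 * INR (S (S i)) ^ 2) = (T ^ 2 + 64) * INR (S i) ^ 2 by field; lra.
  rewrite (S_INR (S i)); have : (INR (S i) + 1) ^ 2 <= 4 * INR (S i) ^ 2 by nra.
  have := pow2_ge_0 (INR (S i)); nra.
have fin : forall i, INR i * x / 4 <= sin (y b) ->
   kap0 T x (x * INR b) ^ 2 * Rpower (x * INR b) (- s) <= h (l b, i).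
  move=> i Hi; have k2 := kb i Hi.
  have := Rmult_le_compat _ _ _ _ (pow2_ge_0 (kap0 T x (x * INR b))) (Rlt_le _ _ (exp_pos _)) k2 pw.
  rewrite -/(Rpower (x * INR b) (- s)) /h [fst _]/= [snd _]/=; lra.
case: (Rle_dec (y b) (PI / 2)) => Hy2.
- have := fin (j b) ltac:(have := sin_lower (y b) ltac:(have := Hy b; lra); have := Hj b; lra); lra.
- have := fin (j' b) ltac:(rewrite -sin_PI_x; have := sin_lower (PI - y b) ltac:(have := Hy b; lra); have := Hj' b; lra); lra.
Qed.

(** Kernel of the region [tau |a b| > 1]: the bound for the geometric sum, divided by
    [(tau |a|)^th1 |b|^th2]. The weight [hiw] restores the powers of [a] and [b], and the remaining
    [tau^th1] is the rate. *)
Definition Kt (T tau th1 th2 : R) (a b : Z) : R :=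
  if Rlt_dec 1 (tau * Rabs (IZR a) * Rabs (IZR b)) is left _ then
    kap0 T (tau * Rabs (IZR a)) (tau * Rabs (IZR a) * Rabs (IZR b)) *
    (Rpower (tau * Rabs (IZR a)) (- th1) * Rpower (Rabs (IZR b)) (- th2))
  else 0.

(** For fixed [a] the spacing [x = tau |a|] decides. If [x < 1], resonances are counted,
    [th1 <= th2] allowing [x^(- 2 th1)] to be replaced by [x^(- 2 th2)]; otherwise the trivial bound
    [T] suffices, as [2 th2 > 1] makes the powers of [b] summable. *)
Lemma Kt_schur T th1 th2 : 0 <= T -> 0 <= th1 <= th2 -> 1 < 2 * th2 -> exists K, 0 < K /\
  forall tau, 0 < tau -> forall a, L2 (Kt T tau th1 th2 a) K.
Proof.
move=> HT Hth Hth2; have [K1 [K10 HK1]] := kap0_sum_small T (2 * th2) HT Hth2.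
pose K2 := T ^ 2 * (1 + / (2 * th2 - 1)).
have T2 : 0 <= T ^ 2 by exact: pow2_ge_0.
have i0 : 0 < / (2 * th2 - 1) by apply: Rinv_0_lt_compat; lra.
have K20 : 0 <= K2 by apply: Rmult_le_pos; lra.
exists (sqrt (2 * (K1 + K2))); split; first by apply: sqrt_lt_R0; lra.
move=> tau Ht a; set x := tau * Rabs (IZR a).
have x0 : 0 <= x by apply: Rmult_le_pos; [lra | exact: Rabs_pos].
have kp : forall b, 0 <= Kt T tau th1 th2 a b.
  move=> b; rewrite /Kt; case: Rlt_dec => _; last lra.
  by apply: Rmult_le_pos; [case: (kap0_le T x (x * Rabs (IZR b)) HT x0) | left; apply: Rmult_lt_0_compat; exact: exp_pos].
split => //; split; first exact: sqrt_pos.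
rewrite pow2_sqrt; last lra.
have sq : forall z t, 0 < z -> Rpower z (- t) ^ 2 = Rpower z (- (2 * t)).
  move=> z t z0; rewrite /pow Rmult_1_r -Rpower_plus; congr Rpower; ring.
pose g (b : nat) := if Rlt_dec 1 (x * INR b) is left _ then
    (kap0 T x (x * INR b)) ^ 2 * (Rpower x (- (2 * th1)) * Rpower (INR b) (- (2 * th2))) else 0.
have g0 : forall b, 0 <= g b.
  move=> b; rewrite /g; case: Rlt_dec => _; last lra.
  by apply: Rmult_le_pos; [exact: pow2_ge_0 | left; apply: Rmult_lt_0_compat; exact: exp_pos].
apply: (Bnd_nat_Z g) => //.
  move=> b; rewrite /Kt /g -/x.
  have -> : INR (Z.abs_nat b) = Rabs (IZR b) by rewrite INR_IZR_INZ Zabs2Nat.id_abs abs_IZR.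
  case: Rlt_dec => Hb; last by rewrite (_ : 0 ^ 2 = 0); [lra | ring].
  have xp : 0 < x by case: (Rle_lt_or_eq_dec _ _ x0) => // E; rewrite -E in Hb; lra.
  have bp : 0 < Rabs (IZR b) by case: (Rle_lt_or_eq_dec _ _ (Rabs_pos (IZR b))) => // E; rewrite -E in Hb; lra.
  by rewrite !Rpow_mult_distr !sq //; lra.
case: (Rlt_dec x 1) => Hx.
- case: (Rle_lt_or_eq_dec _ _ x0) => [xp|E]; last first.
    apply: (Bnd_le _ (fun _ => 0)).
      by move=> b; rewrite /g -E; case: Rlt_dec => H; lra.
    by apply: Bnd_mono (@Bnd_zero nat); lra.
  apply: Bnd_mono (Bnd_le _ _ _ _ (HK1 x ltac:(lra))); first lra.
  move=> b; rewrite /g; case: Rlt_dec => Hb; last lra.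
  apply: Rmult_le_compat_l; first exact: pow2_ge_0.
  have bp : 0 < INR b.
    by case: (Rle_lt_or_eq_dec _ _ (pos_INR b)) => // E; rewrite -E in Hb; lra.
  rewrite -Rpower_mult_distr //; apply: Rmult_le_compat_r; first by left; exact: exp_pos.
  rewrite /Rpower; have Hl : ln x < 0 by rewrite -ln_1; apply: ln_increasing.
  have : - (2 * th1) * ln x <= - (2 * th2) * ln x by nra.
  by case=> [h|h]; [left; exact: exp_increasing | rewrite h; right].
- pose f (b : nat) := T ^ 2 * Rpower (INR (S b)) (- (2 * th2)).
  have Hf : Bnd f K2 by apply: Bnd_scal => //; exact: Bnd_Rpower_nat.
  move=> l Nl.
  pose dec (n : nat) := match n with O => false | S _ => true end.
  apply: Rle_trans (_ : lsum f (map Nat.pred (filter dec l)) <= _).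
    rewrite lsum_map; elim: (l) => [|n l' IH]; first by rewrite /=; lra.
    case: n => [|n]; rewrite [filter _ _]/= [lsum _ (_ :: l')]/=.
      have -> : g 0%nat = 0 by rewrite /g Rmult_0_r; case: Rlt_dec => H; lra.
      lra.
    rewrite [X in _ <= X]/= -/(INR (S n)); apply: Rplus_le_compat => //.
    rewrite /g /f; case: Rlt_dec => _; last first.
      by apply: Rmult_le_pos => //; left; exact: exp_pos.
    apply: Rmult_le_compat; [exact: pow2_ge_0 | by left; apply: Rmult_lt_0_compat; exact: exp_pos | |].
      by apply: pow_incr; apply: kap0_le.
    have px : Rpower x (- (2 * th1)) <= 1.
      rewrite Rpower_Ropp -Rinv_1; apply: Rinv_le_contravar; first lra.
      rewrite -(Rpower_O x); last lra.
      by apply: Rle_Rpower; lra.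
    have := exp_pos (- (2 * th2) * ln (INR (S n))); rewrite -/(Rpower _ _); nra.
  apply: Rle_trans (_ : K2 <= _); last lra.
  apply: Hf; apply: NoDup_map_NoDup_ForallPairs; last exact: NoDup_filter.
  move=> [|n] [|m] /filter_In [_ H1] /filter_In [_ H2] //= E; by rewrite E.
Qed.

(** * The time-summed local error form *)

(** Makes the kernel insensitive to the sign change that [Quad_swap] produces. *)
Definition even2 (kap : Z -> Z -> R) : Prop :=
  (forall a b, kap (- a)%Z b = kap a b) /\ (forall a b, kap a (- b)%Z = kap a b).

Lemma Quad_kap_ext kap kap' A X Y V S : (forall a b, kap a b = kap' a b) ->
  Quad kap A X Y V S -> Quad kap' A X Y V S.
Proof. by move=> H; apply: Bnd_le => t; rewrite /quad H; exact: Rle_refl. Qed.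

Lemma Quad_schur_2 kap c A X Y V a x y v : even2 kap ->
  (forall m, L2 (kap m) c) -> L2 A a -> L1 X x -> L2 Y y -> L2 V v ->
  Quad kap A X Y V (x * (a * c * (y * v))).
Proof.
move=> [He1 He2] Hk HA HX HY HV; apply: Quad_swap.
apply: Quad_kap_ext (fun a b => eq_sym (He1 a b)) _.
by apply: Bnd_mono (Quad_schur _ _ _ _ _ _ _ _ _ _ Hk HX HA HV HY); apply: Req_le; ring.
Qed.

Lemma Quad_schur_3 kap c A X Y V a x y v : even2 kap ->
  (forall m, L2 (kap m) c) -> L2 A a -> L2 X x -> L1 Y y -> L2 V v ->
  Quad kap A X Y V (y * (a * c * (x * v))).
Proof.
move=> [He1 He2] Hk HA HX HY HV; apply: Quad_swap23; apply: Quad_swap; apply: Quad_swap23.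
apply: Quad_kap_ext (fun a b => eq_sym (He2 a b)) _.
by apply: Bnd_mono (Quad_schur _ _ _ _ _ _ _ _ _ _ Hk HY HV HA HX); apply: Req_le; ring.
Qed.

Definition wq (s : R) (f : F) : Z -> R := fun k => W s k * absF f k.

Lemma wq_ge0 s f k : 0 <= wq s f k.
Proof. by apply: Rmult_le_pos; [left; exact: W_pos | exact: Cmod_ge_0]. Qed.

(** Dividing by [<k>] turns [l2] into [l1], so the output factor can be placed in [l1] at the cost
    of the mass norm only. *)
Lemma wq_inv_L1 : exists K, 0 < K /\ forall f A, L2 (absF f) A -> L1 (wq (- (1)) f) (K * A).
Proof.
have [K [K0 HK]] := W_L2 1 ltac:(lra); exists K; split => // f A Hf; exact: L2_CS HK Hf.
Qed.

Definition hiw (th1 th2 : R) (t : Z * (Z * Z)) : R :=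
  jp (fst (snd t) + snd (snd t) - fst t) / jp (fst t) *
  (W th1 (fst (snd t) - fst t) * W th2 (snd (snd t) - fst t)).

(** What is needed of the exponents in the resonant region: the weight
    [(p / k) a^th1 b^th2] is absorbed by two [H^s] norms. *)
Definition high_ok (s th1 th2 : R) : Prop := exists K, 0 < K /\ forall kap c, even2 kap ->
  (forall m, L2 (kap m) c) -> forall mu D r0 r1 r2 r3 f0 f1 f2 f3,
  cls s (r0 * mu) (r0 * D) f0 -> cls s (r1 * mu) (r1 * D) f1 ->
  cls s (r2 * mu) (r2 * D) f2 -> cls s (r3 * mu) (r3 * D) f3 ->
  Bnd (fun t => hiw th1 th2 t * quad kap (absF f0) (absF f1) (absF f2) (absF f3) t)
    (K * c * ((r0 * r1 * r2 * r3) * (mu ^ 2 * D ^ 2))).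

Lemma amgm3 u v w : 0 <= u -> 0 <= v -> 0 <= w -> u * v * w <= u ^ 3 + v ^ 3 + w ^ 3.
Proof.
move=> u0 v0 w0.
have : 0 <= (u + v + w) * ((u - v) ^ 2 + (v - w) ^ 2 + (u - w) ^ 2).
  apply: Rmult_le_pos; first lra.
  by have := pow2_ge_0 (u - v); have := pow2_ge_0 (v - w); have := pow2_ge_0 (u - w); lra.
have : 0 <= u * v * w by repeat apply: Rmult_le_pos.
rewrite /pow; lra.
Qed.

(** The differences are bounded by [k2 + k] and [k3 + k]; a factor [k] cancels the [1 / k]. The
    worst term has three derivatives, on [k2], [k3] and [p], which must land on two factors so that
    the other two keep the mass norm. *)
Lemma high_ok_smooth s : 3 / 2 < s -> high_ok s 1 1.
Proof.
move=> Hs; have [K1 [K10 HK1]] := HS_L1 s 1 ltac:(lra); have [K2 [K20 HK2]] := wq_inv_L1.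
exists (3 * K2 + 3 * K1); split; first lra.
move=> kap c He Hk mu D r0 r1 r2 r3 f0 f1 f2 f3 [m0 d0] [m1 d1] [m2 d2] [m3 d3].
have h15 : forall f A, HS s f A -> L2 (wq (3/2) f) A by move=> f A; apply: HS_le; lra.
have h1 : forall f A, HS s f A -> L2 (wq 1 f) A by move=> f A; apply: HS_le; lra.
have kap0 : forall a b, 0 <= kap a b by move=> a b; case: (Hk a).
have Q1 := Quad_schur _ _ _ _ _ _ _ _ _ _ Hk (HK2 _ _ m0) (h15 _ _ d1) (h15 _ _ d2) m3.
have Q2 := Quad_schur _ _ _ _ _ _ _ _ _ _ Hk (HK2 _ _ m0) (h15 _ _ d1) m2 (h15 _ _ d3).
have Q3 := Quad_schur _ _ _ _ _ _ _ _ _ _ Hk (HK2 _ _ m0) m1 (h15 _ _ d2) (h15 _ _ d3).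
have Q4 := Quad_schur_2 _ _ _ _ _ _ _ _ _ _ He Hk m0 (HK1 _ _ d1) m2 (h1 _ _ d3).
have Q5 := Quad_schur_3 _ _ _ _ _ _ _ _ _ _ He Hk m0 m1 (HK1 _ _ d2) (h1 _ _ d3).
have Q6 := Quad_schur _ _ _ _ _ _ _ _ _ _ Hk (HK1 _ _ d0) m1 m2 (h1 _ _ d3).
have := Bnd_plus _ _ _ _ (Bnd_plus _ _ _ _ (Bnd_plus _ _ _ _ Q1 Q2) (Bnd_plus _ _ _ _ Q3 Q4)) (Bnd_plus _ _ _ _ Q5 Q6) => Q.
apply: Bnd_mono (Bnd_le _ _ _ _ Q); first by apply: Req_le; ring.
move=> [k [k2 k3]]; rewrite /hiw /quad /wq; cbn [fst snd]; set p := (k2 + k3 - k)%Z.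
rewrite !W_1 W_opp W_1.
have jk := jp_ge1 k; have j2 := jp_ge1 k2; have j3 := jp_ge1 k3; have jpp := jp_ge1 p.
set P := absF f0 k * (absF f1 k2 * absF f2 k3 * absF f3 p) * kap (k2 - k)%Z (k3 - k)%Z.
have P0 : 0 <= P by rewrite /P; repeat apply: Rmult_le_pos => //; exact: Cmod_ge_0.
have A1 : jp p / jp k * (jp (k2 - k) * jp (k3 - k)) <= jp p / jp k * ((jp k2 + jp k) * (jp k3 + jp k)).
  apply: Rmult_le_compat_l; first by apply: Rmult_le_pos; [lra | left; apply: Rinv_0_lt_compat; lra].
  by apply: Rmult_le_compat; try exact: jp_sub; have := jp_ge1 (k2 - k); have := jp_ge1 (k3 - k); lra.
(* Arithmetic-geometric mean for the three pairwise products of square roots: their product is the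
   left side, their cubes are products of two [W (3/2)]. This is where the threshold [3/2]
   enters. *)
have A2 : jp p * jp k2 * jp k3 <= W (3/2) k2 * W (3/2) k3 + W (3/2) k2 * W (3/2) p + W (3/2) k3 * W (3/2) p.
  have sqh : forall m, jp m = W (1/2) m ^ 2 by move=> m; rewrite /pow Rmult_1_r -W_plus -(W_1 m); congr W; field.
  have cuh : forall m, W (3/2) m = W (1/2) m ^ 3 by move=> m; rewrite /pow Rmult_1_r -!W_plus; congr W; field.
  have := amgm3 (W (1/2) k2 * W (1/2) k3) (W (1/2) k2 * W (1/2) p) (W (1/2) k3 * W (1/2) p)
    ltac:(left; apply: Rmult_lt_0_compat; exact: W_pos) ltac:(left; apply: Rmult_lt_0_compat; exact: W_pos)
    ltac:(left; apply: Rmult_lt_0_compat; exact: W_pos).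
  by rewrite !sqh !cuh /pow; lra.
have A3 : jp p / jp k * ((jp k2 + jp k) * (jp k3 + jp k)) =
   jp p * jp k2 * jp k3 * / jp k + jp p * jp k2 + jp p * jp k3 + jp p * jp k by field; lra.
have A4 := Rmult_le_compat_r (/ jp k) _ _ ltac:(left; apply: Rinv_0_lt_compat; lra) A2.
have := Rmult_le_compat_r P _ _ P0 (Rle_trans _ _ _ A1 (Req_le _ _ A3)).
have := Rmult_le_compat_r P _ _ P0 A4.
rewrite /P; lra.
Qed.

Lemma W_young th1 th2 a b : 0 <= th1 -> 0 <= th2 -> th1 + th2 = 1 -> W th1 a * W th2 b <= jp a + jp b.
Proof.
move=> h1 h2 E; have ja := jp_ge1 a; have jb := jp_ge1 b.
case: (Rle_dec (jp a) (jp b)) => H.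
- have : W th1 a <= W th1 b by apply: Rle_Rpower_l; lra.
  move=> h; have := Rmult_le_compat_r _ _ _ (Rlt_le _ _ (W_pos th2 b)) h.
  by rewrite -W_plus E W_1; lra.
- have : W th2 b <= W th2 a by apply: Rle_Rpower_l; lra.
  move=> h; have := Rmult_le_compat_l _ _ _ (Rlt_le _ _ (W_pos th1 a)) h.
  by rewrite -W_plus E W_1; lra.
Qed.

(** Since [th1 + th2 = 1], the weight in [a] and [b] costs a single derivative, on [k], [k2] or
    [k3]; on [k] it cancels the [1 / k]. With the derivative on [p], only two factors ever pay the
    [H^s] norm. *)
Lemma high_ok_rough s th1 th2 : 1 <= s -> 0 <= th1 -> 0 <= th2 -> th1 + th2 = 1 -> high_ok s th1 th2.
Proof.
move=> Hs h1 h2 E; have [K1 [K10 HK1]] := HS_L1 s 0 ltac:(lra); have [K2 [K20 HK2]] := wq_inv_L1.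
exists (2 * K1 + 2 * K2); split; first lra.
move=> kap c He Hk mu D r0 r1 r2 r3 f0 f1 f2 f3 [m0 d0] [m1 d1] [m2 d2] [m3 d3].
have hh : forall f A, HS s f A -> L2 (wq 1 f) A by move=> f A; apply: HS_le; lra.
have kap0 : forall a b, 0 <= kap a b by move=> a b; case: (Hk a).
have Q1 := Bnd_scal 2 _ _ ltac:(lra) (Quad_schur _ _ _ _ _ _ _ _ _ _ Hk (HK1 _ _ d0) m1 m2 (hh _ _ d3)).
have Q2 := Quad_schur _ _ _ _ _ _ _ _ _ _ Hk (HK2 _ _ m0) (hh _ _ d1) m2 (hh _ _ d3).
have Q3 := Quad_schur _ _ _ _ _ _ _ _ _ _ Hk (HK2 _ _ m0) m1 (hh _ _ d2) (hh _ _ d3).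
have := Bnd_plus _ _ _ _ (Bnd_plus _ _ _ _ Q1 Q2) Q3 => Q.
apply: Bnd_mono (Bnd_le _ _ _ _ Q); first by apply: Req_le; ring.
move=> [k [k2 k3]]; rewrite /hiw /quad /wq; cbn [fst snd]; set p := (k2 + k3 - k)%Z.
rewrite !W_1 W_opp W_1 W_0.
have jk := jp_ge1 k; have jpp := jp_ge1 p.
set P := absF f0 k * (absF f1 k2 * absF f2 k3 * absF f3 p) * kap (k2 - k)%Z (k3 - k)%Z.
have P0 : 0 <= P by rewrite /P; repeat apply: Rmult_le_pos => //; exact: Cmod_ge_0.
have A1 : W th1 (k2 - k) * W th2 (k3 - k) <= 2 * jp k + jp k2 + jp k3.
  by apply: Rle_trans (W_young _ _ _ _ h1 h2 E) _; have := jp_sub k2 k; have := jp_sub k3 k; lra.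
have q0 : 0 <= jp p / jp k by apply: Rmult_le_pos; [lra | left; apply: Rinv_0_lt_compat; lra].
have A2 := Rmult_le_compat_l _ _ _ q0 A1.
have A3 : jp p / jp k * (2 * jp k + jp k2 + jp k3) = 2 * jp p + / jp k * jp k2 * jp p + / jp k * jp k3 * jp p by field; lra.
have := Rmult_le_compat_r P _ _ P0 (Rle_trans _ _ _ A2 (Req_le _ _ A3)).
rewrite /P; lra.
Qed.

Lemma phi_ab k k2 k3 : phi k k2 k3 = 2 * (IZR (k2 - k) * IZR (k3 - k)).
Proof. rewrite /phi !mult_IZR !minus_IZR; ring. Qed.

Lemma abs_sin_abs x a b : Rabs (sin (x * Rabs a * Rabs b)) = Rabs (sin (x * a * b)).
Proof.
have h : forall y z, Rabs (sin (y * Rabs z)) = Rabs (sin (y * z)).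
  move=> y z; rewrite {2}/Rabs; case: Rcase_abs => _ //.
  by rewrite -Ropp_mult_distr_r sin_neg Rabs_Ropp.
have -> : x * Rabs a * Rabs b = x * Rabs b * Rabs a by ring.
rewrite h; have -> : x * Rabs b * a = x * a * Rabs b by ring.
exact: h.
Qed.

(** Pointwise bound of the time-summed symbol, for the frequencies off the resonant set [k = 0],
    [a = 0], [b = 0]; the geometric sum gains [1 / (tau a b)] when [tau |a b| <= 1]. *)
Lemma sum_symbol_low tau n k k2 k3 : 0 < tau -> k <> 0%Z -> (k2 - k <> 0)%Z -> (k3 - k <> 0)%Z ->
  tau * Rabs (IZR (k2 - k)) * Rabs (IZR (k3 - k)) <= 1 ->
  Cmod (Esym tau k k2 k3) * Cmod (Gs n (tau * phi k k2 k3)) <=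
  16 * tau * (jp (k2 + k3 - k) * (W (- (1)) k + 2 * W (- (1)) (k2 - k) + 2 * W (- (1)) (k3 - k)
     + 4 * (jp k * (W (- (1)) (k2 - k) * W (- (1)) (k3 - k))))).
Proof.
move=> Ht Hk Ha Hb Hlow; set p := (k2 + k3 - k)%Z; set a := (k2 - k)%Z in Ha Hlow *; set b := (k3 - k)%Z in Hb Hlow *.
have a1 := IZR_abs_ge1 _ Ha; have b1 := IZR_abs_ge1 _ Hb.
set A := Rabs (IZR a) in a1 Hlow *; set B := Rabs (IZR b) in b1 Hlow *.
have jk := jp_ge1 k; have jpp := jp_ge1 p.
have AB : 0 < tau * A * B by repeat apply: Rmult_lt_0_compat; lra.
have HG : Cmod (Gs n (tau * phi k k2 k3)) <= 4 / (tau * A * B).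
  have -> : tau * phi k k2 k3 = 2 * (tau * IZR a * IZR b) by rewrite phi_ab -/a -/b; ring.
  have := Gs_sin n (tau * IZR a * IZR b).
  have Hy : Rabs (tau * IZR a * IZR b) = tau * A * B by rewrite !Rabs_mult (Rabs_pos_eq tau) //; lra.
  have := Rabs_sin_lower (tau * IZR a * IZR b) ltac:(rewrite Hy; exact: Hlow); rewrite Hy => h1 h2.
  have g0 := Cmod_ge_0 (Gs n (2 * (tau * IZR a * IZR b))).
  apply: (Rmult_le_reg_r (tau * A * B / 4)); first lra.
  have -> : 4 / (tau * A * B) * (tau * A * B / 4) = 1 by field; lra.
  by apply: Rle_trans h2; apply: Rmult_le_compat_l.
have HE := Esym_bound1 tau k k2 k3 ltac:(lra).
have Hq := qsym_bound k p; rewrite -/p in HE.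
have q0 := Rabs_pos (qsym k p).
have k2A : Rabs (IZR k2) <= A + jp k.
  have -> : IZR k2 = IZR a + IZR k by rewrite /a minus_IZR; ring.
  by apply: Rle_trans (Rabs_triang _ _) _; have := jp_abs k; rewrite -/A; lra.
have k3B : Rabs (IZR k3) <= B + jp k.
  have -> : IZR k3 = IZR b + IZR k by rewrite /b minus_IZR; ring.
  by apply: Rle_trans (Rabs_triang _ _) _; have := jp_abs k; rewrite -/B; lra.
have inv : forall m, m <> 0%Z -> / Rabs (IZR m) <= 2 * W (- (1)) m.
  move=> m Hm; rewrite W_opp W_1; have h1 := jp_le_abs _ Hm; have h2 := jp_ge1 m; have h3 := IZR_abs_ge1 _ Hm.
  apply: (Rmult_le_reg_r (Rabs (IZR m) * jp m)); first nra.
  have -> : / Rabs (IZR m) * (Rabs (IZR m) * jp m) = jp m by field; lra.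
  by have -> : 2 * / jp m * (Rabs (IZR m) * jp m) = 2 * Rabs (IZR m) by field; lra.
have iA := inv _ Ha; have iB := inv _ Hb; rewrite -/A in iA; rewrite -/B in iB.
have HE2 : Cmod (Esym tau k k2 k3) <= 2 * (jp p / jp k) * (2 * tau ^ 2 * ((A + jp k) * (B + jp k))).
  apply: Rle_trans HE _; apply: Rmult_le_compat => //.
    have := pow2_ge_0 tau; have := Rmult_le_pos _ _ (Rabs_pos (IZR k2)) (Rabs_pos (IZR k3)) => h1 h2.
    by apply: Rmult_le_pos; lra.
  apply: Rmult_le_compat_l; first by have := pow2_ge_0 tau; lra.
  by apply: Rmult_le_compat => //; exact: Rabs_pos.
apply: Rle_trans (Rmult_le_compat _ _ _ _ (Cmod_ge_0 _) (Cmod_ge_0 _) HE2 HG) _.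
(* The geometric sum removes one [tau] and the product [A B]. Expanding [(1 + k / A) (1 + k / B)]
   gives the four kernels of the statement. *)
have -> : 2 * (jp p / jp k) * (2 * tau ^ 2 * ((A + jp k) * (B + jp k))) * (4 / (tau * A * B)) =
  16 * tau * (jp p * (/ jp k * ((1 + jp k * / A) * (1 + jp k * / B)))) by field; lra.
apply: Rmult_le_compat_l; first lra.
apply: Rmult_le_compat_l; first lra.
have iA0 : 0 < / A by apply: Rinv_0_lt_compat; lra.
have iB0 : 0 < / B by apply: Rinv_0_lt_compat; lra.
have Wa := W_pos (- (1)) a; have Wb := W_pos (- (1)) b.
have -> : W (- (1)) k + 2 * W (- (1)) a + 2 * W (- (1)) b + 4 * (jp k * (W (- (1)) a * W (- (1)) b)) =
  / jp k * ((1 + jp k * (2 * W (- (1)) a)) * (1 + jp k * (2 * W (- (1)) b))).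
  by rewrite (W_opp 1 k) W_1; field; lra.
apply: Rmult_le_compat_l; first by left; apply: Rinv_0_lt_compat; lra.
by apply: Rmult_le_compat; nra.
Qed.

(** The trivial size [2 tau] of the symbol suffices, its [tau] normalising the geometric sum.
    Inserting [1 = tau^th1 A^th1 (tau A)^(- th1)] and its analogue for [B] extracts the rate. *)
Lemma sum_symbol_high T th1 th2 tau n k k2 k3 : 0 < tau -> INR n * tau <= T -> 0 <= th1 -> 0 <= th2 ->
  (k2 - k <> 0)%Z -> (k3 - k <> 0)%Z ->
  1 < tau * Rabs (IZR (k2 - k)) * Rabs (IZR (k3 - k)) ->
  Cmod (Esym tau k k2 k3) * Cmod (Gs n (tau * phi k k2 k3)) <=
  4 * Rpower tau th1 * (hiw th1 th2 (k, (k2, k3)) * Kt T tau th1 th2 (k2 - k) (k3 - k)).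
Proof.
move=> Ht Hn h1 h2 Ha Hb Hhigh; rewrite /hiw; cbn [fst snd].
set p := (k2 + k3 - k)%Z; set a := (k2 - k)%Z in Ha Hhigh *; set b := (k3 - k)%Z in Hb Hhigh *.
have a1 := IZR_abs_ge1 _ Ha; have b1 := IZR_abs_ge1 _ Hb; have jk := jp_ge1 k; have jpp := jp_ge1 p.
rewrite /Kt; case: Rlt_dec => // _.
set A := Rabs (IZR a) in a1 Hhigh *; set B := Rabs (IZR b) in b1 Hhigh *.
have T0 : 0 <= T by apply: Rle_trans Hn; apply: Rmult_le_pos; [exact: pos_INR | lra].
have tA : 0 < tau * A by apply: Rmult_lt_0_compat; lra.
set kk := kap0 T (tau * A) (tau * A * B).
have HG : tau * Cmod (Gs n (tau * phi k k2 k3)) <= kk.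
  have -> : tau * phi k k2 k3 = 2 * (tau * IZR a * IZR b) by rewrite phi_ab -/a -/b; ring.
  have -> : kk = kap0 T (tau * A) (tau * IZR a * IZR b) by rewrite /kk /kap0 abs_sin_abs.
  apply: Gs_kap0 => //; nra.
have HE := Esym_bound2 tau k k2 k3 ltac:(lra); have Hq := qsym_bound k p; rewrite -/p in HE.
have k0 : 0 <= kk by case: (kap0_le T (tau * A) (tau * A * B) T0 (Rlt_le _ _ tA)).
have q0 : 0 <= jp p / jp k by apply: Rmult_le_pos; [lra | left; apply: Rinv_0_lt_compat; lra].
have g0 := Cmod_ge_0 (Gs n (tau * phi k k2 k3)).
have M1 : Cmod (Esym tau k k2 k3) * Cmod (Gs n (tau * phi k k2 k3)) <= 4 * (jp p / jp k) * kk.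
  apply: Rle_trans (Rmult_le_compat_r _ _ _ g0 HE) _.
  have -> : Rabs (qsym k p) * (2 * tau) * Cmod (Gs n (tau * phi k k2 k3)) =
    2 * (Rabs (qsym k p) * (tau * Cmod (Gs n (tau * phi k k2 k3)))) by ring.
  have -> : 4 * (jp p / jp k) * kk = 2 * (2 * (jp p / jp k) * kk) by ring.
  apply: Rmult_le_compat_l; first lra.
  by apply: Rmult_le_compat => //; [exact: Rabs_pos | apply: Rmult_le_pos; lra].
apply: Rle_trans M1 _.
have E1 : Rpower tau th1 * Rpower A th1 * Rpower (tau * A) (- th1) = 1.
  rewrite Rpower_mult_distr //; last lra.
  by rewrite -Rpower_plus Rplus_opp_r; apply: Rpower_O.
have E2 : Rpower B th2 * Rpower B (- th2) = 1 by rewrite -Rpower_plus Rplus_opp_r; apply: Rpower_O; lra.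
have wa : Rpower A th1 <= W th1 a by apply: Rle_Rpower_l => //; split; [lra | exact: jp_abs].
have wb : Rpower B th2 <= W th2 b by apply: Rle_Rpower_l => //; split; [lra | exact: jp_abs].
set pA := Rpower A th1 in E1 wa *; set pB := Rpower B th2 in E2 wb *.
set nA := Rpower (tau * A) (- th1) in E1 *; set nB := Rpower B (- th2) in E2 *.
set tt := Rpower tau th1 in E1 *.
have pos : 0 < pA /\ 0 < pB /\ 0 < nA /\ 0 < nB /\ 0 < tt by repeat split; exact: exp_pos.
have -> : 4 * (jp p / jp k) * kk = 4 * tt * (jp p / jp k * (pA * pB) * (kk * (nA * nB))).
  transitivity (4 * (jp p / jp k) * kk * (tt * pA * nA) * (pB * nB)); last by ring.
  by rewrite E1 E2; ring.
apply: Rmult_le_compat_l; first lra.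
apply: Rmult_le_compat_r; first by apply: Rmult_le_pos => //; left; apply: Rmult_lt_0_compat; lra.
by apply: Rmult_le_compat_l => //; apply: Rmult_le_compat; lra.
Qed.

Lemma Kt_even T tau th1 th2 : even2 (Kt T tau th1 th2).
Proof. by split=> a b; rewrite /Kt !opp_IZR !Rabs_Ropp. Qed.

(** On the lines [k = 0], [k2 = k] and [k3 = k] the geometric sum has only its trivial bound and the
    symbol must supply [tau^th1]; elsewhere the low and high regions apply. The factors [r0] to [r3]
    let one of the four functions be a small increment. *)
Lemma sum_form s th1 th2 T : 1 <= s -> 0 <= th1 <= 1 -> th1 <= th2 -> 1 < 2 * th2 ->
  th1 + 1/2 < s -> 0 < T -> high_ok s th1 th2 ->
  exists K, 0 < K /\ forall tau n, 0 < tau <= 1 -> INR n * tau <= T ->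
  forall mu D r0 r1 r2 r3 f0 f1 f2 f3,
  cls s (r0 * mu) (r0 * D) f0 -> cls s (r1 * mu) (r1 * D) f1 ->
  cls s (r2 * mu) (r2 * D) f2 -> cls s (r3 * mu) (r3 * D) f3 ->
  Bnd (fun t : Z * (Z * Z) => let k := fst t in let k2 := fst (snd t) in let k3 := snd (snd t) in
     Cmod (Esym tau k k2 k3) * Cmod (Gs n (tau * phi k k2 k3)) *
     (absF f0 k * (absF f1 k2 * absF f2 k3 * absF f3 (k2 + k3 - k)%Z)))
   (K * Rpower tau th1 * ((r0 * r1 * r2 * r3) * (mu ^ 2 * D ^ 2))).
Proof.
move=> Hs Hth Hth2 Hth3 Hst HT [Kh [Kh0 HKh]].
have [Kk [Kk0 HKk]] := Kt_schur T th1 th2 ltac:(lra) ltac:(lra) Hth3.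
have [K1 [K10 HK1]] := HS_L1 s th1 Hst; have [K0 [K00 HK0]] := HS_L1 s 0 ltac:(lra).
have {}HK1 : forall f D, HS s f D -> L1 (wq th1 f) (K1 * D) := HK1.
have {}HK0 : forall f D, HS s f D -> L1 (wq 0 f) (K0 * D) := HK0.
have [K2 [K20 HK2]] := wq_inv_L1; have [Ka [Ka0 HKa]] := W_L2 1 ltac:(lra).
exists (2 * T * (K2 * K1) + 8 * T + 16 * (K2 * K0 + 4 * (K0 * Ka) + 4 * Ka ^ 2) + 4 * (Kh * Kk)); split.
  have := Rmult_lt_0_compat _ _ K20 K10; have := Rmult_lt_0_compat _ _ K20 K00.
  have := Rmult_lt_0_compat _ _ K00 Ka0; have := Rmult_lt_0_compat _ _ Kh0 Kk0; have := pow2_ge_0 Ka.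
  move=> *; have := Rmult_lt_0_compat (2 * T) (K2 * K1) ltac:(lra) ltac:(lra); lra.
move=> tau n Ht Hn mu D r0 r1 r2 r3 f0 f1 f2 f3 c0 c1 c2 c3.
have Hhi := HKh _ _ (Kt_even T tau th1 th2) (HKk tau ltac:(lra)) _ _ _ _ _ _ _ _ _ _ c0 c1 c2 c3.
case: c0 c1 c2 c3 => [m0 d0] [m1 d1] [m2 d2] [m3 d3].
have hh : forall f A, HS s f A -> L2 (wq 1 f) A by move=> f A; apply: HS_le; lra.
have hth : forall f A, HS s f A -> L2 (wq th1 f) A by move=> f A; apply: HS_le; lra.
set tt := Rpower tau th1; have tt0 : 0 < tt by exact: exp_pos.
have ttau : tau <= tt.
  rewrite /tt -{1}(Rpower_1 tau); last lra.
  rewrite /Rpower; have Hl : ln tau <= 0.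
    by rewrite -ln_1; case: (Rle_lt_or_eq_dec tau 1 ltac:(lra)) => [h|->]; [left; apply: ln_increasing; lra | right].
  have : 1 * ln tau <= th1 * ln tau by nra.
  by case=> [h|h]; [left; exact: exp_increasing | rewrite h; right].
have Q1 := Quad_24 _ _ _ _ _ _ _ _ (hth _ _ d1) m3 (HK2 _ _ m0) (HK1 _ _ d2).
have Q2 := Quad_diag _ _ _ _ _ _ _ _ m0 m1 (hh _ _ d2) (hh _ _ d3).
have Q3 := Quad_swap23 (fun a b => diag2 b a) _ _ _ _ _ (Quad_diag _ _ _ _ _ _ _ _ m0 m2 (hh _ _ d1) (hh _ _ d3)).
have Q4 := Quad_34 _ _ _ _ _ _ _ _ m2 (hh _ _ d3) (HK2 _ _ m0) (HK0 _ _ d1).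
have Hal : forall m : Z, L2 ((fun _ b => W (- (1)) b) m) Ka by move=> m.
have Q5 := Quad_swap23 (fun a b => W (- (1)) a) _ _ _ _ _ (Quad_schur _ _ _ _ _ _ _ _ _ _ Hal (HK0 _ _ d0) m2 m1 (hh _ _ d3)).
have Q6 := Quad_schur _ _ _ _ _ _ _ _ _ _ Hal (HK0 _ _ d0) m1 m2 (hh _ _ d3).
have Q7 := Quad_prodkernel _ _ _ _ _ _ _ _ _ _ _ _ HKa HKa (hh _ _ d0) m1 m2 (hh _ _ d3).
have B1 := Bnd_scal (2 * T * tt) _ _ ltac:(left; repeat apply: Rmult_lt_0_compat; lra) Q1.
have B23 := Bnd_scal (4 * T * tt) _ _ ltac:(left; repeat apply: Rmult_lt_0_compat; lra) (Bnd_plus _ _ _ _ Q2 Q3).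
have B47 := Bnd_scal (16 * tt) _ _ ltac:(lra) (Bnd_plus _ _ _ _ (Bnd_plus _ _ _ _ Q4
   (Bnd_scal 2 _ _ ltac:(lra) (Bnd_plus _ _ _ _ Q5 Q6))) (Bnd_scal 4 _ _ ltac:(lra) Q7)).
have B8 := Bnd_scal (4 * tt) _ _ ltac:(lra) Hhi.
apply: Bnd_mono (Bnd_le _ _ _ _ (Bnd_plus _ _ _ _ (Bnd_plus _ _ _ _ B1 B23) (Bnd_plus _ _ _ _ B47 B8))).
  by apply: Req_le; ring.
move=> [k [k2 k3]]; cbv beta zeta; cbn [fst snd].
have qp : forall kap A X Y V t, (forall a b, 0 <= kap a b) -> (forall k, 0 <= A k) -> (forall k, 0 <= X k) ->
   (forall k, 0 <= Y k) -> (forall k, 0 <= V k) -> 0 <= quad kap A X Y V t.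
  by move=> kap A X Y V t *; rewrite /quad; repeat apply: Rmult_le_pos.
have W0 : forall r m, 0 <= W r m by move=> r m; left; exact: W_pos.
have dg : forall a b, 0 <= diag2 a b by move=> a b; rewrite /diag2; case: Z.eqb; lra.
have N1 : 0 <= 2 * T * tt * quad one2 (wq (- (1)) f0) (wq th1 f1) (wq th1 f2) (absF f3) (k, (k2, k3)).
  apply: Rmult_le_pos; first by left; repeat apply: Rmult_lt_0_compat; lra.
  by apply: qp; try exact: wq_ge0; try exact: absF_ge0; move=> *; rewrite /one2; lra.
have N2 : 0 <= quad diag2 (absF f0) (absF f1) (wq 1 f2) (wq 1 f3) (k, (k2, k3)).
  by apply: qp => //; try exact: wq_ge0; exact: absF_ge0.
have N3 : 0 <= quad (fun a b => diag2 b a) (absF f0) (wq 1 f1) (absF f2) (wq 1 f3) (k, (k2, k3)).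
  by apply: qp => //; try exact: wq_ge0; exact: absF_ge0.
have N4 : 0 <= quad one2 (wq (- (1)) f0) (wq 0 f1) (absF f2) (wq 1 f3) (k, (k2, k3)).
  by apply: qp => //; try exact: wq_ge0; try exact: absF_ge0; move=> *; rewrite /one2; lra.
have N5 : 0 <= quad (fun a b => W (- (1)) a) (wq 0 f0) (absF f1) (absF f2) (wq 1 f3) (k, (k2, k3)).
  by apply: qp => //; try exact: wq_ge0; exact: absF_ge0.
have N6 : 0 <= quad (fun a b => W (- (1)) b) (wq 0 f0) (absF f1) (absF f2) (wq 1 f3) (k, (k2, k3)).
  by apply: qp => //; try exact: wq_ge0; exact: absF_ge0.
have N7 : 0 <= quad (fun a b => W (- (1)) a * W (- (1)) b) (wq 1 f0) (absF f1) (absF f2) (wq 1 f3) (k, (k2, k3)).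
  by apply: qp => //; try exact: wq_ge0; try exact: absF_ge0; move=> *; apply: Rmult_le_pos.
have N8 : 0 <= 4 * tt * (hiw th1 th2 (k, (k2, k3)) * quad (Kt T tau th1 th2) (absF f0) (absF f1) (absF f2) (absF f3) (k, (k2, k3))).
  apply: Rmult_le_pos; first lra; apply: Rmult_le_pos.
    rewrite /hiw; cbn [fst snd]; have := jp_ge1 k; have := jp_ge1 (k2 + k3 - k) => *.
    by repeat apply: Rmult_le_pos => //; [lra | left; apply: Rinv_0_lt_compat; lra].
  by apply: qp => //; try exact: absF_ge0; move=> a; case: (HKk tau ltac:(lra) a).
have N23 : 0 <= 4 * T * tt * (quad diag2 (absF f0) (absF f1) (wq 1 f2) (wq 1 f3) (k, (k2, k3)) +
    quad (fun a b => diag2 b a) (absF f0) (wq 1 f1) (absF f2) (wq 1 f3) (k, (k2, k3))).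
  apply: Rmult_le_pos; [by left; repeat apply: Rmult_lt_0_compat; lra | lra].
set R47 := 16 * tt * _.
have N47 : 0 <= R47 by apply: Rmult_le_pos; lra.
set p := (k2 + k3 - k)%Z; set P := absF f0 k * _.
have P0 : 0 <= P by rewrite /P; repeat apply: Rmult_le_pos; exact: absF_ge0.
have jk := jp_ge1 k; have j2 := jp_ge1 k2; have j3 := jp_ge1 k3; have jpp := jp_ge1 p.
have Gn := Gs_le n (tau * phi k k2 k3); have g0 := Cmod_ge_0 (Gs n (tau * phi k k2 k3)).
have E1 : Rpower tau (1 + th1) = tau * tt by rewrite Rpower_plus Rpower_1 //; lra.
have crude : forall z, 0 <= z -> Cmod (Esym tau k k2 k3) <= z * (tau * tt) ->
    Cmod (Esym tau k k2 k3) * Cmod (Gs n (tau * phi k k2 k3)) <= z * T * tt.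
  move=> z z0 Hz; apply: Rle_trans (Rmult_le_compat _ _ _ _ (Cmod_ge_0 _) g0 Hz Gn) _.
  have -> : z * (tau * tt) * INR n = z * tt * (INR n * tau) by ring.
  have -> : z * T * tt = z * tt * T by ring.
  by apply: Rmult_le_compat_l => //; apply: Rmult_le_pos; lra.
(* At [k = 0] the quotient symbol is [1]: no derivative falls on [p], and [f3] stays in [l2]. *)
case: (Z.eq_dec k 0) => [Hk|Hk].
  have Hq := Esym_boundq th1 tau k k2 k3 ltac:(lra) Hth.
  have := crude (2 * (W th1 k2 * W th1 k3)) ltac:(apply: Rmult_le_pos; [lra | exact: Rmult_le_pos])
    ltac:(move: Hq; rewrite /qsym Hk /= Rabs_R1 E1; lra) => Hc.
  have Hc' := Rmult_le_compat_r _ _ _ P0 Hc.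
  have E2 : 2 * (W th1 k2 * W th1 k3) * T * tt * P =
     2 * T * tt * quad one2 (wq (- (1)) f0) (wq th1 f1) (wq th1 f2) (absF f3) (k, (k2, k3)).
    rewrite /quad /wq /one2 /P; cbn [fst snd]; rewrite -/p Hk W_0_eq; ring.
  rewrite E2 in Hc'; lra.
have Hq := Esym_bound th1 tau k k2 k3 ltac:(lra) Hth; rewrite E1 -/p in Hq.
have Wj : forall m, W th1 m <= jp m by move=> m; rewrite -(W_1 m); apply: W_le; lra.
have res : forall m, jp p * (/ jp k * (W th1 k2 * W th1 k3)) <= jp p * jp m ->
   Cmod (Esym tau k k2 k3) * Cmod (Gs n (tau * phi k k2 k3)) * P <= 4 * T * tt * (jp p * jp m * P).
  move=> m Hm.
  have jm := jp_ge1 m.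
  have := crude (4 * (jp p * jp m)) ltac:(apply: Rmult_le_pos; [lra | apply: Rmult_le_pos; lra])
    ltac:(apply: Rle_trans Hq _; have := Rmult_le_compat_l (4 * (tau * tt)) _ _ ltac:(apply: Rmult_le_pos; [lra | apply: Rmult_le_pos; lra]) Hm; rewrite /Rdiv; lra) => Hc.
  have := Rmult_le_compat_r _ _ _ P0 Hc; lra.
case: (Z.eq_dec (k2 - k) 0) => [Ha|Ha].
  have Ek : k2 = k by lia.
  have Ep : p = k3 by rewrite /p Ek; lia.
  have := res k3 ltac:(apply: Rmult_le_compat_l; [lra|]; rewrite Ek;
     have := Rmult_le_compat_r (W th1 k3) _ _ (W0 _ _) (Wj k); have := Wj k3 => h1 h2;
     apply: (Rmult_le_reg_l (jp k)); [lra | rewrite -Rmult_assoc Rinv_r; nra]) => Hc.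
  have E2 : jp p * jp k3 * P = quad diag2 (absF f0) (absF f1) (wq 1 f2) (wq 1 f3) (k, (k2, k3)).
    rewrite /quad /wq /diag2 /P; cbn [fst snd]; rewrite Ha -/p !W_1 /=; ring.
  rewrite E2 in Hc.
  have := Rmult_le_pos (4 * T * tt) _ ltac:(left; repeat apply: Rmult_lt_0_compat; lra) N3; lra.
case: (Z.eq_dec (k3 - k) 0) => [Hb|Hb].
  have Ek : k3 = k by lia.
  have Ep : p = k2 by rewrite /p Ek; lia.
  have := res k2 ltac:(apply: Rmult_le_compat_l; [lra|]; rewrite Ek;
     have := Rmult_le_compat_l (W th1 k2) _ _ (W0 _ _) (Wj k); have := Wj k2 => h1 h2;
     apply: (Rmult_le_reg_l (jp k)); [lra | rewrite -Rmult_assoc Rinv_r; nra]) => Hc.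
  have E2 : jp p * jp k2 * P = quad (fun a b => diag2 b a) (absF f0) (wq 1 f1) (absF f2) (wq 1 f3) (k, (k2, k3)).
    rewrite /quad /wq /diag2 /P; cbn [fst snd]; rewrite Hb -/p !W_1 /=; ring.
  rewrite E2 in Hc.
  have := Rmult_le_pos (4 * T * tt) _ ltac:(left; repeat apply: Rmult_lt_0_compat; lra) N2; lra.
case: (Rle_lt_dec (tau * Rabs (IZR (k2 - k)) * Rabs (IZR (k3 - k))) 1) => Hlow.
  have Hc := Rmult_le_compat_r _ _ _ P0 (sum_symbol_low tau n k k2 k3 ltac:(lra) Hk Ha Hb Hlow).
  set w := jp p * _ in Hc.
  have E2 : 16 * tt * (w * P) = R47.
    rewrite /R47 /w /quad /wq /one2 /P; cbn [fst snd]; rewrite -/p !W_1 !W_0; ring.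
  have w0 : 0 <= w.
    apply: Rmult_le_pos; first lra.
    have := W0 (- (1)) k; have := W0 (- (1)) (k2 - k)%Z; have := W0 (- (1)) (k3 - k)%Z => *.
    have := Rmult_le_pos (jp k) (W (- (1)) (k2 - k) * W (- (1)) (k3 - k)) ltac:(lra) ltac:(exact: Rmult_le_pos); lra.
  have := Rmult_le_compat_r (w * P) _ _ (Rmult_le_pos _ _ w0 P0) ttau; lra.
have Hc := Rmult_le_compat_r _ _ _ P0 (sum_symbol_high T th1 th2 tau n k k2 k3 ltac:(lra) Hn ltac:(lra) ltac:(lra) Ha Hb Hlow).
have E2 : 4 * Rpower tau th1 * (hiw th1 th2 (k, (k2, k3)) * Kt T tau th1 th2 (k2 - k) (k3 - k)) * P =
   4 * tt * (hiw th1 th2 (k, (k2, k3)) * quad (Kt T tau th1 th2) (absF f0) (absF f1) (absF f2) (absF f3) (k, (k2, k3))).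
  rewrite /quad /P /tt; cbn [fst snd]; rewrite -/p; ring.
rewrite E2 in Hc; lra.
Qed.

Lemma abel_sum x (X : nat -> C) m :
  csum (fun j => Cmult (cis (INR j * x)) (X j)) (seq 0 (S m)) =
  Cminus (Cmult (Gs (S m) x) (X m)) (csum (fun j => Cmult (Gs (S j) x) (Cminus (X (S j)) (X j))) (seq 0 m)).
Proof.
elim: m => [|m IH]; first by rewrite /= Rmult_0_l; ring.
have E : Gs (S (S m)) x = Cplus (Gs (S m) x) (cis (INR (S m) * x)) by [].
rewrite seq_S csum_app IH (seq_S m 0) csum_app E !Nat.add_0_l.
rewrite -[csum _ (S m :: nil)]/(Cplus (Cmult (cis (INR (S m) * x)) (X (S m))) 0).
rewrite -[csum _ (m :: nil)]/(Cplus (Cmult (Gs (S m) x) (Cminus (X (S m)) (X m))) 0).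
ring.
Qed.

Lemma tsum_csum {I} (f : nat -> I -> C) l : (forall j, In j l -> summable (f j)) ->
  csum (fun j => tsum (f j)) l = tsum (fun i => csum (fun j => f j i) l) /\
  summable (fun i => csum (fun j => f j i) l).
Proof.
elim: l => [|j l IH] H /=.
  by split; [rewrite tsum_zero | exists 0; apply: Bnd_le (@Bnd_zero I) => i; rewrite Cmod_0; lra].
have [E Hs] := IH (fun i Hi => H i (or_intror Hi)); have Hj := H j (or_introl eq_refl).
by split; [rewrite tsum_plus // E | exact: summable_plus].
Qed.

Lemma Bnd_lsum {I} (f : nat -> I -> R) (S : nat -> R) l : (forall j, In j l -> Bnd (f j) (S j)) ->
  Bnd (fun i => lsum (fun j => f j i) l) (lsum S l).
Proof.
elim: l => [|j l IH] H /=; first exact: Bnd_zero.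
by apply: Bnd_plus; [apply: H; left | apply: IH => i Hi; apply: H; right].
Qed.

Lemma Cmod_prod4 a b c d a' b' c' d' :
  Cmod (Cminus (Cmult (Cmult (Cmult a' b') (Cconj c')) (Cconj d')) (Cmult (Cmult (Cmult a b) (Cconj c)) (Cconj d))) <=
  Cmod d' * (Cmod (Cminus a' a) * Cmod b' * Cmod c') + Cmod d' * (Cmod a * Cmod (Cminus b' b) * Cmod c')
  + Cmod d' * (Cmod a * Cmod b * Cmod (Cminus c' c)) + Cmod (Cminus d' d) * (Cmod a * Cmod b * Cmod c).
Proof.
have -> : Cminus (Cmult (Cmult (Cmult a' b') (Cconj c')) (Cconj d')) (Cmult (Cmult (Cmult a b) (Cconj c)) (Cconj d)) =
  Cplus (Cplus (Cplus (Cmult (Cmult (Cmult (Cminus a' a) b') (Cconj c')) (Cconj d'))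
     (Cmult (Cmult (Cmult a (Cminus b' b)) (Cconj c')) (Cconj d')))
     (Cmult (Cmult (Cmult a b) (Cconj (Cminus c' c))) (Cconj d')))
     (Cmult (Cmult (Cmult a b) (Cconj c)) (Cconj (Cminus d' d))) by rewrite !Cminus_conj; ring.
have t1 := Cmod_triangle; apply: Rle_trans (t1 _ _) _; apply: Rplus_le_compat; last first.
  by rewrite !Cmod_mult !Cmod_conj; apply: Req_le; ring.
apply: Rle_trans (t1 _ _) _; apply: Rplus_le_compat; last by rewrite !Cmod_mult !Cmod_conj; apply: Req_le; ring.
apply: Rle_trans (t1 _ _) _; rewrite !Cmod_mult !Cmod_conj; apply: Req_le; ring.
Qed.

Lemma lsum_seq_const c m : lsum (fun _ => c) (seq 0 m) = INR m * c.
Proof. by rewrite lsum_const length_seq. Qed.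

(** Summation by parts in the time index: the local errors, tested against the slowly varying
    iterates, add up to [tau^th1] relatively to the mass [mu^2]. *)
Lemma err_sum s th1 th2 T : 1 <= s -> 0 <= th1 <= 1 -> th1 <= th2 -> 1 < 2 * th2 ->
  th1 + 1/2 < s -> 0 < T -> high_ok s th1 th2 ->
  exists K, 0 < K /\ forall tau m (V : nat -> F) mu D c, 0 < tau <= 1 -> INR (S m) * tau <= T -> 0 <= c ->
  (forall j, (j <= m)%nat -> cls s mu D (V j)) ->
  (forall j, (j < m)%nat -> cls s (c * tau * mu) (c * tau * D) (fun k => Cminus (V (S j) k) (V j k))) ->
  Cmod (csum (fun j => ip (TB (ph (INR j * tau) (Esym tau)) (V j) (V j) (V j)) (V j)) (seq 0 (S m))) <=
  K * (1 + 4 * c * T) * Rpower tau th1 * (mu ^ 2 * D ^ 2).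
Proof.
move=> h1 h2 h3 h4 h5 h6 h7; have [K [K0 HK]] := sum_form s th1 th2 T h1 h2 h3 h4 h5 h6 h7.
exists K; split => // tau m V mu D c Ht Hm c0 HV HD.
pose X j (t : Z * (Z * Z)) := Cmult (Cmult (Cmult (V j (fst (snd t))) (V j (snd (snd t))))
  (Cconj (V j (fst (snd t) + snd (snd t) - fst t)%Z))) (Cconj (V j (fst t))).
pose E (t : Z * (Z * Z)) := Esym tau (fst t) (fst (snd t)) (snd (snd t)).
pose x (t : Z * (Z * Z)) := tau * phi (fst t) (fst (snd t)) (snd (snd t)).
pose Tj j t := Cmult (E t) (Cmult (cis (INR j * x t)) (X j t)).
have le_n : forall n, (n <= S m)%nat -> INR n * tau <= T.
  by move=> n Hn; apply: Rle_trans Hm; apply: Rmult_le_compat_r; [lra | exact: le_INR].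
have c1 : forall j, (j <= m)%nat -> cls s (1 * mu) (1 * D) (V j) by move=> j Hj; rewrite !Rmult_1_l; exact: HV.
have sT : forall j, (j <= m)%nat -> summable (Tj j).
  move=> j Hj; have cj := c1 j Hj.
  have := HK tau 1%nat Ht (le_n 1%nat ltac:(lia)) _ _ _ _ _ _ _ _ _ _ cj cj cj cj.
  apply: summable_le => -[k [k2 k3]]; rewrite /Tj /X /E; cbv beta zeta; cbn [fst snd].
  rewrite [Gs 1 _]/= Rmult_0_l cis_0 !Cmod_mult !Cmod_conj Cmod_cis.
  have -> : Cplus 0 1 = 1 by ring.
  rewrite Cmod_1 /absF; apply: Req_le; ring.
have E1 : forall j, (j <= m)%nat -> ip (TB (ph (INR j * tau) (Esym tau)) (V j) (V j) (V j)) (V j) = tsum (Tj j).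
  move=> j Hj; rewrite -(tsum_prod _ (sT j Hj)); apply: tsum_ext => k.
  have [_ Hj1] := HV j Hj; have wj := HS_wiener s _ _ ltac:(lra) Hj1.
  have st : summable (tri (ph (INR j * tau) (Esym tau)) (V j) (V j) (V j) k).
    have [K' [_ HK']] := TB_JJ_HS s h1.
    apply: (proj1 (HK' _ (4 * tau) _ _ _ _ _ _ ltac:(lra) _ Hj1 Hj1 Hj1)) => *; apply: ph_JJ; apply: Esym_JJ; lra.
  rewrite Cmult_comm /TB -tsum_scal //; apply: tsum_ext => -[k2 k3]; rewrite /Tj /E /X /x /tri /ph; cbn [fst snd].
  rewrite -Rmult_assoc; ring.
have EL : csum (fun j => ip (TB (ph (INR j * tau) (Esym tau)) (V j) (V j) (V j)) (V j)) (seq 0 (S m)) =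
   csum (fun j => tsum (Tj j)) (seq 0 (S m)).
  by apply: csum_ext => j /in_seq Hj; apply: E1; lia.
have [E2 _] := tsum_csum Tj (seq 0 (S m)) ltac:(by move=> j /in_seq Hj; apply: sT; lia).
rewrite EL E2.
set R := mu ^ 2 * D ^ 2; set tt := Rpower tau th1.
have R0 : 0 <= R by apply: Rmult_le_pos; exact: pow2_ge_0.
have tt0 : 0 < tt by exact: exp_pos.
pose g n (a b c d : F) (t : Z * (Z * Z)) := Cmod (E t) * Cmod (Gs n (x t)) *
     (absF d (fst t) * (absF a (fst (snd t)) * absF b (snd (snd t)) * absF c (fst (snd t) + snd (snd t) - fst t)%Z)).
pose dV j : F := fun k => Cminus (V (S j) k) (V j k).
have B0 : Bnd (g (S m) (V m) (V m) (V m) (V m)) (K * tt * R).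
  have cm := c1 m (Nat.le_refl _).
  by apply: Bnd_mono (HK tau (S m) Ht Hm _ _ _ _ _ _ _ _ _ _ cm cm cm cm); apply: Req_le; rewrite -/tt -/R; ring.
(* One term for each slot that may hold the increment. At most [m] increments of relative size
   [c * tau], with [m * tau <= T], account for the [4 * c * T] of the statement. *)
pose G j t := g (S j) (dV j) (V (S j)) (V (S j)) (V (S j)) t + g (S j) (V j) (dV j) (V (S j)) (V (S j)) t
   + g (S j) (V j) (V j) (dV j) (V (S j)) t + g (S j) (V j) (V j) (V j) (dV j) t.
have BG : forall j, (j < m)%nat -> Bnd (G j) (4 * (K * tt * (c * tau * R))).
  move=> j Hj; have a1 := c1 j ltac:(lia); have a2 := c1 (S j) ltac:(lia); have a3 := HD j Hj.
  have H := HK tau (S j) Ht (le_n (S j) ltac:(lia)).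
  have b1 := H _ _ _ _ _ _ _ _ _ _ a2 a3 a2 a2.
  have b2 := H _ _ _ _ _ _ _ _ _ _ a2 a1 a3 a2.
  have b3 := H _ _ _ _ _ _ _ _ _ _ a2 a1 a1 a3.
  have b4 := H _ _ _ _ _ _ _ _ _ _ a3 a1 a1 a1.
  by apply: Bnd_mono (Bnd_plus _ _ _ _ (Bnd_plus _ _ _ _ (Bnd_plus _ _ _ _ b1 b2) b3) b4);
    apply: Req_le; rewrite -/tt -/R; ring.
have BS := Bnd_lsum G (fun _ => 4 * (K * tt * (c * tau * R))) (seq 0 m)
  ltac:(by move=> j /in_seq Hj; apply: BG; lia).
rewrite lsum_seq_const in BS.
apply: (tsum_bound _ (fun t => g (S m) (V m) (V m) (V m) (V m) t + lsum (fun j => G j t) (seq 0 m))); last first.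
  apply: Bnd_mono (Bnd_plus _ _ _ _ B0 BS).
  have : INR m * tau <= T by apply: le_n; lia.
  have -> : K * tt * R + INR m * (4 * (K * tt * (c * tau * R))) = K * tt * R + (4 * (K * tt * (c * R))) * (INR m * tau) by ring.
  have -> : K * (1 + 4 * c * T) * tt * R = K * tt * R + (4 * (K * tt * (c * R))) * T by ring.
  move=> Hle; apply: Rplus_le_compat_l; apply: Rmult_le_compat_l => //.
  by apply: Rmult_le_pos; [lra | apply: Rmult_le_pos; [apply: Rmult_le_pos; lra | exact: Rmult_le_pos]].
move=> t.
have -> : csum (fun j => Tj j t) (seq 0 (S m)) = Cmult (E t) (csum (fun j => Cmult (cis (INR j * x t)) (X j t)) (seq 0 (S m))).
  by rewrite -csum_scal.
rewrite abel_sum Cmod_mult.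
have e0 := Cmod_ge_0 (E t).
apply: Rle_trans (Rmult_le_compat_l _ _ _ e0 (Cmod_triangle _ _)) _; rewrite Cmod_opp Rmult_plus_distr_l.
apply: Rplus_le_compat.
  by rewrite /g /X !Cmod_mult !Cmod_conj /absF; apply: Req_le; ring.
apply: Rle_trans (Rmult_le_compat_l _ _ _ e0 (Cmod_csum _ _)) _.
rewrite -lsum_scal; apply: lsum_le => j _.
rewrite Cmod_mult /G /g /absF /dV -Rmult_assoc.
have w0 : 0 <= Cmod (E t) * Cmod (Gs (S j) (x t)) by apply: Rmult_le_pos; exact: Cmod_ge_0.
apply: Rle_trans (Rmult_le_compat_l _ _ _ w0 (Cmod_prod4 _ _ _ _ _ _ _ _)) _.
by apply: Req_le; ring.
Qed.

(** * Bounds for one step *)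

Lemma cis_m1 x : Cmod (Cminus (cis x) 1) <= Rabs x.
Proof. by have := cis_lip x 0; rewrite cis_0 Rminus_0_r. Qed.

Definition dsym (tau m0 q : R) (k : Z) : C :=
  Cplus (Cminus (cis (theta tau m0 q k)) 1) (if Z.eqb k 0 then Cmult ci (RtoC (2 * tau * m0)) else RtoC 0).

Lemma dsym_bound tau m0 q L k : 0 <= tau -> Rabs m0 <= L -> Rabs q <= L -> Cmod (dsym tau m0 q k) <= 6 * L * tau.
Proof.
move=> Ht Hm Hq; apply: Rle_trans (Cmod_triangle _ _) _.
have h1 := Rle_trans _ _ _ (cis_m1 (theta tau m0 q k)) (theta_bound tau m0 q k Ht).
have h2 : tau * (2 * (Rabs m0 + Rabs q)) <= tau * (4 * L) by apply: Rmult_le_compat_l; lra.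
have L0 : 0 <= L by have := Rabs_pos m0; lra.
have h3 : Cmod (if Z.eqb k 0 then Cmult ci (RtoC (2 * tau * m0)) else RtoC 0) <= 2 * L * tau.
  case: Z.eqb; last by rewrite Cmod_0; apply: Rmult_le_pos; lra.
  rewrite Cmod_mult Cmod_ci Cmod_R Rmult_1_l Rabs_mult (Rabs_pos_eq (2 * tau)); last lra.
  have := Rmult_le_compat_l (2 * tau) _ _ ltac:(lra) Hm; lra.
lra.
Qed.

Lemma Yst_form tau m0 q t V k : Yst tau m0 q t V k =
  Cplus (Cmult (dsym tau m0 q k) (V k)) (TB (ph t (Bsym tau)) V V V k).
Proof.
rewrite /Yst /PsiV /dsym -/(ph t (Bsym tau)); case: Z.eqb; last by ring.
have -> : RtoC (2 * tau * m0) = Cmult 2 (RtoC (tau * m0)) by rewrite -RtoC_mult; congr RtoC; ring.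
ring.
Qed.

(** The [L2] bound is proportional to [mu] with a constant depending only on the ball, so dividing
    by the mass does no harm later. *)
Lemma Yst_bounds s L D : 1 <= s -> 0 <= L -> 0 <= D -> exists K, 0 < K /\
  forall tau m0 q t V mu, 0 <= tau -> Rabs m0 <= L -> Rabs q <= L -> cls s mu D V ->
  cls s (K * tau * mu) (K * tau) (Yst tau m0 q t V).
Proof.
move=> Hs L0 D0; have [K1 [K10 HK1]] := TB_JJ_HS s Hs; have [K2 [K20 HK2]] := TB_JJ_L2.
have D3 : 0 <= D ^ 3 by exact: pow_le.
have D2 : 0 <= D ^ 2 by exact: pow2_ge_0.
exists (6 * L * (D + 1) + 17 * K1 * D ^ 3 + 17 * K2 * D ^ 2 + 1); split.
  have := Rmult_le_pos L D L0 D0; have := Rmult_le_pos K1 _ (Rlt_le _ _ K10) D3; have := Rmult_le_pos K2 _ (Rlt_le _ _ K20) D2; lra.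
move=> tau m0 q t V mu Ht Hm Hq HV; have [V0 V1] := HV.
have mu0 := L2_ge0 _ _ V0.
have d0 : 0 <= 6 * L * tau by apply: Rmult_le_pos; lra.
have db := fun k => dsym_bound tau m0 q L k Ht Hm Hq.
have bJ : forall k k2 k3, Cmod (ph t (Bsym tau) k k2 k3) <= 17 * tau * JJ k k2 k3.
  by move=> *; apply: ph_JJ; exact: Bsym_JJ.
have [_ H1] := HK1 _ (17 * tau) _ _ _ _ _ _ ltac:(lra) bJ V1 V1 V1.
have H2 := HK2 _ (17 * tau) _ _ _ _ _ ltac:(lra) bJ (cls_le _ _ _ _ _ Hs HV) (cls_le _ _ _ _ _ Hs HV) (cls_le _ _ _ _ _ Hs HV).
have x1 := Rmult_le_pos L D L0 D0; have x2 := Rmult_le_pos K1 _ (Rlt_le _ _ K10) D3; have x3 := Rmult_le_pos K2 _ (Rlt_le _ _ K20) D2.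
have LT : 0 <= L * tau by exact: Rmult_le_pos.
split.
- apply/HS_0; apply: L2_mono (HS_ext _ _ _ _ _ (HS_plus 0 _ _ _ _ (HS_diag 0 _ _ _ _ d0 db (proj2 (HS_0 _ _) V0)) (proj2 (HS_0 _ _) H2))).
    have -> : 6 * L * tau * mu + K2 * (17 * tau) * (mu * D ^ 2) = (6 * L + 17 * (K2 * D ^ 2)) * (tau * mu) by ring.
    rewrite [X in _ <= X]Rmult_assoc; apply: Rmult_le_compat_r; [exact: Rmult_le_pos | lra].
  by move=> k; rewrite Yst_form.
- apply: L2_mono (HS_ext _ _ _ _ _ (HS_plus s _ _ _ _ (HS_diag s _ _ _ _ d0 db V1) H1)).
    have -> : 6 * L * tau * D + K1 * (17 * tau) * (D * D * D) = (6 * (L * D) + 17 * (K1 * D ^ 3)) * tau by ring.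
    by apply: Rmult_le_compat_r => //; lra.
  by move=> k; rewrite Yst_form.
Qed.

Lemma PsiV_lip s L D : 1 <= s -> 0 <= L -> 0 <= D -> exists K, 0 < K /\
  forall tau m0 q t f g d, 0 <= tau -> Rabs m0 <= L -> Rabs q <= L ->
  HS s f D -> HS s g D -> HS s (fun k => Cminus (f k) (g k)) d ->
  HS s (fun k => Cminus (Cminus (PsiV tau m0 q t f k) (PsiV tau m0 q t g k)) (Cminus (f k) (g k))) (K * tau * d).
Proof.
move=> Hs L0 D0; have [K1 [K10 HK1]] := TB_diff_HS s Hs.
have D2 : 0 <= D ^ 2 by exact: pow2_ge_0.
exists (6 * L + 17 * K1 * D ^ 2 + 1); split.
  have := Rmult_le_pos K1 _ (Rlt_le _ _ K10) D2; lra.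
move=> tau m0 q t f g d Ht Hm Hq Hf Hg Hd.
have dd := L2_ge0 _ _ Hd.
have d0 : 0 <= 6 * L * tau by apply: Rmult_le_pos; lra.
have db := fun k => dsym_bound tau m0 q L k Ht Hm Hq.
have bJ : forall k k2 k3, Cmod (ph t (Bsym tau) k k2 k3) <= 17 * tau * JJ k k2 k3.
  by move=> *; apply: ph_JJ; exact: Bsym_JJ.
have H1 := HK1 _ (17 * tau) f g D d ltac:(lra) bJ Hf Hg Hd.
apply: L2_mono (HS_ext _ _ _ _ _ (HS_plus s _ _ _ _ (HS_diag s _ _ _ _ d0 db Hd) H1)).
  have -> : 6 * L * tau * d + K1 * (17 * tau) * (D ^ 2 * d) = (6 * L + 17 * K1 * D ^ 2) * (tau * d) by ring.
  by rewrite [X in _ <= X]Rmult_assoc; apply: Rmult_le_compat_r; [exact: Rmult_le_pos | lra].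
move=> k; cbv beta.
have F1 : forall h : F, PsiV tau m0 q t h k = Cplus (h k) (Yst tau m0 q t h k) by move=> h; rewrite /Yst; ring.
rewrite !F1 !Yst_form; ring.
Qed.

(** The main part of the step drops out of [Re <Y, V>]; the diagonal part contributes only
    [cos theta - 1]. *)
Lemma Rst_decomp tau m0 q t V mu D L : 0 <= tau -> Rabs m0 <= L -> Rabs q <= L -> cls 1 mu D V ->
  Rabs (Rst tau m0 q t V - Re (ip (TB (ph t (Esym tau)) V V V) V)) <= (4 * L * tau) ^ 2 * mu ^ 2.
Proof.
move=> Ht Hm Hq HV; have [V0 V1] := HV.
pose one (k : Z) := 1.
have lam1 : forall k, Rabs (one k) <= jp k by move=> k; rewrite Rabs_R1; exact: jp_ge1.
have ipE : forall f g, ip f g = ipl one f g.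
  by move=> f g; apply: tsum_ext => k; rewrite /one; ring.
have [K [_ HK]] := TB_JJ_HS 1 (Rle_refl 1).
have [_ HM] := HK (ph t (Msym tau)) tau V V V _ _ _ Ht ltac:(by move=> *; apply: ph_JJ; exact: Msym_JJ) V1 V1 V1.
have [_ HE] := HK (ph t (Esym tau)) (4 * tau) V V V _ _ _ ltac:(lra) ltac:(by move=> *; apply: ph_JJ; exact: Esym_JJ) V1 V1 V1.
pose rho k := if Z.eqb k 0 then 2 * tau * m0 else 2 * tau * (massR V - momR V / IZR k).
pose e k := Cplus (Cminus (cis (theta tau m0 q k)) 1) (Cmult ci (RtoC (rho k))).
have EY : Yst tau m0 q t V = fun k => Cplus (Cplus (TB (ph t (Msym tau)) V V V k) (TB (ph t (Esym tau)) V V V k)) (Cmult (e k) (V k)).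
  apply: functional_extensionality => k; rewrite (Yst_decomp _ _ _ _ _ _ _ _ Ht HV) /e /rho /resF.
  case: Z.eqb; ring.
have mq0 := massR_ge0 _ _ V0.
have He : forall k, Cmod (e k) <= 2 + 2 * tau * (L + massR V + Rabs (momR V)).
  move=> k; apply: Rle_trans (Cmod_triangle _ _) _; rewrite Cmod_mult Cmod_ci Cmod_R Rmult_1_l.
  have h1 : Cmod (Cminus (cis (theta tau m0 q k)) 1) <= 2.
    by apply: Rle_trans (Cmod_triangle _ _) _; rewrite Cmod_opp Cmod_cis Cmod_1; lra.
  have hp := Rabs_pos (momR V); have h0 := Rabs_pos m0.
  have h2 : Rabs (rho k) <= 2 * tau * (L + massR V + Rabs (momR V)).
    rewrite /rho; case: (Z.eqb_spec k 0) => Hk; rewrite (Rabs_mult (2 * tau)) (Rabs_pos_eq (2 * tau)); try lra; apply: Rmult_le_compat_l; try lra.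
    apply: Rle_trans (Rabs_triang _ _) _; rewrite Rabs_Ropp /Rdiv Rabs_mult Rabs_inv (Rabs_pos_eq (massR V)) //.
    have := IZR_abs_ge1 _ Hk => H1.
    have : / Rabs (IZR k) <= 1 by rewrite -Rinv_1; apply: Rinv_le_contravar; lra.
    nra.
  lra.
have e0 : 0 <= 2 + 2 * tau * (L + massR V + Rabs (momR V)).
  by apply: Rle_trans (He 0%Z); exact: Cmod_ge_0.
have Hd := HS_diag 1 e _ _ _ e0 He V1.
rewrite /Rst EY !ipE (ipl_plus_l one lam1 _ _ _ _ _ _ (HS_plus _ _ _ _ _ HM HE) Hd V1).
rewrite (ipl_plus_l one lam1 _ _ _ _ _ _ HM HE V1).
have HM0 : Re (ipl one (TB (ph t (Msym tau)) V V V) V) = 0.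
  by apply: (Msym_orth tau t one V mu D Ht HV lam1) => *; rewrite /one; lra.
set A := ipl one (TB (ph t (Esym tau)) V V V) V; set Dg := ipl one (fun k => Cmult (e k) (V k)) V.
rewrite !(_ : forall a b, Re (Cplus a b) = Re a + Re b) // HM0.
have -> : 0 + Re A + Re Dg - Re A = Re Dg by ring.
have [Sd _] := ipl_spec one lam1 _ _ _ _ Hd V1.
have ED := tsum_re _ Sd (fun k => (cos (theta tau m0 q k) - 1) * Cmod (V k) ^ 2).
rewrite -(Cmod_R (Re Dg)) -ED; last first.
  move=> k; rewrite Cmod2_alt /e /cis /one /Re /Im /=; ring.
have Hb : Bnd (fun k => (4 * L * tau) ^ 2 * Cmod (V k) ^ 2) ((4 * L * tau) ^ 2 * mu ^ 2).
  by apply: Bnd_scal; [exact: pow2_ge_0 | case: V0 => _ []].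
apply: tsum_bound Hb => k; rewrite Cmod_R Rabs_mult (Rabs_pos_eq (_ ^ 2)); last exact: pow2_ge_0.
apply: Rmult_le_compat_r; first exact: pow2_ge_0.
have := Rle_trans _ _ _ (re_le_Cmod _) (cis_taylor (theta tau m0 q k)).
have -> : Re (Cminus (Cminus (cis (theta tau m0 q k)) 1) (Cmult ci (RtoC (theta tau m0 q k)))) = cos (theta tau m0 q k) - 1.
  by rewrite /cis /Re /=; ring.
move=> h; apply: Rle_trans h _; rewrite -pow2_abs; apply: pow_incr; split; first exact: Rabs_pos.
apply: Rle_trans (theta_bound tau m0 q k Ht) _.
have -> : 4 * L * tau = tau * (2 * (L + L)) by ring.
by apply: Rmult_le_compat_l => //; lra.
Qed.

(** Everything is rescaled by the mass. With [r = R / m0] and [y = M / m0] one finds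
    [H = - (r + y / 2)] and [h = (r + y / 2) (r / 2 - y / 4)], so [h] and [eta + r] are of second
    order. *)
Lemma eta_bounds tau m0 q t V a b : 0 < m0 -> 0 <= tau <= 1 -> 0 <= a -> 0 <= b ->
  Rabs (Rst tau m0 q t V) <= a * tau * m0 -> 0 <= massR (Yst tau m0 q t V) <= b * tau ^ 2 * m0 ->
  let c := 4 * (a + b + 1) ^ 2 in
  Rabs (eta tau m0 q t V) <= c * tau /\
  Rabs (eta tau m0 q t V + Rst tau m0 q t V / m0) <= c * tau ^ 2 /\
  Rabs (hst tau m0 q t V) <= c * tau ^ 2 /\
  m0 * Rabs (hst tau m0 q t V) <= 4 * (Rst tau m0 q t V ^ 2 / m0 + massR (Yst tau m0 q t V) ^ 2 / m0).
Proof.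
move=> m00 Ht a0 b0 HR HM c; rewrite /eta /hst /Hst.
set R := Rst tau m0 q t V in HR *; set M := massR _ in HM *.
set r := R / m0; set y := M / m0.
have Er : / m0 * R = r by rewrite /r /Rdiv; ring.
have hr : Rabs r <= a * tau.
  rewrite /r /Rdiv Rabs_mult Rabs_inv (Rabs_pos_eq m0); last lra.
  apply: (Rmult_le_reg_r m0) => //; rewrite Rmult_assoc Rinv_l; lra.
have hy : 0 <= y <= b * tau ^ 2.
  split; first by apply: Rmult_le_pos; [lra | left; exact: Rinv_0_lt_compat].
  apply: (Rmult_le_reg_r m0) => //; rewrite /y /Rdiv Rmult_assoc Rinv_l; lra.
set H := - / m0 * (R + 1 / 2 * M).
have EH : H = - (r + y / 2) by rewrite /H /r /y; field; lra.
have Eh : - (1 / 2 * (H * H)) - / m0 * H * R = (r + y / 2) * (r / 2 - y / 4) by rewrite EH /r; field; lra.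
rewrite Eh EH.
have t2 : tau ^ 2 <= tau by rewrite /pow; nra.
have t20 : 0 <= tau ^ 2 by exact: pow2_ge_0.
have ar := Rabs_pos r.
have hy1 : y <= b * tau by apply: Rle_trans (proj2 hy) _; apply: Rmult_le_compat_l.
set z := (r + y / 2) * (r / 2 - y / 4).
have hz : Rabs z <= (Rabs r + y) ^ 2.
  rewrite /z Rabs_mult.
  have h1 : Rabs (r + y / 2) <= Rabs r + y.
    by apply: Rle_trans (Rabs_triang _ _) _; rewrite (Rabs_pos_eq (y / 2)); lra.
  have h2 : Rabs (r / 2 - y / 4) <= Rabs r + y.
    apply: Rle_trans (Rabs_triang _ _) _; rewrite Rabs_Ropp (Rabs_pos_eq (y / 4)); last lra.
    rewrite /Rdiv Rabs_mult (Rabs_pos_eq (/ 2)); lra.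
  have := Rmult_le_compat _ _ _ _ (Rabs_pos _) (Rabs_pos _) h1 h2; rewrite /pow; lra.
have hz2 : Rabs z <= (a + b + 1) ^ 2 * tau ^ 2.
  apply: Rle_trans hz _; rewrite -Rpow_mult_distr; apply: pow_incr; split; lra.
have s1 : 1 <= (a + b + 1) ^ 2 by rewrite /pow; nra.
have s2 : a + b + 1 <= (a + b + 1) ^ 2 by rewrite /pow; nra.
split; [|split; [|split]].
- apply: Rle_trans (Rabs_triang _ _) _; rewrite Rabs_Ropp.
  have := Rabs_triang r (y / 2); rewrite (Rabs_pos_eq (y / 2)); last lra.
  have : (a + b + 1) ^ 2 * tau ^ 2 <= (a + b + 1) ^ 2 * tau by apply: Rmult_le_compat_l; lra.
  have : (a + b + 1) * tau <= (a + b + 1) ^ 2 * tau by apply: Rmult_le_compat_r; lra.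
  rewrite /c; nra.
- have -> : - (r + y / 2) + z + r = z - y / 2 by ring.
  apply: Rle_trans (Rabs_triang _ _) _; rewrite Rabs_Ropp (Rabs_pos_eq (y / 2)); last lra.
  have : (a + b + 1) * tau ^ 2 <= (a + b + 1) ^ 2 * tau ^ 2 by apply: Rmult_le_compat_r; lra.
  rewrite /c; nra.
- rewrite /c; nra.
- have : (Rabs r + y) ^ 2 <= 2 * (r ^ 2 + y ^ 2).
    rewrite -(pow2_abs r); have := pow2_ge_0 (Rabs r - y); rewrite /pow; lra.
  move=> h; have := Rmult_le_compat_l m0 _ _ ltac:(lra) (Rle_trans _ _ _ hz h).
  have -> : m0 * (2 * (r ^ 2 + y ^ 2)) = 2 * (R ^ 2 / m0 + M ^ 2 / m0) by rewrite /r /y; field; lra.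
  have : 0 <= R ^ 2 / m0 + M ^ 2 / m0.
    have i0 := Rinv_0_lt_compat _ m00.
    by apply: Rplus_le_le_0_compat; apply: Rmult_le_pos; try exact: pow2_ge_0; lra.
  lra.
Qed.

(** * Convergence *)

(** Discrete Gronwall in the closed form [n b exp (a n tau)], stable under a step because
    [exp (a * tau)] dominates the amplification [f]. *)
Lemma gronwall_step n tau a b f e : 0 <= a -> 0 <= b -> 0 <= tau -> 0 <= f <= exp (a * tau) ->
  e <= INR n * b * exp (a * (INR n * tau)) ->
  f * e + b <= INR (S n) * b * exp (a * (INR (S n) * tau)).
Proof.
move=> a0 b0 t0 Hf He; rewrite S_INR; have n0 := pos_INR n.
have -> : a * ((INR n + 1) * tau) = a * (INR n * tau) + a * tau by ring.
rewrite exp_plus; set x := exp (a * (INR n * tau)) in He *; set y := exp (a * tau) in Hf *.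
have x1 : 1 <= x.
  by have := exp_ineq1_le (a * (INR n * tau)); rewrite -/x; have := Rmult_le_pos _ _ a0 (Rmult_le_pos _ _ n0 t0); lra.
have y1 : 1 <= y by have := exp_ineq1_le (a * tau); rewrite -/y; have := Rmult_le_pos _ _ a0 t0; lra.
have E0 : 0 <= INR n * b * x by apply: Rmult_le_pos; [exact: Rmult_le_pos | lra].
have h1 := Rmult_le_compat_l f _ _ (proj1 Hf) He.
have h2 := Rmult_le_compat_r _ _ _ E0 (proj2 Hf).
have xy : 1 <= x * y by nra.
have := Rmult_le_compat_l b _ _ b0 xy; lra.
Qed.

Lemma gronwall_end n tau a b T : 0 <= a -> 0 <= b -> 0 <= tau -> INR n * tau <= T ->
  INR n * (b * tau) * exp (a * (INR n * tau)) <= T * b * exp (a * T).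
Proof.
move=> a0 b0 t0 H; have n0 := pos_INR n.
have -> : INR n * (b * tau) * exp (a * (INR n * tau)) = (INR n * tau) * b * exp (a * (INR n * tau)) by ring.
apply: Rmult_le_compat; [|by left; exact: exp_pos| |].
- by apply: Rmult_le_pos => //; exact: Rmult_le_pos.
- exact: Rmult_le_compat_r.
- have : a * (INR n * tau) <= a * T by exact: Rmult_le_compat_l.
  by case=> [h|->]; [left; exact: exp_increasing | right].
Qed.

Fixpoint Vseq (tau m0 q : R) (u0 : F) (n : nat) : F :=
  match n with O => u0 | S m => stepV tau m0 q (INR m * tau) (Vseq tau m0 q u0 m) end.

Lemma Rpower_le1 tau x y : 0 < tau <= 1 -> x <= y -> Rpower tau y <= Rpower tau x.
Proof.
move=> Ht H; rewrite /Rpower; have Hl : ln tau <= 0.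
  by rewrite -ln_1; case: (Rle_lt_or_eq_dec tau 1 ltac:(lra)) => [h|->]; [left; apply: ln_increasing; lra | right].
have : y * ln tau <= x * ln tau by nra.
by case=> [h|->]; [left; exact: exp_increasing | right].
Qed.

Lemma massR_pos f A : L2 (absF f) A -> f <> zeroF -> 0 < massR f.
Proof.
move=> HA Hf; case: (Rle_lt_or_eq_dec _ _ (massR_ge0 _ _ HA)) => // E; exfalso; apply: Hf.
apply: functional_extensionality => k.
have [_ [_ H]] := massR_L2 _ _ HA; rewrite -E sqrt_0 in H.
have := Bnd_point _ _ k H => /= h; apply: Cmod_eq_0.
have := Cmod_ge_0 (f k); rewrite /absF /pow in h; nra.
Qed.

(** * Induction over the time steps with explicit constants *)

Section Scheme.
Context (s th1 th2 T B : R) (Hs : 1 <= s) (Hth : 0 < th1 <= 1) (HT : 0 < T) (B0 : 0 <= B).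
Context (Ky Kp Kl Ke KE : R) (Ky0 : 0 < Ky) (Kp0 : 0 < Kp) (Kl0 : 0 < Kl) (Ke0 : 0 < Ke) (KE0 : 0 < KE).

(** [D] leaves room one around the solution; [L] dominates mass and momentum. [a] and [b] bound
    [Rst] and the squared increment relative to [m0], their [4] being [mu^2 / m0]. [c] comes from
    [eta_bounds], [cd] is the speed of the iterates, [CT] the size of the partial sums, [C8] the
    local defect of the modified error, [C9] the final constant. [cm] and [CM] govern the mass drift
    relative to [m0], [cR] and [ca] the sharp one. *)
Let D := B + 1.
Let L := B ^ 2.
Let a := 4 * Ky.
Let b := 4 * Ky ^ 2.
Let c := 4 * (a + b + 1) ^ 2.
Let cd := Ky + c.
Let CT := T * (c + 4 * (4 * L) ^ 2) + Ke * (1 + 4 * cd * T) * (4 * D ^ 2).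
Let C8 := Kl + Kp * CT * D + CT * cd * D.
Let C9 := T * C8 * exp (Kp * T) + CT * (D * (1 + cd)).
Let cm := c * b + c ^ 2.
Let CM := T * cm * exp (2 * c * T).
Let cR := 2 * (16 * (4 * L) ^ 4 * L + 4 * KE ^ 2 * D ^ 6).
Let ca := 4 * (cR + b ^ 2 * L) * (b + c).

Context (HY : forall tau m0 q t V mu, 0 <= tau -> Rabs m0 <= L -> Rabs q <= L -> cls s mu D V ->
  cls s (Ky * tau * mu) (Ky * tau) (Yst tau m0 q t V)).
Context (HP : forall tau m0 q t f g d, 0 <= tau -> Rabs m0 <= L -> Rabs q <= L ->
  HS s f D -> HS s g D -> HS s (fun k => Cminus (f k) (g k)) d ->
  HS s (fun k => Cminus (Cminus (PsiV tau m0 q t f k) (PsiV tau m0 q t g k)) (Cminus (f k) (g k))) (Kp * tau * d)).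
Context (HL : forall v tau t, 0 < tau <= 1 -> twisted_on s v B t (t + tau) ->
  HS s (fun k => Cminus (v (t + tau) k) (PsiV tau (massR (v t)) (momR (v t)) t (v t) k)) (Kl * Rpower tau (1 + th1))).
Context (HE : forall tau m (V : nat -> F) mu D c, 0 < tau <= 1 -> INR (S m) * tau <= T -> 0 <= c ->
  (forall j, (j <= m)%nat -> cls s mu D (V j)) ->
  (forall j, (j < m)%nat -> cls s (c * tau * mu) (c * tau * D) (fun k => Cminus (V (S j) k) (V j k))) ->
  Cmod (csum (fun j => ip (TB (ph (INR j * tau) (Esym tau)) (V j) (V j) (V j)) (V j)) (seq 0 (S m))) <=
  Ke * (1 + 4 * c * T) * Rpower tau th1 * (mu ^ 2 * D ^ 2)).
Context (HEE : forall tau t f x, 0 < tau -> HS s f x ->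
  HS s (TB (ph t (Esym tau)) f f f) (KE * Rpower tau (1 + th1) * x ^ 3)).

Context (tau m0 q : R) (Ht : 0 < tau <= 1) (Hm0 : 0 < m0 <= L) (Hq : Rabs q <= L).
Context (Htau1 : CM * tau <= 1) (Htau2 : C9 * Rpower tau th1 <= 1).

(** Twice the initial norm: the margin absorbs the mass drift, and [CM * tau <= 1] closes this half
    of the bootstrap. *)
Let mu := 2 * sqrt m0.
Let tt := Rpower tau th1.

Lemma const_pos : 1 <= D /\ 0 <= L /\ 0 < a /\ 0 < b /\ 1 <= c /\ 0 < cd /\ 0 <= CT /\ 0 <= C8 /\ 0 <= cm /\ 0 <= cR /\ 0 <= ca.
Proof.
have D1 : 1 <= D by rewrite /D; lra.
have L0 : 0 <= L by exact: pow2_ge_0.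
have a0 : 0 < a by rewrite /a; lra.
have b0 : 0 < b by have h := pow_lt Ky 2 Ky0; rewrite /b; lra.
have c1 : 1 <= c by rewrite /c /pow; nra.
have cd0 : 0 < cd by rewrite /cd; lra.
have CT0 : 0 <= CT.
  rewrite /CT; apply: Rplus_le_le_0_compat.
    by apply: Rmult_le_pos; [lra | have := pow2_ge_0 (4 * L); lra].
  apply: Rmult_le_pos; last by have := pow2_ge_0 D; lra.
  by apply: Rmult_le_pos; [lra | have := Rmult_lt_0_compat _ _ cd0 HT; lra].
have C80 : 0 <= C8.
  rewrite /C8; have := Rmult_le_pos (Kp * CT) D ltac:(apply: Rmult_le_pos; lra) ltac:(lra).
  have := Rmult_le_pos (CT * cd) D ltac:(apply: Rmult_le_pos; lra) ltac:(lra); lra.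
have cm0 : 0 <= cm by rewrite /cm /pow; nra.
have cR0 : 0 <= cR.
  have h1 : 0 <= (4 * L) ^ 4 * L by apply: Rmult_le_pos => //; apply: pow_le; lra.
  have h2 : 0 <= KE ^ 2 * D ^ 6 by apply: Rmult_le_pos; apply: pow_le; lra.
  rewrite /cR; lra.
have ca0 : 0 <= ca.
  have h3 : 0 <= b ^ 2 * L by apply: Rmult_le_pos => //; exact: pow2_ge_0.
  by rewrite /ca; apply: Rmult_le_pos; lra.
by repeat split.
Qed.

Lemma mu_sq : mu ^ 2 = 4 * m0.
Proof. rewrite /mu Rpow_mult_distr pow2_sqrt; [ring | lra]. Qed.

Lemma tt_facts : 0 < tt /\ tau <= tt /\ Rpower tau (1 + th1) = tt * tau.
Proof.
split; first exact: exp_pos; split.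
  by rewrite /tt -{1}(Rpower_1 tau); [apply: Rpower_le1; lra | lra].
rewrite Rpower_plus Rpower_1; [rewrite /tt; ring | lra].
Qed.

Lemma step_facts t V : cls s mu D V ->
  cls s (Ky * tau * mu) (Ky * tau) (Yst tau m0 q t V) /\
  0 <= massR (Yst tau m0 q t V) <= b * tau ^ 2 * m0 /\
  Rabs (eta tau m0 q t V) <= c * tau /\
  Rabs (eta tau m0 q t V + Rst tau m0 q t V / m0) <= c * tau ^ 2 /\
  Rabs (hst tau m0 q t V) <= c * tau ^ 2 /\
  m0 * Rabs (hst tau m0 q t V) <= 4 * (Rst tau m0 q t V ^ 2 / m0 + massR (Yst tau m0 q t V) ^ 2 / m0).
Proof.
move=> HV; have [_ [_ [a0 [b0 _]]]] := const_pos.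
have HYV := HY tau m0 q t V mu ltac:(lra) ltac:(rewrite Rabs_pos_eq; lra) Hq HV.
split => //.
have HR : Rabs (Rst tau m0 q t V) <= a * tau * m0.
  apply: Rle_trans (re_le_Cmod _) _; apply: Rle_trans (Cmod_ip _ _ _ _ (proj1 HYV) (proj1 HV)) _.
  have -> : a * tau * m0 = Ky * tau * (4 * m0) by rewrite /a; ring.
  by rewrite -mu_sq; apply: Req_le; ring.
have HM : 0 <= massR (Yst tau m0 q t V) <= b * tau ^ 2 * m0.
  split; first exact: massR_ge0 (proj1 HYV).
  apply: Rle_trans (massR_le _ _ (proj1 HYV)) _.
  have -> : b * tau ^ 2 * m0 = (Ky * tau) ^ 2 * (4 * m0) by rewrite /b; ring.
  by rewrite -mu_sq; apply: Req_le; ring.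
split => //; exact: (eta_bounds tau m0 q t V a b ltac:(lra) ltac:(lra) ltac:(lra) ltac:(lra) HR HM).
Qed.

Lemma R_err t V : cls s mu D V ->
  Rabs (Rst tau m0 q t V - Re (ip (TB (ph t (Esym tau)) V V V) V)) <= (4 * L * tau) ^ 2 * mu ^ 2.
Proof.
move=> HV; apply: (Rst_decomp _ _ _ _ _ _ D); [lra | rewrite Rabs_pos_eq; lra | exact: Hq | exact: cls_le HV].
Qed.

(** The error symbol is used here without time summation: [R] has order [tau^(1 + th1)] with one
    factor [mu], and squaring supplies the [mu^2 = 4 m0] that the division consumes. *)
Lemma R_sq t V : cls s mu D V -> Rst tau m0 q t V ^ 2 / m0 <= cR * Rpower tau (2 + 2 * th1).
Proof.
move=> HV; have [tt0 [ttau E1]] := tt_facts; have [D1 [L0 _]] := const_pos.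
have h1 := R_err t V HV.
have HEL : L2 (absF (TB (ph t (Esym tau)) V V V)) (KE * (tt * tau) * D ^ 3).
  by rewrite -E1; apply/HS_0; apply: HS_le (HEE tau t V D ltac:(lra) (proj2 HV)); lra.
have h2 := Rle_trans _ _ _ (re_le_Cmod _) (Cmod_ip _ _ _ _ HEL (proj1 HV)).
set R := Rst tau m0 q t V in h1 *; set E := Re _ in h1 h2.
have h3 : Rabs R <= (4 * L * tau) ^ 2 * mu ^ 2 + KE * (tt * tau) * D ^ 3 * mu.
  have -> : R = (R - E) + E by ring.
  by apply: Rle_trans (Rabs_triang _ _) _; lra.
have h4 : R ^ 2 <= 2 * (((4 * L * tau) ^ 2 * mu ^ 2) ^ 2 + (KE * (tt * tau) * D ^ 3 * mu) ^ 2).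
  rewrite -pow2_abs; apply: Rle_trans (pow_incr _ _ 2 (conj (Rabs_pos R) h3)) _.
  set x := _ * mu ^ 2; set y := _ * mu; have := pow2_ge_0 (x - y); rewrite /pow; lra.
have E2 : Rpower tau (2 + 2 * th1) = (tt * tau) ^ 2.
  rewrite -E1 /pow Rmult_1_r -Rpower_plus; congr Rpower; ring.
rewrite E2.
have t4 : tau ^ 4 <= (tt * tau) ^ 2.
  have -> : tau ^ 4 = (tau * tau) ^ 2 by ring.
  by apply: pow_incr; split; [apply: Rmult_le_pos; lra | apply: Rmult_le_compat_r; lra].
have E3 : 2 * (((4 * L * tau) ^ 2 * mu ^ 2) ^ 2 + (KE * (tt * tau) * D ^ 3 * mu) ^ 2) =
  2 * (16 * (4 * L) ^ 4 * m0 * tau ^ 4 + 4 * KE ^ 2 * D ^ 6 * (tt * tau) ^ 2) * m0.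
  have -> : (KE * (tt * tau) * D ^ 3 * mu) ^ 2 = (KE * (tt * tau) * D ^ 3) ^ 2 * mu ^ 2 by ring.
  rewrite mu_sq; ring.
rewrite E3 in h4.
have h5 : R ^ 2 / m0 <= 2 * (16 * (4 * L) ^ 4 * m0 * tau ^ 4 + 4 * KE ^ 2 * D ^ 6 * (tt * tau) ^ 2).
  by apply: (Rmult_le_reg_r m0); [lra | rewrite /Rdiv Rmult_assoc Rinv_l; lra].
apply: Rle_trans h5 _; rewrite /cR.
have l4 : 0 <= 16 * (4 * L) ^ 4 by have := pow_le (4 * L) 4 ltac:(lra); lra.
have := Rmult_le_compat_l _ _ _ l4 (Rmult_le_compat _ _ _ _ (Rlt_le _ _ (proj1 Hm0)) (pow_le tau 4 ltac:(lra)) (proj2 Hm0) t4).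
lra.
Qed.

Variable u0 : F.
Let V := Vseq tau m0 q u0.
Let et j := eta tau m0 q (INR j * tau) (V j).
Let Th n := lsum et (seq 0 n).

Lemma V_step j k : V (S j) k = Cplus (V j k) (Cplus (Yst tau m0 q (INR j * tau) (V j) k) (Cmult (RtoC (et j)) (V j k))).
Proof. rewrite /V /= /stepV -/(V j) -/(et j) /Yst; ring. Qed.

Lemma dV_cls j : cls s mu D (V j) ->
  cls s (cd * tau * mu) (cd * tau * D) (fun k => Cminus (V (S j) k) (V j k)).
Proof.
move=> HV; have [[HY0 HY1] [_ [He _]]] := step_facts (INR j * tau) (V j) HV; have [D1 _] := const_pos.
have mu0 := L2_ge0 _ _ (proj1 HV).
have E : forall k, Cplus (Yst tau m0 q (INR j * tau) (V j) k) (Cmult (RtoC (et j)) (V j k)) = Cminus (V (S j) k) (V j k).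
  by move=> k; rewrite V_step; ring.
have kt : 0 < Ky * tau by apply: Rmult_lt_0_compat; lra.
split.
- apply/HS_0; apply: HS_ext E _; apply/HS_0; apply: L2_mono (L2_comb (et j) _ _ _ _ HY0 (proj1 HV)).
  rewrite /cd; have := Rmult_le_compat_r mu _ _ mu0 He; rewrite -/(et j); lra.
- apply: HS_ext E _; apply: L2_mono (HS_comb s (RtoC (et j)) _ _ _ _ HY1 (proj2 HV)).
  rewrite Cmod_R /cd; have := Rmult_le_compat_r D _ _ ltac:(lra) He; rewrite -/(et j).
  have : Ky * tau <= Ky * tau * D by nra.
  lra.
Qed.

(** Each [et j + Re (z j) / m0] is of order [tau^2] and there are at most [T / tau] of them. The sum
    of the [z j] is the time-summed error form, whose factor [mu^2 = 4 m0] cancels the division. *)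
Lemma Th_bound m : INR m * tau <= T -> (forall j, (j < m)%nat -> cls s mu D (V j)) -> Rabs (Th m) <= CT * tt.
Proof.
move=> Hm HV; have [tt0 [ttau _]] := tt_facts; have [D1 [L0 [_ [_ [c1 [cd0 [CT0 _]]]]]]] := const_pos.
case: m Hm HV => [|m] Hm HV; first by rewrite /Th /= Rabs_R0; apply: Rmult_le_pos; lra.
pose z j := ip (TB (ph (INR j * tau) (Esym tau)) (V j) (V j) (V j)) (V j).
have HS1 := HE tau m V mu D cd Ht Hm ltac:(lra) ltac:(by move=> j Hj; apply: HV; lia)
  ltac:(by move=> j Hj; apply: dV_cls; apply: HV; lia).
rewrite -/z -/tt mu_sq in HS1.
have E : Th (S m) = lsum (fun j => (et j + Re (z j) / m0)) (seq 0 (S m)) - Re (csum z (seq 0 (S m))) / m0.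
  rewrite lsum_plus -/(Th (S m)) /Re csum_re.
  have -> : lsum (fun j => fst (z j) / m0) (seq 0 (S m)) = lsum (fun j => / m0 * fst (z j)) (seq 0 (S m)).
    by apply: lsum_ext => j _; rewrite /Rdiv; ring.
  rewrite lsum_scal /Rdiv; ring.
have b1 : Rabs (lsum (fun j => (et j + Re (z j) / m0)) (seq 0 (S m))) <= INR (S m) * ((c + 4 * (4 * L) ^ 2) * tau ^ 2).
  rewrite -lsum_seq_const -(Cmod_R (lsum _ _)).
  have -> : RtoC (lsum (fun j => et j + Re (z j) / m0) (seq 0 (S m))) = csum (fun j => RtoC (et j + Re (z j) / m0)) (seq 0 (S m)).
    apply: injective_projections; first by rewrite csum_re.
    by rewrite csum_im /= lsum_const; ring.
  apply: Rle_trans (Cmod_csum _ _) _; apply: lsum_le => j /in_seq Hj; rewrite Cmod_R.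
  have Vj := HV j ltac:(lia).
  have [_ [_ [_ [h1 _]]]] := step_facts (INR j * tau) (V j) Vj.
  have h2 := R_err (INR j * tau) (V j) Vj; rewrite -/(z j) mu_sq in h2; rewrite -/(et j) in h1.
  set R := Rst tau m0 q (INR j * tau) (V j) in h1 h2.
  have -> : et j + Re (z j) / m0 = (et j + R / m0) + - ((R - Re (z j)) / m0) by rewrite /Rdiv; ring.
  apply: Rle_trans (Rabs_triang _ _) _; rewrite Rabs_Ropp /Rdiv Rabs_mult Rabs_inv (Rabs_pos_eq m0); last lra.
  have h3 : Rabs (R - Re (z j)) * / m0 <= 4 * (4 * L) ^ 2 * tau ^ 2.
    apply: (Rmult_le_reg_r m0); first lra.
    rewrite Rmult_assoc Rinv_l; last lra.
    rewrite Rmult_1_r; apply: Rle_trans h2 _; apply: Req_le; ring.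
  rewrite /Rdiv in h1; lra.
have b2 : Rabs (Re (csum z (seq 0 (S m))) / m0) <= Ke * (1 + 4 * cd * T) * (4 * D ^ 2) * tt.
  rewrite /Rdiv Rabs_mult Rabs_inv (Rabs_pos_eq m0); last lra.
  apply: (Rmult_le_reg_r m0); first lra.
  rewrite Rmult_assoc Rinv_l; last lra.
  rewrite Rmult_1_r; apply: Rle_trans (re_le_Cmod _) _; apply: Rle_trans HS1 _; apply: Req_le; ring.
rewrite E; apply: Rle_trans (Rabs_triang _ _) _; rewrite Rabs_Ropp.
have b3 : INR (S m) * ((c + 4 * (4 * L) ^ 2) * tau ^ 2) <= T * (c + 4 * (4 * L) ^ 2) * tt.
  have p0 : 0 <= c + 4 * (4 * L) ^ 2 by have := pow2_ge_0 (4 * L); lra.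
  have -> : INR (S m) * ((c + 4 * (4 * L) ^ 2) * tau ^ 2) = (INR (S m) * tau) * (c + 4 * (4 * L) ^ 2) * tau by ring.
  apply: Rmult_le_compat; [|lra|by apply: Rmult_le_compat_r|exact: ttau].
  by apply: Rmult_le_pos => //; apply: Rmult_le_pos; [exact: pos_INR | lra].
rewrite /CT; lra.
Qed.

(** [v - V + Th V] instead of [v - V]: uniformly in the mass, the corrections [eta_j V_j] are only
    [O(tau)] each, but the partial sums [Th] of the [eta_j] are small. *)
Lemma convergence_twisted (v : R -> F) N : u0 = v 0 -> twisted_on s v B 0 T ->
  (forall t, 0 <= t <= T -> massR (v t) = m0 /\ momR (v t) = q) -> INR N * tau = T ->
  M0_of u0 = RtoC m0 -> P0_of u0 = (0, - q) ->
  forall n, (n <= N)%nat ->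
  scheme tau u0 n = eS (INR n * tau) (V n) /\ cls s mu D (V n) /\
  HS s (fun k => Cminus (v (INR n * tau) k) (V n k)) (C9 * tt) /\
  Rabs (massR (V n) - m0) <= T * ca * exp (2 * c * T) * Rpower tau (3 + 2 * th1).
Proof.
move=> Hu0 Hv Hcons HN HM0 HP0.
have [tt0 [ttau E1]] := tt_facts; have [D1 [L0 [a0 [b0 [c1 [cd0 [CT0 [C80 [cm0 [cR0 ca0]]]]]]]]]] := const_pos.
have inT : forall n, (n <= N)%nat -> 0 <= INR n * tau <= T.
  move=> n Hn; split; first by apply: Rmult_le_pos; [exact: pos_INR | lra].
  by rewrite -HN; apply: Rmult_le_compat_r; [lra | exact: le_INR].
have t3 : Rpower tau (3 + 2 * th1) = Rpower tau (2 + 2 * th1) * tau.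
  by rewrite -{3}(Rpower_1 tau); [rewrite -Rpower_plus; congr Rpower; ring | lra].
set t2 := Rpower tau (2 + 2 * th1) in t3.
have t20 : 0 < t2 by exact: exp_pos.
have tau2 : tau ^ 4 <= t2.
  by rewrite -(Rpower_pow 4 tau); [apply: Rpower_le1; rewrite /=; lra | lra].
(* Two mass bounds run side by side: the one with the factor [m0] keeps the iterates in the class
   [mu], the other has the sharp power of [tau] claimed at the end. *)
pose Inv n := (forall j, (j <= n)%nat -> cls s mu D (V j)) /\
  (forall j, (j <= n)%nat -> scheme tau u0 j = eS (INR j * tau) (V j)) /\
  HS s (fun k => Cplus (Cminus (v (INR n * tau) k) (V n k)) (Cmult (RtoC (Th n)) (V n k)))
     (INR n * ((C8 * tt) * tau) * exp (Kp * (INR n * tau))) /\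
  Rabs (massR (V n) - m0) <= INR n * ((cm * m0 * tau ^ 3) * tau) * exp (2 * c * (INR n * tau)) /\
  Rabs (massR (V n) - m0) <= INR n * ((ca * (t2 * tau)) * tau) * exp (2 * c * (INR n * tau)).
have eps_bound : forall n x, Rabs (Th n) <= CT * tt -> HS s (V n) x ->
  HS s (fun k => Cplus (Cminus (v (INR n * tau) k) (V n k)) (Cmult (RtoC (Th n)) (V n k)))
     (INR n * ((C8 * tt) * tau) * exp (Kp * (INR n * tau))) ->
  HS s (fun k => Cminus (v (INR n * tau) k) (V n k))
    (INR n * ((C8 * tt) * tau) * exp (Kp * (INR n * tau)) + CT * tt * x).
  move=> n x HTh HVn Hd.
  apply: L2_mono (HS_ext _ _ _ _ _ (HS_comb s (RtoC (- Th n)) _ _ _ _ Hd HVn)).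
    rewrite Cmod_R Rabs_Ropp; apply: Rplus_le_compat_l; apply: Rmult_le_compat_r => //.
    exact: L2_ge0 HVn.
  by move=> k; rewrite RtoC_opp; ring.
suff HInv : forall n, (n <= N)%nat -> Inv n.
  move=> n Hn; have [I1 [I2 [I3 [I4 I5]]]] := HInv n Hn; have Hin := inT n Hn.
  split; first exact: I2; split; first exact: I1; split.
  - have HTh := Th_bound n ltac:(lra) ltac:(by move=> j Hj; apply: I1; lia).
    apply: L2_mono (eps_bound n _ HTh (proj2 (I1 n (Nat.le_refl _))) I3).
    have := gronwall_end n tau Kp (C8 * tt) T ltac:(lra) ltac:(apply: Rmult_le_pos; lra) ltac:(lra) ltac:(lra).
    have : 0 <= CT * (D * cd) * tt by apply: Rmult_le_pos; [apply: Rmult_le_pos => //; apply: Rmult_le_pos | ]; lra.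
    rewrite /C9; lra.
  - apply: Rle_trans I5 _; rewrite t3.
    have := gronwall_end n tau (2 * c) (ca * (t2 * tau)) T ltac:(lra)
      ltac:(apply: Rmult_le_pos => //; apply: Rmult_le_pos; lra) ltac:(lra) ltac:(lra); lra.
elim=> [|n IH] Hn.
  have [Hv0 _] := Hv 0 ltac:(lra).
  have EV : V 0%nat = u0 by [].
  have [Em _] := Hcons 0 ltac:(lra); rewrite -Hu0 in Em Hv0.
  have Hv00 : L2 (absF u0) B by apply/HS_0; apply: HS_le Hv0; lra.
  have C0 : cls s mu D (V 0%nat).
    rewrite EV; split; last by apply: L2_mono Hv0; rewrite /D; lra.
    by apply: L2_mono (massR_L2 _ _ Hv00); rewrite Em /mu; have := sqrt_pos m0; lra.
  split; first by move=> j Hj; have -> : j = 0%nat by lia.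
  split.
    move=> j Hj; have -> : j = 0%nat by lia.
    rewrite Rmult_0_l; apply: functional_extensionality => k; rewrite eS_cis.
    have -> : - 0 * IZR k ^ 2 = 0 by ring.
    by rewrite cis_0 EV; change (scheme tau u0 0 k) with (u0 k); ring.
  rewrite EV Em Rminus_diag Rabs_R0 !Rmult_0_l.
  split; last by split; lra.
  have Z0 : HS s (fun _ => RtoC 0) 0 by apply: L2_ext (@L2_zero Z) => k; rewrite /absF Cmod_0; ring.
  apply: HS_ext Z0 => k.
  have -> : Th 0%nat = 0 by []. by rewrite -Hu0; ring.
have {IH} [I1 [I2 [I3 [I4 I5]]]] := IH ltac:(lia).
have Hin := inT n ltac:(lia); have HinS := inT (S n) Hn; rewrite S_INR in HinS.
set t := INR n * tau in I3 Hin.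
have Et : INR (S n) * tau = t + tau by rewrite S_INR /t; ring.
have CV := I1 n (Nat.le_refl _).
have [[HY0 HY1] [HMY [He [_ [Hh Hh2]]]]] := step_facts t (V n) CV.
have [HD0 HD1] := dV_cls n CV.
have HTn := Th_bound n ltac:(rewrite -/t; lra) ltac:(by move=> j Hj; apply: I1; lia).
have HTSn := Th_bound (S n) ltac:(rewrite S_INR; lra) ltac:(by move=> j Hj; apply: I1; lia).
have ThS : Th (S n) = Th n + et n by rewrite /Th seq_S lsum_app /=; ring.
set En := INR n * (C8 * tt * tau) * exp (Kp * t) in I3.
have En0 : 0 <= En by exact: L2_ge0 I3.
have Heps := eps_bound n _ HTn (proj2 CV) I3; rewrite -/t -/En in Heps.
have HvD : HS s (v t) D by apply: L2_mono (proj1 (Hv t ltac:(lra))); rewrite /D; lra.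
have HtT : 0 <= t + tau <= T by rewrite -Et S_INR.
have Hvt : twisted_on s v B t (t + tau) by move=> r Hr; apply: Hv; lra.
have HLE := HL v tau t Ht Hvt.
have [Em Eq] := Hcons t ltac:(lra); rewrite Em Eq E1 in HLE.
have HPs := HP tau m0 q t (v t) (V n) _ ltac:(lra) ltac:(rewrite Rabs_pos_eq; lra) Hq HvD (proj2 CV) Heps.
have HdS : HS s (fun k => Cplus (Cminus (v (INR (S n) * tau) k) (V (S n) k)) (Cmult (RtoC (Th (S n))) (V (S n) k)))
     (INR (S n) * ((C8 * tt) * tau) * exp (Kp * (INR (S n) * tau))).
  (* Local error, old modified error, Lipschitz part, and [Th (S n)] times the increment of [V]: the
     contribution [et n] of the step is absorbed by [Th (S n) - Th n]. *)
  have H1 := HS_comb s (RtoC (Th (S n))) _ _ _ _ (HS_plus s _ _ _ _ (HS_plus s _ _ _ _ HLE I3) HPs) HD1.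
  apply: L2_mono (HS_ext _ _ _ _ _ H1).
    rewrite Cmod_R.
    have := gronwall_step n tau Kp (C8 * tt * tau) (1 + Kp * tau) En ltac:(lra)
      ltac:(apply: Rmult_le_pos; [apply: Rmult_le_pos; lra | lra]) ltac:(lra)
      ltac:(split; [have := Rmult_lt_0_compat _ _ Kp0 (proj1 Ht); lra | exact: exp_ineq1_le]) ltac:(rewrite /En /t; lra).
    apply: Rle_trans.
    have h1 := Rmult_le_compat_r (cd * tau * D) _ _ ltac:(repeat apply: Rmult_le_pos; lra) HTSn.
    have E8 : C8 * tt * tau = Kl * (tt * tau) + Kp * tau * (CT * tt * D) + CT * tt * (cd * tau * D) by rewrite /C8; ring.
    rewrite E8; lra.
  move=> k; cbv beta; rewrite Et V_step ThS RtoC_plus.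
  have FY : PsiV tau m0 q t (V n) k = Cplus (V n k) (Yst tau m0 q t (V n) k) by rewrite /Yst; ring.
  rewrite -/t FY; ring.
have HVS : L2 (absF (V (S n))) (mu + cd * tau * mu).
  apply/HS_0; apply: HS_ext (HS_plus 0 _ _ _ _ (proj2 (HS_0 _ _) (proj1 CV)) (proj2 (HS_0 _ _) HD0)) => k; ring.
have EVS : V (S n) = stepV tau m0 q t (V n) by [].
have Hms := mass_step tau m0 q t (V n) mu (Ky * tau * mu) ltac:(lra) (proj1 CV) HY0; rewrite -EVS in Hms; cbv zeta in Hms.
set e := eta tau m0 q t (V n) in He Hms; set h := hst tau m0 q t (V n) in Hh Hh2 Hms; set MY := massR (Yst tau m0 q t (V n)) in HMY Hh2 Hms.
set dM := massR (V n) - m0 in I4 I5 Hms.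
have fac : 0 <= (1 + e) ^ 2 <= exp (2 * c * tau).
  split; first exact: pow2_ge_0.
  have -> : 2 * c * tau = c * tau + c * tau by ring.
  rewrite exp_plus; have := exp_ineq1_le (c * tau) => h1.
  rewrite -pow2_abs /pow Rmult_1_r; have := Rabs_triang 1 e; rewrite Rabs_R1 => h2.
  by apply: Rmult_le_compat; try exact: Rabs_pos; lra.
have loc : Rabs (massR (V (S n)) - m0) <= (1 + e) ^ 2 * Rabs dM + m0 * Rabs h * ((b + c) * tau ^ 2).
  have m1 : Rabs ((1 + e) ^ 2 * dM) = (1 + e) ^ 2 * Rabs dM.
    by rewrite Rabs_mult (Rabs_pos_eq _ (proj1 fac)).
  have m2 : Rabs (h * MY) = Rabs h * MY by rewrite Rabs_mult (Rabs_pos_eq MY) //; lra.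
  have m3 : Rabs (m0 * h ^ 2) = m0 * h ^ 2.
    by rewrite Rabs_pos_eq //; apply: Rmult_le_pos; [lra | exact: pow2_ge_0].
  rewrite Hms; apply: Rle_trans (Rabs_triang _ _) _.
  have := Rabs_triang ((1 + e) ^ 2 * dM) (- (h * MY)).
  rewrite -/(Rminus _ _) Rabs_Ropp m1 m2 m3.
  have hp := Rabs_pos h.
  have h1 := Rmult_le_compat_l (Rabs h) _ _ hp (proj2 HMY).
  have h2 := Rmult_le_compat_l (m0 * Rabs h) _ _ ltac:(apply: Rmult_le_pos; lra) Hh.
  have E2 : h ^ 2 = Rabs h * Rabs h by rewrite -pow2_abs /pow; ring.
  rewrite E2; lra.
have hp := Rabs_pos h; have tt2 : 0 <= tau ^ 2 by exact: pow2_ge_0.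
have rel : Rabs (massR (V (S n)) - m0) <= INR (S n) * ((cm * m0 * tau ^ 3) * tau) * exp (2 * c * (INR (S n) * tau)).
  apply: Rle_trans loc _.
  have := gronwall_step n tau (2 * c) (cm * m0 * tau ^ 3 * tau) ((1 + e) ^ 2) (Rabs dM) ltac:(lra)
    ltac:(repeat apply: Rmult_le_pos => //; try lra; apply: pow_le; lra) ltac:(lra) fac I4.
  apply: Rle_trans; apply: Rplus_le_compat_l.
  have := Rmult_le_compat_r (m0 * ((b + c) * tau ^ 2)) _ _ ltac:(apply: Rmult_le_pos; [lra | apply: Rmult_le_pos; lra]) Hh.
  rewrite /cm /pow; lra.
(* By [R_sq], [m0 * Rabs h] is of order [t2] uniformly in the mass; the further [tau^2] in [loc]
   makes the local drift [t2 * tau^2], of which one [tau] is lost in the summation. *)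
have abs : Rabs (massR (V (S n)) - m0) <= INR (S n) * ((ca * (t2 * tau)) * tau) * exp (2 * c * (INR (S n) * tau)).
  apply: Rle_trans loc _.
  have := gronwall_step n tau (2 * c) (ca * (t2 * tau) * tau) ((1 + e) ^ 2) (Rabs dM) ltac:(lra)
    ltac:(repeat apply: Rmult_le_pos => //; lra) ltac:(lra) fac I5.
  apply: Rle_trans; apply: Rplus_le_compat_l.
  have r1 := R_sq t (V n) CV; rewrite -/t2 in r1.
  have r2 : MY ^ 2 / m0 <= b ^ 2 * L * t2.
    apply: (Rmult_le_reg_r m0); first lra.
    rewrite /Rdiv Rmult_assoc Rinv_l; last lra.
    rewrite Rmult_1_r; apply: Rle_trans (pow_incr _ _ 2 HMY) _.
    have -> : (b * tau ^ 2 * m0) ^ 2 = b ^ 2 * (m0 * tau ^ 4) * m0 by ring.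
    apply: Rmult_le_compat_r; first lra.
    rewrite Rmult_assoc; apply: Rmult_le_compat_l; first exact: pow2_ge_0.
    by apply: Rmult_le_compat; [lra | apply: pow_le; lra | lra | exact: tau2].
  have r3 : m0 * Rabs h <= 4 * (cR + b ^ 2 * L) * t2 by lra.
  have := Rmult_le_compat_r ((b + c) * tau ^ 2) _ _ ltac:(apply: Rmult_le_pos; lra) r3.
  rewrite /ca /pow; lra.
(* The relative drift is at most [m0], which restores the bound [mu] for the new iterate. *)
have HVS4 : massR (V (S n)) <= 4 * m0.
  have := gronwall_end (S n) tau (2 * c) (cm * m0 * tau ^ 3) T ltac:(lra)
    ltac:(repeat apply: Rmult_le_pos => //; try lra; apply: pow_le; lra) ltac:(lra) ltac:(rewrite Et; lra).
  have -> : T * (cm * m0 * tau ^ 3) * exp (2 * c * T) = (CM * tau) * (m0 * tau ^ 2) by rewrite /CM; ring.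
  have g1 : 0 <= m0 * tau ^ 2 by apply: Rmult_le_pos; lra.
  have g2 := Rmult_le_compat_r _ _ _ g1 Htau1.
  have g3 : m0 * tau ^ 2 <= m0 * 1 by apply: Rmult_le_compat_l; [lra | rewrite /pow; nra].
  have := Rle_abs (massR (V (S n)) - m0); lra.
have CVS0 : L2 (absF (V (S n))) mu.
  apply: L2_mono (massR_L2 _ _ HVS); rewrite /mu.
  have -> : 2 * sqrt m0 = sqrt (4 * m0).
    by rewrite sqrt_mult; [congr Rmult; have -> : 4 = 2 * 2 by [lra | ]; rewrite sqrt_square; lra | lra | lra].
  exact: sqrt_le_1_alt.
(* A provisional radius, slightly too large, lets the modified error be converted into [v - V]; [C9]
   contains the factor [1 + cd] for it. *)
have HVS1 : HS s (V (S n)) (D * (1 + cd)).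
  apply: L2_mono (HS_ext _ _ _ _ _ (HS_plus s _ _ _ _ (proj2 CV) HD1)); last by move=> k; ring.
  have := Rmult_le_compat_r (cd * D) _ _ ltac:(apply: Rmult_le_pos; lra) (proj2 Ht); lra.
have HepsS := eps_bound (S n) _ HTSn HVS1 HdS.
(* [C9 * tt <= 1] places the iterate within distance one of the solution, hence back in the ball of
   radius [B + 1]. *)
have CVS1 : HS s (V (S n)) D.
  have Hvt' : HS s (v (INR (S n) * tau)) B by apply: (proj1 (Hv _ _)); rewrite Et; lra.
  apply: L2_mono (HS_ext _ _ _ _ _ (HS_minus s _ _ _ _ Hvt' HepsS)); last by move=> k; ring.
  have := gronwall_end (S n) tau Kp (C8 * tt) T ltac:(lra) ltac:(apply: Rmult_le_pos; lra) ltac:(lra) ltac:(rewrite Et; lra).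
  move: Htau2; rewrite -/tt /C9 /D; lra.
split; last split; [| |by split].
- move=> j Hj; case: (Nat.eq_dec j (S n)) => [->|Hj']; first by split.
  by apply: I1; lia.
- move=> j Hj; case: (Nat.eq_dec j (S n)) => [->|Hj']; last by apply: I2; lia.
  rewrite Et [scheme _ _ _]/= HM0 HP0 (I2 n (Nat.le_refl _)) -/t.
  apply: (scheme_twisted tau m0 q t (V n) mu (Ky * tau * mu)); [lra | exact: (HS_wiener s _ _ ltac:(lra) (proj2 CV)) | exact: (proj1 CV) | exact: HY0].
Qed.
End Scheme.

Lemma convergence s th1 th2 T B : 1 <= s -> 0 < th1 <= 1 -> th1 <= th2 -> 1 < 2 * th2 -> th1 + 1/2 < s -> 0 < T ->
  high_ok s th1 th2 ->
  exists tau0 K : R, 0 < tau0 <= 1 /\ 0 < K /\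
  forall (u0 : F) (u : R -> F), in_H s u0 -> u0 <> zeroF -> is_NLS_solution s T u0 u ->
  (forall t, 0 <= t <= T -> Hnorm s (u t) <= B) ->
  forall tau, 0 < tau <= tau0 -> forall N, INR N * tau = T -> forall n, (n <= N)%nat ->
  in_H s (subF (u (INR n * tau)) (scheme tau u0 n)) /\
  Hnorm s (subF (u (INR n * tau)) (scheme tau u0 n)) <= K * Rpower tau th1 /\
  Cmod (Cminus (mass (scheme tau u0 n)) (mass u0)) <= K * Rpower tau (3 + 2 * th1).
Proof.
move=> Hs Hth Hth12 Hth2 Hsth HT Hok.
(* A negative [B] bounds no norm, so the claim is vacuous. *)
case: (Rlt_le_dec B 0) => B0.
  exists 1, 1; split; first lra; split; first lra.
  move=> u0 u _ _ _ Hu; exfalso.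
  by have := Hu 0 ltac:(lra); have := sqrt_pos (2 * PI * zsumR (Hterm s (u 0))); rewrite /Hnorm; lra.
have L0 : 0 <= B ^ 2 by exact: pow2_ge_0.
have [Ky [Ky0 HY]] := Yst_bounds s (B ^ 2) (B + 1) Hs L0 ltac:(lra).
have [Kp [Kp0 HP]] := PsiV_lip s (B ^ 2) (B + 1) Hs L0 ltac:(lra).
have [Kl [Kl0 HL]] := local_error s th1 B Hs ltac:(lra) Hsth B0.
have [Ke [Ke0 HE]] := err_sum s th1 th2 T Hs ltac:(lra) Hth12 Hth2 Hsth HT Hok.
have [KE [KE0 HEE]] := TB_Esym s th1 Hs ltac:(lra) Hsth.
(* Quantifying the constants first records that they depend neither on the data nor on [tau], [m0]
   and [q]. *)
have [M [C9 [K5 main]]] : exists M C9 K5, forall tau m0 q, 0 < tau <= 1 -> 0 < m0 <= B ^ 2 -> Rabs q <= B ^ 2 ->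
  M * tau <= 1 -> C9 * Rpower tau th1 <= 1 -> forall u0 v N, u0 = v 0 -> twisted_on s v B 0 T ->
  (forall t, 0 <= t <= T -> massR (v t) = m0 /\ momR (v t) = q) -> INR N * tau = T ->
  M0_of u0 = RtoC m0 -> P0_of u0 = (0, - q) ->
  forall n, (n <= N)%nat -> exists V mu, scheme tau u0 n = eS (INR n * tau) V /\ L2 (absF V) mu /\
  HS s (fun k => Cminus (v (INR n * tau) k) (V k)) (C9 * Rpower tau th1) /\
  Rabs (massR V - m0) <= K5 * Rpower tau (3 + 2 * th1).
  eexists; eexists; eexists => tau m0 q Ht Hm0 Hq H1 H2 u0 v N e1 e2 e3 e4 e5 e6 n Hn.
  have [h1 [[h2 _] h3]] := @convergence_twisted s th1 T B Hs Hth HT B0 Ky Kp Kl Ke KE Ky0 Kp0 Kl0 Ke0 KE0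
    HY HP HL HE HEE tau m0 q Ht Hm0 Hq H1 H2 u0 v N e1 e2 e3 e4 e5 e6 n Hn.
  by eexists; eexists; split; [exact: h1 | split; [exact: h2 | exact: h3]].
have M0 := Rabs_pos M; have C0 := Rabs_pos C9; have K0 := Rabs_pos K5.
have iM : 0 < / (Rabs M + 1) by apply: Rinv_0_lt_compat; lra.
have iC : 0 < / (Rabs C9 + 1) by apply: Rinv_0_lt_compat; lra.
(* The second entry gives [M * tau <= 1]; the third is the solution of
   [(Rabs C9 + 1) * tau^th1 = 1]. *)
pose tau0 := Rmin 1 (Rmin (/ (Rabs M + 1)) (Rpower (/ (Rabs C9 + 1)) (/ th1))).
have [t1 [t2 [t3 t0]]] : tau0 <= 1 /\ tau0 <= / (Rabs M + 1) /\ tau0 <= Rpower (/ (Rabs C9 + 1)) (/ th1) /\ 0 < tau0.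
  split; first exact: Rmin_l; split; first by apply: Rle_trans (Rmin_r _ _) _; exact: Rmin_l.
  split; first by apply: Rle_trans (Rmin_r _ _) _; exact: Rmin_r.
  by do 2 (apply: Rmin_glb_lt; first lra); exact: exp_pos.
exists tau0, (3 * Rabs C9 + Rabs K5 + 1); split; first lra; split; first lra.
move=> u0 u Hu0 Hnz Hsol HB tau Ht N HN n Hn.
have P1 : 0 < Rpower tau th1 by exact: exp_pos.
have P2 : 0 < Rpower tau (3 + 2 * th1) by exact: exp_pos.
have HM : M * tau <= 1.
  apply: Rle_trans (Rmult_le_compat_r tau _ _ ltac:(lra) (Rle_abs M)) _.
  have := Rmult_le_compat_l (Rabs M + 1) tau _ ltac:(lra) (Rle_trans _ _ _ (proj2 Ht) t2).
  rewrite Rinv_r; lra.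
have HC : C9 * Rpower tau th1 <= 1.
  apply: Rle_trans (Rmult_le_compat_r _ _ _ (Rlt_le _ _ P1) (Rle_abs C9)) _.
  have h : Rpower tau th1 <= / (Rabs C9 + 1).
    have -> : / (Rabs C9 + 1) = Rpower (Rpower (/ (Rabs C9 + 1)) (/ th1)) th1.
      by rewrite Rpower_mult Rinv_l ?Rpower_1 //; lra.
    by apply: Rle_Rpower_l; lra.
  have := Rmult_le_compat_l (Rabs C9 + 1) _ _ ltac:(lra) h; rewrite Rinv_r; lra.
have [v [Ev0 Hv]] := exact_twisted s T u0 u Hs HT Hsol.
have HvB : forall t, 0 <= t <= T -> HS s (v t) B.
  move=> t Htt; apply/(HS_eS s t); rewrite -(proj1 (Hv t Htt)).
  by apply: L2_mono (HB t Htt) _; apply: Hnorm_HS; exact: (proj1 Hsol).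
have Htw : twisted_on s v B 0 T by move=> r Hr; split; [exact: HvB | exact: (proj2 (Hv r Hr))].
have Htw1 : twisted_on 1 v B 0 T by move=> r Hr; have [h1 h2] := Htw r Hr; split => //; exact: HS_le h1.
have Hcons := conservation v B T ltac:(lra) Htw1; rewrite Ev0 in Hcons.
have Hu1 : HS 1 u0 B by have [h _] := Htw1 0 ltac:(lra); rewrite -Ev0.
have HuL : L2 (absF u0) B by apply/HS_0; apply: HS_le Hu1; lra.
have [V [mu [E1 [E2 [E3 E4]]]]] := main tau (massR u0) (momR u0) ltac:(lra)
  (conj (massR_pos _ _ HuL Hnz) (massR_le _ _ HuL))
  ltac:(rewrite /pow Rmult_1_r; exact: (proj2 (summable_mom _ _ _ (conj HuL Hu1)))) HM HC u0 v N (eq_sym Ev0) Htw Hcons HN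
  (mass_massR _ _ HuL) (P0_momR _ _ _ HuL Hu1) n Hn.
have Hn0 : 0 <= INR n * tau <= T.
  split; first by apply: Rmult_le_pos; [exact: pos_INR | lra].
  by rewrite -HN; apply: Rmult_le_compat_r; [lra | exact: le_INR].
have HD : HS s (subF (u (INR n * tau)) (scheme tau u0 n)) (C9 * Rpower tau th1).
  rewrite E1 (proj1 (Hv _ Hn0)).
  apply: HS_ext (proj1 (HS_eS s (INR n * tau) _ _) E3) => k; rewrite /subF !eS_cis; ring.
have [Hin HHn] := HS_Hnorm _ _ _ HD; split => //; split.
  apply: Rle_trans HHn _; have := Rmult_le_compat_r _ _ _ (Rlt_le _ _ P1) (Rle_abs C9).
  have := Rmult_le_pos _ _ K0 (Rlt_le _ _ P1); lra.
have HVL : L2 (absF (eS (INR n * tau) V)) mu by rewrite absF_eS.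
rewrite E1 (mass_massR _ _ HVL) massR_eS (mass_massR _ _ HuL) -RtoC_minus Cmod_R.
apply: Rle_trans E4 _; apply: Rmult_le_compat_r; first lra.
have := Rle_abs K5; lra.
Qed.

Theorem theorem1p3 :
  (* (a) gamma > 3/2 *)
  (forall (gamma T B : R), 3/2 < gamma -> 0 < T ->
     exists tau0 Cst : R, 0 < tau0 /\ 0 < Cst /\
     forall (u0 : F) (u : R -> F),
       in_H gamma u0 -> u0 <> zeroF ->
       is_NLS_solution gamma T u0 u ->
       (forall t, 0 <= t <= T -> Hnorm gamma (u t) <= B) ->
       forall tau : R, 0 < tau <= tau0 ->
       forall N : nat, INR N * tau = T ->
       forall n : nat, (n <= N)%nat ->
         in_H gamma (subF (u (INR n * tau)) (scheme tau u0 n)) /\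
         Hnorm gamma (subF (u (INR n * tau)) (scheme tau u0 n)) <= Cst * tau /\
         Cmod (Cminus (mass (scheme tau u0 n)) (mass u0)) <= Cst * tau ^ 5) /\
  (* (b) gamma = 1 *)
  (forall (eps T B : R), 0 < eps -> 0 < T ->
     exists tau0 Cst : R, 0 < tau0 /\ 0 < Cst /\
     forall (u0 : F) (u : R -> F),
       in_H 1 u0 -> u0 <> zeroF ->
       is_NLS_solution 1 T u0 u ->
       (forall t, 0 <= t <= T -> Hnorm 1 (u t) <= B) ->
       forall tau : R, 0 < tau <= tau0 ->
       forall N : nat, INR N * tau = T ->
       forall n : nat, (n <= N)%nat ->
         in_H 1 (subF (u (INR n * tau)) (scheme tau u0 n)) /\
         Hnorm 1 (subF (u (INR n * tau)) (scheme tau u0 n)) <= Cst * Rpower tau (1/2 - eps)).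
Proof.
split.
- move=> gamma T B Hg HT.
  have [tau0 [K [t0 [K0 HK]]]] := convergence gamma 1 1 T B ltac:(lra) ltac:(lra) ltac:(lra) ltac:(lra) ltac:(lra) HT
    (high_ok_smooth gamma Hg).
  exists tau0, K; split; first lra; split => // u0 u Hu0 Hnz Hsol HB tau Ht N HN n Hn.
  have := HK u0 u Hu0 Hnz Hsol HB tau Ht N HN n Hn.
  rewrite Rpower_1; last lra.
  have -> : 3 + 2 * 1 = INR 5 by rewrite /=; ring.
  by rewrite Rpower_pow; last lra.
- move=> eps T B He HT.
  (* Cutting [eps] at [1/4] keeps [th1 = 1/2 - e] positive; with [th2 = 1/2 + e] the exponents sum
     to one and [2 th2 > 1]. A larger [eps] only weakens the claim as [tau <= 1]. *)
  have e1 := Rmin_l eps (1/4); have e2 := Rmin_r eps (1/4); have e3 := Rmin_glb_lt eps (1/4) 0 He ltac:(lra).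
  set e := Rmin eps (1/4) in e1 e2 e3.
  have [tau0 [K [t0 [K0 HK]]]] := convergence 1 (1/2 - e) (1/2 + e) T B ltac:(lra) ltac:(lra) ltac:(lra) ltac:(lra)
    ltac:(lra) HT (high_ok_rough 1 (1/2 - e) (1/2 + e) ltac:(lra) ltac:(lra) ltac:(lra) ltac:(lra)).
  exists tau0, K; split; first lra; split => // u0 u Hu0 Hnz Hsol HB tau Ht N HN n Hn.
  have [h1 [h2 _]] := HK u0 u Hu0 Hnz Hsol HB tau Ht N HN n Hn; split => //.
  apply: Rle_trans h2 _; apply: Rmult_le_compat_l; first lra.
  by apply: Rpower_le1; lra.
Qed.
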